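(* Let $\alpha>c>0$ and $T>0$. Given an initial density $\rho_0\in\mathcal P(\mathbb T)\cap L^\infty(\mathbb T)\cap BV(\mathbb T)$ with $\rho_0\ge\alpha$ a.e., there exists a continuous curve of measures $\rho$ which is a weak solution (in the sense given in the context) of the TV gradient flow $$\partial_t\rho+\operatorname{div}\Big[\rho\nabla\Big(\operatorname{div}\Big(\frac{\nabla\rho}{|\nabla\rho|}\Big)\Big)\Big]=0,\qquad\rho|_{t=0}=\rho_0,$$ and which satisfies $J(\rho_t)\le J(\rho_0)$ for $t\in[0,T]$ and $\alpha\le\rho\le\|\rho_0\|_{L^\infty}$ a.e.
   Context: $\mathbb T=\mathbb T^d=\mathbb R^d/\mathbb Z^d$ is the flat torus, $d\ge1$. $\mathcal P(\mathbb T)$ is the set of Borel probability measures on $\mathbb T$, absolutely continuous measures being identified with their densities; $W_2$ is the quadratic Wasserstein distance; $\rho_t=\rho(t,\cdot)$. Total variation: $J(\rho)=\sup\{\int_{\mathbb T}-\rho\operatorname{div}z:\ z\in C^\infty(\mathbb T,\mathbb R^d),\ \|z\|_\infty\le1\}$ for $\rho\in L^1(\mathbb T)$, and $BV(\mathbb T)=\{\rho\in L^1(\mathbb T):J(\rho)<\infty\}$. $H^1_{\operatorname{div}}(\mathbb T)=\{z\in L^2(\mathbb T,\mathbb R^d):\operatorname{div}z\in L^2(\mathbb T)\}$. $\mathcal A=\{(\rho,z):\rho\in BV(\mathbb T)\cap L^2(\mathbb T),\ z\in H^1_{\operatorname{div}}(\mathbb T),\ \|z\|_\infty\le1,\ J(\rho)\le-\int_{\mathbb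 T}\rho\operatorname{div}z\}$. Weak solution: a function $\rho\in L^\infty((0,T);BV(\mathbb T)\cap L^\infty(\mathbb T))\cap C^0([0,T];(\mathcal P(\mathbb T),W_2))$ with $\rho>c$ a.e., for which there exists $z\in L^\infty((0,T)\times\mathbb T;\mathbb R^d)$ such that $(\rho(t,\cdot),z(t,\cdot))\in\mathcal A$ for a.e. $t\in(0,T)$, $\operatorname{div}z\in L^2((0,T);H^1(\mathbb T))$, and for every $u\in C_c^\infty([0,T)\times\mathbb T)$, $$\int_0^T\int_{\mathbb T}(\rho\,\partial_tu+\rho\nabla\operatorname{div}z\cdot\nabla u)\,dx\,dt=-\int_{\mathbb T}\rho_0(x)u(0,x)\,dx.$$ *)

(* Defs.v *)
From HB Require Import structures.
From mathcomp Require Import all_boot all_order all_algebra.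
From mathcomp Require Import all_classical all_reals all_analysis.

Set Implicit Arguments.
Unset Strict Implicit.
Unset Printing Implicit Defensive.

Import Order.TTheory GRing.Theory Num.Theory.
Import numFieldNormedType.Exports.

Local Open Scope classical_set_scope.
Local Open Scope ring_scope.

(* Conventions.
   The flat torus R^d / Z^d is handled through the covering space
   'rV[R]_d.  The Lebesgue measure of the torus is [torus], the uniform
   probability on the unit cube, so that L^p functions on the torus are
   functions on 'rV[R]_d of which only the values on the cube matter, whereas
   smooth functions on the torus are smooth Z^d-periodic functions on 'rV[R]_d.
   The norm of the library on 'rV[R]_d is the sup-norm; pointwise lengths of
   vector fields and distances are Euclidean, see [enorm]. *)

Section row_measurable.
Context {R : realType} (n : nat).

Let coord (i : 'I_n) (x : 'rV[R]_n) : R := x 0 i.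

Let row_set0 : g_sigma_preimage coord set0.
Proof. exact: sigma_algebra0. Qed.

Let row_setC A : g_sigma_preimage coord A -> g_sigma_preimage coord (~` A).
Proof. exact: sigma_algebraC. Qed.

Let row_bigcup (F : (set 'rV[R]_n)^nat) :
  (forall i, g_sigma_preimage coord (F i)) ->
  g_sigma_preimage coord (\bigcup_i (F i)).
Proof. exact: sigma_algebra_bigcup. Qed.

(* The Borel sigma-algebra of 'rV[R]_n, generated by the coordinates. *)
HB.instance Definition _ := @isMeasurable.Build default_measure_display
  'rV[R]_n (g_sigma_preimage coord) row_set0 row_setC row_bigcup.

Lemma measurable_row_coord (i : 'I_n) :
  measurable_fun [set: 'rV[R]_n] (fun x : 'rV[R]_n => x 0 i).
Proof.
move=> _ Y mY; rewrite setTI; apply: sub_sigma_algebra => /=.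
rewrite -bigcup_seq/=; exists i => /=; first by rewrite mem_index_enum.
by exists Y => //; rewrite setTI.
Qed.

Lemma measurable_fun_rowP d (T : measurableType d) (f : T -> 'rV[R]_n) :
  (forall i, measurable_fun [set: T] (fun x => f x 0 i)) ->
  measurable_fun [set: T] f.
Proof.
move=> mf _ B; rewrite setTI.
suff : g_sigma_preimage coord `<=` [set B | measurable (f @^-1` B)] by apply.
apply: smallest_sub.
  split => /=.
  - by rewrite preimage_set0.
  - by move=> A mA; rewrite setTD preimage_setC; exact: measurableC.
  - by move=> F mF; rewrite preimage_bigcup; exact: bigcupT_measurable.
rewrite -bigcup_seq => A [i _ [C mC <-]] /=.
by have := mf i measurableT C mC; rewrite !setTI.
Qed.

End row_measurable.

Section row_cons.
Context {R : realType} (n : nat).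

Definition row_cons (p : measurableTypeR R * 'rV[R]_n) : 'rV[R]_n.+1 :=
  \row_j if unlift ord0 j is Some k then p.2 0 k else p.1.

Let measurable_row_cons : measurable_fun setT row_cons.
Proof.
apply: measurable_fun_rowP => i; rewrite /row_cons.
under eq_fun do rewrite mxE.
case: unlift => [k|]; last exact: measurable_fst.
apply: (measurableT_comp (measurable_row_coord k)); exact: measurable_snd.
Qed.

HB.instance Definition _ := isMeasurableFun.Build _ _ _ _ row_cons
  measurable_row_cons.

End row_cons.

(* Law of a row vector with n independent coordinates uniform on [0, 1]. *)
Fixpoint torus {R : realType} (n : nat) : probability 'rV[R]_n R :=
  match n with
  | 0 => \d_(0 : 'rV[R]_0)
  | m.+1 => distribution
      (uniform_prob (@ltr01 R) \x torus m)%E (@row_cons R m)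
  end.

Section smooth.
Context {R : realType}.

(* All iterated directional derivatives up to order k exist and are continuous;
   for finite-dimensional V this is the class C^k. *)
Fixpoint Ck {V : normedModType R} (k : nat) (f : V -> R) : Prop :=
  match k with
  | 0 => continuous f
  | l.+1 => continuous f /\
      forall v : V, (forall x, derivable f x v) /\ Ck l (fun x => 'D_v f x)
  end.

Definition smooth {V : normedModType R} (f : V -> R) : Prop :=
  forall k, Ck k f.

Definition dot {d} (u v : 'rV[R]_d) : R := \sum_(i < d) u 0 i * v 0 i.

Definition enorm {d} (u : 'rV[R]_d) : R := Num.sqrt (dot u u).

Definition unitv {d} (i : 'I_d) : 'rV[R]_d := delta_mx 0 i.

Definition periodic {d} {A : Type} (f : 'rV[R]_d -> A) : Prop :=
  forall (x : 'rV[R]_d) (k : 'rV[int]_d), f (x + map_mx intr k) = f x.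

Definition grad {d} (f : 'rV[R]_d -> R) (x : 'rV[R]_d) : 'rV[R]_d :=
  \row_i 'D_(unitv i) f x.

Definition diverg {d} (z : 'rV[R]_d -> 'rV[R]_d) (x : 'rV[R]_d) : R :=
  \sum_(i < d) 'D_(unitv i) (fun y => z y 0 i) x.

Definition torus_test {d} (f : 'rV[R]_d -> R) : Prop :=
  smooth f /\ periodic f.

Definition torus_test_field {d} (z : 'rV[R]_d -> 'rV[R]_d) : Prop :=
  (forall i, smooth (fun x => z x 0 i)) /\ periodic z.

(* u (t, x) represents an element of C_c^oo([0, T) x torus): smooth up to t = 0
   (as the restriction of a smooth function of t in R) and vanishing near T;
   values at negative times are irrelevant. *)
Definition spacetime_test {d} (T : R) (u : R * 'rV[R]_d -> R) : Prop :=
  [/\ smooth u,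
      forall t, periodic (fun x => u (t, x)) &
      exists2 S, S < T & forall t x, S <= t -> u (t, x) = 0].

Definition time_deriv {d} (u : R * 'rV[R]_d -> R) (p : R * 'rV[R]_d) : R :=
  'D_((1, 0) : R * 'rV[R]_d) u p.

End smooth.

Section torus_functions.
Context {R : realType} {d : nat}.
Implicit Types (f w : 'rV[R]_d -> R) (z g : 'rV[R]_d -> 'rV[R]_d).

(* Real-valued integrals below are only meaningful for integrable integrands;
   this is so for TV f when f is in L^1. *)
Definition TV f : \bar R :=
  ereal_sup [set (\int[torus d]_x (- f x * diverg z x))%:E
            | z in [set z | torus_test_field z /\ forall x, enorm (z x) <= 1]].

Definition BV f : Prop := f \in Lfun (torus d) 1%E /\ (TV f < +oo)%E.

Definition Lfun2_field z : Prop :=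
  forall i, (fun x => z x 0 i) \in Lfun (torus d) 2%:E.

Definition weak_div z w : Prop :=
  forall phi, torus_test phi ->
    \int[torus d]_x dot (z x) (grad phi x) = - \int[torus d]_x (w x * phi x).

Definition weak_grad w g : Prop :=
  forall phi i, torus_test phi ->
    \int[torus d]_x (w x * 'D_(unitv i) phi x) =
    - \int[torus d]_x (g x 0 i * phi x).

(* [Hdiv z w]: z is in H^1_div and its distributional divergence, which is
   unique up to almost everywhere equality, is w. *)
Definition Hdiv z w : Prop :=
  [/\ Lfun2_field z, w \in Lfun (torus d) 2%:E & weak_div z w].

Definition calA f z : Prop :=
  [/\ BV f, f \in Lfun (torus d) 2%:E,
      ('N[torus d]_+oo[EFin \o (enorm \o z)] <= 1)%E &
      exists2 w, Hdiv z w & (TV f <= (- \int[torus d]_x (f x * w x))%:E)%E].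

(* A probability on 'rV[R]_d with a density with respect to [torus d] is carried
   by the unit cube, and is thereby a measure on the torus. *)
Definition has_density (mu : probability 'rV[R]_d R) f : Prop :=
  [/\ measurable_fun setT f, {ae torus d, forall x, 0 <= f x} &
      forall A, measurable A -> mu A = (\int[torus d]_(x in A) (f x)%:E)%E].

(* Quotient distance of the Euclidean one.  It is Z^d-periodic, hence W2 below
   is the Wasserstein distance between the images of mu and nu on the torus. *)
Definition torus_dist (x y : 'rV[R]_d) : R :=
  inf (range (fun k : 'rV[int]_d => enorm (x - y + map_mx intr k))).

Definition coupling (mu nu : probability 'rV[R]_d R)
    (gamma : probability ('rV[R]_d * 'rV[R]_d)%type R) : Prop :=
  forall A, measurable A ->
    gamma (A `*` setT) = mu A /\ gamma (setT `*` A) = nu A.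

Definition W2 (mu nu : probability 'rV[R]_d R) : \bar R :=
  (ereal_inf [set (\int[gamma]_p (torus_dist p.1 p.2 ^+ 2)%:E)
             | gamma in [set gamma | coupling mu nu gamma]] `^ 2^-1)%E.

End torus_functions.

Section evolution.
Context {R : realType} {d : nat}.
Implicit Types (T c : R) (rho : R -> 'rV[R]_d -> R).

Definition slab T : set (R * 'rV[R]_d) := `]0, T[ `*` setT.

Definition spacetime := (@lebesgue_measure R \x torus d)%E.

Definition ae_time T (P : R -> Prop) : Prop :=
  {ae @lebesgue_measure R, forall t, t \in `]0, T[ -> P t}.

Definition ae_spacetime T (P : R -> 'rV[R]_d -> Prop) : Prop :=
  {ae spacetime, forall p, p.1 \in `]0, T[ -> P p.1 p.2}.

Definition slab_measurable e (E : measurableType e) T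
    (f : R -> 'rV[R]_d -> E) : Prop :=
  measurable_fun (slab T) (fun p => f p.1 p.2).

(* L^oo((0, T); BV `&` L^oo), read as joint measurability together with
   essential boundedness in time of the BV norm and of the L^oo norm *)
Definition Loo_BV_Loo T rho : Prop :=
  slab_measurable T rho /\
  exists M : R, ae_time T (fun t =>
    [/\ BV (rho t), rho t \in Lfun (torus d) +oo%E,
        ('N[torus d]_1[EFin \o rho t] + TV (rho t) <= M%:E)%E &
        ('N[torus d]_+oo[EFin \o rho t] <= M%:E)%E]).

(* C^0([0, T]; (P, W_2)), measures being identified with their densities *)
Definition W2_continuous_curve T rho : Prop :=
  exists mu : R -> probability 'rV[R]_d R,
    (forall t, t \in `[0, T] -> has_density (mu t) (rho t)) /\
    (forall t, t \in `[0, T] ->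
      W2 (mu s) (mu t) @[s --> within `[0, T] (nbhs t)] --> 0%E).

Definition Loo_field T (z : R -> 'rV[R]_d -> 'rV[R]_d) : Prop :=
  slab_measurable T z /\
  exists M : R, ae_spacetime T (fun t x => enorm (z t x) <= M).

(* div z is in L^2((0, T); H^1), with w = div z and g = grad (div z) *)
Definition div_L2_H1 T (z : R -> 'rV[R]_d -> 'rV[R]_d)
    (w : R -> 'rV[R]_d -> R) (g : R -> 'rV[R]_d -> 'rV[R]_d) : Prop :=
  [/\ slab_measurable T w, slab_measurable T g,
      ae_time T (fun t => weak_div (z t) (w t) /\ weak_grad (w t) (g t)) &
      (\int[spacetime]_(p in slab T)
         (w p.1 p.2 ^+ 2 + enorm (g p.1 p.2) ^+ 2)%:E < +oo)%E].

Definition weak_equation T (rho0 : 'rV[R]_d -> R) rho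
    (g : R -> 'rV[R]_d -> 'rV[R]_d) : Prop :=
  forall u, spacetime_test T u ->
    \int[spacetime]_(p in slab T)
      (rho p.1 p.2 * time_deriv u p +
       rho p.1 p.2 * dot (g p.1 p.2) (grad (fun x => u (p.1, x)) p.2)) =
    - \int[torus d]_x (rho0 x * u (0, x)).

Definition weak_solution c T (rho0 : 'rV[R]_d -> R) rho : Prop :=
  [/\ Loo_BV_Loo T rho, W2_continuous_curve T rho,
      ae_spacetime T (fun t x => c < rho t x) &
      exists z w g,
        [/\ Loo_field T z, ae_time T (fun t => calA (rho t) (z t)),
            div_L2_H1 T z w g & weak_equation T rho0 rho g]].

End evolution.

(* Main.v *)
(* The equation is discretised on a fine periodic grid by an explicit Euler
   scheme in which the total variation is replaced by a nonlocal one, a weighted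
   sum of mean values of |rho (x + h) - rho x|.  It dissipates along the scheme,
   which bounds grad (div z) in L^2.  Since it is exactly shift invariant, it
   satisfies a discrete coarea formula, whence a maximum principle: the mobility
   turns differences of eta into differences of a nondecreasing function of rho,
   so that an entropy penalising the values outside [alpha, M] hardly grows.
   The vectors h are the endpoints of long random walks; by Lindeberg's
   replacement argument the weights are nearly isotropic, so that the nonlocal
   variation is close to the Euclidean one on smooth functions, and the field z
   has length at most 1 + o(1).

   The pigeonhole principle for finitely many box averages yields densities that
   converge in the mean, uniformly in time.  The fields z, div z and
   grad (div z) converge only weakly; in place of weak compactness, among all
   tuples satisfying the linear relations up to 2^-n, which form a decreasing
   sequence of convex sets, tuples of nearly minimal L^2 norm are Cauchy by the
   parallelogram identity.  Continuity in the mean gives continuity in W_2 by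
   coupling the common part of two densities along the diagonal. *)
From HB Require Import structures.
Require Import Defs.
From mathcomp Require Import all_boot all_order all_algebra.
From mathcomp Require Import all_classical all_reals all_analysis.
From mathcomp Require Import measurable_realfun ess_sup_inf.
From mathcomp Require Import ring lra zify.
Import Order.TTheory GRing.Theory Num.Theory.
Import numFieldNormedType.Exports.
Local Open Scope classical_set_scope.
Local Open Scope ring_scope.
Set Implicit Arguments.
Unset Strict Implicit.
Unset Printing Implicit Defensive.

(** * The nonlocal variation on a finite group *)

(** Everything claimed about z, div z and grad div z has to survive a weak limit, while rho
    multiplies these functions. Hence the strong limit of rho comes before any other: with rho
    fixed, each relation is affine in the triple, up to errors that are small in the mean, and
    convex combinations do no harm. The explicit scheme is not stable uniformly in the grid. This is
    harmless because the regularisation of the sign and the time step are chosen after the grid, so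
    that bounds that grow with the grid suffice; only the energy, its dissipation and the entropy
    are bounded uniformly. The inequality J(rho) <= - \int rho div z stems from the 1-homogeneity of
    the nonlocal variation, and J(rho_t) <= J(rho_0) from its decrease. For both it must be compared
    with J in two directions. At time 0 it is at most (1 + e) J, by duality with smooth fields.
    Later it dominates J, up to O(e), after the density has been averaged over a small fraction
    delta of the torus; delta is fixed before the mesh, so that second differences of the average
    become negligible. *)

Section average.
Context {R : realType} {G : finZmodType}.
Implicit Types (f g : G -> R) (h : G).

Definition avg f : R := (\sum_x f x) / #|G|%:R.

Definition dif h f (x : G) : R := f (x + h) - f x.

Lemma eq_avg f g : f =1 g -> avg f = avg g.
Proof. by move=> fg; congr (_ / _); apply: eq_bigr => x _; rewrite fg. Qed.

Lemma avg_shift h f : avg (fun x => f (x + h)) = avg f.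
Proof.
by rewrite /avg [in RHS](reindex_inj (addIr h)).
Qed.

Lemma avgD f g : avg (fun x => f x + g x) = avg f + avg g.
Proof. by rewrite /avg big_split mulrDl. Qed.

Lemma avgZ (a : R) f : avg (fun x => a * f x) = a * avg f.
Proof. by rewrite /avg -mulr_sumr mulrA. Qed.

Lemma avgN f : avg (fun x => - f x) = - avg f.
Proof. by rewrite /avg sumrN mulNr. Qed.

Lemma avgB f g : avg (fun x => f x - g x) = avg f - avg g.
Proof. by rewrite avgD avgN. Qed.

Lemma avg_sum (I : Type) (r : seq I) (F : I -> G -> R) :
  avg (fun x => \sum_(i <- r) F i x) = \sum_(i <- r) avg (F i).
Proof. by rewrite /avg exchange_big mulr_suml. Qed.

Lemma cardR_gt0 : 0 < #|G|%:R :> R.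
Proof. by rewrite ltr0n; apply/card_gt0P; exists 0. Qed.

Lemma avg_cst (a : R) : avg (fun=> a) = a.
Proof.
by rewrite /avg sumr_const -[a *+ _]mulr_natr mulfK // gt_eqF // cardR_gt0.
Qed.

Lemma le_avg f g : (forall x, f x <= g x) -> avg f <= avg g.
Proof.
move=> fg; rewrite /avg ler_pM2r ?invr_gt0 ?cardR_gt0//.
by apply: ler_sum => x _.
Qed.

Lemma avg_ge0 f : (forall x, 0 <= f x) -> 0 <= avg f.
Proof. by move=> f0; rewrite -(avg_cst 0); exact: le_avg. Qed.

Lemma le_norm_avg f : `|avg f| <= avg (fun x => `|f x|).
Proof.
rewrite /avg normrM [X in _ * X]ger0_norm ?invr_ge0 ?(ltW cardR_gt0)//.
by rewrite ler_wpM2r ?invr_ge0 ?(ltW cardR_gt0)//; exact: ler_norm_sum.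
Qed.

Lemma avg_dif_parts h f g :
  avg (fun x => dif h f x * g x) = avg (fun x => f x * (g (x - h) - g x)).
Proof.
have -> : avg (fun x => f x * (g (x - h) - g x)) =
    avg (fun x => f x * g (x - h)) - avg (fun x => f x * g x).
  by rewrite -avgB; apply: eq_avg => x; rewrite mulrBr.
rewrite -(avg_shift h (fun x => f x * g (x - h))) -avgB.
by apply: eq_avg => x; rewrite addrK mulrBl.
Qed.

Lemma avg_norm_dif_opp h f :
  avg (fun x => `|dif (- h) f x|) = avg (fun x => `|dif h f x|).
Proof.
rewrite -(avg_shift h); apply: eq_avg => x.
by rewrite /dif addrK distrC.
Qed.

Lemma avg_norm_dif_add h k f :
  avg (fun x => `|dif (h + k) f x|) <=
  avg (fun x => `|dif h f x|) + avg (fun x => `|dif k f x|).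
Proof.
rewrite -(avg_shift h (fun x => `|dif k f x|)) -avgD; apply: le_avg => x.
rewrite /dif addrA [leRHS]addrC.
by apply: le_trans (ler_normD _ _); rewrite addrA subrK.
Qed.

Lemma avg_norm_dif_mul h f (l : nat) :
  avg (fun x => `|dif (h *+ l) f x|) <= l%:R * avg (fun x => `|dif h f x|).
Proof.
elim: l => [|l IH].
  rewrite mul0r mulr0n -[leRHS](avg_cst 0); apply: le_avg => x.
  by rewrite /dif addr0 subrr normr0.
by rewrite mulrS (le_trans (avg_norm_dif_add _ _ _))// -natr1 mulrDl mul1r addrC lerD2r.
Qed.

End average.

(** * Truncation to [al, M], its mobility and its entropy *)

Section mobility.
Context {R : realType} (al M lam : R).
Implicit Types s a b : R.

Definition clip s : R := Num.max al (Num.min M s).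

Definition excess s : R := Num.max 0 (s - M).

Definition deficit s : R := Num.max 0 (al - s).

(* The derivative of [entropy]; its slope is 1 on [al, M] and 1 + lam outside, so that
   large lam penalises the values outside [al, M]. *)
Definition eta s : R := clip s + (1 + lam) * (excess s - deficit s).

Definition Theta s : R :=
  clip s ^+ 2 / 2 + (1 + lam) * (M * excess s - al * deficit s).

(* Theta' = clip * eta'; along an edge, [mob] turns differences of eta into
   differences of Theta. *)
Definition mob a b : R :=
  if eta a == eta b then clip a else (Theta b - Theta a) / (eta b - eta a).

Definition entropy s : R :=
  s ^+ 2 / 2 + lam / 2 * (excess s ^+ 2 + deficit s ^+ 2).

Hypotheses (al_gt0 : 0 < al) (al_le_M : al <= M) (lam_ge0 : 0 <= lam).

(** Every function of this section is polynomial on each of these three pieces. The cases carry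
    their inequalities along, al <= M included, so that the lemmas below reduce to arithmetic on
    pairs of cases. *)
Lemma cut3 s :
  [\/ [/\ s <= al, al <= M, clip s = al, excess s = 0 & deficit s = al - s],
      [/\ al <= s, s <= M, clip s = s, excess s = 0 & deficit s = 0] |
      [/\ al <= M, M <= s, clip s = M, excess s = s - M & deficit s = 0]].
Proof.
have al0 := al_gt0; have aM := al_le_M; have l0 := lam_ge0.
rewrite /clip /excess /deficit; have [sa|/ltW sa] := leP s al.
  apply: Or31; split => //.
  - by rewrite min_r ?max_l// (le_trans sa).
  - by rewrite max_l// subr_le0 (le_trans sa).
  - by rewrite max_r// subr_ge0.
have [sM|/ltW sM] := leP s M.
  apply: Or32; split => //; first by rewrite max_r.
  - by rewrite max_l// subr_le0.
  - by rewrite max_l// subr_le0.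
apply: Or33; split => //; first by rewrite max_r.
- by rewrite max_r// subr_ge0.
- by rewrite max_l// subr_le0.
Qed.

Lemma clip_itv s : al <= clip s <= M.
Proof.
have al0 := al_gt0; have aM := al_le_M; have l0 := lam_ge0.
by case: (cut3 s) => -[h1 h2 -> _ _]; rewrite ?lexx ?al_le_M ?h1 ?h2.
Qed.

Lemma clip_mono a b : a <= b -> clip a <= clip b.
Proof.
have al0 := al_gt0; have aM := al_le_M; have l0 := lam_ge0.
by move=> ab; case: (cut3 a) => -[? ? -> _ _]; case: (cut3 b) => -[? ? -> _ _];
  lra.
Qed.

Lemma clip_id s : al <= s <= M -> clip s = s.
Proof. have aM := al_le_M. by move=> /andP[? ?]; case: (cut3 s) => -[? ? -> _ _]; lra. Qed.

Lemma clip_lip a b : `|clip b - clip a| <= `|b - a|.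
Proof.
have al0 := al_gt0; have aM := al_le_M; have l0 := lam_ge0.
wlog ab : a b / a <= b.
  move=> H; have [ab|/ltW ba] := leP a b; first exact: H.
  by rewrite distrC [leRHS]distrC; exact: H.
rewrite !ger0_norm ?subr_ge0 ?clip_mono//.
by case: (cut3 a) => -[? ? -> _ _]; case: (cut3 b) => -[? ? -> _ _]; lra.
Qed.

Lemma sub_clip s : s - clip s = excess s - deficit s.
Proof. have aM := al_le_M. by case: (cut3 s) => -[? ? -> -> ->]; lra. Qed.

(** The mean value bound for Theta' = clip * eta', with [clip] and [eta] nondecreasing. It places
    the quotient in [mob] between the values of [clip] at the two ends. *)
Lemma eta_Theta a b : a <= b ->
  clip a * (eta b - eta a) <= Theta b - Theta a <= clip b * (eta b - eta a).
Proof.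
have al0 := al_gt0; have aM := al_le_M; have l0 := lam_ge0.
move=> ab; rewrite /eta /Theta.
have : 1 <= 1 + lam by rewrite lerDl.
move: (1 + lam) => K K1.
have K0 : 0 <= K by rewrite (le_trans _ K1).
have h (x y : R) : x <= y -> 0 <= y - x by rewrite subr_ge0.
case: (cut3 a) => -[a1 a2 -> -> ->]; case: (cut3 b) => -[b1 b2 -> -> ->];
  have s1 := sqr_ge0 (al - M); have s2 := sqr_ge0 (a - b);
  have s3 := sqr_ge0 (al - b); have s4 := sqr_ge0 (a - M);
  have p0 := mulr_ge0 K0 (h _ _ ab).
- by apply/andP; split; lra.
- by apply/andP; split; have := mulr_ge0 (h _ _ b1) (mulr_ge0 K0 (h _ _ a1)); lra.
- apply/andP; split; have := mulr_ge0 (h _ _ aM) (mulr_ge0 K0 (h _ _ a1));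
    have := mulr_ge0 (h _ _ aM) (mulr_ge0 K0 (h _ _ b2)); lra.
- have -> : a = al by lra.
  have -> : b = al by lra.
  by apply/andP; split; lra.
- by apply/andP; split; lra.
- by apply/andP; split; have := mulr_ge0 (h _ _ a2) (mulr_ge0 K0 (h _ _ b2)); lra.
- have e1 : a = b by lra.
  have e2 : al = M by lra.
  have e3 : b = al by lra.
  by rewrite e1 -e2 e3; apply/andP; split; lra.
- have e1 : a = M by lra.
  have e2 : b = M by lra.
  by rewrite e1 e2; apply/andP; split; lra.
- by apply/andP; split; lra.
Qed.

Lemma etaE s : eta s = s + lam * (s - clip s).
Proof. by have := sub_clip s; rewrite /eta => h; rewrite -h; lra. Qed.

Lemma sub_clip_mono a b : a <= b -> a - clip a <= b - clip b.
Proof.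
move=> ab; have := clip_mono ab; have := clip_lip a b.
by rewrite !ger0_norm ?subr_ge0 ?clip_mono//; lra.
Qed.

Lemma eta_mono a b : a <= b -> b - a <= eta b - eta a.
Proof.
by move=> ab; rewrite !etaE; have := ler_wpM2l lam_ge0 (sub_clip_mono ab); lra.
Qed.

Lemma eta_lip a b : a <= b -> eta b - eta a <= (1 + lam) * (b - a).
Proof.
by move=> ab; rewrite !etaE; have := ler_wpM2l lam_ge0 (clip_mono ab); lra.
Qed.

Lemma Theta_mono a b : a <= b -> 0 <= Theta b - Theta a <= M * (1 + lam) * (b - a).
Proof.
have al0 := al_gt0; have aM := al_le_M; have l0 := lam_ge0.
move=> ab; have /andP[h1 h2] := eta_Theta ab.
have e1 := eta_mono ab; have e2 := eta_lip ab.
have /andP[a1 a2] := clip_itv a; have /andP[b1 b2] := clip_itv b.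
have e0 : 0 <= eta b - eta a by apply: le_trans e1; rewrite subr_ge0.
apply/andP; split.
  by apply: le_trans h1; rewrite mulr_ge0// (le_trans _ a1)// ltW.
apply: (le_trans h2); rewrite -mulrA; apply: ler_pM => //.
by rewrite (le_trans _ b1)// ltW.
Qed.

(** A chain rule that is exact on the grid. In the degenerate branch of [mob] the slope of [eta], at
    least 1, forces a = b. *)
Lemma mobE a b : mob a b * (eta b - eta a) = Theta b - Theta a.
Proof.
have al0 := al_gt0; have aM := al_le_M; have l0 := lam_ge0.
rewrite /mob; case: eqP => [e|/eqP ne]; last first.
  by rewrite divfK// subr_eq0 eq_sym.
rewrite e subrr mulr0.
have ab : a = b.
  have [ab|/ltW ba] := leP a b.
    by have := eta_mono ab; rewrite e; lra.
  by have := eta_mono ba; rewrite e; lra.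
by rewrite ab subrr.
Qed.

Lemma mob_close a b : `|mob a b - clip a| <= `|clip b - clip a|.
Proof.
have al0 := al_gt0; have aM := al_le_M; have l0 := lam_ge0.
rewrite /mob; case: eqP => [e|/eqP ne]; first by rewrite subrr normr0.
have [ab|/ltW ba] := leP a b.
  have d0 : 0 < eta b - eta a.
    by have := eta_mono ab; rewrite lt0r subr_eq0 eq_sym ne/=; lra.
  have /andP[] := eta_Theta ab; rewrite -ler_pdivlMr// => h1; rewrite -ler_pdivrMr// => h2.
  by rewrite !ger0_norm ?subr_ge0 ?clip_mono ?lerD2r.
have d0 : 0 < eta a - eta b.
  by have := eta_mono ba; rewrite lt0r subr_eq0 ne/=; lra.
have -> : (Theta b - Theta a) / (eta b - eta a) = (Theta a - Theta b) / (eta a - eta b).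
  by rewrite -mulrNN -invrN !opprB.
have /andP[] := eta_Theta ba; rewrite -ler_pdivlMr// => h1; rewrite -ler_pdivrMr// => h2.
by rewrite !ler0_norm ?subr_le0 ?clip_mono ?lerN2 ?lerD2r.
Qed.

Lemma mob_itv a b : al <= mob a b <= M.
Proof.
have al0 := al_gt0; have aM := al_le_M; have l0 := lam_ge0.
have /andP[a1 a2] := clip_itv a; have /andP[b1 b2] := clip_itv b.
rewrite /mob; case: eqP => [e|/eqP ne]; first by rewrite a1.
have [ab|/ltW ba] := leP a b.
  have d0 : 0 < eta b - eta a.
    by have := eta_mono ab; rewrite lt0r subr_eq0 eq_sym ne/=; lra.
  have /andP[] := eta_Theta ab; rewrite -ler_pdivlMr// => h1; rewrite -ler_pdivrMr// => h2.
  by rewrite (le_trans a1)// (le_trans h2).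
have d0 : 0 < eta a - eta b.
  by have := eta_mono ba; rewrite lt0r subr_eq0 ne/=; lra.
have -> : (Theta b - Theta a) / (eta b - eta a) = (Theta a - Theta b) / (eta a - eta b).
  by rewrite -mulrNN -invrN !opprB.
have /andP[] := eta_Theta ba; rewrite -ler_pdivlMr// => h1; rewrite -ler_pdivrMr// => h2.
by rewrite (le_trans b1)// (le_trans h2).
Qed.

Lemma entropy_itv s : al <= s <= M -> entropy s = s ^+ 2 / 2.
Proof.
move=> /andP[s1 s2]; rewrite /entropy /excess /deficit !max_l ?subr_le0//.
by rewrite expr0n addr0 mulr0 addr0.
Qed.

Lemma entropy_taylor a b :
  entropy b <= entropy a + eta a * (b - a) + (1 + lam) / 2 * (b - a) ^+ 2.
Proof.
have al0 := al_gt0; have aM := al_le_M; have l0 := lam_ge0.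
rewrite /entropy etaE.
have e (s : R) : excess s ^+ 2 + deficit s ^+ 2 = (s - clip s) ^+ 2.
  rewrite sub_clip; case: (cut3 s) => -[_ _ _ -> ->]; lra.
have /andP[a1 a2] := clip_itv a.
(* both sides compare b with points of [al, M], the nearest being [clip b] *)
have H : (b - clip b) ^+ 2 <= (b - clip a) ^+ 2.
  case: (cut3 b) => -[b1 b2 -> _ _].
  - have := @mulr_ge0 _ (clip a - al) (clip a + al - 2 * b); lra.
  - by rewrite subrr expr0n sqr_ge0.
  - have := @mulr_ge0 _ (M - clip a) (2 * b - M - clip a); lra.
rewrite !e; have := ler_wpM2l lam_ge0 H; lra.
Qed.

End mobility.

(** * The Moreau envelope of the absolute value *)

Section soft_sign.
Context {R : realType} (eps : R).
Implicit Types a b : R.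

Definition ssgn a : R := Num.max (-1) (Num.min 1 (a / eps)).

(* Moreau envelope of the absolute value; its derivative is [ssgn]. *)
Definition sabs a : R := ssgn a * a - eps / 2 * ssgn a ^+ 2.

Hypothesis eps_gt0 : 0 < eps.

Lemma ssgn3 a : [\/ a <= - eps /\ ssgn a = -1,
  [/\ a = eps * ssgn a, -1 <= ssgn a & ssgn a <= 1] | eps <= a /\ ssgn a = 1].
Proof.
have e0 := eps_gt0.
rewrite /ssgn; have [h|/ltW h] := leP a (- eps).
  apply: Or31; split => //.
  rewrite max_l// ge_min; apply/orP; right.
  by rewrite ler_pdivrMr// mulN1r.
have [h2|/ltW h2] := leP a eps.
  apply: Or32.
  have a1 : a / eps <= 1 by rewrite ler_pdivrMr// mul1r.
  have a2 : -1 <= a / eps by rewrite ler_pdivlMr// mulN1r.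
  by rewrite min_r// max_r//; split => //; rewrite mulrC divfK// gt_eqF.
apply: Or33; split => //.
have a1 : 1 <= a / eps by rewrite ler_pdivlMr// mul1r.
by rewrite min_l// max_r//; lra.
Qed.

Lemma ssgn_itv a : -1 <= ssgn a <= 1.
Proof.
have e0 := eps_gt0.
case: (ssgn3 a) => [[_ ->]|[_ -> ->]//|[_ ->]]; rewrite lexx ?andbT; lra.
Qed.

Lemma norm_ssgn a : `|ssgn a| <= 1.
Proof. by rewrite ler_norml ssgn_itv. Qed.

(** [sabs a] is the maximum of [b * a - eps / 2 * b ^+ 2] over b in [-1, 1], attained at [ssgn a].
    Particular choices of b give the convexity inequality and the comparison with the absolute
    value. *)
Lemma sabs_ge a b : -1 <= b <= 1 -> b * a - eps / 2 * b ^+ 2 <= sabs a.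
Proof.
have e0 := eps_gt0.
move=> /andP[b1 b2]; rewrite /sabs.
case: (ssgn3 a) => [[h e]|[e _ _]|[h e]].
- have p1 : 0 <= (b + 1) * (- eps - a) by rewrite mulr_ge0; lra.
  have p2 : 0 <= eps * (b + 1) ^+ 2 by rewrite mulr_ge0 ?sqr_ge0// ltW.
  by rewrite e; lra.
- have p2 : 0 <= eps * (b - ssgn a) ^+ 2 by rewrite mulr_ge0 ?sqr_ge0// ltW.
  have -> : b * a = b * (eps * ssgn a) by rewrite -e.
  have -> : ssgn a * a = ssgn a * (eps * ssgn a) by rewrite -e.
  lra.
- have p1 : 0 <= (1 - b) * (a - eps) by rewrite mulr_ge0; lra.
  have p2 : 0 <= eps * (b - 1) ^+ 2 by rewrite mulr_ge0 ?sqr_ge0// ltW.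
  by rewrite e; lra.
Qed.

Lemma ssgn_lip a b : (ssgn b - ssgn a) * (b - a) <= (b - a) ^+ 2 / eps.
Proof.
have e0 := eps_gt0.
wlog ab : a b / a <= b.
  move=> H; have [ab|/ltW ba] := leP a b; first exact: H.
  by rewrite -mulrNN !opprB -[in leRHS]sqrrN opprB; exact: H.
rewrite expr2 mulrAC ler_wpM2r ?subr_ge0// ler_pdivlMr//.
case: (ssgn3 a) => [[h1 e1]|[e1 a1 a2]|[h1 e1]];
case: (ssgn3 b) => [[h2 e2]|[e2 b1 b2]|[h2 e2]].
- by rewrite e1 e2; lra.
- by rewrite e1; have := ler_wpM2l (ltW e0) b2; lra.
- by rewrite e1 e2; lra.
- by rewrite e2; have := ler_wpM2l (ltW e0) a1; lra.
- by rewrite mulrC mulrBr -e1 -e2.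
- by rewrite e2; have := ler_wpM2l (ltW e0) a1; lra.
- by rewrite e1 e2; lra.
- by rewrite e1; have := ler_wpM2l (ltW e0) b2; lra.
- by rewrite e1 e2; lra.
Qed.

Lemma sabs_taylor a b :
  sabs b <= sabs a + ssgn a * (b - a) + (b - a) ^+ 2 / eps.
Proof.
have e0 := eps_gt0.
(* With [ssgn b] as competitor at a, sabs b - sabs a <= ssgn b * (b - a); the Lipschitz bound then
   replaces [ssgn b] by [ssgn a]. *)
have := sabs_ge a (ssgn_itv b); have := ssgn_lip a b.
rewrite /sabs; lra.
Qed.

Lemma sabs_bounds a : `|a| - eps / 2 <= sabs a <= `|a|.
Proof.
have e0 := eps_gt0.
apply/andP; split.
  have i1 : -1 <= (1 : R) <= 1 by rewrite lexx andbT; lra.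
  have i2 : -1 <= (-1 : R) <= 1 by rewrite lexx /=; lra.
  have := sabs_ge a i1; have := sabs_ge a i2.
  have [a0|a0] := leP 0 a; first by rewrite ger0_norm//; lra.
  by rewrite ltr0_norm//; lra.
have -> : `|a| = `|a| - 0 by rewrite subr0.
apply: lerB; last by rewrite mulr_ge0 ?sqr_ge0// divr_ge0// ltW.
apply: le_trans (ler_norm _) _; rewrite normrM ler_piMl//; exact: norm_ssgn.
Qed.

Lemma ssgn_mul_ge a : `|a| - eps <= ssgn a * a.
Proof.
have e0 := eps_gt0.
have /andP[h _] := sabs_bounds a; have : 0 <= eps / 2 * ssgn a ^+ 2.
  by rewrite mulr_ge0 ?sqr_ge0// divr_ge0// ltW.
move: h; rewrite /sabs; lra.
Qed.

(* Only the differences a shorter than eps contribute to the defect. *)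
Lemma ssgn_comonotone (L a A : R) : 0 <= L ->
  (0 <= a -> 0 <= A <= L * a) -> (a <= 0 -> L * a <= A <= 0) ->
  `|A| - ssgn a * A <= L * eps.
Proof.
have e0 := eps_gt0.
move=> L0 h1 h2.
have Le : 0 <= L * eps by rewrite mulr_ge0// ltW.
case: (ssgn3 a) => [[h e]|[e t1 t2]|[h e]].
- have /andP[_ A0] : L * a <= A <= 0 by apply: h2; lra.
  by rewrite e ler0_norm//; lra.
- have [a0|/ltW a0] := leP 0 a.
    have /andP[A0 A1] := h1 a0; rewrite ger0_norm//.
    have t0 : 0 <= ssgn a by rewrite -(pmulr_rge0 _ eps_gt0) -e.
    have : 0 <= ssgn a * A by rewrite mulr_ge0.
    have : L * a <= L * eps by rewrite ler_wpM2l// e ler_piMr// ltW.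
    lra.
  have /andP[A0 A1] := h2 a0; rewrite ler0_norm//.
  have t0 : ssgn a <= 0 by rewrite -(pmulr_rle0 _ eps_gt0) -e.
  have : 0 <= ssgn a * A by rewrite mulr_le0.
  have : L * - a <= L * eps.
    by rewrite ler_wpM2l// e -mulrN ler_piMr ?(ltW eps_gt0)// lerNl.
  lra.
- have /andP[A0 _] : 0 <= A <= L * a by apply: h1; lra.
  by rewrite e ger0_norm//; lra.
Qed.

End soft_sign.

(** * Nonlocal total variation and its gradient *)

Section curvature.
Context {R : realType} {G : finZmodType}.
Variables (W : seq (R * G)) (eps : R).
Implicit Types f g phi : G -> R.

(* Nonlocal total variation: weighted differences along finitely many vectors. *)
Definition nltv f : R := \sum_(v <- W) v.1 * avg (fun x => `|dif v.2 f x|).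

Definition energy f : R := \sum_(v <- W) v.1 * avg (fun x => sabs eps (dif v.2 f x)).

(* Minus the gradient of [energy] for the scalar product (f, g) |-> avg (f g) *)
Definition curv f x : R := \sum_(v <- W)
  v.1 * (ssgn eps (dif v.2 f x) - ssgn eps (dif v.2 f (x - v.2))).

Definition weight : R := \sum_(v <- W) v.1.

Hypotheses (W_ge0 : forall v, v \in W -> 0 <= v.1) (eps_gt0 : 0 < eps).

Lemma weight_ge0 : 0 <= weight.
Proof. by rewrite /weight big_seq; apply: sumr_ge0 => v /W_ge0. Qed.

Lemma ler_wsum (a b : R * G -> R) : (forall v, v \in W -> a v <= b v) ->
  \sum_(v <- W) v.1 * a v <= \sum_(v <- W) v.1 * b v.
Proof.
move=> ab; rewrite big_seq [leRHS]big_seq; apply: ler_sum => v vW.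
by rewrite ler_wpM2l ?W_ge0 ?ab.
Qed.

Lemma avg_curv f phi :
  avg (fun x => curv f x * phi x) =
  - \sum_(v <- W) v.1 * avg (fun x => ssgn eps (dif v.2 f x) * dif v.2 phi x).
Proof.
transitivity (avg (fun x => \sum_(v <- W) v.1 *
    ((ssgn eps (dif v.2 f x) - ssgn eps (dif v.2 f (x - v.2))) * phi x))).
  by apply: eq_avg => x; rewrite mulr_suml; apply: eq_bigr => v _; rewrite mulrA.
rewrite avg_sum -sumrN; apply: eq_bigr => v _.
rewrite avgZ -mulrN; congr (_ * _).
have -> : avg (fun x => ssgn eps (dif v.2 f x) * dif v.2 phi x) =
    avg (fun x => dif v.2 phi x * ssgn eps (dif v.2 f x)).
  by apply: eq_avg => x; rewrite mulrC.
by rewrite avg_dif_parts -avgN; apply: eq_avg => x; rewrite -mulrN opprB mulrC.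
Qed.

Lemma norm_curv f x : `|curv f x| <= 2 * weight.
Proof.
rewrite mulrC /weight mulr_suml (le_trans (ler_norm_sum _ _ _))//.
rewrite big_seq [leRHS]big_seq; apply: ler_sum => v vW.
rewrite normrM (ger0_norm (W_ge0 vW)) ler_wpM2l ?W_ge0//.
apply: le_trans (ler_normB _ _) _.
by rewrite -[2]/(1 + 1); apply: lerD; exact: norm_ssgn.
Qed.

Lemma energy_le f : energy f <= nltv f.
Proof.
by apply: ler_wsum => v _; apply: le_avg => x; have /andP[] := sabs_bounds eps_gt0 (dif v.2 f x).
Qed.

Lemma energy_ge f : nltv f - weight * (eps / 2) <= energy f.
Proof.
rewrite /weight mulr_suml -sumrB /energy.
rewrite (eq_bigr (fun v => v.1 * (avg (fun x => `|dif v.2 f x|) - eps / 2))); last first.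
  by move=> v _; rewrite mulrBr.
apply: ler_wsum => v _; rewrite -[X in _ - X](@avg_cst _ G) -avgB.
by apply: le_avg => x; have /andP[] := sabs_bounds eps_gt0 (dif v.2 f x).
Qed.

(** Euler's identity for a 1-homogeneous functional, up to the smoothing of the sign. In the limit
    it turns into the inequality between J(rho) and - \int rho div z that defines [calA]. *)
Lemma curv_ge f : nltv f - weight * eps <= - avg (fun x => curv f x * f x).
Proof.
rewrite avg_curv opprK /weight mulr_suml -sumrB.
rewrite (eq_bigr (fun v => v.1 * (avg (fun x => `|dif v.2 f x|) - eps))); last first.
  by move=> v _; rewrite mulrBr.
apply: ler_wsum => v _; rewrite -[X in _ - X](@avg_cst _ G) -avgB.
by apply: le_avg => x; exact: ssgn_mul_ge.
Qed.

Lemma energy_taylor f g (C : R) : (forall x, `|g x| <= C) ->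
  energy (fun x => f x + g x) <=
  energy f - avg (fun x => curv f x * g x) + weight * ((2 * C) ^+ 2 / eps).
Proof.
move=> gC; rewrite avg_curv opprK /weight mulr_suml -!big_split/=.
rewrite [leRHS](eq_bigr (fun v => v.1 * (avg (fun x => sabs eps (dif v.2 f x)) +
   avg (fun x => ssgn eps (dif v.2 f x) * dif v.2 g x) + (2 * C) ^+ 2 / eps))); last first.
  by move=> v _; rewrite !mulrDr.
apply: ler_wsum => v _; rewrite -[X in _ + X](@avg_cst _ G) -!avgD.
apply: le_avg => x.
have -> : dif v.2 (fun x => f x + g x) x = dif v.2 f x + dif v.2 g x.
  by rewrite /dif; lra.
have := sabs_taylor eps_gt0 (dif v.2 f x) (dif v.2 f x + dif v.2 g x).
rewrite (addrC _ (dif v.2 g x)) addrK => /le_trans; apply; rewrite lerD2l.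
rewrite ler_pM2r ?invr_gt0//.
have C0 : 0 <= C by rewrite (le_trans _ (gC x)).
rewrite -real_normK ?num_real// ler_pXn2r ?nnegrE ?mulr_ge0//.
apply: le_trans (ler_normB _ _) _.
by rewrite mulrDl mul1r lerD.
Qed.

(* Discrete coarea: shifting Theta o f does not change its nonlocal variation,
   on which the subgradient at f acts as at Theta o f. *)
Lemma curv_shift f (Th : R -> R) (L : R) (h : G) :
  0 <= L -> (forall a b, a <= b -> 0 <= Th b - Th a <= L * (b - a)) ->
  avg (fun x => curv f x * (Th (f x) - Th (f (x + h)))) <= weight * (L * eps).
Proof.
move=> L0 hTh; rewrite avg_curv -sumrN /weight mulr_suml.
rewrite [leLHS](eq_bigr (fun v => v.1 *
  - avg (fun x => ssgn eps (dif v.2 f x) *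
       dif v.2 (fun x => Th (f x) - Th (f (x + h))) x))); last first.
  by move=> v _; rewrite mulrN.
apply: ler_wsum => v _.
pose D := dif v.2 (Th \o f).
have -> : - avg (fun x => ssgn eps (dif v.2 f x) *
       dif v.2 (fun x => Th (f x) - Th (f (x + h))) x) =
    avg (fun x => ssgn eps (dif v.2 f x) * D (x + h)) -
    avg (fun x => ssgn eps (dif v.2 f x) * D x).
  rewrite -avgN -avgB; apply: eq_avg => x; rewrite /D /dif/= (addrAC x v.2 h); lra.
apply: (@le_trans _ _ (avg (fun x => `|D x|) -
    avg (fun x => ssgn eps (dif v.2 f x) * D x))).
  rewrite lerD2r -(avg_shift h (fun x => `|D x|)); apply: le_avg => x.
  apply: le_trans (ler_norm _) _; rewrite normrM ler_piMl//; exact: norm_ssgn.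
rewrite -avgB -(@avg_cst _ G (L * eps)); apply: le_avg => x.
apply: ssgn_comonotone => //; rewrite /D /dif/=.
  by rewrite subr_ge0 => /hTh.
rewrite subr_le0 => /hTh /andP[h1 h2]; apply/andP; split; lra.
Qed.

End curvature.

(** * The explicit Euler scheme *)

Section euler_step.
Context {R : realType} {G : finZmodType} {d : nat}.
Variables (e : 'I_d -> G) (n2 : R).
Implicit Types (m : 'I_d -> G -> R) (w phi f : G -> R).

(** The discrete - div (m grad w) in flux form, with [n2] the inverse square of the mesh width. *)
Definition incr m w x : R := n2 * \sum_i
  (m i (x - e i) * dif (e i) w (x - e i) - m i x * dif (e i) w x).

Lemma avg_incr m w phi :
  avg (fun x => incr m w x * phi x) =
  n2 * \sum_i avg (fun x => m i x * dif (e i) w x * dif (e i) phi x).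
Proof.
rewrite /incr (eq_avg (g := fun x => n2 * \sum_i
   (m i (x - e i) * dif (e i) w (x - e i) - m i x * dif (e i) w x) * phi x)); last first.
  by move=> x; rewrite -mulrA mulr_suml.
rewrite avgZ avg_sum; congr (_ * _); apply: eq_bigr => i _.
have -> : avg (fun x => m i x * dif (e i) w x * dif (e i) phi x) =
    avg (fun x => dif (e i) phi x * (m i x * dif (e i) w x)).
  by apply: eq_avg => x; rewrite mulrC.
by rewrite avg_dif_parts; apply: eq_avg => x; rewrite mulrC.
Qed.

Lemma norm_incr m w (M C : R) x : 0 <= n2 ->
  (forall i y, `|m i y| <= M) -> (forall y, `|w y| <= C) ->
  `|incr m w x| <= n2 * (d%:R * (4 * M * C)).
Proof.
move=> n0 mM wC; rewrite normrM (ger0_norm n0) ler_wpM2l//.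
rewrite (le_trans (ler_norm_sum _ _ _))//.
rewrite -[X in X%:R]card_ord mulr_natl -sumr_const; apply: ler_sum => i _.
have M0 : 0 <= M by rewrite (le_trans _ (mM i x)).
have dC y : `|dif (e i) w y| <= 2 * C.
  by apply: le_trans (ler_normB _ _) _; rewrite mulrDl mul1r lerD.
apply: le_trans (ler_normB _ _) _; rewrite !normrM.
have -> : 4 * M * C = M * (2 * C) + M * (2 * C) by lra.
by apply: lerD; apply: ler_pM.
Qed.

End euler_step.

Section euler_scheme.
Context {R : realType} {G : finZmodType} {d : nat}.
Variables (W : seq (R * G)) (e : 'I_d -> G) (n2 tau eps al M lam : R).

Definition mobility (f : G -> R) i x : R := mob al M lam (f x) (f (x + e i)).

Definition rate f : G -> R := incr e n2 (mobility f) (curv W eps f).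

Definition euler f x : R := f x + tau * rate f x.

Definition dissip f : R :=
  n2 * \sum_i avg (fun x => mobility f i x * dif (e i) (curv W eps f) x ^+ 2).

(** A bound on the rate that only uses that curvature and mobility are bounded. It grows with the
    grid, but is always multiplied by the time step, which is chosen last. *)
Definition rmax : R := n2 * (d%:R * (4 * M * (2 * weight W))).

Hypotheses (W_ge0 : forall v, v \in W -> 0 <= v.1) (eps_gt0 : 0 < eps)
  (al_gt0 : 0 < al) (al_le_M : al <= M) (lam_ge0 : 0 <= lam)
  (n2_ge0 : 0 <= n2) (tau_ge0 : 0 <= tau).

Lemma norm_rate f x : `|rate f x| <= rmax.
Proof.
apply: norm_incr => //; last by move=> y; exact: norm_curv.
move=> i y; have /andP[h1 h2] := mob_itv al_gt0 al_le_M lam_ge0 (f y) (f (y + e i)).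
by rewrite ger0_norm// (le_trans _ h1)// ltW.
Qed.

Lemma avg_rate f phi : avg (fun x => rate f x * phi x) =
  n2 * \sum_i avg (fun x =>
    mobility f i x * dif (e i) (curv W eps f) x * dif (e i) phi x).
Proof. exact: avg_incr. Qed.

Lemma energy_euler f : energy W eps (euler f) <=
  energy W eps f - tau * dissip f + tau ^+ 2 * (weight W * ((2 * rmax) ^+ 2 / eps)).
Proof.
have H := @energy_taylor _ _ _ _ W_ge0 eps_gt0 f (fun x => tau * rate f x) (tau * rmax).
apply: le_trans (H _) _.
  by move=> x; rewrite normrM ger0_norm// ler_wpM2l// norm_rate.
have -> : avg (fun x => curv W eps f x * (tau * rate f x)) = tau * dissip f.
  rewrite /dissip (eq_bigr (fun i => avg (fun x => mobility f i x *
     dif (e i) (curv W eps f) x * dif (e i) (curv W eps f) x))); last first.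
    by move=> i _; apply: eq_avg => x; rewrite expr2 mulrA.
  rewrite -avg_rate -avgZ; apply: eq_avg => x; lra.
by rewrite lerD2l; lra.
Qed.

(** The first-order term pairs the rate with [eta]. After summation by parts, [mobE] turns it into
    differences of the curvature against differences of [Theta], hence into the curvature tested
    with [Theta] minus its shifts by e i and by - e i. The coarea argument of [curv_shift] bounds
    each of these by a multiple of eps. *)
Lemma entropy_euler f : avg (fun x => entropy al M lam (euler f x)) <=
  avg (fun x => entropy al M lam (f x)) +
  tau * (n2 * (d%:R * (2 * (weight W * (M * (1 + lam) * eps))))) +
  tau ^+ 2 * ((1 + lam) / 2 * rmax ^+ 2).
Proof.
apply: (@le_trans _ _ (avg (fun x => entropy al M lam (f x) +
   tau * (rate f x * eta al M lam (f x)) + tau ^+ 2 * ((1 + lam) / 2 * rmax ^+ 2)))).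
  apply: le_avg => x.
  apply: le_trans (entropy_taylor al_gt0 al_le_M lam_ge0 (f x) (euler f x)) _.
  have -> : euler f x - f x = tau * rate f x by rewrite /euler; lra.
  rewrite [X in _ + X + _ <= _]mulrC -[X in _ + X + _ <= _]mulrA lerD2l.
  rewrite exprMn mulrCA ler_wpM2l ?sqr_ge0// ler_wpM2l ?divr_ge0 ?addr_ge0//.
  have := norm_rate f x => h.
  by rewrite -real_normK ?num_real// ler_pXn2r ?nnegrE// (le_trans _ h).
rewrite avgD avg_cst lerD2r avgD lerD2l avgZ ler_wpM2l// avg_rate ler_wpM2l//.
rewrite -[X in X%:R]card_ord mulr_natl -sumr_const; apply: ler_sum => i _.
have -> : avg (fun x => mobility f i x * dif (e i) (curv W eps f) x *
     dif (e i) (fun x0 => eta al M lam (f x0)) x) =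
   avg (fun x => dif (e i) (curv W eps f) x * dif (e i) (Theta al M lam \o f) x).
  apply: eq_avg => x; rewrite mulrAC [RHS]mulrC; congr (_ * _).
  exact: mobE.
rewrite avg_dif_parts.
have -> : avg (fun x => curv W eps f x * (dif (e i) (Theta al M lam \o f) (x - e i) -
     dif (e i) (Theta al M lam \o f) x)) =
  avg (fun x => curv W eps f x * (Theta al M lam (f x) - Theta al M lam (f (x + e i)))) +
  avg (fun x => curv W eps f x * (Theta al M lam (f x) - Theta al M lam (f (x - e i)))).
  by rewrite -avgD; apply: eq_avg => x; rewrite /dif/= subrK; lra.
have L0 : 0 <= M * (1 + lam).
  by rewrite mulr_ge0 ?addr_ge0// (le_trans _ al_le_M)// ltW.
rewrite [leRHS]mulrDl mul1r; apply: lerD; apply: curv_shift => // a b ab;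
  exact: Theta_mono.
Qed.

Lemma energy_iter f k : energy W eps (iter k euler f) +
   tau * \sum_(j < k) dissip (iter j euler f) <=
  energy W eps f + k%:R * tau * (tau * (weight W * ((2 * rmax) ^+ 2 / eps))).
Proof.
elim: k => [|k IH]; first by rewrite big_ord0 !mul0r mulr0.
rewrite big_ord_recr/= -natr1; have := energy_euler (iter k euler f).
lra.
Qed.

Lemma entropy_iter f k : avg (fun x => entropy al M lam (iter k euler f x)) <=
  avg (fun x => entropy al M lam (f x)) +
  k%:R * tau * (n2 * (d%:R * (2 * (weight W * (M * (1 + lam) * eps)))) +
                tau * ((1 + lam) / 2 * rmax ^+ 2)).
Proof.
elim: k => [|k IH]; first by rewrite !mul0r addr0.
rewrite -natr1; have := entropy_euler (iter k euler f); rewrite /=; lra.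
Qed.

End euler_scheme.

Section walk_evaluation.
Context {d : nat}.

(* A walk is a sequence of signed coordinate directions; [walk_end u p] is its
   endpoint when the i-th direction is the vector u i. *)
Definition step_end {V : zmodType} (u : 'I_d -> V) (s : 'I_d * bool) : V :=
  if s.2 then u s.1 else - u s.1.

Definition walk_end {V : zmodType} (u : 'I_d -> V) (p : seq ('I_d * bool)) : V :=
  \sum_(s <- p) step_end u s.

Lemma walk_end_cons {V : zmodType} (u : 'I_d -> V) s p :
  walk_end u (s :: p) = step_end u s + walk_end u p.
Proof. exact: big_cons. Qed.

Lemma walk_end0 {V : zmodType} (u : 'I_d -> V) : walk_end u [::] = 0.
Proof. exact: big_nil. Qed.

End walk_evaluation.

(** * Box averages *)

Section box_smoothing.
Context {R : realType} {G : finZmodType}.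
Variables (L : nat).
Implicit Types (f g : G -> R) (h k : G) (es : seq G).

Definition box1 h f x : R := (\sum_(l < L) f (x + h *+ l)) / L%:R.

Definition box es f : G -> R := foldr box1 f es.

Hypothesis L_gt0 : (0 < L)%N.

Let LR : 0 < L%:R :> R. Proof. by rewrite ltr0n. Qed.

Lemma box1_norm h f x : `|box1 h f x| <= box1 h (fun x => `|f x|) x.
Proof.
rewrite /box1 normrM [X in _ * X]ger0_norm ?invr_ge0 ?(ltW LR)//.
by rewrite ler_wpM2r ?invr_ge0 ?(ltW LR)//; exact: ler_norm_sum.
Qed.

Lemma avg_box1 h f : avg (box1 h f) = avg f.
Proof.
rewrite /box1 (eq_avg (g := fun x => L%:R^-1 * \sum_(l < L) f (x + h *+ l))).
  rewrite avgZ avg_sum (eq_bigr (fun=> avg f)); last by move=> l _; exact: avg_shift.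
  by rewrite sumr_const card_ord -[avg f *+ L]mulr_natl mulKf// gt_eqF.
by move=> x; rewrite mulrC.
Qed.

Lemma avg_norm_box1 h f : avg (fun x => `|box1 h f x|) <= avg (fun x => `|f x|).
Proof.
rewrite -[leRHS](avg_box1 h); apply: le_avg => x; exact: box1_norm.
Qed.

Lemma dif_box1 h k f : dif k (box1 h f) = box1 h (dif k f).
Proof.
apply/funext => x; rewrite /dif /box1 -mulrBl -sumrB; congr (_ / _).
by apply: eq_bigr => l _; rewrite addrAC.
Qed.

(** Telescoping: differencing a mean over L consecutive translates leaves its two ends, a gain of 1
    / L. All regularity of box averages comes from here. *)
Lemma dif_box1_self h f x : dif h (box1 h f) x = (f (x + h *+ L) - f x) / L%:R.
Proof.
rewrite dif_box1 /box1; congr (_ / _).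
rewrite -(big_mkord xpredT (fun l => dif h f (x + h *+ l))).
rewrite (eq_big_nat _ _ (F2 := fun l => f (x + h *+ l.+1) - f (x + h *+ l))).
  by rewrite telescope_sumr ?leq0n// mulr0n addr0.
by move=> l _; rewrite /dif mulrSr addrA.
Qed.

Lemma avg_box1_sub h f : avg (fun x => `|box1 h f x - f x|) <=
  L%:R * avg (fun x => `|dif h f x|).
Proof.
apply: (@le_trans _ _ (avg (box1 h (fun=> 0)) + L%:R^-1 * \sum_(l < L)
   avg (fun x => `|dif (h *+ l) f x|))).
  rewrite avg_box1 avg_cst add0r -avg_sum -avgZ; apply: le_avg => x.
  have -> : box1 h f x - f x = L%:R^-1 * \sum_(l < L) dif (h *+ l) f x.
    rewrite /dif sumrB sumr_const card_ord mulrBr -[f x *+ L]mulr_natl mulKf ?gt_eqF//.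
    by rewrite mulrC.
  rewrite normrM ger0_norm ?invr_ge0 ?(ltW LR)//.
  by rewrite ler_wpM2l ?invr_ge0 ?(ltW LR)//; exact: ler_norm_sum.
rewrite avg_box1 avg_cst add0r ler_pdivrMl//.
apply: (@le_trans _ _ (\sum_(l < L) L%:R * avg (fun x => `|dif h f x|))).
  apply: ler_sum => l _; apply: le_trans (avg_norm_dif_mul _ _ _) _.
  by apply: ler_wpM2r; [exact: avg_ge0|rewrite ler_nat ltnW].
by rewrite sumr_const card_ord -[_ *+ _]mulr_natl.
Qed.

Lemma avg_norm_box es f : avg (fun x => `|box es f x|) <= avg (fun x => `|f x|).
Proof.
by elim: es => //= h es IH; apply: le_trans (avg_norm_box1 _ _) IH.
Qed.

Lemma dif_box es k f : dif k (box es f) = box es (dif k f).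
Proof. by elim: es => //= h es IH; rewrite dif_box1 IH. Qed.

Lemma avg_dif_box es h f : h \in es ->
  avg (fun x => `|dif h (box es f) x|) <= 2 / L%:R * avg (fun x => `|f x|).
Proof.
elim: es => //= k es IH; rewrite inE => /orP[/eqP <-|hes]; last first.
  by rewrite dif_box1; apply: le_trans (avg_norm_box1 _ _) (IH hes).
apply: (@le_trans _ _ (L%:R^-1 *
    (avg (fun x => `|box es f (x + h *+ L)|) + avg (fun x => `|box es f x|)))).
  rewrite -avgD -avgZ; apply: le_avg => x; rewrite dif_box1_self.
  rewrite mulrC normrM ger0_norm ?invr_ge0 ?(ltW LR)//.
  by rewrite ler_wpM2l ?invr_ge0 ?(ltW LR)//; exact: ler_normB.
rewrite (avg_shift (h *+ L) (fun x => `|box es f x|)).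
rewrite mulrAC [leRHS]mulrC ler_wpM2l ?invr_ge0 ?(ltW LR)// mulrDl mul1r.
by apply: lerD; exact: avg_norm_box.
Qed.

Lemma avg_box_sub es f : avg (fun x => `|box es f x - f x|) <=
  L%:R * \sum_(h <- es) avg (fun x => `|dif h f x|).
Proof.
elim: es => [|h es IH] /=.
  rewrite big_nil mulr0 -[leRHS](@avg_cst R G); apply: le_avg => x.
  by rewrite subrr normr0.
rewrite big_cons mulrDr.
apply: (@le_trans _ _ (avg (fun x => `|box1 h (box es f) x - box es f x|) +
  avg (fun x => `|box es f x - f x|))).
  rewrite -avgD; apply: le_avg => x; apply: le_trans (ler_normD _ _).
  by rewrite addrA subrK.
apply: lerD => //; apply: le_trans (avg_box1_sub _ _) _.
rewrite ler_wpM2l//; apply: le_trans (avg_norm_box es _).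
by rewrite dif_box.
Qed.

Lemma norm_box es f (C : R) : (forall x, `|f x| <= C) -> forall x, `|box es f x| <= C.
Proof.
move=> fC; elim: es => //= h es IH x; apply: le_trans (box1_norm _ _ _) _.
rewrite /box1 ler_pdivrMr// mulrC.
apply: (@le_trans _ _ (\sum_(l < L) C)); first exact: ler_sum.
by rewrite sumr_const card_ord -[_ *+ _]mulr_natl.
Qed.

Lemma norm_dif_box es h f (C : R) : h \in es -> (forall x, `|f x| <= C) ->
  forall x, `|dif h (box es f) x| <= 2 * C / L%:R.
Proof.
move=> + fC; elim: es => //= k es IH; rewrite inE => /orP[/eqP <-|hes] x.
  rewrite dif_box1_self normrM [X in _ * X]ger0_norm ?invr_ge0 ?(ltW LR)//.
  rewrite ler_pM2r ?invr_gt0//; apply: le_trans (ler_normB _ _) _.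
  by rewrite mulrDl mul1r; apply: lerD; exact: norm_box.
rewrite dif_box1; apply: le_trans (box1_norm _ _ _) _.
rewrite /box1 ler_pdivrMr// mulrC.
apply: (@le_trans _ _ (\sum_(l < L) (2 * C / L%:R))); last first.
  by rewrite sumr_const card_ord -[_ *+ _]mulr_natl.
by apply: ler_sum => l _; exact: IH.
Qed.

Lemma box1C h k f : box1 h (box1 k f) = box1 k (box1 h f).
Proof.
apply/funext => x; rewrite /box1 -!mulr_suml; congr (_ / _ / _).
by rewrite exchange_big; apply: eq_bigr => i _; apply: eq_bigr => j _; rewrite addrAC.
Qed.

Lemma box_box1 es h f : box es (box1 h f) = box1 h (box es f).
Proof. by elim: es => //= k es ->; rewrite box1C. Qed.

(** The adjoint averages along the opposite directions. It serves to move an average from a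
    difference of densities onto its sign, which then has bounded difference quotients. *)
Lemma avg_box_adjoint es f g : avg (fun x => box es f x * g x) =
  avg (fun x => f x * box [seq - h | h <- es] g x).
Proof.
elim: es g => //= h es IH g.
transitivity (avg (fun x => box es f x * box1 (- h) g x)).
  rewrite (eq_avg (g := fun x => L%:R^-1 * \sum_(l < L) (box es f (x + h *+ l) * g x))).
    rewrite [RHS](eq_avg (g := fun x =>
      L%:R^-1 * \sum_(l < L) (box es f x * g (x - h *+ l)))).
      rewrite !avgZ !avg_sum; congr (_ * _); apply: eq_bigr => l _.
      by rewrite -[RHS](avg_shift (h *+ l)); apply: eq_avg => x; rewrite addrK.
    move=> x; rewrite /box1 -mulr_sumr mulrA [RHS]mulrC; congr (_ / _); congr (_ * _).
    by apply: eq_bigr => l _; rewrite mulNrn.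
  by move=> x; rewrite /box1 -mulr_suml mulrA (mulrC L%:R^-1).
by rewrite IH; apply: eq_avg => x; rewrite box_box1.
Qed.

End box_smoothing.

(** With these weights a bound N^2 for N steps becomes exactly (N + 1)^2 for N + 1 steps, since (1 +
    1 / N) N^2 + (1 + N) = (N + 1)^2. *)
Lemma sqrD_young {R : realType} (a b N : R) : 0 < N ->
  (a + b) ^+ 2 <= (1 + N^-1) * a ^+ 2 + (1 + N) * b ^+ 2.
Proof.
move=> N0; rewrite -subr_ge0.
have -> : (1 + N^-1) * a ^+ 2 + (1 + N) * b ^+ 2 - (a + b) ^+ 2 =
    N^-1 * (a - N * b) ^+ 2 by field; exact: lt0r_neq0.
by rewrite mulr_ge0 ?sqr_ge0// invr_ge0 ltW.
Qed.

(** * Differences along walks and a discrete Poincare inequality *)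

Section discrete_estimates.
Context {R : realType} {G : finZmodType} {d : nat}.
Variables (e : 'I_d -> G).
Implicit Types (f w : G -> R) (p : seq ('I_d * bool)).

Lemma avg_norm_dif_walk p f (Q : R) :
  (forall i, avg (fun x => `|dif (e i) f x|) <= Q) ->
  avg (fun x => `|dif (walk_end e p) f x|) <= (size p)%:R * Q.
Proof.
move=> fQ; elim: p => [|s p IH] /=.
  rewrite walk_end0 mul0r -[leRHS](@avg_cst R G); apply: le_avg => x.
  by rewrite /dif addr0 subrr normr0.
rewrite walk_end_cons (le_trans (avg_norm_dif_add _ _ _))// -natr1 mulrDl mul1r addrC.
apply: lerD => //; rewrite /step_end; case: ifP => // _.
by rewrite avg_norm_dif_opp.
Qed.

(** Splitting a step h off the rest g of the walk costs [dif g (dif h f)], in the mean as many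
    second differences as g has steps. A backward step costs one more, from - dif (e i) f to dif (-
    e i) f. Along the walk this adds up to at most the square of its length. *)
Lemma avg_dif_walk p f (Q : R) :
  (forall i j, avg (fun x => `|dif (e i) (dif (e j) f) x|) <= Q) ->
  avg (fun x => `|dif (walk_end e p) f x - walk_end (fun i => dif (e i) f x) p|) <=
  (size p)%:R ^+ 2 * Q.
Proof.
move=> fQ; elim: p => [|s p IH] /=.
  rewrite expr0n mul0r -[leRHS](@avg_cst R G); apply: le_avg => x.
  by rewrite !walk_end0 /dif addr0 subrr subr0 normr0.
have Q0 : 0 <= Q by apply: le_trans (fQ s.1 s.1); apply: avg_ge0.
pose h := step_end e s; pose g := walk_end e p.
apply: (@le_trans _ _ (avg (fun x => `|dif g f x - walk_end (fun i => dif (e i) f x) p|) +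
   avg (fun x => `|dif g (dif h f) x|) +
   avg (fun x => `|dif h f x - step_end (fun i => dif (e i) f x) s|))).
  rewrite -!avgD; apply: le_avg => x; rewrite !walk_end_cons -/h -/g.
  have -> : dif (h + g) f x - (step_end (fun i => dif (e i) f x) s +
      walk_end (fun i => dif (e i) f x) p) =
    (dif g f x - walk_end (fun i => dif (e i) f x) p) + dif g (dif h f) x +
    (dif h f x - step_end (fun i => dif (e i) f x) s).
    by rewrite /dif (addrC h g) addrA; lra.
  by apply: le_trans (ler_normD _ _) _; rewrite lerD2r; exact: ler_normD.
have H2 : avg (fun x => `|dif g (dif h f) x|) <= (size p)%:R * Q.
  apply: avg_norm_dif_walk => i; rewrite /h /step_end; case: ifP => // _.
  apply: le_trans (fQ i s.1); rewrite -(avg_shift (- e s.1)  (fun x => `|dif (e i) (dif (e s.1) f) x|)).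
  apply: le_avg => x; rewrite -normrN /dif (addrAC x (- e s.1)) !subrK.
  by rewrite le_eqVlt; apply/orP; left; apply/eqP; congr `|_|; lra.
have H3 : avg (fun x => `|dif h f x - step_end (fun i => dif (e i) f x) s|) <= Q.
  rewrite /h /step_end; case: ifP => _.
    by rewrite -[leLHS]addr0 -[leRHS](@avg_cst R G) -[0](@avg_cst R G) -avgD;
      apply: le_avg => x; rewrite subrr normr0 addr0.
  apply: le_trans (fQ s.1 s.1).
  rewrite -[leRHS](avg_shift (- e s.1)); apply: le_avg => x.
  rewrite /dif !subrK le_eqVlt; apply/orP; left; apply/eqP; congr `|_|; lra.
rewrite -natr1; have := mulr_ge0 (ler0n R (size p)) Q0.
by move: IH H2 H3; set l := _%:R; lra.
Qed.

Lemma avg_sqr_dif_mul h w (l : nat) :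
  avg (fun x => dif (h *+ l) w x ^+ 2) <= l%:R ^+ 2 * avg (fun x => dif h w x ^+ 2).
Proof.
case: l => [|l].
  rewrite expr0n mul0r mulr0n -[leRHS](@avg_cst R G); apply: le_avg => x.
  by rewrite /dif addr0 subrr expr0n.
elim: l => [|l IH]; first by rewrite mulr1n expr1n mul1r.
set N : R := l.+1%:R in IH *.
have N0 : 0 < N by rewrite ltr0n.
apply: (@le_trans _ _ ((1 + N^-1) * avg (fun x => dif (h *+ l.+1) w x ^+ 2) +
   (1 + N) * avg (fun x => dif h w x ^+ 2))).
  rewrite -(avg_shift (h *+ l.+1) (fun x => dif h w x ^+ 2)) -!avgZ -avgD.
  apply: le_avg => x; rewrite mulrSr.
  have -> : dif (h *+ l.+1 + h) w x = dif (h *+ l.+1) w x + dif h w (x + h *+ l.+1).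
    by rewrite /dif addrA; lra.
  set a := dif _ _ _; set b := dif _ _ _.
  exact: sqrD_young.
have -> : l.+2%:R = N + 1 by rewrite -natr1.
have -> : (N + 1) ^+ 2 * avg (fun x => dif h w x ^+ 2) =
   (1 + N^-1) * (N ^+ 2 * avg (fun x => dif h w x ^+ 2)) +
   (1 + N) * avg (fun x => dif h w x ^+ 2).
  by field; exact: lt0r_neq0.
by rewrite lerD2r ler_wpM2l// addr_ge0 ?invr_ge0 ?(ltW N0).
Qed.

Lemma avg_sqr_dif_sum (r : seq 'I_d) (h : 'I_d -> G) w :
  avg (fun x => dif (\sum_(i <- r) h i) w x ^+ 2) <=
  (size r)%:R * \sum_(i <- r) avg (fun x => dif (h i) w x ^+ 2).
Proof.
elim: r => [|i r IH].
  rewrite !big_nil mulr0 -[leRHS](@avg_cst R G); apply: le_avg => x.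
  by rewrite /dif addr0 subrr expr0n.
case: r IH => [|j r] IH; first by rewrite !big_seq1 mul1r.
rewrite 2!(big_cons _ _ i); set g := \sum_(_ <- _ :: r) h _ in IH *.
set S := \sum_(_ <- _ :: r) _ in IH *.
rewrite [size _]/= -[(size r).+2%:R]natr1; set N : R := (size r).+1%:R in IH *.
have N0 : 0 < N by rewrite ltr0n.
clearbody N.
apply: (@le_trans _ _ ((1 + N) * avg (fun x => dif (h i) w x ^+ 2) +
   (1 + N^-1) * avg (fun x => dif g w x ^+ 2))).
  rewrite -(avg_shift g (fun x => dif (h i) w x ^+ 2)) -!avgZ -avgD.
  apply: le_avg => x; rewrite (addrC (h i)).
  have -> : dif (g + h i) w x = dif g w x + dif (h i) w (x + g).
    by rewrite /dif addrA; lra.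
  set a := dif _ _ _; set b := dif _ _ _.
  by rewrite [leRHS]addrC; exact: sqrD_young.
have : (1 + N^-1) * avg (fun x => dif g w x ^+ 2) <= (1 + N^-1) * (N * S).
  by rewrite ler_wpM2l// addr_ge0 ?invr_ge0 ?(ltW N0).
have -> : (1 + N^-1) * (N * S) = (N + 1) * S by field; exact: lt0r_neq0.
lra.
Qed.

(** For w of mean zero, the squared L2 norm of [dif g w], averaged over all g, is twice that of w,
    because the mixed term vanishes. Each g is a sum of at most n steps in each of d directions, and
    the square of a sum of l differences costs at most a factor l. *)
Lemma poincare w (n : nat) :
  (forall g : G, exists a : 'I_d -> nat,
     (forall i, (a i <= n)%N) /\ g = \sum_i e i *+ a i) ->
  avg w = 0 ->
  avg (fun x => w x ^+ 2) <=
  d%:R * \sum_i n%:R ^+ 2 * avg (fun x => dif (e i) w x ^+ 2).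
Proof.
move=> gen w0.
set B := leRHS.
have H g : avg (fun x => dif g w x ^+ 2) <= B.
  have [a [an ->]] := gen g.
  apply: le_trans (avg_sqr_dif_sum _ _ _) _.
  rewrite -[X in (size X)%:R]enumT size_enum_ord.
  rewrite ler_wpM2l//; apply: ler_sum => i _.
  apply: le_trans (avg_sqr_dif_mul _ _ _) _.
  rewrite ler_wpM2r//; first by apply: avg_ge0 => x; exact: sqr_ge0.
  by rewrite ler_pXn2r ?nnegrE// ler_nat.
have E : avg (fun g => avg (fun x => dif g w x ^+ 2)) = 2 * avg (fun x => w x ^+ 2).
  rewrite (eq_avg (g := fun g => 2 * avg (fun x => w x ^+ 2) -
    2 * avg (fun x => w x * w (x + g)))); last first.
    move=> g; rewrite -avgZ -avgZ.
    have -> : avg (fun x => 2 * w x ^+ 2) = avg (fun x => w (x + g) ^+ 2) + avg (fun x => w x ^+ 2).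
      by rewrite (avg_shift g (fun x => w x ^+ 2)) avgZ; lra.
    by rewrite -avgD -avgB; apply: eq_avg => x; rewrite /dif; lra.
  rewrite avgB avg_cst avgZ.
  have -> : avg (fun g => avg (fun x => w x * w (x + g))) = 0.
    rewrite {1}/avg -mulr_suml; apply/eqP; rewrite mulf_eq0; apply/orP; left.
    rewrite mulf_eq0; apply/orP; left.
    rewrite exchange_big big1// => x _; rewrite -mulr_sumr.
    have -> : \sum_i w (x + i) = #|G|%:R * avg w.
      rewrite -(avg_shift x w) /avg mulrC divfK; last exact/lt0r_neq0/(@cardR_gt0 R G).
      by apply: eq_bigr => i _; rewrite addrC.
    by rewrite w0 !mulr0.
  by rewrite mulr0 subr0.
have : avg (fun g => avg (fun x => dif g w x ^+ 2)) <= B.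
  by rewrite -[leRHS](@avg_cst R G); apply: le_avg.
rewrite E; have : 0 <= avg (fun x => w x ^+ 2) by apply: avg_ge0 => x; exact: sqr_ge0.
lra.
Qed.

End discrete_estimates.

(** * Euclidean length of row vectors *)

Section euclidean.
Context {R : realType} {d : nat}.
Implicit Types u v : 'rV[R]_d.

Lemma dot_ge0 u : 0 <= dot u u.
Proof. by apply: sumr_ge0 => i _; rewrite -expr2 sqr_ge0. Qed.

Lemma enorm_ge0 u : 0 <= enorm u.
Proof. exact: sqrtr_ge0. Qed.

Lemma sqr_enorm u : enorm u ^+ 2 = dot u u.
Proof. by rewrite sqr_sqrtr// dot_ge0. Qed.

Lemma dotC u v : dot u v = dot v u.
Proof. by apply: eq_bigr => i _; rewrite mulrC. Qed.

Lemma dotDl u v w : dot (u + v) w = dot u w + dot v w.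
Proof. by rewrite /dot -big_split; apply: eq_bigr => i _; rewrite mxE mulrDl. Qed.

Lemma dotZl (a : R) u v : dot (a *: u) v = a * dot u v.
Proof. by rewrite /dot mulr_sumr; apply: eq_bigr => i _; rewrite mxE mulrA. Qed.

Lemma enormZ (a : R) u : enorm (a *: u) = `|a| * enorm u.
Proof.
by rewrite /enorm dotZl dotC dotZl mulrA -expr2 sqrtrM ?sqr_ge0// sqrtr_sqr.
Qed.

Lemma norm_coord_enorm u i : `|u 0 i| <= enorm u.
Proof.
rewrite -sqrtr_sqr; apply: ler_wsqrtr; rewrite /dot (bigD1 i)//= -expr2 lerDl.
by apply: sumr_ge0 => j _; rewrite -expr2 sqr_ge0.
Qed.

Lemma enorm0_eq0 u : enorm u = 0 -> u = 0.
Proof.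
move=> u0; apply/rowP => i; rewrite mxE; apply/eqP.
by rewrite -normr_eq0 eq_le normr_ge0 andbT -u0 norm_coord_enorm.
Qed.

Lemma dot_le u v : dot u v <= enorm u * enorm v.
Proof.
have [u0|u0] := eqVneq (enorm u) 0.
  by rewrite u0 mul0r (enorm0_eq0 u0) /dot big1// => i _; rewrite mxE mul0r.
have [v0|v0] := eqVneq (enorm v) 0.
  by rewrite v0 mulr0 (enorm0_eq0 v0) /dot big1// => i _; rewrite mxE mulr0.
have up : 0 < enorm u by rewrite lt0r u0 enorm_ge0.
have vp : 0 < enorm v by rewrite lt0r v0 enorm_ge0.
have := dot_ge0 (enorm v *: u + (- enorm u) *: v).
rewrite !(dotDl, dotC _ (_ + _), dotZl, dotC _ (_ *: _)) -!sqr_enorm (dotC v u).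
set a := enorm u in up *; set b := enorm v in vp *; set c := dot u v => h.
have : 0 <= (a * b) * (a * b - c) by lra.
by rewrite pmulr_rge0 ?mulr_gt0// subr_ge0.
Qed.

Lemma enormD u v : enorm (u + v) <= enorm u + enorm v.
Proof.
rewrite -(ler_pXn2r (n := 2)) ?nnegrE ?addr_ge0 ?enorm_ge0//.
rewrite sqr_enorm dotDl !(dotC _ (_ + _)) !dotDl -!sqr_enorm (dotC v u).
have := dot_le u v; lra.
Qed.

Lemma enorm_sum u : enorm u <= \sum_i `|u 0 i|.
Proof.
rewrite -(ler_pXn2r (n := 2)) ?nnegrE ?enorm_ge0 ?sumr_ge0// sqr_enorm.
rewrite /dot expr2 mulr_suml; apply: ler_sum => i _.
rewrite -expr2 -real_normK ?num_real// expr2 ler_wpM2l//.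
by rewrite (bigD1 i)//= lerDl sumr_ge0.
Qed.

End euclidean.

(** * From the nonlocal variation to the Euclidean gradient *)

Section smoothed_gradient.
Context {R : realType} {G : finZmodType} {d : nat}.
Variables (e : 'I_d -> G) (WL : seq (R * seq ('I_d * bool))) (n : R) (L : nat).
Implicit Types (f : G -> R).

Definition axes : seq G := [seq e i | i <- enum 'I_d].

Definition weights : seq (R * G) := [seq (n * cp.1, walk_end e cp.2) | cp <- WL].

(** Two passes, because second differences are to be controlled and each pass gains one factor 1 /
    L. *)
Definition smoothen f : G -> R := box L axes (box L axes f).

Hypotheses (WL_ge0 : forall cp, cp \in WL -> 0 <= cp.1) (n_gt0 : 0 < n)
  (L_gt0 : (0 < L)%N).

Lemma weights_ge0 v : v \in weights -> 0 <= v.1.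
Proof. by move=> /mapP[cp /WL_ge0 c0 ->]; rewrite mulr_ge0// ltW. Qed.

Lemma mem_axes i : e i \in axes.
Proof. by apply/mapP; exists i => //; rewrite mem_enum. Qed.

Lemma nltv_weightsE f : nltv weights f =
  n * \sum_(cp <- WL) cp.1 * avg (fun x => `|dif (walk_end e cp.2) f x|).
Proof.
by rewrite /nltv big_map mulr_sumr; apply: eq_bigr => cp _; rewrite mulrA.
Qed.

Lemma nltv_box f es : nltv weights (box L es f) <= nltv weights f.
Proof.
apply: ler_wsum; first exact: weights_ge0.
by move=> v _; rewrite dif_box; exact: avg_norm_box.
Qed.

Lemma avg_smoothen_sub f :
  avg (fun x => `|smoothen f x - f x|) <=
  2 * L%:R * \sum_i avg (fun x => `|dif (e i) f x|).
Proof.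
have E g : \sum_(h <- axes) avg (fun x => `|dif h g x|) =
    \sum_i avg (fun x => `|dif (e i) g x|) by rewrite big_map big_enum.
apply: (@le_trans _ _ (avg (fun x => `|smoothen f x - box L axes f x|) +
    avg (fun x => `|box L axes f x - f x|))).
  rewrite -avgD; apply: le_avg => x; apply: le_trans (ler_normD _ _).
  by rewrite addrA subrK.
have h1 := avg_box_sub L_gt0 axes f; have h2 := avg_box_sub L_gt0 axes (box L axes f).
rewrite !E in h1 h2; apply: le_trans (lerD h2 h1) _.
rewrite -mulrDr -[2 * _ * _]mulrA mulrCA ler_wpM2l// mulrDl mul1r lerD2r.
by apply: ler_sum => i _; rewrite dif_box; exact: avg_norm_box.
Qed.

Lemma avg_dif2_smoothen f i j :
  avg (fun x => `|dif (e i) (dif (e j) (smoothen f)) x|) <=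
  (2 / L%:R) ^+ 2 * avg (fun x => `|f x|).
Proof.
rewrite /smoothen [dif (e j) _]dif_box.
apply: le_trans (avg_dif_box L_gt0 _ (mem_axes i)) _.
rewrite expr2 -(mulrA (2 / L%:R)); apply: ler_wpM2l; first by rewrite divr_ge0.
exact: (avg_dif_box L_gt0 _ (mem_axes j)).
Qed.

(** Isotropy is applied at every point to the gradient of the smoothed function. Replacing the
    linear increment along a walk by the true difference costs second differences, which are of
    order 1 / L^2, and averaging does not increase the nonlocal variation. *)
Lemma grad_smoothen f (eps : R) :
  (forall nu : 'rV[R]_d, (1 - eps) * enorm nu <=
     \sum_(cp <- WL) cp.1 * `|walk_end (fun i => nu 0 i) cp.2|) ->
  (1 - eps) * avg (fun x => n * enorm (\row_i dif (e i) (smoothen f) x)) <=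
  nltv weights f + n * (\sum_(cp <- WL) cp.1 * (size cp.2)%:R ^+ 2) *
     ((2 / L%:R) ^+ 2 * avg (fun x => `|f x|)).
Proof.
move=> iso; set Q := (2 / _) ^+ 2 * _.
have Q2 := avg_dif2_smoothen f.
set F := smoothen f in Q2 *.
have tvF : nltv weights F <= nltv weights f.
  by apply: le_trans (nltv_box _ _) _; exact: nltv_box.
apply: le_trans (lerD tvF (lexx _)).
rewrite nltv_weightsE avgZ mulrCA -mulrA -mulrDr ler_wpM2l ?(ltW n_gt0)//.
rewrite mulr_suml -big_split/= -avgZ.
apply: (@le_trans _ _ (avg (fun x => \sum_(cp <- WL)
   cp.1 * `|walk_end (fun i => dif (e i) F x) cp.2|))).
  apply: le_avg => x; apply: le_trans (iso _) _; rewrite le_eqVlt; apply/orP; left.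
  apply/eqP; apply: eq_bigr => cp _; congr (_ * `|_|).
  by rewrite /walk_end; apply: eq_bigr => s _; rewrite /step_end !mxE.
rewrite avg_sum big_seq [leRHS]big_seq; apply: ler_sum => cp cpWL.
rewrite avgZ -mulrA -mulrDr ler_wpM2l ?WL_ge0//.
apply: le_trans (lerD (lexx _) (avg_dif_walk cp.2 Q2)).
rewrite -avgD; apply: le_avg => x.
set a := dif _ _ _; set b := walk_end _ _.
by rewrite -[b in leLHS](subKr a); apply: ler_normB.
Qed.

Lemma avg_norm_dif_smoothen f i : n * avg (fun x => `|dif (e i) (smoothen f) x|) <=
  avg (fun x => n * enorm (\row_i dif (e i) (smoothen f) x)).
Proof.
rewrite avgZ ler_wpM2l ?(ltW n_gt0)//; apply: le_avg => x.
by have := norm_coord_enorm (\row_i dif (e i) (smoothen f) x) i; rewrite mxE.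
Qed.

Lemma avg_parts_smoothen f (zeta : G -> 'rV[R]_d) :
  (forall x, enorm (zeta x) <= 1) ->
  - avg (fun x => smoothen f x * (n * \sum_i (zeta x 0 i - zeta (x - e i) 0 i))) <=
  avg (fun x => n * enorm (\row_i dif (e i) (smoothen f) x)).
Proof.
move=> z1; set F := smoothen f.
have -> : - avg (fun x => F x * (n * \sum_i (zeta x 0 i - zeta (x - e i) 0 i))) =
    avg (fun x => n * dot (\row_i dif (e i) F x) (zeta x)).
  rewrite -avgN (eq_avg (g := fun x => n * \sum_i (F x * (zeta (x - e i) 0 i - zeta x 0 i)))).
    rewrite [RHS](eq_avg (g := fun x => n * \sum_i (dif (e i) F x * zeta x 0 i))).
      rewrite !avgZ !avg_sum; congr (_ * _); apply: eq_bigr => i _.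
      by rewrite (avg_dif_parts (e i) F (fun x => zeta x 0 i)).
    by move=> x; rewrite /dot; congr (_ * _); apply: eq_bigr => i _; rewrite !mxE.
  move=> x; rewrite mulrCA -mulrN -mulr_sumr -mulrN -sumrN.
  by congr (_ * (_ * _)); apply: eq_bigr => i _; rewrite opprB.
apply: le_avg => x; rewrite ler_wpM2l ?(ltW n_gt0)//.
by apply: le_trans (dot_le _ _) _; rewrite ler_piMr// enorm_ge0.
Qed.

End smoothed_gradient.

(** * Isotropic weights *)

Section smooth_modulus.
Context {R : realType} (L : R).
Hypothesis L_gt0 : 0 < L.

(** A smooth substitute for the modulus, as the replacement argument needs a third-order remainder.
    The scale L will be large, but small compared with the typical extent of a walk. *)
Definition smod (y : R) : R := Num.sqrt (L ^+ 2 + y ^+ 2).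

Lemma smod_bounds y : `|y| <= smod y <= `|y| + L.
Proof.
have L0 := L_gt0.
rewrite /smod; apply/andP; split.
  by rewrite -[leLHS]sqrtr_sqr; apply: ler_wsqrtr; rewrite lerDr sqr_ge0.
rewrite -[leRHS]ger0_norm ?addr_ge0 ?(ltW L0)// -sqrtr_sqr; apply: ler_wsqrtr.
rewrite sqrrD real_normK ?num_real//.
have : 0 <= `|y| * L by rewrite mulr_ge0 ?(ltW L0).
lra.
Qed.

(** With r = smod a and D = smod (a + b) - r, the remainder is exactly (a / r * b - D) * (a / r * b
    + D) / (2 * r). The two factors are at most |b|^2 / (2 r) and 2 |b|, and r >= L. *)
Lemma smod_taylor a b :
  `|smod (a + b) - smod a - a / smod a * b - L ^+ 2 / (2 * smod a ^+ 3) * b ^+ 2|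
  <= (2 * L ^+ 2)^-1 * `|b| ^+ 3.
Proof.
have L0 := L_gt0.
have sq y : smod y ^+ 2 = L ^+ 2 + y ^+ 2 by rewrite sqr_sqrtr// addr_ge0 ?sqr_ge0.
have rL y : L <= smod y.
  rewrite -[leLHS]ger0_norm ?(ltW L0)// -sqrtr_sqr; apply: ler_wsqrtr.
  by rewrite lerDl sqr_ge0.
have /andP[ya _] := smod_bounds a; have /andP[yb _] := smod_bounds (a + b).
have sa := sq a; have sb := sq (a + b); have La := rL a; have Lb := rL (a + b).
move: (smod a) (smod (a + b)) sa sb La Lb ya yb => r r' sa sb La Lb ya yb.
have r0 : 0 < r by lra.
have r'0 : 0 < r' by lra.
pose D := r' - r.
have key : D * (r + r') = b * (2 * a + b).
  have -> : D * (r + r') = r' ^+ 2 - r ^+ 2 by rewrite /D; ring.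
  by rewrite sa sb; ring.
have Db : `|D| <= `|b|.
  rewrite -(ler_pM2r (x := r + r')) ?addr_gt0//.
  rewrite -[X in `|D| * X]ger0_norm ?(ltW (addr_gt0 _ _))// -normrM key normrM.
  rewrite ler_wpM2l//.
  have -> : 2 * a + b = a + (a + b) by ring.
  by apply: le_trans (ler_normD _ _) _; exact: lerD.
have e1 : a / r * b - D = (D ^+ 2 - b ^+ 2) / (2 * r).
  have : D * (2 * r + D) = b * (2 * a + b) by rewrite -key /D; ring.
  move=> h; have : 2 * (a * b - D * r) = D ^+ 2 - b ^+ 2 by lra.
  by move=> <-; field; exact: lt0r_neq0.
have -> : r' - r - a / r * b - L ^+ 2 / (2 * r ^+ 3) * b ^+ 2 =
   (a / r * b - D) * (a / r * b + D) / (2 * r).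
  have -> : L ^+ 2 = r ^+ 2 - a ^+ 2 by lra.
  have -> : r' - r - a / r * b = - (a / r * b - D) by rewrite /D; ring.
  rewrite [X in - X]e1.
  by field; exact: lt0r_neq0.
have ar : `|a / r * b| <= `|b|.
  rewrite normrM ler_piMl// normrM [X in _ * X]ger0_norm ?invr_ge0 ?(ltW r0)//.
  by rewrite ler_pdivrMr// mul1r.
have h1 : `|a / r * b + D| <= 2 * `|b|.
  by apply: le_trans (ler_normD _ _) _; rewrite mulrDl mul1r lerD.
have h2 : `|a / r * b - D| <= `|b| ^+ 2 / (2 * r).
  rewrite e1 normrM [X in _ * X]ger0_norm ?invr_ge0 ?mulr_ge0 ?(ltW r0)//.
  rewrite ler_wpM2r ?invr_ge0 ?mulr_ge0 ?(ltW r0)// -[b ^+ 2]real_normK ?num_real//.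
  rewrite -[D ^+ 2]real_normK ?num_real//.
  have : `|D| ^+ 2 <= `|b| ^+ 2 by rewrite ler_pXn2r ?nnegrE.
  have := sqr_ge0 `|D|; rewrite ler_norml; lra.
rewrite !normrM [X in _ * X <= _]ger0_norm ?invr_ge0 ?mulr_ge0 ?(ltW r0)//.
apply: (@le_trans _ _ (`|b| ^+ 2 / (2 * r) * (2 * `|b|) / (2 * r))).
  rewrite ler_wpM2r ?invr_ge0 ?mulr_ge0 ?(ltW r0)//.
  by rewrite -normrM; rewrite normrM; apply: ler_pM.
have -> : `|b| ^+ 2 / (2 * r) * (2 * `|b|) / (2 * r) = (2 * r ^+ 2)^-1 * `|b| ^+ 3.
  by field; exact: lt0r_neq0.
rewrite ler_wpM2r ?exprn_ge0// lef_pV2 ?posrE ?mulr_gt0 ?exprn_gt0//.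
by rewrite ler_wpM2l// ler_pXn2r ?nnegrE ?(ltW L0) ?(ltW r0).
Qed.

End smooth_modulus.

(** * Random walks and Lindeberg replacement *)

Section random_walk.
Context {R : realType} {d : nat}.
Hypothesis d_gt0 : (0 < d)%N.
Implicit Types (nu : 'I_d -> R) (F g : R -> R).

Definition steps : seq ('I_d * bool) :=
  [seq (i, b) | i <- enum 'I_d, b <- [:: true; false]].

Fixpoint walks (m : nat) : seq (seq ('I_d * bool)) :=
  if m is l.+1 then [seq s :: p | s <- steps, p <- walks l] else [:: [::]].

(** The mean of g after one random step from a. In use [nu] is a unit vector, and [walk_avg] is the
    expectation of F at the projection of the walk on it, started at a. *)
Definition step_avg nu g (a : R) : R :=
  (\sum_i (g (a + nu i) + g (a - nu i))) / (2 * d%:R).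

Definition walk_avg nu (m : nat) F (a : R) : R :=
  (\sum_(p <- walks m) F (a + walk_end nu p)) / (2 * d%:R) ^+ m.

Let d2 : 0 < 2 * d%:R :> R. Proof. by rewrite mulr_gt0// ltr0n. Qed.

Lemma walk_avg0 nu F : walk_avg nu 0 F = F.
Proof.
by apply/funext => a; rewrite /walk_avg/= big_seq1 walk_end0 addr0 expr0 divr1.
Qed.

Lemma walk_avgS nu m F : walk_avg nu m.+1 F = step_avg nu (walk_avg nu m F).
Proof.
apply/funext => a; rewrite /walk_avg /step_avg/= big_allpairs_dep.
rewrite (eq_bigr (fun s => \sum_(p <- walks m) F (a + step_end nu s + walk_end nu p))); last first.
  by move=> s _; apply: eq_bigr => p _; rewrite walk_end_cons addrA.
rewrite /steps big_allpairs_dep big_enum/=.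
rewrite (eq_bigr (fun i => (\sum_(p <- walks m) F (a + nu i + walk_end nu p)) +
  \sum_(p <- walks m) F (a - nu i + walk_end nu p))); last first.
  by move=> i _; rewrite !big_cons big_nil addr0.
rewrite exprS invfM mulrA mulrAC; congr (_ / _).
by rewrite mulr_suml; apply: eq_bigr => i _; rewrite mulrDl.
Qed.

Lemma step_avg_norm nu g h (C : R) : (forall a, `|g a - h a| <= C) ->
  forall a, `|step_avg nu g a - step_avg nu h a| <= C.
Proof.
move=> gh a; rewrite /step_avg -mulrBl -sumrB normrM.
rewrite [X in _ * X]ger0_norm ?invr_ge0 ?(ltW d2)// ler_pdivrMr//.
apply: le_trans (ler_norm_sum _ _ _) _.
apply: (@le_trans _ _ (\sum_(i < d) (C + C))); last first.
  by rewrite sumr_const card_ord -[_ *+ _]mulr_natl; lra.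
apply: ler_sum => i _.
have -> : g (a + nu i) + g (a - nu i) - (h (a + nu i) + h (a - nu i)) =
  (g (a + nu i) - h (a + nu i)) + (g (a - nu i) - h (a - nu i)) by ring.
by apply: le_trans (ler_normD _ _) _; exact: lerD.
Qed.

Definition taylor2 (C : R) g := exists p q : R -> R, forall a b,
  `|g (a + b) - g a - p a * b - q a * b ^+ 2| <= C * `|b| ^+ 3.

Lemma taylor2_step nu C g : taylor2 C g -> taylor2 C (step_avg nu g).
Proof.
move=> [p [q pq]]; exists (step_avg nu p), (step_avg nu q) => a b.
rewrite /step_avg.
have -> : (\sum_i (g (a + b + nu i) + g (a + b - nu i))) / (2 * d%:R) -
   (\sum_i (g (a + nu i) + g (a - nu i))) / (2 * d%:R) -
   (\sum_i (p (a + nu i) + p (a - nu i))) / (2 * d%:R) * b -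
   (\sum_i (q (a + nu i) + q (a - nu i))) / (2 * d%:R) * b ^+ 2 =
  (\sum_i ((g (a + nu i + b) - g (a + nu i) - p (a + nu i) * b - q (a + nu i) * b ^+ 2) +
     (g (a - nu i + b) - g (a - nu i) - p (a - nu i) * b - q (a - nu i) * b ^+ 2)))
  / (2 * d%:R).
  rewrite ![_ / _ * _]mulrAC -!mulrBl; congr (_ / _).
  rewrite !mulr_suml -!sumrB; apply: eq_bigr => i _.
  by rewrite (addrAC a (nu i)) (addrAC a (- nu i)); ring.
rewrite normrM [X in _ * X]ger0_norm ?invr_ge0 ?(ltW d2)// ler_pdivrMr//.
apply: le_trans (ler_norm_sum _ _ _) _.
apply: (@le_trans _ _ (\sum_(i < d) (C * `|b| ^+ 3 + C * `|b| ^+ 3))); last first.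
  by rewrite sumr_const card_ord -[_ *+ _]mulr_natl; lra.
apply: ler_sum => i _; apply: le_trans (ler_normD _ _) _; exact: lerD.
Qed.

Lemma taylor2_walk nu m C g : taylor2 C g -> taylor2 C (walk_avg nu m g).
Proof.
move=> tg; elim: m => [|m IH]; first by rewrite walk_avg0.
by rewrite walk_avgS; exact: taylor2_step.
Qed.

Let sq nu := \sum_i nu i ^+ 2.

(** The two signs of a step cancel the first-order term, and the second-order one sees the vector
    only through its length. Hence one q serves all unit vectors, which makes walks projected in
    different directions comparable. *)
Lemma step_avg_taylor nu C g : sq nu = 1 -> 0 <= C ->
  taylor2 C g -> exists q : R -> R, forall mu, sq mu = 1 ->
  forall a, `|step_avg mu g a - g a - q a| <= C.
Proof.
move=> nu1 C0 [p [q pq]]; exists (fun a => q a / d%:R) => mu mu1 a.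
have dn0 : d%:R != 0 :> R by rewrite pnatr_eq0 -lt0n.
have -> : step_avg mu g a - g a - q a / d%:R =
  (\sum_i ((g (a + mu i) - g a - p a * mu i - q a * mu i ^+ 2) +
     (g (a - mu i) - g a - p a * (- mu i) - q a * (- mu i) ^+ 2))) / (2 * d%:R).
  rewrite (eq_bigr (fun i => (g (a + mu i) + g (a - mu i)) - 2 * g a -
    2 * q a * mu i ^+ 2)); last by move=> i _; ring.
  have e : \sum_i mu i ^+ 2 = 1 by [].
  have e2 : \sum_i 2 * q a * mu i ^+ 2 = 2 * q a by rewrite -mulr_sumr e mulr1.
  rewrite !sumrB e2 sumr_const card_ord -[_ *+ d]mulr_natl.
  by rewrite /step_avg; field; rewrite dn0.
rewrite normrM [X in _ * X]ger0_norm ?invr_ge0 ?(ltW d2)// ler_pdivrMr//.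
apply: le_trans (ler_norm_sum _ _ _) _.
apply: (@le_trans _ _ (\sum_(i < d) (C + C))); last first.
  by rewrite sumr_const card_ord -[_ *+ _]mulr_natl; lra.
have m1 i : `|mu i| <= 1.
  rewrite -(ler_pXn2r (n := 2)) ?nnegrE// expr1n real_normK ?num_real// -mu1.
  by rewrite /sq (bigD1 i)//= lerDl sumr_ge0// => j _; exact: sqr_ge0.
apply: ler_sum => i _; apply: le_trans (ler_normD _ _) _; apply: lerD;
  apply: le_trans (pq _ _) _; rewrite ?normrN ler_piMr// exprn_ile1//.
Qed.

(* Lindeberg's replacement of the steps of one walk by those of another *)
Lemma walk_avg_compare nu mu C F m : sq nu = 1 -> sq mu = 1 -> 0 <= C ->
  taylor2 C F -> forall a, `|walk_avg nu m F a - walk_avg mu m F a| <= m%:R * (2 * C).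
Proof.
move=> nu1 mu1 C0 tF; elim: m => [|m IH] a.
  by rewrite !walk_avg0 subrr normr0 mul0r.
rewrite !walk_avgS -natr1 mulrDl mul1r.
have [q hq] := step_avg_taylor nu1 C0 (taylor2_walk mu m tF).
have h1 := step_avg_norm nu IH a; have h2 := hq _ nu1 a; have h3 := hq _ mu1 a.
have -> : step_avg nu (walk_avg nu m F) a - step_avg mu (walk_avg mu m F) a =
  (step_avg nu (walk_avg nu m F) a - step_avg nu (walk_avg mu m F) a) +
  ((step_avg nu (walk_avg mu m F) a - walk_avg mu m F a - q a) -
   (step_avg mu (walk_avg mu m F) a - walk_avg mu m F a - q a)) by ring.
apply: le_trans (ler_normD _ _) _; apply: lerD => //.
apply: le_trans (ler_normB _ _) _; rewrite mulrDl mul1r; exact: lerD.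
Qed.

Lemma walk_avg_le nu m F g a : (forall y, F y <= g y) -> walk_avg nu m F a <= walk_avg nu m g a.
Proof.
move=> Fg; rewrite /walk_avg ler_wpM2r ?invr_ge0 ?exprn_ge0 ?(ltW d2)//.
exact: ler_sum.
Qed.

Lemma walk_avgD nu m F g a :
  walk_avg nu m (fun y => F y + g y) a = walk_avg nu m F a + walk_avg nu m g a.
Proof. by rewrite /walk_avg big_split mulrDl. Qed.

Lemma walk_avgZ nu m (c : R) F a : walk_avg nu m (fun y => c * F y) a = c * walk_avg nu m F a.
Proof. by rewrite /walk_avg -mulr_sumr mulrA. Qed.

Lemma walk_avg_cst nu m (c : R) a : walk_avg nu m (fun=> c) a = c.
Proof.
elim: m a => [|m IH] a; first by rewrite walk_avg0.
rewrite walk_avgS /step_avg (eq_bigr (fun=> c + c)); last by move=> i _; rewrite !IH.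
by rewrite sumr_const card_ord -[_ *+ d]mulr_natl; field; rewrite pnatr_eq0 -lt0n.
Qed.

Let i0 : 'I_d := Ordinal d_gt0.

Definition axis0 : 'I_d -> R := fun i => (i == i0)%:R.

Lemma sq_axis0 : sq axis0 = 1.
Proof.
rewrite /sq (bigD1 i0)//= /axis0 eqxx expr1n big1 ?addr0// => i /negbTE ->.
by rewrite expr0n.
Qed.

Lemma step_avg_axis0 g a : step_avg axis0 g a =
  g a + (g (a + 1) + g (a - 1) - 2 * g a) / (2 * d%:R).
Proof.
rewrite /step_avg (bigD1 i0)//= {1 2}/axis0 eqxx.
rewrite (eq_bigr (fun=> 2 * g a)); last first.
  by move=> i /negbTE ni; rewrite /axis0 ni addr0 subr0; ring.
rewrite sumr_const.
have -> : #|[pred i | i != i0]| = d.-1.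
  by have := cardC1 i0; rewrite card_ord => <-; apply: eq_card => i; rewrite !inE.
have -> : d%:R = d.-1%:R + 1 :> R by rewrite natr1 prednK.
rewrite -[2 * g a *+ _]mulr_natl mulr1n; field.
by rewrite natr1 pnatr_eq0.
Qed.

Lemma walk_avg_sqr m a : walk_avg axis0 m (fun y => y ^+ 2) a = a ^+ 2 + m%:R / d%:R.
Proof.
have dn0 : d%:R != 0 :> R by rewrite pnatr_eq0 -lt0n.
elim: m a => [|m IH] a; first by rewrite walk_avg0 mul0r addr0.
by rewrite walk_avgS step_avg_axis0 !IH -natr1; field.
Qed.

Lemma walk_avg_pow4 m a : walk_avg axis0 m (fun y => y ^+ 4) a =
  a ^+ 4 + 6 * (m%:R / d%:R) * a ^+ 2 + m%:R / d%:R + 3 * (m%:R * (m%:R - 1)) / d%:R ^+ 2.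
Proof.
have dn0 : d%:R != 0 :> R by rewrite pnatr_eq0 -lt0n.
elim: m a => [|m IH] a; first by rewrite walk_avg0; field.
by rewrite walk_avgS step_avg_axis0 !IH -natr1; field.
Qed.

(** The first absolute moment is bounded below through the second and the fourth, by |y| >= y^2 / s
    - y^4 / (4 s^3). Here s = K^3 is the standard deviation of the projection of d K^6 steps on an
    axis. *)
Lemma walk_avg_norm_ge (K : nat) : (1 < K)%N ->
  K%:R ^+ 3 / 8 <= walk_avg axis0 (d * K ^ 6) (fun y => `|y|) 0.
Proof.
move=> K1; have dn0 : d%:R != 0 :> R by rewrite pnatr_eq0 -lt0n.
set s : R := K%:R ^+ 3.
have K2 : 2 <= K%:R :> R by rewrite ler_nat.
have s8 : 8 <= s.
  have : 2 ^+ 3 <= s by rewrite ler_pXn2r ?nnegrE// (le_trans _ K2).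
  by rewrite -natrX.
have s0 : 0 < s by lra.
have mE : (d * K ^ 6)%:R = d%:R * s ^+ 2 :> R.
  by rewrite natrM natrX /s -exprM.
have h : forall y : R, s^-1 * y ^+ 2 + (- (4 * s ^+ 3)^-1) * y ^+ 4 <= `|y|.
  move=> y; pose u := `|y| / s; have u0 : 0 <= u by rewrite divr_ge0 ?(ltW s0).
  have -> : `|y| = s * u by rewrite /u mulrC divfK// lt0r_neq0.
  have -> : y ^+ 2 = (s * u) ^+ 2.
    by rewrite /u mulrC divfK ?lt0r_neq0// real_normK ?num_real.
  have -> : y ^+ 4 = (s * u) ^+ 4.
    rewrite /u mulrC divfK ?lt0r_neq0//.
    by rewrite -[4%N]/(2 * 2)%N !exprM real_normK ?num_real.
  have -> : s^-1 * (s * u) ^+ 2 + - (4 * s ^+ 3)^-1 * (s * u) ^+ 4 =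
    s * (u ^+ 2 - u ^+ 4 / 4) by field; exact: lt0r_neq0.
  rewrite ler_wpM2l ?(ltW s0)//.
  have -> : u = u * 1 by rewrite mulr1.
  have -> : (u * 1) ^+ 2 - (u * 1) ^+ 4 / 4 = u * (u - u ^+ 3 / 4) by ring.
  clearbody u; rewrite ler_wpM2l//.
  have : 0 <= (u + 2) * (u - 1) ^+ 2 by rewrite mulr_ge0 ?sqr_ge0// addr_ge0.
  have [u2|u2] := leP u 2; first by lra.
  have : 0 <= u * ((u - 2) * (u + 2)) by rewrite !mulr_ge0//; lra.
  lra.
have := walk_avg_le axis0 (d * K ^ 6) 0 h.
rewrite walk_avgD !walk_avgZ walk_avg_sqr walk_avg_pow4 mE !expr0n /= => h2.
apply: le_trans h2.
rewrite add0r mulr0 !add0r.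
have -> : s^-1 * (d%:R * s ^+ 2 / d%:R) + - (4 * s ^+ 3)^-1 *
  (d%:R * s ^+ 2 / d%:R + 3 * (d%:R * s ^+ 2 * (d%:R * s ^+ 2 - 1)) / d%:R ^+ 2) =
  s / 4 - (4 * s)^-1 + 3 / (4 * s * d%:R).
  by field; rewrite dn0 lt0r_neq0.
have : 0 <= 3 / (4 * s * d%:R) by rewrite divr_ge0 ?mulr_ge0 ?(ltW s0).
have : (4 * s)^-1 <= 1 by rewrite invf_le1; lra.
lra.
Qed.

Lemma walk_endZ (c : R) nu p : walk_end (fun i => c * nu i) p = c * walk_end nu p.
Proof.
rewrite /walk_end mulr_sumr; apply: eq_bigr => s _; rewrite /step_end.
by case: ifP => // _; rewrite mulrN.
Qed.

(** All walks of m = d K^6 steps get the same weight, normalised by the mean along an axis, which is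
    of order K^3. Smoothing the modulus at scale K^2 and the m replacements change this mean by at
    most (1 + d) K^2 in any other direction. The unit steps are added with the small weight [beta]:
    they cost eps / 2 and make the weights control every single-step difference. *)
Lemma isotropic_weights (eps : R) : 0 < eps ->
  exists (WL : seq (R * seq ('I_d * bool))) (beta : R),
  [/\ 0 < beta, forall cp, cp \in WL -> 0 <= cp.1,
      forall (F : seq ('I_d * bool) -> R) i, (forall p, 0 <= F p) ->
        beta * F [:: (i, true)] <= \sum_(cp <- WL) cp.1 * F cp.2 &
      forall nu : 'rV[R]_d,
      (1 - eps) * enorm nu <= \sum_(cp <- WL) cp.1 * `|walk_end (fun i => nu 0 i) cp.2|
        <= (1 + eps) * enorm nu].
Proof.
move=> eps0.
have dR : 0 < d%:R :> R by rewrite ltr0n.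
(* The error (1 + d) K^2, relative to the mean K^3 / 8 at least, is to be at most eps / 2; the
   summand 2 ensures 1 < K. *)
have [K Kbig] : exists K : nat, 16 * (1 + d%:R) / eps + 2 <= K%:R.
  exists (Num.trunc (16 * (1 + d%:R) / eps + 2)).+1.
  by rewrite ltW// truncnS_gt.
have X0 : 0 <= 16 * (1 + d%:R) / eps by rewrite divr_ge0 ?mulr_ge0 ?addr_ge0 ?(ltW eps0).
have K1 : (1 < K)%N by rewrite -(ler_nat R); lra.
have K0 : 0 < K%:R :> R by rewrite ltr0n (ltn_trans _ K1).
pose m := (d * K ^ 6)%N.
pose kap := walk_avg axis0 m (fun y => `|y|) 0.
have kap8 : K%:R ^+ 3 / 8 <= kap by exact: walk_avg_norm_ge.
have kap0 : 0 < kap by apply: lt_le_trans kap8; rewrite divr_gt0 ?exprn_gt0.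
pose beta := eps / (2 * d%:R).
have b0 : 0 < beta by rewrite divr_gt0 ?mulr_gt0.
pose c := (kap * (2 * d%:R) ^+ m)^-1.
have c0 : 0 <= c by rewrite invr_ge0 ltW// mulr_gt0 ?exprn_gt0.
have E (F : seq ('I_d * bool) -> R) :
    \sum_(cp <- [seq (c, p) | p <- walks m] ++ [seq (beta, [:: (i, true)]) | i <- enum 'I_d])
      cp.1 * F cp.2 = c * (\sum_(p <- walks m) F p) + beta * \sum_i F [:: (i, true)].
  rewrite big_cat; congr (_ + _); rewrite big_map mulr_sumr//.
  by rewrite big_enum.
exists ([seq (c, p) | p <- walks m] ++
        [seq (beta, [:: (i, true)]) | i <- enum 'I_d]), beta.
split => //.
- move=> cp; rewrite mem_cat => /orP[|] /mapP[p _ ->] //; exact: ltW.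
- move=> F i F0; rewrite E (bigD1 i)//= mulrDr addrCA lerDl addr_ge0//.
    by rewrite mulr_ge0// sumr_ge0.
  by rewrite mulr_ge0 ?(ltW b0)// sumr_ge0.
move=> nu; rewrite (E (fun p => `|walk_end (fun i => nu 0 i) p|)).
have -> : \sum_(i < d) `|walk_end (fun i0 => nu 0 i0) [:: (i, true)]| =
    \sum_(i < d) `|nu 0 i|.
  by apply: eq_bigr => i _; rewrite walk_end_cons walk_end0 addr0.
have h1 : 0 <= \sum_(i < d) `|nu 0 i| <= d%:R * enorm nu.
  rewrite sumr_ge0//=; apply: (@le_trans _ _ (\sum_(i < d) enorm nu)).
    by apply: ler_sum => i _; exact: norm_coord_enorm.
  by rewrite sumr_const card_ord -[_ *+ d]mulr_natl.
have h2 : beta * \sum_(i < d) `|nu 0 i| <= eps / 2 * enorm nu.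
  move: h1 => /andP[_ h1]; apply: le_trans (ler_wpM2l (ltW b0) h1) _.
  by rewrite le_eqVlt; apply/orP; left; apply/eqP; rewrite /beta; field; exact: lt0r_neq0.
have h3 : 0 <= beta * \sum_(i < d) `|nu 0 i|.
  by rewrite mulr_ge0 ?(ltW b0)//; case/andP: h1.
suff : (1 - eps / 2) * enorm nu <=
   c * \sum_(p <- walks m) `|walk_end (fun i => nu 0 i) p|
   <= (1 + eps / 2) * enorm nu.
  by move: h2 h3; clear=> h2 h3 /andP[k1 k2]; apply/andP; split; lra.
rewrite /c invfM -mulrA (mulrC ((2 * d%:R) ^+ m)^-1).
have -> : (\sum_(p <- walks m) `|walk_end (fun i => nu 0 i) p|) / (2 * d%:R) ^+ m =
    walk_avg (fun i => nu 0 i) m (fun y => `|y|) 0.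
  by rewrite /walk_avg; congr (_ / _); apply: eq_bigr => p _; rewrite add0r.
have [nu0|nu0] := eqVneq (enorm nu) 0.
  rewrite nu0 !mulr0 (enorm0_eq0 nu0).
  rewrite /walk_avg big1 ?mul0r ?mulr0 ?lexx// => p _.
  rewrite /walk_end big1 ?addr0 ?normr0// => s _; rewrite /step_end !mxE oppr0.
  by case: ifP.
have np : 0 < enorm nu by rewrite lt0r nu0 enorm_ge0.
pose mu i := (enorm nu)^-1 * nu 0 i.
have -> : walk_avg (fun i => nu 0 i) m (fun y => `|y|) 0 =
    enorm nu * walk_avg mu m (fun y => `|y|) 0.
  rewrite -walk_avgZ /walk_avg; congr (_ / _); apply: eq_bigr => p _.
  rewrite !add0r /mu walk_endZ normrM ger0_norm ?invr_ge0 ?enorm_ge0//.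
  by rewrite mulVKf.
have mu1 : sq mu = 1.
  rewrite /sq /mu (eq_bigr (fun i => (enorm nu) ^- 2 * (nu 0 i * nu 0 i))).
    by rewrite -mulr_sumr -/(dot nu nu) -sqr_enorm mulVf// expf_neq0.
  by move=> i _; rewrite exprMn exprVn expr2.
have KK : 0 < K%:R ^+ 2 :> R by rewrite exprn_gt0.
have tF : taylor2 ((2 * (K%:R ^+ 2) ^+ 2)^-1) (smod (K%:R ^+ 2 : R)).
  eexists; eexists; exact: smod_taylor.
have CC : 0 <= (2 * (K%:R ^+ 2) ^+ 2)^-1 :> R by rewrite invr_ge0 mulr_ge0 ?exprn_ge0.
have cmp := walk_avg_compare m mu1 sq_axis0 CC tF 0.
have eC : m%:R * (2 * (2 * (K%:R ^+ 2) ^+ 2)^-1) = d%:R * K%:R ^+ 2 :> R.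
  by rewrite /m natrM natrX; field; exact: lt0r_neq0.
rewrite eC in cmp.
have up x : walk_avg x m (fun y => `|y|) 0 <= walk_avg x m (smod (K%:R ^+ 2)) 0.
  by apply: walk_avg_le => y; case/andP: (smod_bounds KK y).
have lo x : walk_avg x m (smod (K%:R ^+ 2)) 0 <= walk_avg x m (fun y => `|y|) 0 + K%:R ^+ 2.
  rewrite -[X in _ + X](walk_avg_cst x m (K%:R ^+ 2) 0) -walk_avgD.
  by apply: walk_avg_le => y; case/andP: (smod_bounds KK y).
have close : `|walk_avg mu m (fun y => `|y|) 0 - kap| <= eps / 2 * kap.
  apply: (@le_trans _ _ ((1 + d%:R) * K%:R ^+ 2)).
    have := up mu; have := lo mu; have := up axis0; have := lo axis0.
    rewrite -/kap; move: cmp; rewrite !ler_norml; clear=> /andP[? ?] ? ? ? ?.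
    by apply/andP; split; lra.
  apply: (@le_trans _ _ (eps / 2 * (K%:R ^+ 3 / 8))); last first.
    by rewrite ler_wpM2l// divr_ge0 ?(ltW eps0).
  have -> : eps / 2 * (K%:R ^+ 3 / 8) = eps * K%:R / 16 * K%:R ^+ 2 by field.
  rewrite ler_wpM2r ?exprn_ge0// ler_pdivlMr// mulrC -ler_pdivrMl//.
  by rewrite mulrC; lra.
have hk : kap^-1 * (enorm nu * walk_avg mu m (fun y => `|y|) 0) =
   enorm nu * (walk_avg mu m (fun y => `|y|) 0 / kap) by ring.
rewrite hk ![_ * enorm nu]mulrC !ler_pM2l// ler_pdivlMr// ler_pdivrMr//.
move: close; rewrite ler_norml; clear; lra.
Qed.

End random_walk.

(** * Cells of the discrete torus *)

Section cells.
Context {R : realType} {d : nat} (p : nat).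
Local Notation n := p.+1.
Local Notation G := 'rV['I_p.+1]_d.
Implicit Types (x : 'rV[R]_d) (g : G).

(** The floor of n t modulo n, written as a multiple of the generator of the cyclic group.
    Periodicity in t and the passage from translations by 1 / n to group additions are then laws of
    integer multiples. *)
Definition cell1 (t : R) : 'I_p.+1 := Zp1 *~ Num.floor (n%:R * t).

Definition cell x : G := \row_i cell1 (x 0 i).

Definition node g : 'rV[R]_d := \row_i ((g 0 i)%:R / n%:R).

Definition unit_shift (i : 'I_d) : G := \row_j (if j == i then Zp1 else 0).

Definition congr_tor (x y : 'rV[R]_d) := exists k : 'rV[int]_d, x = y + map_mx intr k.

Lemma periodic_congr {A : Type} (f : 'rV[R]_d -> A) x y :
  Defs.periodic f -> congr_tor x y -> f x = f y.
Proof. by move=> pf [k ->]; rewrite pf. Qed.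

Lemma congr_tor_refl x : congr_tor x x.
Proof. by exists 0; apply/rowP => i; rewrite !mxE addr0. Qed.

Lemma congr_tor_sym x y : congr_tor x y -> congr_tor y x.
Proof.
move=> [k ->]; exists (- k); apply/rowP => i; rewrite !mxE raddfN/= addrK//.
Qed.

Lemma congr_tor_trans x y z : congr_tor x y -> congr_tor y z -> congr_tor x z.
Proof.
move=> [k ->] [l ->]; exists (l + k); apply/rowP => i.
by rewrite !mxE raddfD/= addrA.
Qed.

Lemma congr_torD x y z : congr_tor x y -> congr_tor (x + z) (y + z).
Proof. by move=> [k ->]; exists k; rewrite addrAC. Qed.

Let n0 : 0 < n%:R :> R. Proof. by rewrite ltr0n. Qed.

Lemma Zp1_mulrz (k : int) : Zp1 *~ k = inZp `|(k %% n)%Z|%N :> 'I_p.+1.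
Proof.
have En : Zp1 *+ n = 0 :> 'I_p.+1.
  by rewrite Zp_mulrn; apply/val_inj => /=; rewrite modnMl.
rewrite {1}(divz_eq k n) mulrzDr mulrC mulrzA -[Zp1 *~ n]/(Zp1 *+ n).
rewrite En mul0rz add0r.
have : 0 <= (k %% n)%Z by rewrite modz_ge0.
case: (k %% n)%Z => // m _; rewrite -pmulrn Zp_mulrn absz_nat.
by apply/val_inj => /=; rewrite modnMml mul1n.
Qed.

(* Every point is congruent to a point of the half-open cell of its node. *)
Lemma cell1P (t : R) : exists k : int,
  0 <= t - k%:~R - (cell1 t : nat)%:R / n%:R < n%:R^-1.
Proof.
pose q := Num.floor (n%:R * t).
have /andP[q1 q2] : q%:~R <= n%:R * t < (q + 1)%:~R by exact: floor_itv.
exists (q %/ n)%Z.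
have qE : q%:~R = (q %/ n)%Z%:~R * n%:R + (cell1 t : nat)%:R :> R.
  rewrite [in LHS](divz_eq q n) intrD intrM; congr (_ + _).
  rewrite /cell1 -/q Zp1_mulrz /=.
  have m0 : 0 <= (q %% n)%Z by rewrite modz_ge0.
  rewrite modn_small; last by rewrite -ltz_nat gez0_abs// ltz_pmod.
  by rewrite -[in LHS](gez0_abs m0).
rewrite intrD1 qE in q2; rewrite qE in q1.
have -> : t - (q %/ n)%Z%:~R - (cell1 t : nat)%:R / n%:R =
   (n%:R * t - ((q %/ n)%Z%:~R * n%:R + (cell1 t : nat)%:R)) / n%:R.
  by field; rewrite lt0r_neq0.
rewrite divr_ge0 ?subr_ge0 ?(ltW n0)//= ltr_pdivrMr// mulVf ?lt0r_neq0//.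
lra.
Qed.

Lemma cellP x : exists y, congr_tor x y /\
  forall i, 0 <= y 0 i - node (cell x) 0 i < n%:R^-1.
Proof.
have /choice[k hk] : forall i, exists k : int,
   0 <= x 0 i - k%:~R - (cell1 (x 0 i) : nat)%:R / n%:R < n%:R^-1.
  by move=> i; exact: cell1P.
exists (\row_i (x 0 i - (k i)%:~R)); split.
  by exists (\row_i k i); apply/rowP => i; rewrite !mxE subrK.
by move=> i; rewrite !mxE.
Qed.

Lemma node_shift g i : congr_tor (node (g + unit_shift i)) (node g + n%:R^-1 *: unitv i).
Proof.
have [h|h] := boolP ((g 0%R i).+1 < n)%N.
  exists 0; apply/rowP => j; rewrite !mxE /= ?eqxx ?addr0 /=.
  case: eqP => [->|_]; last by rewrite addn0 modn_small// mulr0 addr0.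
  by rewrite /= modnDmr addn1 modn_small// -natr1 mulrDl mul1r mulr1.
exists (- delta_mx 0 i); apply/rowP => j; rewrite !mxE /= ?eqxx /=.
case: eqP => [->|_]; last by rewrite addn0 modn_small// mulr0 oppr0 !addr0.
have gE : (g 0 i).+1 = n by apply/eqP; rewrite eqn_leq ltn_ord leqNgt.
rewrite /= modnDmr addn1 gE modnn mul0r mulr1 rmorphN rmorph1.
have -> : (g 0 i : nat)%:R = n%:R - 1 :> R 
  by have := congr1 (fun k => k%:R : R) gE; rewrite -natr1 => <-; rewrite addrK.
by field; rewrite lt0r_neq0.
Qed.

Lemma node_step g (s : 'I_d * bool) : congr_tor (node (g + step_end unit_shift s))
  (node g + step_end (fun i => n%:R^-1 *: unitv i) s).
Proof.
rewrite /step_end; case: ifP => _; first exact: node_shift.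
apply: congr_tor_sym.
have := node_shift (g - unit_shift s.1) s.1; rewrite subrK.
by move=> /(congr_torD (- (n%:R^-1 *: unitv s.1))); rewrite addrK.
Qed.

Lemma node_walk g w : congr_tor (node (g + walk_end unit_shift w))
  (node g + walk_end (fun i => n%:R^-1 *: unitv i) w).
Proof.
elim: w g => [|s w IH] g; first by rewrite !walk_end0 !addr0; exact: congr_tor_refl.
rewrite !walk_end_cons !addrA; apply: congr_tor_trans (IH _) _.
exact/congr_torD/node_step.
Qed.

Lemma cell_shift x i : cell (x + n%:R^-1 *: unitv i) = cell x + unit_shift i.
Proof.
apply/rowP => j; rewrite !mxE eqxx /= /cell1 mulrDr mulrA mulfV ?lt0r_neq0// mul1r.
rewrite floorDrz; last by rewrite natr_int.
case: eqP => /= _; first by rewrite floor1 mulrzDr.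
by rewrite floor0 !addr0.
Qed.

Lemma cell_walk x w :
  cell (x + walk_end (fun i => n%:R^-1 *: unitv i) w) = cell x + walk_end unit_shift w.
Proof.
elim: w x => [|s w IH] x; first by rewrite !walk_end0 !addr0.
rewrite !walk_end_cons !addrA IH; congr (_ + _); rewrite /step_end.
case: ifP => _; first exact: cell_shift.
have := cell_shift (x - n%:R^-1 *: unitv s.1) s.1; rewrite subrK => ->.
by rewrite addrK.
Qed.

Lemma unit_shift_gen g : exists a : 'I_d -> nat,
  (forall i, (a i <= n)%N) /\ g = \sum_i unit_shift i *+ a i.
Proof.
exists (fun i => g 0 i : nat); split; first by move=> i; rewrite ltnW.
apply/rowP => j; rewrite summxE (bigD1 j)//= big1 ?addr0.
  rewrite mulmxnE !mxE eqxx Zp_mulrn; apply/val_inj => /=.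
  by rewrite modnMml mul1n modn_small.
by move=> i /negbTE ij; rewrite mulmxnE !mxE eq_sym ij mul0rn.
Qed.

Lemma cellD_int x (k : 'rV[int]_d) : cell (x + map_mx intr k) = cell x.
Proof.
have En : Zp1 *~ n = 0 :> 'I_p.+1.
  by rewrite -pmulrn Zp_mulrn; apply/val_inj => /=; rewrite modnMl.
apply/rowP => i; rewrite !mxE /cell1 mulrDr.
have -> : n%:R * (k 0 i)%:~R = (n%:Z * k 0 i)%:~R :> R by rewrite intrM.
by rewrite floorDrz ?intr_int// intrKfloor mulrzDr mulrzA En mul0rz addr0.
Qed.

End cells.

(** * Functions of finite range *)

Section finite_range.
Context {dsp : measure_display} {X : measurableType dsp} {R : realType}
  {I : finType} (c : X -> I) (D : set X).
Hypotheses (mD : measurable D) (mc : forall i, measurable (D `&` c @^-1` [set i])).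

Lemma measurable_finite_range {e} {E : measurableType e} (f : I -> E) :
  measurable_fun D (fun x => f (c x)).
Proof.
move=> _ Y mY.
have -> : D `&` (fun x => f (c x)) @^-1` Y =
    \bigcup_(i in [set i | Y (f i)]) (D `&` c @^-1` [set i]).
  apply/seteqP; split=> [x [Dx Yx]|x [i Yi [Dx /= xi]]]; first by exists (c x).
  by split=> //=; rewrite xi.
by apply: fin_bigcup_measurable => // i _; exact: mc.
Qed.

Lemma Rintegral_finite_range (mu : measure X R) (f : I -> R) : (mu D < +oo)%E ->
  \int[mu]_(x in D) f (c x) = \sum_i f i * fine (mu (D `&` c @^-1` [set i])).
Proof.
move=> muD.
have fin i : mu (D `&` c @^-1` [set i]) \is a fin_num.
  rewrite ge0_fin_numE//; apply: le_lt_trans muD; apply: le_measure => //.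
  - by rewrite inE; exact: mc.
  - by rewrite inE.
rewrite /Rintegral.
under eq_integral => x xD.
  rewrite (_ : (f (c x))%:E =
      (\sum_i (f i)%:E * (\1_(D `&` c @^-1` [set i]) x)%:E)%E); last first.
    rewrite inE in xD.
    rewrite (bigD1 (c x))//= indicE mem_set// mule1 big1 ?adde0// => i /negbTE ni.
    by rewrite indicE memNset ?mule0//= => -[_ e]; rewrite e eqxx in ni.
  over.
have int i : mu.-integrable D (fun x => (\1_(D `&` c @^-1` [set i]) x)%:E).
  apply: measurable_bounded_integrable => //.
  exists 1; split => // M M1 x _ /=; rewrite indicE; apply: le_trans (ltW M1).
  by case: (_ \in _); rewrite ?normr1 ?normr0.
have EI i : (\int[mu]_(x in D) (\1_(D `&` c @^-1` [set i]) x)%:E = mu (D `&` c @^-1` [set i]))%E.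
  by rewrite integral_indic// setIAC setIid.
rewrite integral_sum//=; last first.
  by move=> i; apply: integrableZl => //; exact: int.
rewrite -sum_fine; last first.
  by move=> i _; rewrite integralZl//= EI fin_numM.
by apply: eq_bigr => i _; rewrite integralZl//= EI fineM.
Qed.

End finite_range.

(** * Measure of the cells *)

Section torus_cells.
Context {R : realType}.

Lemma torus_box (n : nat) (A : 'I_n -> set R) : (forall i, measurable (A i)) ->
  torus n [set x : 'rV[R]_n | forall i, A i (x 0 i)] =
  (\prod_(i < n) (uniform_prob (@ltr01 R) (A i)))%E.
Proof.
elim: n A => [|n IH] A mA.
  rewrite big_ord0 /= diracE mem_set//= => -[]//.
rewrite big_ord_recl -IH; last by move=> i; exact: mA.
rewrite /= /distribution /pushforward /=.
set B := [set x : 'rV[R]_n | forall i, A (lift ord0 i) (x 0 i)].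
have mB : measurable B.
  have -> : B = \bigcap_(i in [set: 'I_n])
      ((fun x : 'rV[R]_n => x 0 i) @^-1` A (lift ord0 i)).
    by apply/seteqP; split=> [x /= h i _|x /= h i]; exact: h.
  apply: fin_bigcap_measurable => // i _.
  by rewrite -[_ @^-1` _]setTI; exact: measurable_row_coord.
have -> : @row_cons R n @^-1` [set x | forall i, A i (x 0 i)] = A ord0 `*` B; last first.
  by apply: product_measure1E => //; exact: mA.
apply/seteqP; split => [[t x] /= h|[t x] /= [h1 h2] i].
  split=> [|i].
    by have := h ord0; rewrite /row_cons mxE unlift_none.
  by have := h (lift ord0 i); rewrite /row_cons mxE liftK.
rewrite /row_cons mxE; case: unliftP => [j|] ->; [exact: h2|exact: h1].
Qed.

Lemma uniform_probE (U : set R) : measurable U ->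
  uniform_prob (@ltr01 R) U = lebesgue_measure (U `&` `[0%R, 1%R]).
Proof.
move=> mU; rewrite /uniform_prob integral_uniform_pdf.
rewrite (eq_integral (cst 1%E)); last first.
  move=> x; rewrite inE => -[_ /=]; rewrite in_itv/= /uniform_pdf => ->.
  by rewrite subr0 invr1.
by rewrite integral_cst ?mul1e//; exact: measurableI.
Qed.

Context (p : nat).
Local Notation n := p.+1.

Lemma measurable_cell1 a : measurable ((@cell1 R p) @^-1` [set a]).
Proof.
have -> : (@cell1 R p) @^-1` [set a] = \bigcup_(k in [set: int])
    (if Zp1 *~ k == a then [set` `[(k%:~R / n%:R : R), ((k + 1)%:~R / n%:R)[] else set0).
  have n0 : 0 < n%:R :> R by rewrite ltr0n.
  apply/seteqP; split => [t /= ta|t [k _]].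
    exists (Num.floor (n%:R * t)) => //; rewrite -ta eqxx /= in_itv/=.
    rewrite ler_pdivrMr// ltr_pdivlMr// ![t * _]mulrC; exact: floor_itv.
  case: eqP => // <- /=; rewrite in_itv/= ler_pdivrMr// ltr_pdivlMr// ![t * _]mulrC => h.
  by rewrite /cell1; congr (_ *~ _); apply: floor_def.
apply: countable_bigcupT_measurable; first exact: countableP.
by move=> k; case: ifP.
Qed.

(** Within [0, 1] the fibre is the half-open interval of the cell, but for the point 1, which wraps
    round to the cell 0; this null set is added in the upper bound. *)
Lemma uniform_cell1 a : uniform_prob (@ltr01 R) ((@cell1 R p) @^-1` [set a]) = (n%:R^-1)%:E.
Proof.
have n0 : 0 < n%:R :> R by rewrite ltr0n.
rewrite uniform_probE; last exact: measurable_cell1.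
set U := _ `&` _.
pose I := `[((a : nat)%:R / n%:R : R), ((a : nat).+1%:R / n%:R)[%classic.
have mI : lebesgue_measure I = (n%:R^-1)%:E.
  rewrite lebesgue_measure_itv/= lte_fin ltr_pM2r ?invr_gt0// ltr_nat ltnSn.
  by rewrite -EFinB -mulrBl -natr1 addrAC subrr add0r mul1r.
have aE (k : nat) : (k < n)%N -> (Zp1 *~ k == a :> 'I_p.+1) = (k == a).
  by move=> kn; rewrite -pmulrn Zp_mulrn -val_eqE /= modnMml mul1n modn_small.
have IU : I `<=` U.
  move=> t; rewrite /I /= in_itv/= ler_pdivrMr// ltr_pdivlMr// ![t * _]mulrC => h.
  have fl : Num.floor (n%:R * t) = (a : nat)%:Z.
    by apply: floor_def; rewrite intrD1 -!pmulrn natr1.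
  split; first by apply/eqP; rewrite /cell1 fl aE.
  rewrite /= in_itv/=; move: h => /andP[h1 h2].
  rewrite -(pmulr_rge0 _ n0) (le_trans _ h1)//=.
  rewrite -(ler_pM2l n0) mulr1 (le_trans (ltW h2))//.
  by rewrite ler_nat.
have UI : U `<=` I `|` [set 1].
  move=> t [/= ta]; rewrite in_itv/= => /andP[t0 t1].
  have [->|tn1] := eqVneq t 1; first by right.
  left; have {}t1 : t < 1 by rewrite lt_neqAle tn1.
  rewrite /I /= in_itv/= ler_pdivrMr// ltr_pdivlMr// ![t * _]mulrC.
  have := floor_itv (n%:R * t); move: ta; rewrite /cell1.
  have : 0 <= Num.floor (n%:R * t) by rewrite floor_ge0 mulr_ge0// ltW.
  case: (Num.floor (n%:R * t)) => // k _ /eqP ka /andP[k1 k2].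
  have kn : (k < n)%N.
    rewrite -(ltr_nat R); apply: le_lt_trans k1 _.
    by rewrite -[ltRHS]mulr1 ltr_pM2l.
  move: ka; rewrite aE// => /eqP <-.
  by move: k1 k2; rewrite intrD1 -!pmulrn natr1 => -> ->.
have mU : measurable U by apply: measurableI => //; exact: measurable_cell1.
have mI' : measurable I by exact: measurable_itv.
apply/eqP; rewrite eq_le -{2}mI; apply/andP; split; last first.
  by apply: le_measure => //; rewrite inE.
apply: (@le_trans _ _ (lebesgue_measure (I `|` [set 1]))).
  by apply: le_measure => //; rewrite inE//; exact: measurableU.
apply: le_trans (measureU2 _ _ _) _ => //.
rewrite -[leRHS]adde0; apply: leeD; first by rewrite -mI; exact: lexx.
by rewrite -(lebesgue_measure_set1 (1 : R)); exact: lexx.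
Qed.

Context {d : nat}.
Local Notation G := 'rV['I_p.+1]_d.

Lemma cell_fiberE (g : G) : (@cell R d p) @^-1` [set g] =
  [set x | forall i, ((@cell1 R p) @^-1` [set g 0 i]) (x 0 i)].
Proof.
apply/seteqP; split => [x /= <- i|x /= h]; first by rewrite mxE.
by apply/rowP => i; rewrite mxE h.
Qed.

Lemma measurable_cell (g : G) : measurable ((@cell R d p) @^-1` [set g]).
Proof.
have -> : (@cell R d p) @^-1` [set g] = \bigcap_(i in [set: 'I_d])
    ((fun x : 'rV[R]_d => x 0 i) @^-1` ((@cell1 R p) @^-1` [set g 0 i])).
  by rewrite cell_fiberE; apply/seteqP; split=> [x /= h i _|x /= h i]; exact: h.
apply: fin_bigcap_measurable => // i _.
rewrite -[_ @^-1` (_ @^-1` _)]setTI; apply: measurable_row_coord => //.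
exact: measurable_cell1.
Qed.

Lemma torus_cell (g : G) : torus d ((@cell R d p) @^-1` [set g]) = (#|{: G}|%:R^-1)%:E.
Proof.
rewrite cell_fiberE (torus_box (A := fun i => (@cell1 R p) @^-1` [set g 0 i])); last first.
  by move=> i; exact: measurable_cell1.
rewrite (eq_bigr (fun=> (n%:R^-1)%:E)); last by move=> i _; exact: uniform_cell1.
rewrite prodEFin prodr_const card_ord card_mx card_ord mul1n.
by rewrite natrX exprVn.
Qed.

Lemma Rintegral_cell (f : G -> R) : \int[torus d]_x f (cell p x) = avg f.
Proof.
rewrite (Rintegral_finite_range (D := setT)) //.
- rewrite /avg mulr_suml; apply: eq_bigr => g _.
  by rewrite setTI; congr (_ * _); exact: (congr1 fine (torus_cell g)).
- by move=> g; rewrite setTI; exact: measurable_cell.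
- by rewrite ltey_eq fin_num_measure.
Qed.

End torus_cells.

(** * Time steps and space-time cells *)

Section time_cells.
Context {R : realType} {d : nat} (T : R) (K p : nat).
Hypotheses (T_gt0 : 0 < T) (K_gt0 : (0 < K)%N).

Definition tick (t : R) : nat := Num.truncn (t * K%:R / T).

Lemma tickP t : 0 <= t -> (tick t)%:R * (T / K%:R) <= t < (tick t).+1%:R * (T / K%:R).
Proof.
move=> t0; have T0 := T_gt0; have K0 : 0 < K%:R :> R by rewrite ltr0n.
have /andP[h1 h2] : (tick t)%:R <= t * K%:R / T < (tick t).+1%:R.
  by apply: truncn_itv; rewrite divr_ge0 ?mulr_ge0// ltW.
apply/andP; split.
  by rewrite mulrA ler_pdivrMr// -ler_pdivlMr.
by rewrite mulrA ltr_pdivlMr// -ltr_pdivrMr.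
Qed.

Lemma tick_lt t : 0 <= t -> t < T -> (tick t < K)%N.
Proof.
move=> t0 tT; rewrite -(ltr_nat R); have T0 := T_gt0.
have K0 : 0 < K%:R :> R by rewrite ltr0n.
have /andP[h1 _] := tickP t0.
rewrite -(ltr_pM2r (x := T / K%:R)) ?divr_gt0//; apply: le_lt_trans h1 _.
by rewrite mulrCA mulfV ?lt0r_neq0// mulr1.
Qed.

Lemma tick_le t : 0 <= t <= T -> (tick t <= K)%N.
Proof.
move=> /andP[t0 tT]; rewrite -(ler_nat R); have T0 := T_gt0.
have K0 : 0 < K%:R :> R by rewrite ltr0n.
have /andP[h1 _] := tickP t0.
rewrite -(ler_pM2r (x := T / K%:R)) ?divr_gt0//; apply: le_trans h1 _.
by rewrite mulrCA mulfV ?lt0r_neq0// mulr1.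
Qed.

Local Notation ST := (measurableTypeR R * 'rV[R]_d)%type.

(** [K.-1.+1] is K in a form that shows the ordinal type to be inhabited, as [inord] requires. Only
    points of the slab matter; there the tick is below K. *)
Definition stcell (q : ST) : 'I_K.-1.+1 * 'rV['I_p.+1]_d :=
  (inord (tick q.1), cell p q.2).

Lemma tick_fiber (k : nat) : (k < K)%N ->
  `]0, T[ `&` tick @^-1` [set k] = `]0, T[ `&` `[k%:R * (T / K%:R), k.+1%:R * (T / K%:R)[.
Proof.
move=> kK; have T0 := T_gt0; have K0 : 0 < K%:R :> R by rewrite ltr0n.
apply/seteqP; split => t [t1 /= h]; split => //; move: t1; rewrite /= !in_itv/= => /andP[t0 t1].
  by rewrite -h; apply: tickP; exact: ltW.
rewrite in_itv/= in h.
apply: truncn_def; move: h => /andP[h1 h2]; rewrite ler_pdivlMr// ltr_pdivrMr//.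
by rewrite -ler_pdivrMr// -ltr_pdivlMr// -!mulrA h1 h2.
Qed.

Lemma measurable_tick_fiber (k : nat) : (k < K)%N ->
  measurable (`]0, T[ `&` tick @^-1` [set k]).
Proof. by move=> kK; rewrite tick_fiber//; exact: measurableI. Qed.

Lemma lebesgue_tick_fiber (k : nat) : (k < K)%N ->
  lebesgue_measure (`]0, T[ `&` tick @^-1` [set k]) = (T / K%:R)%:E.
Proof.
move=> kK; have T0 := T_gt0; have K0 : 0 < K%:R :> R by rewrite ltr0n.
have tau0 : 0 < T / K%:R by rewrite divr_gt0.
rewrite tick_fiber//; set I := `[_, _[%classic.
(* The slab is open, so that for k = 0 the fibre lacks its left end point: it is squeezed between
   the open and the half-open interval. *)
set I' := `]k%:R * (T / K%:R), k.+1%:R * (T / K%:R)[%classic.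
have e : k%:R * (T / K%:R) < k.+1%:R * (T / K%:R) by rewrite ltr_pM2r// ltr_nat.
have mI : lebesgue_measure I = (T / K%:R)%:E.
  rewrite lebesgue_measure_itv/= lte_fin e -EFinB -mulrBl -natr1.
  by rewrite addrAC subrr add0r mul1r.
have mI' : lebesgue_measure I' = (T / K%:R)%:E.
  rewrite lebesgue_measure_itv/= lte_fin e -EFinB -mulrBl -natr1.
  by rewrite addrAC subrr add0r mul1r.
have meI : measurable I by exact: measurable_itv.
have meI' : measurable I' by exact: measurable_itv.
have sub : I' `<=` `]0, T[ `&` I.
  move=> t; rewrite /I' /I /= !in_itv/= => /andP[t1 t2]; split; last first.
    by rewrite (ltW t1) t2.
  apply/andP; split; first by apply: le_lt_trans t1; rewrite mulr_ge0// ltW.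
  apply: lt_le_trans t2 _; rewrite mulrCA -[leRHS]mulr1 ler_pM2l//.
  by rewrite ler_pdivrMr// mul1r ler_nat.
apply/eqP; rewrite eq_le; apply/andP; split.
  by rewrite -mI; apply: le_measure; rewrite ?inE//; exact: measurableI.
by rewrite -mI'; apply: le_measure; rewrite ?inE//; exact: measurableI.
Qed.

Lemma lebesgue_slab : (@lebesgue_measure R `]0%R, T[ = T%:E)%E.
Proof. by rewrite lebesgue_measure_itv/= lte_fin T_gt0 -EFinB subr0. Qed.

Lemma measurable_slab : measurable (slab T : set ST).
Proof. by apply: measurableX. Qed.

Lemma spacetime_slab : (@spacetime R d (slab T) = T%:E)%E.
Proof.
rewrite /spacetime /slab product_measure1E//.
transitivity (@lebesgue_measure R `]0%R, T[ * 1)%E.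
  by congr (_ * _)%E; exact: (probability_setT (torus d)).
by rewrite mule1; exact: lebesgue_slab.
Qed.

Lemma stcell_fiber (k : nat) g : (k < K)%N ->
  slab T `&` stcell @^-1` [set (inord k, g)] =
  (`]0, T[ `&` tick @^-1` [set k]) `*` ((@cell R d p) @^-1` [set g]).
Proof.
move=> kK; apply/seteqP; split => -[t x] /=.
  move=> [[t0 _]]; rewrite /stcell /= => -[e1 e2]; split => //; split => //=.
  move: t0; rewrite /= in_itv/= => /andP[t0 t1].
  have := congr1 val e1; rewrite /= !inordK ?prednK//.
  by apply: tick_lt => //; exact: ltW.
by move=> [[t0 e1] e2]; split => //; rewrite /stcell/= e1 e2.
Qed.

Lemma measurable_stcell i : measurable (slab T `&` stcell @^-1` [set i]).
Proof.
case: i => k g; have kK : (k < K)%N by apply: leq_trans (ltn_ord k) _; rewrite prednK.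
rewrite -[k]inord_val stcell_fiber//.
apply: measurableX; first exact: measurable_tick_fiber.
exact: measurable_cell.
Qed.

Lemma slab_tick (q : ST) : slab T q -> (stcell q).1 = tick q.1 :> nat.
Proof.
move=> [/= ]; rewrite in_itv/= => /andP[t0 t1] _.
by rewrite inordK// prednK// tick_lt// ltW.
Qed.

Lemma measurable_step {e} {E : measurableType e} (f : nat -> 'rV['I_p.+1]_d -> E) :
  measurable_fun (slab T) (fun q : ST => f (tick q.1) (cell p q.2)).
Proof.
have h := measurable_finite_range measurable_stcell (fun i => f i.1 i.2).
move: (h); apply: eq_measurable_fun => q; rewrite inE => /slab_tick <-.
by [].
Qed.

Lemma Rintegral_step (f : nat -> 'rV['I_p.+1]_d -> R) :
  \int[spacetime]_(q in slab T) f (tick q.1) (cell p q.2) =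
  T / K%:R * \sum_(k < K) avg (f k).
Proof.
have -> : \int[spacetime]_(q in slab T) f (tick q.1) (cell p q.2) =
    \int[spacetime]_(q in slab T) f (stcell q).1 (stcell q).2.
  by apply: eq_Rintegral => q; rewrite inE => /slab_tick ->.
have fin : (@spacetime R d (slab T) < +oo)%E by rewrite spacetime_slab ltry.
have := Rintegral_finite_range measurable_slab measurable_stcell (fun i => f i.1 i.2) fin.
move=> /= ->.
rewrite mulr_sumr.
have -> : \sum_(k < K) T / K%:R * avg (f k) = \sum_(k < K.-1.+1) T / K%:R * avg (f k).
  by rewrite prednK.
transitivity (\sum_(k < K.-1.+1) \sum_(g : 'rV['I_p.+1]_d) f k g *
    fine (spacetime (slab T `&` stcell @^-1` [set (k, g)]))).
  by rewrite pair_bigA; apply: eq_bigr => -[k g] _.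
apply: eq_bigr => k _; have kK : (k < K)%N by apply: leq_trans (ltn_ord k) _; rewrite prednK.
rewrite /avg mulrA mulr_sumr mulr_suml; apply: eq_bigr => g _.
have -> : spacetime (slab T `&` stcell @^-1` [set (k, g)]) =
    ((T / K%:R) * #|{: 'rV['I_p.+1]_d}|%:R^-1)%:E.
  rewrite -{1}[k]inord_val stcell_fiber// EFinM /spacetime product_measure1E//.
  - congr (_ * _)%E; first exact: lebesgue_tick_fiber.
    exact: torus_cell.
  - exact: measurable_tick_fiber.
  - exact: measurable_cell.
by rewrite /= [RHS]mulrC mulrA [RHS]mulrC; ring.
Qed.

End time_cells.

(** * Test functions *)

Section lines.
Context {R : realType} {V : normedModType R}.
Implicit Types (phi : V -> R) (x v : V).

Lemma is_derive_line phi x v (t : R) : derivable phi (x + t *: v) v ->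
  is_derive t 1 (fun s => phi (x + s *: v)) ('D_v phi (x + t *: v)).
Proof.
move=> h.
have e : (fun h : R => h^-1 *: (((fun s => phi (x + s *: v)) \o shift t) (h *: 1) -
      phi (x + t *: v))) =
    (fun h : R => h^-1 *: ((phi \o shift (x + t *: v)) (h *: v) - phi (x + t *: v))).
  apply/funext => r /=; congr (_ *: (phi _ - _)).
  by rewrite scalerDl /GRing.scale/= mulr1 addrCA.
by apply: DeriveDef; rewrite /derivable /derive e.
Qed.

Lemma mvt_line phi x v (a b : R) : a <= b ->
  (forall t, derivable phi (x + t *: v) v) ->
  exists2 c, a <= c <= b &
    phi (x + b *: v) - phi (x + a *: v) = (b - a) * 'D_v phi (x + c *: v).
Proof.
move=> ab dphi.
have cont : {within `[a, b], continuous (fun s => phi (x + s *: v))}.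
  apply: derivable_within_continuous => t _.
  by have [] := is_derive_line (dphi t).
have [c + e] := MVT_segment ab (fun t _ => is_derive_line (dphi t)) cont.
by rewrite in_itv/= => hc; exists c => //; rewrite e mulrC.
Qed.

Lemma lip_line phi x v (c B : R) : (forall y, derivable phi y v) ->
  (forall t, `|t| <= `|c| -> `|'D_v phi (x + t *: v)| <= B) ->
  `|phi (x + c *: v) - phi x| <= `|c| * B.
Proof.
move=> dphi hB; have [c0|/ltW c0] := leP 0 c.
  have [t /andP[t0 tc]] := mvt_line c0 (fun t => dphi (x + t *: v)).
  rewrite scale0r addr0 subr0 => ->; rewrite normrM ler_wpM2l//; apply: hB.
  by rewrite !ger0_norm.
have [t /andP[t0 tc]] := mvt_line c0 (fun t => dphi (x + t *: v)).
rewrite scale0r addr0 sub0r distrC => ->; rewrite normrM normrN ler_wpM2l//; apply: hB.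
by rewrite !ler0_norm// lerN2.
Qed.

Implicit Types P : seq (R * V).

(** Smoothness is defined by directional derivatives. Increments are therefore followed along
    polygonal paths whose legs have fixed directions, and only derivatives in these directions
    enter. *)
Definition path_sum P : V := \sum_(c <- P) c.1 *: c.2.

Definition path_len P : R := \sum_(c <- P) `|c.1|.

Lemma path_len_ge0 P : 0 <= path_len P.
Proof. by apply: sumr_ge0. Qed.

Lemma lip_path phi (B : R) P x : 
  (forall c y, c \in P -> derivable phi y c.2) ->
  (forall c y, c \in P -> `|'D_(c.2) phi y| <= B) ->
  `|phi (x + path_sum P) - phi x| <= B * path_len P.
Proof.
elim: P x => [|[c v] P IH] x dphi hB.
  by rewrite /path_sum /path_len !big_nil addr0 subrr normr0 mulr0.
rewrite /path_sum /path_len !big_cons mulrDr -/(path_sum P) -/(path_len P) addrA /=.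
have h1 := IH (x + c *: v) (fun c y cP => dphi c y (mem_behead (s := _ :: _) cP))
  (fun c y cP => hB c y (mem_behead (s := _ :: _) cP)).
have h2 : `|phi (x + c *: v) - phi x| <= B * `|c|.
  rewrite mulrC; apply: lip_line => [y|t _].
    by apply: (dphi (c, v)); exact: mem_head.
  by apply: (hB (c, v)); exact: mem_head.
rewrite [leRHS]addrC; apply: le_trans (lerD h1 h2).
by apply: le_trans (ler_normD _ _); rewrite addrA subrK.
Qed.

(** The new leg (c, v) is run through last. Its increment is c times D_v phi at some point of the
    leg, and this point is joined to x by the path followed by a part of the leg, along which D_v
    phi is Lipschitz. *)
Lemma taylor_path phi (B : R) P x :
  (forall c y, c \in P -> derivable phi y c.2) ->
  (forall (c v : R * V) y, c \in P -> v \in P -> derivable ('D_(v.2) phi) y c.2) ->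
  (forall (c v : R * V) y, c \in P -> v \in P -> `|'D_(c.2) ('D_(v.2) phi) y| <= B) ->
  0 <= B ->
  `|phi (x + path_sum P) - phi x - \sum_(c <- P) c.1 * 'D_(c.2) phi x| <=
  B * path_len P ^+ 2.
Proof.
move=> + + + B0.
elim: P x => [|[c v] P IH] x dphi d2phi hB.
  by rewrite /path_sum /path_len !big_nil addr0 subrr subr0 normr0 expr0n mulr0.
have sub w : w \in P -> w \in (c, v) :: P by rewrite inE => ->; rewrite orbT.
have hd : (c, v) \in (c, v) :: P by exact: mem_head.
have h1 := IH x (fun c y cP => dphi c y (sub _ cP))
  (fun (c v : R * V) y cP vP => d2phi c v y (sub _ cP) (sub _ vP))
  (fun (c v : R * V) y cP vP => hB c v y (sub _ cP) (sub _ vP)).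
pose s := path_sum P; pose l := path_len P.
have l0 : 0 <= l by exact: path_len_ge0.
have h2 : `|phi (x + s + c *: v) - phi (x + s) - c * 'D_v phi x| <=
    `|c| * (B * (l + `|c|)).
  have key t : `|t| <= `|c| -> `|'D_v phi (x + s + t *: v) - 'D_v phi x| <= B * (l + `|c|).
    move=> tc; have := lip_path (phi := 'D_v phi) (B := B) (P := rcons P (t, v)) x.
    rewrite /path_sum /path_len -!cats1 !big_cat !big_seq1 /= -/s -/l addrA => H.
    apply: le_trans (H _ _) _.
    - move=> w y; rewrite mem_cat inE => /orP[wP|/eqP ->/=]; first exact: (d2phi w (c, v) y (sub _ wP) hd).
      exact: (d2phi (c, v) (c, v) y hd hd).
    - move=> w y; rewrite mem_cat inE => /orP[wP|/eqP ->/=]; first exact: (hB w (c, v) y (sub _ wP) hd).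
      exact: (hB (c, v) (c, v) y hd hd).
    - by rewrite ler_wpM2l// lerD2l.
  have dv t : derivable phi (x + s + t *: v) v by exact: (dphi (c, v) _ hd).
  have [c0|/ltW c0] := leP 0 c.
    have [t /andP[t0 tc]] := mvt_line c0 dv.
    rewrite scale0r addr0 subr0 => ->; rewrite -mulrBr normrM ler_wpM2l//; apply: key.
    by rewrite !ger0_norm.
  have [t /andP[t0 tc]] := mvt_line c0 dv.
  rewrite scale0r addr0 sub0r => e.
  have -> : phi (x + s + c *: v) - phi (x + s) = c * 'D_v phi (x + s + t *: v).
    by rewrite -opprB e mulNr opprK.
  rewrite -mulrBr normrM ler_wpM2l//; apply: key.
  by rewrite !ler0_norm// lerN2.
rewrite {1}/path_sum /path_len !big_cons -/(path_sum P) -/(path_len P) -/s -/l /=.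
have -> : phi (x + (c *: v + s)) - phi x -
    (c * 'D_v phi x + \sum_(j <- P) j.1 * 'D_(j.2) phi x) =
  (phi (x + s + c *: v) - phi (x + s) - c * 'D_v phi x) +
  (phi (x + s) - phi x - \sum_(c <- P) c.1 * 'D_(c.2) phi x).
  by rewrite (addrC (c *: v)) addrA; ring.
apply: le_trans (ler_normD _ _) _; apply: le_trans (lerD h2 h1) _.
rewrite -/l; have : 0 <= B * (`|c| * l) by rewrite !mulr_ge0.
lra.
Qed.

End lines.

Section periodic_bounds.
Context {R : realType} {d : nat}.

Lemma into_cube (x : 'rV[R]_d) : exists2 y, congr_tor x y &
  forall i, y 0 i \in `[0, 1].
Proof.
exists (x - map_mx intr (\row_i Num.floor (x 0 i))).
  by exists (\row_i Num.floor (x 0 i)); rewrite subrK.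
move=> i; rewrite !mxE in_itv/=; have := floor_itv (x 0 i).
by rewrite intrD1 => /andP[h1 h2]; apply/andP; split; lra.
Qed.

Lemma spacetime_bounded (T : R) (g : R * 'rV[R]_d -> R) :
  continuous g -> (forall t, Defs.periodic (fun x => g (t, x))) ->
  exists2 B, 0 <= B & forall t x, 0 <= t <= T -> `|g (t, x)| <= B.
Proof.
move=> cg pg.
pose C : set (R * 'rV[R]_d) := `[0, T]%classic `*` [set x : 'rV[R]_d | forall i, (fun=> `[0, 1]%classic : set R) i (x ord0 i)].
have cC : compact C.
  apply: compact_setX; first exact: segment_compact.
  exact: (@rV_compact R d (fun=> `[0, 1]%classic) (fun i => @segment_compact R 0 1)).
have cgC : compact (g @` C).
  by apply: continuous_compact => //; exact: continuous_subspaceT.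
have [M [_ HM]] := compact_bounded cgC.
exists (`|M| + 1) => // t x tT.
have [y xy yC] := into_cube x.
rewrite (periodic_congr (pg t) xy); apply: HM.
  by apply: le_lt_trans (ler_norm M) _; rewrite ltrDl.
by exists (t, y) => //; split => //= i; exact: yC.
Qed.

Lemma periodic_bounded (g : 'rV[R]_d -> R) : continuous g -> Defs.periodic g ->
  exists2 B, 0 <= B & forall x, `|g x| <= B.
Proof.
move=> cg pg.
pose C : set 'rV[R]_d := [set x | forall i, (fun=> `[0, 1]%classic : set R) i (x ord0 i)].
have cC : compact C.
  exact: (@rV_compact R d (fun=> `[0, 1]%classic) (fun i => @segment_compact R 0 1)).
have cgC : compact (g @` C).
  by apply: continuous_compact => //; exact: continuous_subspaceT.
have [M [_ HM]] := compact_bounded cgC.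
exists (`|M| + 1) => // x.
have [y xy yC] := into_cube x.
rewrite (periodic_congr pg xy); apply: HM.
  by apply: le_lt_trans (ler_norm M) _; rewrite ltrDl.
by exists y => // i; exact: yC.
Qed.

Lemma periodic_derive (g : 'rV[R]_d -> R) v : Defs.periodic g -> Defs.periodic ('D_v g).
Proof.
move=> pg x k; rewrite /derive.
suff -> : (fun h : R => h^-1 *: ((g \o shift (x + map_mx intr k)) (h *: v) -
      g (x + map_mx intr k))) = (fun h => h^-1 *: ((g \o shift x) (h *: v) - g x)) by [].
by apply/funext => h /=; rewrite pg addrA pg.
Qed.

(* B bounds phi, its first derivatives, and all the remainders below. *)
Definition test_bound (phi : 'rV[R]_d -> R) (B : R) : Prop :=
  [/\ 0 <= B, forall x, `|phi x| <= B, forall x i, `|'D_(unitv i) phi x| <= B,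
      forall x y, `|phi (x + y) - phi x| <= B * \sum_i `|y 0 i| /\
        forall i, `|'D_(unitv i) phi (x + y) - 'D_(unitv i) phi x| <= B * \sum_i `|y 0 i| &
      forall x p (h : R),
        `|phi (x + walk_end (fun i => h *: unitv i) p) - phi x -
          h * walk_end (fun i => 'D_(unitv i) phi x) p| <= B * (h * (size p)%:R) ^+ 2].

Lemma row_path (y : 'rV[R]_d) :
  path_sum [seq (y 0 i, unitv i) | i <- enum 'I_d] = y.
Proof.
rewrite /path_sum big_map big_enum/= [RHS]row_sum_delta.
by apply: eq_bigr => i _.
Qed.

Lemma row_path_len (y : 'rV[R]_d) :
  path_len [seq (y 0 i, unitv i : 'rV[R]_d) | i <- enum 'I_d] = \sum_i `|y 0 i|.
Proof. by rewrite /path_len big_map big_enum. Qed.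

Lemma walk_path (h : R) (p : seq ('I_d * bool)) :
  path_sum [seq (if s.2 then h else - h, unitv s.1 : 'rV[R]_d) | s <- p] =
  walk_end (fun i => h *: unitv i) p.
Proof.
rewrite /path_sum big_map; apply: eq_bigr => s _; rewrite /step_end /=.
by case: ifP => // _; rewrite scaleNr.
Qed.

Lemma test_boundP (phi : 'rV[R]_d -> R) : torus_test phi -> exists B, test_bound phi B.
Proof.
move=> [sphi pphi].
have [c0 h1] := sphi 2%N.
have dphi v x : derivable phi x v by exact: (h1 v).1.
have d2phi v w x : derivable ('D_v phi) x w by exact: ((h1 v).2.2 w).1.
have c1 v : continuous ('D_v phi) by exact: (h1 v).2.1.
have c2 v w : continuous ('D_w ('D_v phi)) by exact: ((h1 v).2.2 w).2.
have [B0 B00 HB0] := periodic_bounded c0 pphi.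
have /choice[B1 HB1] : forall i : 'I_d, exists B, 0 <= B /\ forall x, `|'D_(unitv i) phi x| <= B.
  move=> i; have [B ? ?] := periodic_bounded (c1 (unitv i)) (periodic_derive (unitv i) pphi).
  by exists B.
have /choice[B2 HB2] : forall ij : 'I_d * 'I_d, exists B, 0 <= B /\
    forall x, `|'D_(unitv ij.1) ('D_(unitv ij.2) phi) x| <= B.
  move=> [i j]; have [B ? ?] := periodic_bounded (c2 (unitv j) (unitv i))
    (periodic_derive (unitv i) (periodic_derive (unitv j) pphi)).
  by exists B.
pose B := B0 + \sum_i B1 i + \sum_ij B2 ij.
have s1 : 0 <= \sum_i B1 i by apply: sumr_ge0 => i _; exact: (HB1 i).1.
have s2 : 0 <= \sum_ij B2 ij by apply: sumr_ge0 => i _; exact: (HB2 i).1.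
have b0 : 0 <= B by rewrite !addr_ge0.
have b1 i x : `|'D_(unitv i) phi x| <= B.
  apply: le_trans ((HB1 i).2 x) _; rewrite /B (bigD1 i)//=.
  have : 0 <= \sum_(j | j != i) B1 j by apply: sumr_ge0 => j _; exact: (HB1 j).1.
  lra.
have b2 i j x : `|'D_(unitv i) ('D_(unitv j) phi) x| <= B.
  apply: le_trans ((HB2 (i, j)).2 x) _; rewrite /B (bigD1 (i, j))//=.
  have : 0 <= \sum_(k | k != (i, j)) B2 k by apply: sumr_ge0 => k _; exact: (HB2 k).1.
  lra.
exists B; split => //.
- move=> x; apply: le_trans (HB0 x) _; rewrite /B; lra.
- move=> x y; rewrite -(row_path_len y); split=> [|i].
    rewrite -{1}(row_path y); apply: (@lip_path _ _ phi B) => c z; first by [].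
    by move=> /mapP[j _ ->]; exact: b1.
  rewrite -{1}(row_path y); apply: (@lip_path _ _ ('D_(unitv i) phi) B) => c z.
    by [].
  by move=> /mapP[j _ ->]; exact: b2.
move=> x p h; rewrite -walk_path.
set P := [seq _ | _ <- p].
have lP : path_len P = `|h| * (size p)%:R.
  rewrite /path_len /P big_map; elim: p {P} => [|s p IH]; first by rewrite big_nil mulr0.
  rewrite big_cons IH /= -natr1 mulrDr mulr1 addrC; congr (_ + _).
  by case: ifP => _; rewrite ?normrN.
have -> : h * walk_end (fun i => 'D_(unitv i) phi x) p = \sum_(c <- P) c.1 * 'D_(c.2) phi x.
  rewrite /P big_map /walk_end mulr_sumr; apply: eq_bigr => s _; rewrite /step_end/=.
  by case: ifP => // _; rewrite mulNr mulrN.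
rewrite exprMn -[h ^+ 2]real_normK ?num_real// -exprMn -lP.
apply: (@taylor_path _ _ phi B) => //.
by move=> c v y /mapP[s _ ->] /mapP[s' _ ->] /=.
Qed.

End periodic_bounds.

(** * Smooth approximation of cell indicators *)

Section Ck_calculus.
Context {R : realType} {V : normedModType R}.
Implicit Types (f g : V -> R) (x v : V).

Lemma is_derive_from_line f x v (D : R) :
  is_derive (0 : R) 1 (fun s : R => f (x + s *: v)) D -> is_derive x v f D.
Proof.
move=> [h1 h2].
have e : (fun h : R => h^-1 *: ((f \o shift x) (h *: v) - f x)) =
    (fun h : R => h^-1 *: (((fun s : R => f (x + s *: v)) \o shift 0) (h *: 1) -
      (fun s : R => f (x + s *: v)) 0)).
  apply/funext => h /=; rewrite scale0r !addr0; congr (_ *: (f _ - _)).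
  by rewrite /GRing.scale/= mulr1 addrC.
by apply: DeriveDef; rewrite /derivable /derive e.
Qed.

Lemma is_derive_comp1 (h : R -> R) f x v (a b : R) :
  is_derive (f x) 1 h a -> is_derive x v f b -> is_derive x v (h \o f) (a * b).
Proof.
move=> hh [fd fb]; apply: is_derive_from_line.
have := @is_derive_line _ _ f x v 0; rewrite scale0r addr0 fb => /(_ fd) hl.
apply: (@is_derive1_comp _ h (fun s : R => f (x + s *: v))).
by rewrite scale0r addr0.
Qed.

Lemma CkW k f : Ck k.+1 f -> Ck k f.
Proof.
elim: k f => [|k IH] f; first by case.
move=> /= [cf df]; split => // v; have [d1 [c1 d2]] := df v.
by split => //; apply: IH.
Qed.

Lemma Ck_cst k (c : R) : Ck k (fun _ : V => c).
Proof.
elim: k c => [|k IH] c /=; first by move=> x; exact: cst_continuous.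
split=> [x|v]; first exact: cst_continuous.
have h x : is_derive x v (fun _ : V => c) 0 by exact: is_derive_cst.
split=> [x|]; first by have [] := h x.
have -> : 'D_v (fun _ : V => c) = fun=> 0 by apply/funext => x; have [] := h x.
exact: IH.
Qed.

Lemma CkD k f g : Ck k f -> Ck k g -> Ck k (fun x => f x + g x).
Proof.
elim: k f g => [|k IH] f g /=.
  by move=> cf cg x; apply: cvgD; [exact: cf|exact: cg].
move=> [cf df] [cg dg]; split=> [x|v]; first by apply: cvgD; [exact: cf|exact: cg].
have [df1 df2] := df v; have [dg1 dg2] := dg v.
have h x : is_derive x v (f + g) ('D_v f x + 'D_v g x).
  by apply: is_deriveD; apply/derivableP.
split=> [x|]; first by have [] := h x.
have -> : 'D_v (fun x => f x + g x) = fun x => 'D_v f x + 'D_v g x.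
  by apply/funext => x; have [] := h x.
exact: IH.
Qed.

Lemma CkM k f g : Ck k f -> Ck k g -> Ck k (fun x => f x * g x).
Proof.
elim: k f g => [|k IH] f g.
  by move=> cf cg x; apply: cvgM; [exact: cf|exact: cg].
move=> hf hg; have hf' := CkW hf; have hg' := CkW hg; move: hf hg => /=.
move=> [cf df] [cg dg]; split=> [x|v]; first by apply: cvgM; [exact: cf|exact: cg].
have [df1 df2] := df v; have [dg1 dg2] := dg v.
have h x : is_derive x v (f * g) (f x *: 'D_v g x + g x *: 'D_v f x).
  by apply: is_deriveM; apply/derivableP.
split=> [x|]; first by have [] := h x.
have -> : 'D_v (fun x => f x * g x) = fun x => f x * 'D_v g x + g x * 'D_v f x.
  by apply/funext => x; have [] := h x.
by apply: CkD; exact: IH.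
Qed.

Lemma Ck_sum k (I : Type) (r : seq I) (F : I -> V -> R) : (forall i, Ck k (F i)) ->
  Ck k (fun x => \sum_(i <- r) F i x).
Proof.
move=> hF; elim: r => [|i r IH].
  have -> : (fun x => \sum_(i <- [::]) F i x) = fun=> 0.
    by apply/funext => x; rewrite big_nil.
  exact: Ck_cst.
have -> : (fun x => \sum_(j <- i :: r) F j x) = fun x => F i x + \sum_(j <- r) F j x.
  by apply/funext => x; rewrite big_cons.
exact: CkD.
Qed.

Lemma Ck_expR k f : Ck k f -> Ck k (fun x => expR (f x)).
Proof.
elim: k => [|k IH].
  by move=> cf x; apply: continuous_comp; [exact: cf|exact: continuous_expR].
move=> hf; have hf' := CkW hf; move: hf => /= [cf df]; split=> [x|v].
  by apply: continuous_comp; [exact: cf|exact: continuous_expR].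
have [df1 df2] := df v.
have h x : is_derive x v (expR \o f) (expR (f x) * 'D_v f x).
  by apply: is_derive_comp1; apply/derivableP.
split=> [x|]; first by have [] := h x.
have -> : 'D_v (fun x => expR (f x)) = fun x => expR (f x) * 'D_v f x.
  by apply/funext => x; have [] := h x.
by apply: CkM => //; exact: IH.
Qed.

Lemma Ck_inv k f : (forall x, f x != 0) -> Ck k f -> Ck k (fun x => (f x)^-1).
Proof.
move=> f0; elim: k => [|k IH].
  by move=> cf x; apply: cvgV => //; exact: cf.
move=> hf; have hf' := CkW hf; move: hf => /= [cf df]; split=> [x|v].
  by apply: cvgV => //; exact: cf.
have [df1 df2] := df v.
split=> [x|]; first exact: derivableV.
have -> : 'D_v (fun x => (f x)^-1) = fun x => -1 * ((f x)^-1 * (f x)^-1) * 'D_v f x.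
  apply/funext => x; rewrite deriveV// /GRing.scale/= -exprVn expr2; ring.
apply: CkM => //; apply: CkM; first exact: Ck_cst.
by apply: CkM; exact: IH.
Qed.

(** The derivative of f does not depend on the point, so differentiating the cosine and the sine of
    f exchanges them up to a constant factor; the two inductions run together. *)
Lemma Ck_cos_sin k f (c : V -> R) : (forall x v, is_derive x v f (c v)) ->
  continuous f -> Ck k (fun x => cos (f x)) /\ Ck k (fun x => sin (f x)).
Proof.
move=> df cf.
have cc : continuous (fun x => cos (f x)).
  by move=> x; apply: continuous_comp; [exact: cf|exact: continuous_cos].
have cs : continuous (fun x => sin (f x)).
  by move=> x; apply: continuous_comp; [exact: cf|exact: continuous_sin].
elim: k => [|k [IHc IHs]] //=.
have hc x v : is_derive x v (cos \o f) (- sin (f x) * c v) by exact: is_derive_comp1.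
have hs x v : is_derive x v (sin \o f) (cos (f x) * c v) by exact: is_derive_comp1.
split; split => // v; split=> [x|].
- by have [] := hc x v.
- have -> : 'D_v (fun x => cos (f x)) = fun x => sin (f x) * (- c v).
    by apply/funext => x; have [_] := hc x v; rewrite /comp => ->; rewrite mulrN mulNr.
  by apply: CkM => //; exact: Ck_cst.
- by have [] := hs x v.
- have -> : 'D_v (fun x => sin (f x)) = fun x => cos (f x) * c v.
    by apply/funext => x; have [_] := hs x v; rewrite /comp => ->.
  by apply: CkM => //; exact: Ck_cst.
Qed.

End Ck_calculus.

Section Ck_translate.
Context {R : realType} {d : nat}.

Lemma continuous_coord (i : 'I_d) : continuous (fun x : 'rV[R]_d => x 0 i).
Proof. by move=> x; exact: coord_continuous. Qed.

Lemma Ck_shift k (f : 'rV[R]_d -> R) (a : 'rV[R]_d) : Ck k f -> Ck k (fun x => f (x + a)).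
Proof.
have ca : continuous (fun x : 'rV[R]_d => x + a).
  by move=> x; apply: continuousD; [exact: cvg_id|exact: cst_continuous].
have cs (g : 'rV[R]_d -> R) : continuous g -> continuous (fun x : 'rV[R]_d => g (x + a)).
  move=> cg x; exact: (continuous_comp (ca x) (cg _)).
elim: k f => [|k IH] f; first exact: cs.
move=> /= [cf df]; split=> [|v]; first exact: cs.
have [df1 df2] := df v.
have h x : is_derive x v (fun x => f (x + a)) ('D_v f (x + a)).
  apply: is_derive_from_line.
  have := @is_derive_line _ _ f (x + a) v 0; rewrite scale0r addr0 => /(_ (df1 _)).
  have -> : (fun s : R => f (x + a + s *: v)) = (fun s => f (x + s *: v + a)) => //.
  by apply/funext => s; rewrite addrAC.
split=> [x|]; first by have [] := h x.
have -> : 'D_v (fun x => f (x + a)) = fun x => 'D_v f (x + a).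
  by apply/funext => x; have [] := h x.
exact: (IH ('D_v f) df2).
Qed.

Lemma Ck_cos_coord k (i : 'I_d) (a b : R) : Ck k (fun x : 'rV[R]_d => cos (a * (x 0 i - b))).
Proof.
have df (x v : 'rV[R]_d) : is_derive x v (fun x : 'rV[R]_d => a * (x 0 i - b)) (a * v 0 i).
  apply: is_derive_from_line.
  have -> : (fun s : R => a * ((x + s *: v) 0 i - b)) =
      (fun s : R => a * (x 0 i - b) + s * (a * v 0 i)).
    by apply/funext => s; rewrite !mxE; ring.
  have h := is_deriveD (is_derive_cst (a * (x 0 i - b)) (0 : R) (1 : R))
    (is_deriveM (is_derive_id (0 : R) (1 : R)) (is_derive_cst (a * v 0 i) (0 : R) (1 : R))).
  apply: (is_derive_eq h).
  by rewrite add0r scaler0 add0r /GRing.scale/= mulr1.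
have [] // := @Ck_cos_sin _ _ k _ _ df.
have ca : continuous (fun y : R => a * (y - b)).
  by move=> y; apply: cvgM; [exact: cvg_cst|apply: cvgB; [exact: cvg_id|exact: cvg_cst]].
by move=> x; exact: (continuous_comp (@continuous_coord i x) (ca _)).
Qed.

End Ck_translate.

(** * Smooth periodic partitions of unity that concentrate on the cells *)

Section softmax.
Context {R : realType} {d : nat} (p : nat).
Local Notation n := p.+1.
Local Notation G := 'rV['I_p.+1]_d.

(** Closeness of x to the centre of the cell g, measured by a smooth periodic function. Off the grid
    the cell containing x is the unique maximiser, so that the normalised exponentials of j times
    the affinity tend to the indicators of the cells as j grows. *)
Definition affinity (g : G) (x : 'rV[R]_d) : R :=
  \sum_i cos (2 * pi * (x 0 i - ((g 0 i)%:R + 2^-1) / n%:R)).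

Definition gibbs (j : nat) (g : G) x : R := expR (j%:R * affinity g x).

Definition softmax (j : nat) (s : G -> R) x : R :=
  (\sum_g s g * gibbs j g x) / \sum_g gibbs j g x.

Let n0 : 0 < n%:R :> R. Proof. by rewrite ltr0n. Qed.

Lemma sum_gibbs_gt0 j x : 0 < \sum_g gibbs j g x.
Proof. by rewrite (bigD1 0)//= ltr_wpDr ?expR_gt0// sumr_ge0// => g _; exact: expR_ge0. Qed.

Lemma smooth_softmax j s : smooth (softmax j s).
Proof.
move=> k.
have cg g : Ck k (gibbs j g).
  apply: Ck_expR; apply: CkM; first exact: Ck_cst.
  by apply: Ck_sum => i; exact: Ck_cos_coord.
apply: CkM.
  by apply: Ck_sum => g; apply: CkM; [exact: Ck_cst|exact: cg].
apply: Ck_inv; last by apply: Ck_sum.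
by move=> x; rewrite gt_eqF// sum_gibbs_gt0.
Qed.

Lemma cosD2pi_int (x : R) (k : int) : cos (x + 2 * pi * k%:~R) = cos x.
Proof.
have h (y : R) : cos (y + 2 * pi) = cos y.
  have -> : y + 2 * pi = y + pi + pi by ring.
  by rewrite !cosDpi opprK.
elim/int_ind: k x => [x|m IH x|m IH x]; first by rewrite mulr0 addr0.
  have -> : m.+1%:~R = m%:~R + 1 :> R by rewrite -!pmulrn natr1.
  by rewrite mulrDr mulr1 addrA h; exact: IH.
rewrite -[RHS](IH x) -[LHS]h; congr cos.
have -> : (- m.+1%:Z)%:~R = (- m%:Z)%:~R - 1 :> R.
  by rewrite !rmorphN/= -!pmulrn -natr1 opprD.
ring.
Qed.

Lemma periodic_softmax j s : Defs.periodic (softmax j s).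
Proof.
move=> x k.
have e g : gibbs j g (x + map_mx intr k) = gibbs j g x.
  rewrite /gibbs /affinity; congr (expR (_ * _)); apply: eq_bigr => i _.
  rewrite !mxE -[RHS](cosD2pi_int _ (k 0 i)); congr cos; ring.
by rewrite /softmax; congr (_ / _); apply: eq_bigr => g _; rewrite e.
Qed.

Lemma norm_softmax j s x : (forall g, `|s g| <= 1) -> `|softmax j s x| <= 1.
Proof.
move=> s1; rewrite /softmax normrM [X in _ * X]ger0_norm ?invr_ge0 ?(ltW (sum_gibbs_gt0 _ _))//.
rewrite ler_pdivrMr ?sum_gibbs_gt0// mul1r.
apply: le_trans (ler_norm_sum _ _ _) _; apply: ler_sum => g _.
by rewrite normrM [X in _ * X]ger0_norm ?expR_ge0// ler_piMl// expR_ge0.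
Qed.

(** Up to an integer, t is the centre of its cell plus some u with |u| < 1 / (2 n), and the other
    centre is m / n away, 0 < m < n. With v = u or v = - u the gap is 2 sin X sin Y for X = pi (2 v
    + m / n) and Y = pi m / n, both strictly between 0 and pi. *)
Lemma cos_cell_gap (t : R) (b : 'I_p.+1) : (forall k : int, n%:R * t != k%:~R) ->
  b != cell1 p t ->
  cos (2 * pi * (t - ((b : nat)%:R + 2^-1) / n%:R)) <
  cos (2 * pi * (t - ((cell1 p t : nat)%:R + 2^-1) / n%:R)).
Proof.
move=> toff; have [k /andP[r0 rn]] := cell1P p t.
move: (cell1 p t) r0 rn => a r0 rn ba.
have r0' : t - k%:~R - (a : nat)%:R / n%:R != 0.
  apply: contra (toff (k * n + (a : nat))%R) => /eqP r0'.
  apply/eqP; rewrite intrD intrM -!pmulrn.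
  move: r0' => /eqP; rewrite -addrA -opprD subr_eq0 => /eqP ->.
  by field; rewrite lt0r_neq0.
have {r0'}r0 : 0 < t - k%:~R - (a : nat)%:R / n%:R by rewrite lt0r r0'.
have [r er] : exists r, r = t - k%:~R - (a : nat)%:R / n%:R by eexists.
have [iv eiv] : exists iv : R, iv = n%:R^-1 by eexists.
rewrite -er -?eiv in r0 rn.
pose u := r - iv / 2.
have u1 : - (iv / 2) < u by rewrite /u; lra.
have u2 : u < iv / 2 by rewrite /u; lra.
have ->  : 2 * pi * (t - ((a : nat)%:R + 2^-1) / n%:R) = 2 * pi * u + 2 * pi * k%:~R.
  by rewrite /u er eiv; field; rewrite lt0r_neq0.
have ->  : 2 * pi * (t - ((b : nat)%:R + 2^-1) / n%:R) =
    2 * pi * (u + ((a : nat)%:R - (b : nat)%:R) / n%:R) + 2 * pi * k%:~R.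
  by rewrite /u er eiv; field; rewrite lt0r_neq0.
rewrite !cosD2pi_int; clearbody u => {r0 rn toff er}.
have key (v : R) (m : nat) : - (iv / 2) < v -> v < iv / 2 -> (0 < m < n)%N ->
    cos (2 * pi * (v + m%:R / n%:R)) < cos (2 * pi * v).
  move=> v1 v2 /andP[m0 mn]; have p0 := pi_gt0 R.
  have m1 : 1 <= m%:R :> R by rewrite ler1n.
  have m2 : m%:R + 1 <= n%:R :> R by rewrite natr1 ler_nat.
  have i0 : 0 < iv by rewrite eiv invr_gt0.
  have e1 : iv <= m%:R / n%:R :> R by rewrite eiv ler_peMl// invr_ge0 ltW.
  have e2 : m%:R / n%:R + iv <= 1 :> R.
    by rewrite eiv -[X in _ + X]mul1r -mulrDl ler_pdivrMr// mul1r.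
  move: (m%:R / n%:R) e1 e2 => q e1 e2.
  pose X := pi * (2 * v + q); pose Y := pi * q : R.
  have -> : 2 * pi * (v + q) = X + Y by rewrite /X /Y; ring.
  have -> : 2 * pi * v = X - Y by rewrite /X /Y; ring.
  rewrite cosB cosD.
  have pq (c : R) : 0 < c -> c < 1 -> 0 < pi * c < pi.
    by move=> c0 c1; rewrite mulr_gt0//= -[ltRHS]mulr1 ltr_pM2l.
  have : 0 < sin X * sin Y.
    by rewrite mulr_gt0// sin_gt0_pi// /X /Y pq//; lra.
  lra.
have [ab|ab|ab] := ltngtP a b; last by move/eqP: ba; case; exact/val_inj.
- have -> : 2 * pi * (u + ((a : nat)%:R - (b : nat)%:R) / n%:R) =
     - (2 * pi * (- u + (b - a)%N%:R / n%:R)).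
    by rewrite natrB ?(ltnW ab)//; ring.
  have -> : 2 * pi * u = - (2 * pi * - u) by ring.
  rewrite !cosN; apply: key; [lra|lra|].
  by rewrite subn_gt0 ab/= (leq_ltn_trans (leq_subr _ _))// ltn_ord.
- rewrite -natrB ?(ltnW ab)//; apply: key => //.
  by rewrite subn_gt0 ab/= (leq_ltn_trans (leq_subr _ _))// ltn_ord.
Qed.

Lemma affinity_gap (g : G) (x : 'rV[R]_d) : (forall i (k : int), n%:R * x 0 i != k%:~R) ->
  g != cell p x -> affinity g x < affinity (cell p x) x.
Proof.
move=> off gx.
have [i gi] : exists i, g 0 i != cell1 p (x 0 i).
  apply: contrapT => h; move/eqP: gx; apply; apply/rowP => i; rewrite mxE.
  by apply/eqP; apply: contrapT => /negP gi; apply: h; exists i.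
rewrite /affinity (bigD1 i)//= [ltRHS](bigD1 i)//=; apply: ltr_leD.
  by rewrite mxE; apply: cos_cell_gap => // k; exact: off.
apply: ler_sum => j _; rewrite mxE.
have [->//|gj] := eqVneq (g 0 j) (cell1 p (x 0 j)).
by apply/ltW; apply: cos_cell_gap => // k; exact: off.
Qed.

(** Dividing all weights by that of the cell of x leaves j-th powers of numbers in (0, 1), except
    for this cell, where the power is constantly 1. *)
Lemma cvg_softmax (s : G -> R) (x : 'rV[R]_d) : (forall i (k : int), n%:R * x 0 i != k%:~R) ->
  softmax j s x @[j --> \oo] --> s (cell p x).
Proof.
move=> off; pose g0 := cell p x.
pose c g := expR (affinity g x - affinity g0 x).
have c1 g : g != g0 -> `|c g| < 1.
  move=> gg0; rewrite ger0_norm ?expR_ge0// /c -expR0 ltr_expR subr_lt0.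
  exact: affinity_gap.
have E j : softmax j s x = (\sum_g s g * c g ^+ j) / \sum_g c g ^+ j.
  have h g : gibbs j g x = expR (j%:R * affinity g0 x) * c g ^+ j.
    by rewrite /c -expRM_natl -expRD /gibbs; congr expR; ring.
  rewrite /softmax (eq_bigr (fun g => expR (j%:R * affinity g0 x) * (s g * c g ^+ j))).
    rewrite -mulr_sumr [X in _ / X](eq_bigr (fun g => expR (j%:R * affinity g0 x) * c g ^+ j)) //.
    by rewrite -mulr_sumr -mulf_div mulfV ?mul1r// gt_eqF// expR_gt0.
  by move=> g _; rewrite h; ring.
rewrite (_ : (fun j => softmax j s x) = fun j => (\sum_g s g * c g ^+ j) / \sum_g c g ^+ j); last first.
  by apply/funext => j; exact: E.
have lim (a : G -> R) : \sum_g a g * c g ^+ j @[j --> \oo] --> a g0.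
  have -> : a g0 = \sum_g (if g == g0 then a g0 else 0).
    by rewrite -big_mkcond big_pred1_eq.
  apply: cvg_big => [|g _]; first exact: add_continuous.
  case: eqP => [->|/eqP gg0].
    have -> : (fun j => a g0 * c g0 ^+ j) = fun=> a g0.
      by apply/funext => j; rewrite /c subrr expR0 expr1n mulr1.
    exact: cvg_cst.
  rewrite -(mulr0 (a g)); apply: cvgM; first exact: cvg_cst.
  by apply: cvg_expr; exact: c1.
rewrite -[s _]mulr1 -[X in _ * X]invr1; apply: cvgM; first exact: lim.
apply: cvgV; first exact: oner_neq0.
have := lim (fun=> 1); rewrite (_ : (fun j => _) = (fun j => \sum_g c g ^+ j))//.
by apply/funext => j; apply: eq_bigr => g _; rewrite mul1r.
Qed.

End softmax.

(** * Bounded measurable functions *)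

Section bounded_measurable.
Context {e} {X : measurableType e} {R : realType}.
Variables (mu : {measure set X -> \bar R}) (D : set X).
Implicit Types (f g : X -> R).

(** Discrete solutions and test functions are bounded and measurable, on sets of finite measure. The
    class is closed under the algebraic operations, which settles the integrability conditions at
    once. *)
Definition bm f := measurable_fun D f /\ exists B, forall x, D x -> `|f x| <= B.

Lemma bm_cst (c : R) : bm (fun=> c).
Proof. by split; [exact: measurable_cst|exists `|c|]. Qed.

Lemma bmD f g : bm f -> bm g -> bm (fun x => f x + g x).
Proof.
move=> [mf [B fB]] [mg [C gC]]; split; first exact: measurable_funD.
exists (B + C) => x Dx; apply: le_trans (ler_normD _ _) _.
by apply: lerD; [exact: fB|exact: gC].
Qed.

Lemma bmN f : bm f -> bm (fun x => - f x).
Proof.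
move=> [mf [B fB]]; split; first exact: measurableT_comp.
by exists B => x Dx; rewrite normrN; exact: fB.
Qed.

Lemma bmB f g : bm f -> bm g -> bm (fun x => f x - g x).
Proof. by move=> bf bg; apply: bmD => //; exact: bmN. Qed.

Lemma bmM f g : bm f -> bm g -> bm (fun x => f x * g x).
Proof.
move=> [mf [B fB]] [mg [C gC]]; split; first exact: measurable_funM.
exists (B * C) => x Dx; rewrite normrM.
by apply: ler_pM => //; [exact: fB|exact: gC].
Qed.

Lemma bmZ c f : bm f -> bm (fun x => c * f x).
Proof. by apply: bmM; exact: bm_cst. Qed.

Lemma bmX n f : bm f -> bm (fun x => f x ^+ n).
Proof.
move=> bf; elim: n => [|n IH]; first exact: bm_cst.
by under eq_fun do rewrite exprS; exact: bmM.
Qed.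

Lemma bm_norm f : bm f -> bm (fun x => `|f x|).
Proof.
move=> [mf [B fB]]; split; first exact: measurableT_comp.
by exists B => x Dx; rewrite normr_id; exact: fB.
Qed.

Lemma bm_sum (I : Type) (r : seq I) (F : I -> X -> R) : (forall i, bm (F i)) ->
  bm (fun x => \sum_(i <- r) F i x).
Proof.
move=> bF; elim: r => [|i r IH].
  by under eq_fun do rewrite big_nil; exact: bm_cst.
by under eq_fun do rewrite big_cons; exact: bmD.
Qed.

Hypotheses (mD : measurable D) (muD : (mu D < +oo)%E).

Lemma bm_integrable f : bm f -> mu.-integrable D (EFin \o f).
Proof.
move=> [mf [B fB]]; apply: measurable_bounded_integrable => //.
exists `|B|; split; first exact: num_real.
move=> M BM x Dx /=; apply: le_trans (fB x Dx) _.
by apply: le_trans (ler_norm B) _; exact: ltW.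
Qed.

Lemma Rintegral_sum (I : Type) (r : seq I) (F : I -> X -> R) :
  (forall i, mu.-integrable D (EFin \o F i)) ->
  \int[mu]_(x in D) (\sum_(i <- r) F i x) = \sum_(i <- r) \int[mu]_(x in D) F i x.
Proof.
move=> bF; elim: r => [|i r IH].
  rewrite big_nil; under eq_Rintegral do rewrite big_nil.
  by rewrite Rintegral_cst// mul0r.
rewrite big_cons -IH; under eq_Rintegral do rewrite big_cons.
rewrite RintegralD//.
have -> : EFin \o (fun x => \sum_(i <- r) F i x) =
    (fun x => \sum_(i <- r) (EFin \o F i) x)%E.
  by apply/funext => x /=; rewrite sumEFin.
exact: integrable_sum.
Qed.

Lemma le_norm_Rintegral f g : mu.-integrable D (EFin \o f) ->
  mu.-integrable D (EFin \o g) -> (forall x, D x -> `|f x| <= g x) ->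
  `|\int[mu]_(x in D) f x| <= \int[mu]_(x in D) g x.
Proof.
move=> bf bg fg; apply: le_trans (le_normr_Rintegral mD bf) _.
apply: le_Rintegral => //.
by have := integrable_norm bf; apply: eq_integrable => // x _.
Qed.

Lemma Rintegral_le_cst f (B : R) : bm f -> (forall x, D x -> `|f x| <= B) ->
  `|\int[mu]_(x in D) f x| <= B * fine (mu D).
Proof.
move=> bf fB; rewrite -Rintegral_cst//.
by apply: le_norm_Rintegral => //; apply: bm_integrable => //; exact: bm_cst.
Qed.

Lemma ae_eq_Rintegral f g : measurable_fun D f -> measurable_fun D g ->
  {ae mu, forall x, D x -> f x = g x} ->
  \int[mu]_(x in D) f x = \int[mu]_(x in D) g x.
Proof.
move=> mf mg fg; congr fine; apply: ae_eq_integral => //; try exact/measurable_EFinP.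
by apply: filterS fg => x h Dx /=; rewrite h.
Qed.

Lemma bounded_cvg_Rintegral (F : nat -> X -> R) f (B : R) :
  (forall k, measurable_fun D (F k)) -> measurable_fun D f ->
  (forall k x, D x -> `|F k x| <= B) ->
  {ae mu, forall x, D x -> F k x @[k --> \oo] --> f x} ->
  \int[mu]_(x in D) F k x @[k --> \oo] --> \int[mu]_(x in D) f x.
Proof.
move=> mF mf FB Ff.
have [] := @dominated_convergence _ _ _ mu D mD (fun k x => (F k x)%:E)
  (EFin \o f) (cst B%:E).
- by move=> k; exact/measurable_EFinP.
- exact/measurable_EFinP.
- apply: filterS Ff => x h Dx; apply: cvg_EFin; last exact: h.
  by apply: nearW.
- by apply: bm_integrable; exact: bm_cst.
- by apply: aeW => x k Dx /=; rewrite lee_fin FB.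
move=> fi _ h; apply: (@fine_cvg _ _ _ _ (fun k => \int[mu]_(x in D) (F k x)%:E)%E).
by rewrite fineK//; exact: integrable_fin_num.
Qed.

End bounded_measurable.

(** * Measurability of continuous periodic functions *)

Section periodic_measurable.
Context {R : realType} {d : nat}.
Implicit Types f : 'rV[R]_d -> R.

Lemma nodeP (p : nat) (x : 'rV[R]_d) :
  exists y, congr_tor y (node (cell p x)) /\ forall i, `|x 0 i - y 0 i| < p.+1%:R^-1.
Proof.
have [y [[k xy] hy]] := cellP p x; exists (node (cell p x) + map_mx intr k).
split; first by exists k.
move=> i; have := hy i; rewrite xy !mxE => /andP[h1 h2].
by rewrite opprD addrACA subrr addr0 ger0_norm.
Qed.

Lemma cvg_nodes (x : 'rV[R]_d) : exists y : nat -> 'rV[R]_d,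
  (forall p, congr_tor (y p) (node (cell p x))) /\ y p @[p --> \oo] --> x.
Proof.
have /choice[y hy] := fun p => nodeP p x.
exists y; split=> [p|]; first exact: (hy p).1.
apply/cvg_ballP => eps eps0.
near=> p; split=> // i j; rewrite (ord1 i) /ball/=.
apply: lt_trans ((hy p).2 j) _.
near: p; exact: (near_infty_natSinv_lt (PosNum eps0)).
Unshelve. all: by end_near. Qed.

(** The sigma-algebra of row vectors is the one generated by the coordinates. Rather than through
    open sets, f is reached as the pointwise limit of its values at the nodes of finer and finer
    cells, functions of finite range. *)
Lemma measurable_periodic f : continuous f -> Defs.periodic f -> measurable_fun setT f.
Proof.
move=> cf pf.
apply: (@measurable_fun_cvg _ _ _ _ (fun p x => f (node (cell p x)))).
  move=> p; apply: (measurable_finite_range (D := setT) (fun g => _) (fun g => f (node g))).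
  by move=> g; rewrite setTI; exact: measurable_cell.
move=> x _; have [y [hy yx]] := cvg_nodes x.
rewrite (_ : (fun p => f (node (cell p x))) = f \o y).
  exact: (continuous_cvg _ (cf x) yx).
by apply/funext => p; rewrite /= (periodic_congr pf (hy p)).
Qed.

Lemma bm_periodic D f : measurable D -> continuous f -> Defs.periodic f -> bm D f.
Proof.
move=> mD cf pf; split; first exact: measurable_funS (measurable_periodic cf pf).
by have [B _ hB] := periodic_bounded cf pf; exists B => x _.
Qed.

Lemma torus_lty : (torus d [set: 'rV[R]_d] < +oo)%E.
Proof. by rewrite ltey_eq fin_num_measure. Qed.

Lemma torus_integrable f : bm setT f -> (torus d).-integrable setT (EFin \o f).
Proof. by apply: bm_integrable => //; exact: torus_lty. Qed.

Lemma torus_le_cst f (B : R) : bm setT f -> (forall x, `|f x| <= B) ->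
  `|\int[torus d]_x f x| <= B.
Proof.
move=> bf fB; apply: le_trans (Rintegral_le_cst _ _ bf (fun x _ => fB x)) _ => //.
  exact: torus_lty.
have e : fine (torus d [set: 'rV[R]_d]) = 1 by exact: (congr1 fine (probability_setT (torus d))).
by rewrite [X in _ * X]e mulr1.
Qed.

Local Notation ST := (measurableTypeR R * 'rV[R]_d)%type.

Lemma bm_spacetime (T : R) (u : R * 'rV[R]_d -> R) : 0 < T -> continuous u ->
  (forall t, Defs.periodic (fun x => u (t, x))) -> bm (slab T : set ST) (u : ST -> R).
Proof.
move=> T0 cu pu; split; last first.
  have [B _ hB] := spacetime_bounded T cu pu; exists B => -[t x] [/= + _].
  by rewrite in_itv/= => /andP[/ltW t0 /ltW t1]; apply: hB; rewrite t0.
apply: (@measurable_fun_cvg _ _ _ _ (fun p (q : ST) =>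
   u ((tick T p.+1 q.1)%:R * (T / p.+1%:R), node (cell p q.2)))).
  by move=> p; exact: (measurable_step (K := p.+1) T0 _ (fun k g => u (k%:R * (T / p.+1%:R), node g))).
move=> [t x] [/= + _]; rewrite in_itv/= => /andP[t0 t1].
have [y [hy yx]] := cvg_nodes x.
rewrite (_ : (fun p => _) =
    u \o (fun p => ((tick T p.+1 t)%:R * (T / p.+1%:R), y p))); last first.
  by apply/funext => p /=; rewrite (periodic_congr (pu _) (hy p)).
apply: (continuous_cvg _ (cu (t, x))).
suff h : (tick T p.+1 t)%:R * (T / p.+1%:R) @[p --> \oo] --> t by exact: (cvg_pair h yx).
apply/cvgrPdist_lt => eps eps0.
near=> p.
have /andP[h1 h2] := @tickP R T p.+1 T0 isT t (ltW t0).
rewrite ger0_norm ?subr_ge0//.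
have : T / p.+1%:R < eps.
  rewrite ltr_pdivrMr ?ltr0n// mulrC -ltr_pdivrMr//.
  apply: (@lt_trans _ _ p%:R); last by rewrite ltr_nat.
  near: p; exact: nbhs_infty_gtr.
move: h2; rewrite -natr1 mulrDl mul1r => h2 h3.
by rewrite ltrBlDl; apply: lt_trans h2 _; rewrite ltrD2l.
Unshelve. all: by end_near. Qed.

End periodic_measurable.

(** * Total variation of cell averages *)

Section divergence_combination.
Context {R : realType} {d : nat}.

Lemma is_derive_bigsum {V : normedModType R} (I : Type) (r : seq I) (F : I -> V -> R)
  (dF : I -> R) x v : (forall i, is_derive x v (F i) (dF i)) ->
  is_derive x v (fun y => \sum_(i <- r) F i y) (\sum_(i <- r) dF i).
Proof.
move=> hF; elim: r => [|i r IH].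
  rewrite big_nil (_ : (fun y => _) = cst 0); first exact: is_derive_cst.
  by apply/funext => y; rewrite big_nil.
rewrite big_cons (_ : (fun y => _) = F i + (fun y => \sum_(j <- r) F j y)).
  exact: is_deriveD.
by apply/funext => y; rewrite big_cons.
Qed.

Lemma is_derive_scale {V : normedModType R} (f : V -> R) (a D : R) x v :
  is_derive x v f D -> is_derive x v (fun y => a * f y) (a * D).
Proof. by move=> h; exact: (is_deriveZ a h). Qed.

Lemma is_derive_shift (f : 'rV[R]_d -> R) a D x v :
  is_derive (x + a) v f D -> is_derive x v (fun y => f (y + a)) D.
Proof.
move=> [h1 h2]; apply: is_derive_from_line.
have := @is_derive_line _ _ f (x + a) v 0; rewrite scale0r addr0 h2 => /(_ h1).
have -> // : (fun s : R => f (x + a + s *: v)) = (fun s => f (x + s *: v + a)).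
by apply/funext => s; rewrite addrAC.
Qed.

Lemma walk_end_coord (nu : 'I_d -> R) w :
  walk_end nu w = \sum_i walk_end (fun i => unitv i : 'rV[R]_d) w 0 i * nu i.
Proof.
elim: w => [|s w IH].
  by rewrite !walk_end0 big1// => i _; rewrite mxE mul0r.
rewrite !walk_end_cons IH [RHS](eq_bigr (fun i =>
  step_end (fun i => unitv i : 'rV[R]_d) s 0 i * nu i +
  walk_end (fun i => unitv i : 'rV[R]_d) w 0 i * nu i)); last first.
  by move=> i _; rewrite mxE mulrDl.
rewrite big_split/=; congr (_ + _); rewrite (bigD1 s.1)//= big1 ?addr0.
  by rewrite /step_end; case: ifP => _; rewrite !mxE !eqxx ?mulN1r ?mul1r.
by move=> i /negbTE si; rewrite /step_end; case: ifP => _; rewrite !mxE eqxx si ?oppr0 mul0r.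
Qed.

Lemma walk_end_scale (a : R) w : walk_end (fun i => a *: unitv i : 'rV[R]_d) w =
  a *: walk_end (fun i => unitv i) w.
Proof.
rewrite /walk_end scaler_sumr; apply: eq_bigr => s _; rewrite /step_end.
by case: ifP => // _; rewrite scalerN.
Qed.

Lemma diverg_comb (I : Type) (r : seq I) (b : I -> R) (S : I -> 'rV[R]_d -> R)
  (w : I -> seq ('I_d * bool)) x : (forall q y v, derivable (S q) y v) ->
  diverg (fun y => \sum_(q <- r) (b q * S q y) *: walk_end (fun i => unitv i) (w q)) x =
  \sum_(q <- r) b q * walk_end (fun i => 'D_(unitv i) (S q) x) (w q).
Proof.
move=> dS; rewrite /diverg (eq_bigr (fun i => \sum_(q <- r)
    b q * (walk_end (fun i => unitv i : 'rV[R]_d) (w q) 0 i * 'D_(unitv i) (S q) x))).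
  rewrite exchange_big; apply: eq_bigr => q _.
  by rewrite -mulr_sumr [in RHS]walk_end_coord.
move=> i _.
have -> : (fun y => (\sum_(q <- r) (b q * S q y) *: walk_end (fun i => unitv i) (w q)) 0 i) =
    (fun y => \sum_(q <- r) (b q * walk_end (fun i => unitv i : 'rV[R]_d) (w q) 0 i) * S q y).
  by apply/funext => y; rewrite summxE; apply: eq_bigr => q _; rewrite mxE mulrAC.
have [|_ ->] := @is_derive_bigsum _ _ r
  (fun q y => (b q * walk_end (fun i => unitv i : 'rV[R]_d) (w q) 0 i) * S q y)
  (fun q => (b q * walk_end (fun i => unitv i : 'rV[R]_d) (w q) 0 i) * 'D_(unitv i) (S q) x)
  x (unitv i).
  by move=> q; apply: is_derive_scale; apply/derivableP.
by apply: eq_bigr => q _; rewrite mulrA.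
Qed.

(** Duality: pairing the vector v with itself gives the factors s times the increments of v along
    the walks, at most a |v| by the upper half of isotropy. This bounds both the test fields below
    and the discrete field z. *)
Lemma enorm_comb (WL : seq (R * seq ('I_d * bool))) (a : R) :
  (forall cp, cp \in WL -> 0 <= cp.1) -> 0 <= a ->
  (forall nu : 'rV[R]_d,
     \sum_(cp <- WL) cp.1 * `|walk_end (fun i => nu 0 i) cp.2| <= a * enorm nu) ->
  forall s : R * seq ('I_d * bool) -> R, (forall cp, `|s cp| <= 1) ->
  enorm (\sum_(cp <- WL) (cp.1 * s cp) *: walk_end (fun i => unitv i) cp.2 : 'rV[R]_d) <= a.
Proof.
move=> c0 a0 iso s s1; set v := \sum_(cp <- WL) _.
have [v0|vn0] := eqVneq (enorm v) 0; first by rewrite v0.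
have vp : 0 < enorm v by rewrite lt0r vn0 enorm_ge0.
rewrite -(ler_pM2r vp) -expr2 sqr_enorm; apply: le_trans (iso v).
have -> : dot v v = \sum_(cp <- WL) (cp.1 * s cp) * walk_end (fun i => v 0 i) cp.2.
  rewrite {1}/dot (eq_bigr (fun i => \sum_(cp <- WL) (cp.1 * s cp) *
     (walk_end (fun i => unitv i : 'rV[R]_d) cp.2 0 i * v 0 i))); last first.
    move=> i _; rewrite {1}/v summxE mulr_suml; apply: eq_bigr => cp _.
    by rewrite mxE mulrA.
  by rewrite exchange_big; apply: eq_bigr => cp _; rewrite -mulr_sumr [in RHS]walk_end_coord.
rewrite big_seq [leRHS]big_seq; apply: ler_sum => cp cpW; rewrite -mulrA.
rewrite ler_wpM2l ?c0//; apply: le_trans (ler_norm _) _.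
by rewrite normrM ler_piMl.
Qed.

End divergence_combination.

Section off_grid.
Context {R : realType} {d : nat} (p : nat).

Lemma countable_grid : countable [set t : R | exists k : int, p.+1%:R * t = k%:~R].
Proof.
have n0 : p.+1%:R != 0 :> R by rewrite pnatr_eq0.
have -> : [set t : R | exists k : int, p.+1%:R * t = k%:~R] =
    (fun k : int => k%:~R / p.+1%:R) @` [set: int].
  apply/seteqP; split=> [t [k tk]|t [k _ <-]].
    by exists k => //; rewrite -tk mulrAC mulfV// mul1r.
  by exists k; rewrite mulrC divfK.
exact: sub_countable (card_image_le _ _) (countableP _).
Qed.

Lemma off_grid_ae :
  {ae torus d, forall x : 'rV[R]_d, forall i (k : int), p.+1%:R * x 0 i != k%:~R}.
Proof.
apply: filterS (_ : {ae torus d, forall x : 'rV[R]_d, forall i : 'I_d,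
  ~ exists k : int, p.+1%:R * x 0 i = k%:~R}).
  by move=> x h i k; apply/eqP => e; apply: (h i); exists k.
apply: filter_forall => i.
pose A (j : 'I_d) : set R := if j == i then [set t : R | exists k : int, p.+1%:R * t = k%:~R]
  else setT.
have mG : measurable [set t : R | exists k : int, p.+1%:R * t = k%:~R].
  apply: countable_measurable => [t|]; [exact: measurable_set1|exact: countable_grid].
have mA j : measurable (A j) by rewrite /A; case: ifP.
exists [set x : 'rV[R]_d | forall j, A j (x 0 j)]; split.
- have -> : [set x : 'rV[R]_d | forall j, A j (x 0 j)] =
    \bigcap_(j in [set: 'I_d]) ((fun x : 'rV[R]_d => x 0 j) @^-1` A j).
    by apply/seteqP; split=> [x /= h j _|x /= h j]; exact: h.
  apply: fin_bigcap_measurable => // j _.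
  by rewrite -[_ @^-1` _]setTI; apply: measurable_row_coord.
- rewrite torus_box// (bigD1 i)//=.
  have -> : uniform_prob (@ltr01 R) (A i) = 0%E.
    rewrite uniform_probE// /A eqxx.
    apply: countable_lebesgue_measure0; apply: sub_countable countable_grid.
    by apply: subset_card_le => x [].
  by rewrite mul0e.
- move=> x /contrapT xi j; rewrite /A; case: eqP => [->|//]; exact: xi.
Qed.

End off_grid.

Section cell_averages.
Context {R : realType} {d : nat} (p : nat).
Local Notation n := p.+1.
Local Notation G := 'rV['I_p.+1]_d.
Variables (rho0 : 'rV[R]_d -> R) (V : R).
Hypotheses (brho0 : bm setT rho0)
  (HV : forall zeta : 'rV[R]_d -> 'rV[R]_d, torus_test_field zeta ->
     (forall x, enorm (zeta x) <= 1) -> \int[torus d]_x (- rho0 x * diverg zeta x) <= V).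

Definition cell_avg (g : G) : R :=
  #|{: G}|%:R * \int[torus d]_x (rho0 x * (cell p x == g)%:R).

Lemma bm_cell (s : G -> R) : bm setT (fun x : 'rV[R]_d => s (cell p x)).
Proof.
split.
  apply: (measurable_finite_range (D := setT)) => g.
  by rewrite setTI; exact: measurable_cell.
exists (\sum_g `|s g|) => x _; rewrite (bigD1 (cell p x))//= lerDl.
exact: sumr_ge0.
Qed.

Lemma avg_cell_avg (s : G -> R) :
  avg (fun g => s g * cell_avg g) = \int[torus d]_x (rho0 x * s (cell p x)).
Proof.
have b g : bm setT (fun x : 'rV[R]_d => rho0 x * (cell p x == g)%:R).
  by apply: bmM => //; exact: (bm_cell (fun h => (h == g)%:R)).
rewrite /avg (eq_bigr (fun g => #|{: G}|%:R *
   \int[torus d]_x (s g * (rho0 x * (cell p x == g)%:R)))); last first.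
  by move=> g _; rewrite RintegralZl//; [rewrite mulrCA|exact: torus_integrable].
rewrite -mulr_sumr mulrAC mulfV ?mul1r; last by rewrite gt_eqF// cardR_gt0.
rewrite -Rintegral_sum//; last by move=> g; apply: torus_integrable; exact: bmZ.
apply: eq_Rintegral => x _; rewrite (bigD1 (cell p x))//= eqxx mulr1 mulrC big1 ?addr0//.
by move=> g /negbTE; rewrite eq_sym => ->; rewrite !mulr0.
Qed.

Section smooth_shift.
Variables (S : 'rV[R]_d -> R) (w : seq ('I_d * bool)) (N : nat).
Hypotheses (tS : torus_test S) (N_gt0 : (0 < N)%N).

Let h : 'rV[R]_d := walk_end (fun i => n%:R^-1 *: unitv i) w.

(** A Riemann sum for the integral of S (x - s h) over s in [0, 1], whose derivative along h is S x
    - S (x - h). In this way a finite difference is, up to O(1 / N), the divergence of a smooth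
    field. *)
Definition shift_mean x : R := N%:R^-1 * \sum_(l < N) S (x + (- (l%:R / N%:R)) *: h).

Lemma test_shift_mean : torus_test shift_mean.
Proof.
split=> [k|x k].
  apply: CkM; first exact: Ck_cst.
  by apply: Ck_sum => l; apply: Ck_shift; exact: tS.1.
congr (_ * _); apply: eq_bigr => l _; rewrite addrAC; exact: tS.2.
Qed.

Lemma derive_shift_mean x v : 'D_v shift_mean x =
  N%:R^-1 * \sum_(l < N) 'D_v S (x + (- (l%:R / N%:R)) *: h).
Proof.
have dS y : derivable S y v by exact: ((tS.1 1%N).2 v).1.
suff [] : is_derive x v shift_mean
  (N%:R^-1 * \sum_(l < N) 'D_v S (x + (- (l%:R / N%:R)) *: h)) by [].
apply: is_derive_scale; apply: is_derive_bigsum => l.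
by apply: is_derive_shift; apply/derivableP.
Qed.

Lemma norm_shift_mean x : (forall y, `|S y| <= 1) -> `|shift_mean x| <= 1.
Proof.
move=> S1; have N0 : 0 < N%:R :> R by rewrite ltr0n.
rewrite /shift_mean normrM ger0_norm ?invr_ge0 ?(ltW N0)// ler_pdivrMl// mulr1.
apply: le_trans (ler_norm_sum _ _ _) _.
apply: (@le_trans _ _ (\sum_(l < N) 1)); first by apply: ler_sum => l _; exact: S1.
by rewrite sumr_const card_ord.
Qed.

(* Telescoping over N steps; the Taylor remainders add up to O(1/N). *)
Lemma shift_mean_walk (B : R) x : test_bound S B ->
  `|n%:R * (S (x - h) - S x) + walk_end (fun i => 'D_(unitv i) shift_mean x) w| <=
  B * (size w)%:R ^+ 2 / N%:R.
Proof.
move=> [B0 _ _ _ tB]; have N0 : 0 < N%:R :> R by rewrite ltr0n.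
have n0 : 0 < n%:R :> R by rewrite ltr0n.
have -> : walk_end (fun i => 'D_(unitv i) shift_mean x) w =
    N%:R^-1 * \sum_(l < N)
      walk_end (fun i => 'D_(unitv i) S (x + (- (l%:R / N%:R)) *: h)) w.
  rewrite (eq_bigr (fun l : 'I_N => \sum_i walk_end (fun i => unitv i : 'rV[R]_d) w 0 i *
     'D_(unitv i) S (x + (- (l%:R / N%:R)) *: h))); last by move=> l _; exact: walk_end_coord.
  rewrite exchange_big mulr_sumr walk_end_coord; apply: eq_bigr => i _.
  by rewrite derive_shift_mean -mulr_sumr mulrCA.
have -> : S (x - h) - S x = \sum_(l < N)
    (S (x + (- (l%:R / N%:R)) *: h - N%:R^-1 *: h) - S (x + (- (l%:R / N%:R)) *: h)).
  rewrite (eq_bigr (fun l : 'I_N => S (x + (- (l.+1%:R / N%:R)) *: h) -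
     S (x + (- (l%:R / N%:R)) *: h))).
    rewrite -(big_mkord xpredT (fun l => S (x + (- (l.+1%:R / N%:R)) *: h) -
     S (x + (- (l%:R / N%:R)) *: h))) telescope_sumr//.
    by rewrite mulfV ?gt_eqF// scaleN1r mul0r oppr0 scale0r addr0.
  move=> l _; congr (S _ - _); rewrite -addrA -scalerBl -natr1 mulrDl mul1r; congr (_ + _ *: _).
  by rewrite opprD.
rewrite !mulr_sumr -big_split/=; apply: le_trans (ler_norm_sum _ _ _) _.
have -> : B * (size w)%:R ^+ 2 / N%:R = \sum_(l < N) (n%:R * (B * (- (n%:R * N%:R)^-1 * (size w)%:R) ^+ 2) * n%:R).
  rewrite sumr_const card_ord -[RHS]mulr_natl exprMn sqrrN; field.
  by rewrite !gt_eqF.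
apply: ler_sum => l _.
set y := x + _; have := tB y w (- (n%:R * N%:R)^-1).
have -> : walk_end (fun i => - (n%:R * N%:R)^-1 *: unitv i) w = - (N%:R^-1 *: h).
  rewrite /h !walk_end_scale scalerA -scaleNr.
  have -> : - (n%:R * N%:R)^-1 = - (N%:R^-1 * n%:R^-1) :> R by rewrite invfM mulrC.
  by [].
set D := walk_end _ _; set S1 := S (y - _); set S0 := S y => hh.
have -> : n%:R * (S1 - S0) + N%:R^-1 * D = n%:R * (S1 - S0 - - (n%:R * N%:R)^-1 * D).
  by field; rewrite !gt_eqF.
rewrite normrM ger0_norm ?(ltW n0)// -[leRHS]mulrA ler_wpM2l ?(ltW n0)//.
apply: le_trans hh _; by rewrite ler_peMr ?ler1n// mulr_ge0 ?sqr_ge0.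
Qed.

End smooth_shift.

Variables (WL : seq (R * seq ('I_d * bool))) (eps : R).
Hypotheses (WL_ge0 : forall cp, cp \in WL -> 0 <= cp.1) (eps_ge0 : 0 <= eps)
  (iso : forall nu : 'rV[R]_d,
     \sum_(cp <- WL) cp.1 * `|walk_end (fun i => nu 0 i) cp.2| <= (1 + eps) * enorm nu).

Let hw (w : seq ('I_d * bool)) : 'rV[R]_d := walk_end (fun i => n%:R^-1 *: unitv i) w.

(** The test field combines the walk vectors with coefficients [shift_mean (S cp)], divided by 1 +
    eps to have length at most 1, see [enorm_comb]. Its divergence reproduces the finite differences
    up to O(1 / N), and N is arbitrary. *)
Lemma smooth_dual_bound (S : R * seq ('I_d * bool) -> 'rV[R]_d -> R) :
  (forall cp, torus_test (S cp)) -> (forall cp x, `|S cp x| <= 1) ->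
  \sum_(cp <- WL) cp.1 * \int[torus d]_x (rho0 x * (n%:R * (S cp (x - hw cp.2) - S cp x))) <=
  (1 + eps) * V.
Proof.
move=> tS S1; have a0 : 0 < 1 + eps by rewrite ltr_pwDl.
have [_ [M0 hM0]] := brho0; pose M := `|M0|.
have hM x : `|rho0 x| <= M by apply: le_trans (hM0 x I) (ler_norm _).
have /choice[B hB] : forall cp, exists B, test_bound (S cp) B.
  by move=> cp; exact: test_boundP.
pose C := M * \sum_(cp <- WL) cp.1 * (B cp * (size cp.2)%:R ^+ 2).
suff key N : (0 < N)%N -> \sum_(cp <- WL) cp.1 * \int[torus d]_x
    (rho0 x * (n%:R * (S cp (x - hw cp.2) - S cp x))) <= (1 + eps) * V + C / N%:R.
  apply/ler_addgt0Pr => e e0.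
  have [N hN] : exists N : nat, C / e < N%:R.
    by exists (Num.truncn (C / e)).+1; exact: truncnS_gt.
  apply: le_trans (key N.+1 isT) _; rewrite lerD2l ler_pdivrMr ?ltr0n// mulrC -ler_pdivrMr//.
  by apply/ltW/(lt_trans hN); rewrite ltr_nat.
move=> N0; have NR : 0 < N%:R :> R by rewrite ltr0n.
pose T cp := shift_mean (S cp) cp.2 N.
have tT cp : torus_test (T cp) by exact: test_shift_mean.
have dT cp y v : derivable (T cp) y v by exact: (((tT cp).1 1%N).2 v).1.
pose zeta y : 'rV[R]_d := \sum_(cp <- WL) ((1 + eps)^-1 * cp.1 * T cp y) *: walk_end (fun i => unitv i) cp.2.
have zt : torus_test_field zeta.
  split=> [i k|x k]; last first.
    by apply: eq_bigr => cp _; rewrite (tT cp).2.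
  have -> : (fun x => zeta x 0 i) = fun x => \sum_(cp <- WL)
     ((1 + eps)^-1 * cp.1 * walk_end (fun i => unitv i : 'rV[R]_d) cp.2 0 i) * T cp x.
    by apply/funext => x; rewrite /zeta summxE; apply: eq_bigr => cp _; rewrite mxE mulrAC.
  by apply: Ck_sum => cp; apply: CkM; [exact: Ck_cst|exact: (tT cp).1].
have z1 x : enorm (zeta x) <= 1.
  have -> : zeta x = (1 + eps)^-1 *: \sum_(cp <- WL) (cp.1 * T cp x) *: walk_end (fun i => unitv i) cp.2.
    rewrite /zeta scaler_sumr.
    apply: eq_bigr => cp _.
    by rewrite scalerA -!mulrA.
  rewrite enormZ ger0_norm ?invr_ge0 ?(ltW a0)// ler_pdivrMl// mulr1.
  by apply: enorm_comb => //; [exact: ltW|move=> cp; exact: norm_shift_mean].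
have := HV zt z1.
have dz x : diverg zeta x = (1 + eps)^-1 * \sum_(cp <- WL) cp.1 *
    walk_end (fun i => 'D_(unitv i) (T cp) x) cp.2.
  rewrite /zeta diverg_comb// mulr_sumr; apply: eq_bigr => cp _; first by rewrite mulrA.
have cS cp : continuous (S cp) by exact: (tS cp).1 0%N.
have bD cp : bm setT (fun x => walk_end (fun i => 'D_(unitv i) (T cp) x) cp.2).
  under eq_fun do rewrite walk_end_coord.
  apply: bm_sum => i; apply: bmM; first exact: bm_cst.
  by apply: bm_periodic => //; [exact: (((tT cp).1 1%N).2 (unitv i)).2|exact: periodic_derive (tT cp).2].
have bS cp a : bm setT (fun x : 'rV[R]_d => S cp (x + a)).
  apply: bm_periodic => //; first exact: (@Ck_shift _ _ 0 _ _ (cS cp)).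
  by move=> x k; rewrite addrAC (tS cp).2.
have bS0 cp : bm setT (S cp) by apply: bm_periodic => //; exact: (tS cp).2.
rewrite (_ : \int[torus d]_x (- rho0 x * diverg zeta x) = (1 + eps)^-1 *
   \sum_(cp <- WL) cp.1 * \int[torus d]_x (- rho0 x *
      walk_end (fun i => 'D_(unitv i) (T cp) x) cp.2)); last first.
  rewrite (eq_bigr (fun cp => \int[torus d]_x (cp.1 * (- rho0 x *
      walk_end (fun i => 'D_(unitv i) (T cp) x) cp.2)))); last first.
    move=> cp _; rewrite RintegralZl//; apply: torus_integrable; apply: bmM => //; exact: bmN.
  rewrite -Rintegral_sum//; last first.
    by move=> cp; apply: torus_integrable; apply: bmZ; apply: bmM => //; exact: bmN.
  rewrite -RintegralZl//; last first.
    by apply: torus_integrable; apply: bm_sum => cp; apply: bmZ; apply: bmM => //; exact: bmN.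
  apply: eq_Rintegral => x _; rewrite dz mulrCA mulr_sumr; congr (_ * _).
  by apply: eq_bigr => cp _; rewrite mulrCA.
rewrite ler_pdivrMl// => h; apply: le_trans (lerD h (lexx _)).
rewrite /C mulr_sumr mulr_suml -big_split/= big_seq [leRHS]big_seq; apply: ler_sum => cp cpW.
have -> : M * (cp.1 * (B cp * (size cp.2)%:R ^+ 2)) / N%:R =
    cp.1 * (M * (B cp * (size cp.2)%:R ^+ 2 / N%:R)) by ring.
rewrite -mulrDr ler_wpM2l ?WL_ge0// addrC -lerBlDr.
rewrite -RintegralB//; first last.
- by apply: torus_integrable; apply: bmM => //; exact: bmN.
- by apply: torus_integrable; apply: bmM => //; apply: bmZ; apply: bmB.
apply: le_trans (ler_norm _) _; apply: torus_le_cst.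
  by apply: bmB; apply: bmM => //; [apply: bmZ; exact: bmB|exact: bmN].
move=> x; rewrite mulNr opprK -mulrDr normrM; apply: ler_pM => //.
exact: shift_mean_walk.
Qed.

(** The nonlocal variation of the cell averages is [rho0] paired with differences of signs that are
    constant on cells. Their softmax versions are smooth and bounded by 1, hence covered by
    [smooth_dual_bound], and bounded convergence off the grid removes the approximation. *)
Lemma nltv_cell_avg : nltv (weights (unit_shift p) WL n%:R) cell_avg <= (1 + eps) * V.
Proof.
pose s (cp : R * seq ('I_d * bool)) (g : G) := Num.sg (dif (walk_end (unit_shift p) cp.2) cell_avg g).
have s1 cp g : `|s cp g| <= 1 by rewrite /s normr_sg; case: (_ == _).
pose L cp := \int[torus d]_x (rho0 x * (n%:R * (s cp (cell p (x - hw cp.2)) - s cp (cell p x)))).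
have -> : nltv (weights (unit_shift p) WL n%:R) cell_avg = \sum_(cp <- WL) cp.1 * L cp.
  rewrite nltv_weightsE mulr_sumr; apply: eq_bigr => cp _.
  rewrite mulrCA; congr (_ * _).
  pose h := walk_end (unit_shift p) cp.2.
  have -> : avg (fun g => `|dif h cell_avg g|) = avg (fun g => (s cp (g - h) - s cp g) * cell_avg g).
    rewrite (eq_avg (g := fun g => dif h cell_avg g * s cp g)).
      by rewrite avg_dif_parts; apply: eq_avg => g; rewrite mulrC.
    by move=> g; rewrite /s mulrC -normrEsg.
  have -> : n%:R * avg (fun g => (s cp (g - h) - s cp g) * cell_avg g) =
      avg (fun g => (n%:R * (s cp (g - h) - s cp g)) * cell_avg g).
    by rewrite -avgZ; apply: eq_avg => g; rewrite mulrA.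
  rewrite avg_cell_avg; apply: eq_Rintegral => x _.
  have := cell_walk p (x - hw cp.2) cp.2; rewrite subrK => ->.
  by rewrite -/h addrK.
pose S (j : nat) cp := softmax j (s cp).
have Slim cp : \int[torus d]_x (rho0 x * (n%:R * (S j cp (x - hw cp.2) - S j cp x)))
    @[j --> \oo] --> L cp.
  have [_ [M0 hM0]] := brho0.
  have bS j : bm setT (S j cp).
    by apply: bm_periodic => //; [exact: (smooth_softmax j (s cp) 0%N)|exact: periodic_softmax].
  have bS' j : bm setT (fun x : 'rV[R]_d => S j cp (x - hw cp.2)).
    apply: bm_periodic => //.
      exact: (@Ck_shift _ _ 0 _ _ (smooth_softmax j (s cp) 0%N)).
    by move=> x k; rewrite addrAC; exact: periodic_softmax.
  have bs' : bm setT (fun x : 'rV[R]_d => s cp (cell p (x - hw cp.2))).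
    have -> : (fun x : 'rV[R]_d => s cp (cell p (x - hw cp.2))) =
        fun x : 'rV[R]_d => s cp (cell p x - walk_end (unit_shift p) cp.2).
      apply/funext => x; have := cell_walk p (x - hw cp.2) cp.2; rewrite subrK => ->.
      by rewrite addrK.
    exact: (bm_cell (fun g => s cp (g - _))).
  apply: (@bounded_cvg_Rintegral _ _ _ _ _ _ _ _ _ (`|M0| * (n%:R * 2))) => //.
  - exact: torus_lty.
  - by move=> j; apply: (bmM brho0 (bmZ _ (bmB _ _))).1.
  - by apply: (bmM brho0 (bmZ _ (bmB _ (bm_cell _)))).1.
  - move=> j x _; rewrite normrM; apply: ler_pM => //.
      by apply: le_trans (hM0 x I) (ler_norm _).
    rewrite normrM ger0_norm// ler_wpM2l//; apply: le_trans (ler_normB _ _) _.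
    by rewrite -[2]/(1 + 1); apply: lerD; exact: norm_softmax.
  - apply: filterS (off_grid_ae p) => x off _.
    apply: cvgM; first exact: cvg_cst.
    apply: cvgM; first exact: cvg_cst.
    apply: cvgB; last exact: cvg_softmax.
    apply: cvg_softmax => i k.
    (* In units of the mesh width [hw] is an integer vector, so translation by it keeps a point off
       the grid. *)
    have -> : n%:R * (x - hw cp.2) 0 i = n%:R * x 0 i -
        (walk_end (fun i => delta_mx 0 i : 'rV[int]_d) cp.2 0 i)%:~R.
      rewrite !mxE mulrDr mulrN; congr (_ - _).
      rewrite /hw walk_end_scale mxE mulrA mulfV ?mul1r ?pnatr_eq0//.
      rewrite /walk_end !summxE rmorph_sum/=; apply: eq_bigr => t _.
      by rewrite /step_end; case: ifP => _; rewrite !mxE ?rmorphN rmorph_nat.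
    by rewrite subr_eq -intrD; exact: off.
have lim : (\sum_(cp <- WL) cp.1 *
    \int[torus d]_x (rho0 x * (n%:R * (S j cp (x - hw cp.2) - S j cp x)))) @[j --> \oo] -->
    \sum_(cp <- WL) cp.1 * L cp.
  apply: cvg_big => [|cp _]; first exact: add_continuous.
  by apply: cvgM; [exact: cvg_cst|exact: Slim].
rewrite -(cvg_lim _ lim)//; apply: limr_le; first exact: cvgP lim.
apply: nearW => j; apply: smooth_dual_bound => [cp|cp x].
  by split; [exact: smooth_softmax|exact: periodic_softmax].
exact: norm_softmax.
Qed.

End cell_averages.

(** * Choice of the discretisation parameters *)

Section scheme.
Context {R : realType} {d : nat}.
Variables (al M V T : R) (rho0 : 'rV[R]_d -> R).

(** All that later steps use of the discrete solution, for a tolerance e; j bounds the grid from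
    below. [sw] is the discrete div z and the [ssg] are the soft signs that make up z. The
    regularisation of the sign and the penalty of the entropy no longer appear. *)
Record scheme (e : R) (j : nat) : Type := Scheme {
  sp : nat;
  sK : nat;
  sL : nat;
  sWL : seq (R * seq ('I_d * bool));
  srho : nat -> 'rV['I_sp.+1]_d -> R;
  sw : nat -> 'rV['I_sp.+1]_d -> R;
  ssg : nat -> R * seq ('I_d * bool) -> 'rV['I_sp.+1]_d -> R;
  smob : nat -> 'I_d -> 'rV['I_sp.+1]_d -> R;
  sK_gt0 : (0 < sK)%N;
  sL_gt0 : (0 < sL)%N;
  sp_large : (j <= sp)%N;
  sp_fine : sp.+1%:R^-1 <= e;
  stau : T / sK%:R <= e;
  sWL_ge0 : forall cp, cp \in sWL -> 0 <= cp.1;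
  sWL_small : (\sum_(cp <- sWL) cp.1 * (size cp.2)%:R ^+ 2) / sp.+1%:R <= e;
  sWL_iso : forall nu : 'rV[R]_d,
     \sum_(cp <- sWL) cp.1 * `|walk_end (fun i => nu 0 i) cp.2| <= (1 + e) * enorm nu;
  srho_0 : srho 0%N = cell_avg rho0;
  srho_step : forall k phi, avg (fun x => (srho k.+1 x - srho k x) * phi x) =
     T / sK%:R * \sum_i avg (fun x => smob k i x *
       (sp.+1%:R * dif (unit_shift sp i) (sw k) x) *
       (sp.+1%:R * dif (unit_shift sp i) phi x));
  srho_close : forall k x, `|srho k.+1 x - srho k x| <= e;
  ssg_le1 : forall k cp x, `|ssg k cp x| <= 1;
  sw_parts : forall k phi, avg (fun x => sw k x * phi x) =
     - \sum_(cp <- sWL) cp.1 * avg (fun x => ssg k cp x *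
         (sp.+1%:R * dif (walk_end (unit_shift sp) cp.2) phi x));
  smob_itv : forall k i x, al <= smob k i x <= M;
  smob_close : forall k i, (k <= sK)%N ->
    avg (fun x => `|smob k i x - clip al M (srho k x)|) <= e ^+ 2;
  srho_tv : forall k, (k <= sK)%N ->
    nltv (weights (unit_shift sp) sWL sp.+1%:R) (srho k) <= (1 + e) * V + e;
  srho_curv : forall k,
    nltv (weights (unit_shift sp) sWL sp.+1%:R) (srho k) - e <=
    - avg (fun x => sw k x * srho k x);
  srho_clip : forall k, (k <= sK)%N ->
    avg (fun x => (srho k x - clip al M (srho k x)) ^+ 2) <= e ^+ 2;
  srho_smoothen : forall k, (k <= sK)%N ->
    avg (fun x => `|smoothen (unit_shift sp) sL (srho k) x - srho k x|) <= e;
  srho_grad : forall k, (k <= sK)%N -> (1 - e) *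
    avg (fun x => sp.+1%:R * enorm (\row_i dif (unit_shift sp i)
       (smoothen (unit_shift sp) sL (srho k)) x)) <=
    nltv (weights (unit_shift sp) sWL sp.+1%:R) (srho k) + e;
  sdissip : T / sK%:R * \sum_(k < sK) \sum_i
     avg (fun x => (sp.+1%:R * dif (unit_shift sp i) (sw k) x) ^+ 2) <= (2 * V + 2) / al }.

Lemma entropy_ge (lam s : R) : 0 < al -> al <= M ->
  lam / 2 * (s - clip al M s) ^+ 2 <= entropy al M lam s.
Proof.
move=> al0 alM; rewrite (sub_clip al0 alM (lexx 0)) /entropy.
have := sqr_ge0 s.
by case: (cut3 al0 alM (lexx 0) s) => -[_ _ _ -> ->]; lra.
Qed.

Lemma avg_norm_le_sqr {G : finZmodType} (f : G -> R) (e : R) : 0 < e ->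
  avg (fun x => f x ^+ 2) <= e ^+ 2 -> avg (fun x => `|f x|) <= e.
Proof.
move=> e0 h; apply: (@le_trans _ _ (avg (fun x => (2 * e)^-1 * f x ^+ 2 + e / 2))).
  apply: le_avg => x; rewrite -[f x ^+ 2]real_normK ?num_real//.
  have : 0 <= (2 * e)^-1 * (`|f x| - e) ^+ 2 by rewrite mulr_ge0 ?sqr_ge0// invr_ge0 mulr_ge0// ltW.
  have -> : (2 * e)^-1 * (`|f x| - e) ^+ 2 = (2 * e)^-1 * `|f x| ^+ 2 + e / 2 - `|f x|.
    by field; rewrite lt0r_neq0.
  by rewrite subr_ge0.
rewrite avgD avg_cst avgZ.
have : (2 * e)^-1 * avg (fun x => f x ^+ 2) <= (2 * e)^-1 * e ^+ 2.
  by rewrite ler_wpM2l// invr_ge0 mulr_ge0// ltW.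
have -> : (2 * e)^-1 * e ^+ 2 = e / 2 by field; rewrite lt0r_neq0.
lra.
Qed.

Lemma avg_le_cst {G : finZmodType} (f : G -> R) (c : R) : (forall x, f x <= c) -> avg f <= c.
Proof. by move=> h; rewrite -[leRHS](@avg_cst R G); exact: le_avg. Qed.

Lemma large_nat (a : R) : exists n : nat, forall m, (n <= m)%N -> a <= m%:R.
Proof.
exists (Num.truncn a).+1 => m nm; apply/ltW/(lt_le_trans (truncnS_gt a)).
by rewrite ler_nat.
Qed.

Hypotheses (d_gt0 : (0 < d)%N) (al_gt0 : 0 < al) (al_le_M : al <= M) (V_ge0 : 0 <= V)
  (T_gt0 : 0 < T) (mrho0 : measurable_fun setT rho0) (rho0_itv : forall x, al <= rho0 x <= M)
  (HV : forall zeta : 'rV[R]_d -> 'rV[R]_d, torus_test_field zeta ->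
     (forall x, enorm (zeta x) <= 1) -> \int[torus d]_x (- rho0 x * diverg zeta x) <= V).

Lemma bm_rho0 : bm setT rho0.
Proof.
split=> //; exists M => x _; have /andP[h1 h2] := rho0_itv x.
by rewrite ger0_norm// (le_trans _ h1)// ltW.
Qed.

Lemma cell_avg_itv p (g : 'rV['I_p.+1]_d) : al <= cell_avg rho0 g <= M.
Proof.
have c0 : 0 < #|{: 'rV['I_p.+1]_d}|%:R :> R by exact: cardR_gt0.
have bc : bm setT (fun x : 'rV[R]_d => ((cell p x == g)%:R : R)).
  exact: (bm_cell (fun h => (h == g)%:R)).
have e : \int[torus d]_x (cell p x == g)%:R = #|{: 'rV['I_p.+1]_d}|%:R^-1 :> R.
  have -> : \int[torus d]_x ((cell p x == g)%:R : R) = avg (fun h => (h == g)%:R).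
    exact: (Rintegral_cell (fun h => (h == g)%:R)).
  rewrite /avg (bigD1 g)//= eqxx big1 ?addr0 ?mul1r//.
  by move=> h /negbTE ->.
have h (a : R) : #|{: 'rV['I_p.+1]_d}|%:R * \int[torus d]_x (a * (cell p x == g)%:R) = a.
  rewrite RintegralZl//; last exact: torus_integrable.
  by rewrite e mulrCA mulfV ?mulr1// gt_eqF.
have bM (a : R) : (torus d).-integrable setT
    (EFin \o (fun x : 'rV[R]_d => a * (cell p x == g)%:R)).
  by apply: torus_integrable; exact: bmZ.
have bR : (torus d).-integrable setT
    (EFin \o (fun x : 'rV[R]_d => rho0 x * (cell p x == g)%:R)).
  by apply: torus_integrable; exact: bmM bm_rho0 _.
apply/andP; split.
  rewrite -(h al) ler_wpM2l ?(ltW c0)//; apply: le_Rintegral => // x _.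
  by rewrite ler_wpM2r//; have /andP[] := rho0_itv x.
rewrite -(h M) ler_wpM2l ?(ltW c0)//; apply: le_Rintegral => // x _.
by rewrite ler_wpM2r//; have /andP[] := rho0_itv x.
Qed.

(** The order of the choices matters. The weights depend on e alone, the smoothing length delta on e
    and [beta], the mesh on all of these; then come the penalty lam, the regularisation eps, small
    against the total weight and the entropy production on this grid, and at last the time step. *)
Lemma scheme_exists (e : R) (j : nat) : 0 < e -> e <= 2^-1 -> inhabited (scheme e j).
Proof.
move=> e0 e1.
have al0 := al_gt0; have aM := al_le_M; have V0 := V_ge0; have T0 := T_gt0.
have M0 : 0 < M by exact: lt_le_trans aM.
have he2 : e / 2 <= e by lra.
have [WL [beta [b0 WL0 Wbeta iso]]] := isotropic_weights d_gt0 e0.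
pose kap := \sum_(cp <- WL) cp.1 * (size cp.2)%:R ^+ 2.
have kap0 : 0 <= kap.
  by rewrite /kap big_seq; apply: sumr_ge0 => cp cpW; rewrite mulr_ge0 ?sqr_ge0 ?WL0.
pose V1 := 2 * V + 1.
have V10 : 0 < V1 by rewrite /V1; lra.
have dR : 0 < d%:R :> R by rewrite ltr0n.
(* The fraction L / n of the torus over which densities are smoothed: in the mean this moves them by
   at most 2 d delta V1 / beta = e. *)
pose delta := e * beta / (2 * d%:R * V1).
have del0 : 0 < delta by rewrite divr_gt0 ?mulr_gt0.
(* The summands ensure in turn: mesh width at most e; L positive and at least delta n / 2; small
   Taylor errors along the walks; mobility within e^2 of the clipped density in the mean; small
   second differences after smoothing. *)
have [n1 hn1] := large_nat (e^-1 + 2 / delta + kap / e + V1 / beta / e ^+ 2 +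
   16 * kap * (M + 1) / (delta ^+ 2 * e)).
pose p := (n1 + j)%N; pose n := p.+1.
have n0 : 0 < n%:R :> R by rewrite ltr0n.
have big_n := hn1 n (leq_trans (leq_addr j n1) (leqnSn _)).
have t1 : 0 <= e^-1 by rewrite invr_ge0 ltW.
have t2 : 0 <= 2 / delta by rewrite divr_ge0// ltW.
have t3 : 0 <= kap / e by rewrite divr_ge0// ltW.
have t4 : 0 <= V1 / beta / e ^+ 2 by rewrite !divr_ge0 ?exprn_ge0// ltW.
have t5 : 0 <= 16 * kap * (M + 1) / (delta ^+ 2 * e).
  have M1 : 0 <= M + 1 by lra.
  by rewrite divr_ge0// mulr_ge0 ?sqr_ge0 ?mulr_ge0// ltW.
have n_1 : e^-1 <= n%:R by lra.
have n_2 : 2 / delta <= n%:R by lra.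
have n_3 : kap / e <= n%:R by lra.
have n_4 : V1 / beta / e ^+ 2 <= n%:R by lra.
have n_5 : 16 * kap * (M + 1) / (delta ^+ 2 * e) <= n%:R by lra.
pose L := Num.truncn (delta * n%:R).
have dn2 : 2 <= delta * n%:R by rewrite mulrC -ler_pdivrMr.
have /andP[L1 L2] : L%:R <= delta * n%:R < L.+1%:R by apply: truncn_itv; rewrite mulr_ge0// ltW.
rewrite -natr1 in L2.
have LR : delta * n%:R / 2 <= L%:R by lra.
have L0 : (0 < L)%N by rewrite -(ltr_nat R); lra.
pose es := unit_shift p : 'I_d -> 'rV['I_p.+1]_d.
pose W := weights es WL n%:R.
have W0 : forall v, v \in W -> 0 <= v.1 by exact: weights_ge0.
pose Wt := weight W.
have Wt0 : 0 <= Wt by exact: weight_ge0.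
pose lam := (M ^+ 2 + 2) / e ^+ 2.
have lam0 : 0 < lam by rewrite divr_gt0 ?exprn_gt0// ltr_wpDl ?sqr_ge0.
pose n2 : R := n%:R ^+ 2.
have n20 : 0 <= n2 by exact: sqr_ge0.
pose A := T * (n2 * (d%:R * (2 * (Wt * (M * (1 + lam)))))).
have A0 : 0 <= A by rewrite !mulr_ge0 ?addr_ge0// ltW.
(* Makes both [Wt * eps], the defect of the soft sign, and [A * eps], the coarea defect accumulated
   up to time T, at most e / 2. *)
pose eps := e / (2 * (Wt + A + 1)).
have eps0 : 0 < eps by rewrite divr_gt0// mulr_gt0// !(ltr_wpDl, addr_ge0).
have epsE : eps * (Wt + A + 1) = e / 2.
  by rewrite /eps; field; rewrite gt_eqF// !(ltr_wpDl, addr_ge0).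
have We : Wt * eps <= e / 2.
  have : 0 <= eps * A by rewrite mulr_ge0// ltW.
  by move: eps0; rewrite -epsE; clear; lra.
have Ae : A * eps <= e / 2.
  have : 0 <= eps * Wt by rewrite mulr_ge0// ltW.
  by move: eps0; rewrite -epsE; clear; lra.
clearbody eps => {epsE}.
have epsW := ltW eps0; have lamW := ltW lam0; have MW := ltW M0; have TW := ltW T0.
pose rm := rmax W (d := d) n2 M.
have rm0 : 0 <= rm by rewrite /rm /rmax !mulr_ge0// ltW.
(* The sum of all quantities that get multiplied by [tau]: 1 for [tau] itself, the rate, and the
   second-order terms of entropy and energy up to time T. *)
pose B := 1 + rm + T * ((1 + lam) / 2 * rm ^+ 2) + T * (Wt * ((2 * rm) ^+ 2 / eps)).
have B1 : 0 <= T * ((1 + lam) / 2 * rm ^+ 2).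
  by rewrite !mulr_ge0 ?sqr_ge0 ?addr_ge0 ?invr_ge0// ltW.
have B2 : 0 <= T * (Wt * ((2 * rm) ^+ 2 / eps)).
  by rewrite !mulr_ge0 ?sqr_ge0 ?invr_ge0// ltW.
have B0 : 0 < B by rewrite /B; move: rm0 B1 B2; clear; lra.
have [K1 hK] := large_nat (2 * T * B / e).
pose K := K1.+1.
have K0 : 0 < K%:R :> R by rewrite ltr0n.
pose tau := T / K%:R.
have tau0 : 0 < tau by rewrite divr_gt0.
have tauB : tau * B <= e / 2.
  have := hK K (leqnSn _); rewrite ler_pdivrMr// => h.
  rewrite /tau mulrAC ler_pdivrMr//; move: h; clear; lra.
have tau_b (b : R) : 0 <= b -> b <= B -> tau * b <= e / 2.
  by move=> b0' bB; apply: le_trans tauB; rewrite ler_wpM2l// ltW.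
have tauk k : (k <= K)%N -> k%:R * tau <= T.
  move=> kK; have -> : T = K%:R * tau by rewrite /tau mulrCA mulfV ?mulr1// gt_eqF.
  by rewrite ler_wpM2r ?ler_nat// ltW.
pose r0 : 'rV['I_p.+1]_d -> R := cell_avg rho0.
pose rho k := iter k (euler W es n2 tau eps al M lam) r0.
have tv0 : nltv W r0 <= (1 + e) * V.
  have h := @nltv_cell_avg R d p rho0 V bm_rho0 HV WL e WL0 (ltW e0).
  by apply: h => nu; have /andP[] := iso nu.
have dis0 f : 0 <= dissip W es n2 eps al M lam f.
  rewrite /dissip mulr_ge0// sumr_ge0// => i _; apply: avg_ge0 => x.
  rewrite mulr_ge0 ?sqr_ge0//.
  have /andP[h _] := mob_itv al0 aM (ltW lam0) (f x) (f (x + es i)).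
  by rewrite (le_trans _ h)// ltW.
have en k : (k <= K)%N -> energy W eps (rho k) +
    tau * \sum_(l < k) dissip W es n2 eps al M lam (rho l) <= (1 + e) * V + e / 2.
  move=> kK; have := energy_iter es W0 eps0 al0 aM (ltW lam0) n20 (ltW tau0) r0 k.
  have h1 := energy_le W0 eps0 r0.
  have h2 : k%:R * tau * (tau * (Wt * ((2 * rm) ^+ 2 / eps))) <= e / 2.
    apply: (@le_trans _ _ (T * (tau * (Wt * ((2 * rm) ^+ 2 / eps))))).
      rewrite ler_wpM2r ?tauk// !mulr_ge0 ?sqr_ge0 ?invr_ge0// ltW//.
    by rewrite mulrCA; apply: tau_b => //; rewrite /B; move: rm0 B1; clear; lra.
  rewrite -/rm -/Wt; move: h1 h2 tv0; rewrite /rho; clear; lra.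
have tv k : (k <= K)%N -> nltv W (rho k) <= (1 + e) * V + e.
  move=> kK; have h1 := energy_ge W0 eps0 (rho k); have h2 := en k kK.
  have h3 : 0 <= tau * \sum_(l < k) dissip W es n2 eps al M lam (rho l).
    by rewrite mulr_ge0 ?(ltW tau0)//; apply: sumr_ge0.
  move: h1 h2 h3 We e0; rewrite -/Wt; clear; lra.
have tvV1 k : (k <= K)%N -> nltv W (rho k) <= V1.
  move=> /tv h; apply: le_trans h _; rewrite /V1.
  have : e * V <= 2^-1 * V by rewrite ler_wpM2r.
  lra.
have dif1 k i : (k <= K)%N -> avg (fun x => `|dif (es i) (rho k) x|) <= V1 / (beta * n%:R).
  move=> kK; rewrite ler_pdivlMr ?mulr_gt0//; apply: le_trans (tvV1 k kK).
  rewrite nltv_weightsE; have h := Wbeta (fun q => avg (fun x => `|dif (walk_end es q) (rho k) x|)) i.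
  have -> : avg (fun x => `|dif (es i) (rho k) x|) * (beta * n%:R) =
     n%:R * (beta * avg (fun x => `|dif (es i) (rho k) x|)) by ring.
  rewrite ler_wpM2l ?(ltW n0)//.
  have e' : walk_end es [:: (i, true)] = es i by rewrite walk_end_cons walk_end0 addr0.
  by have := h (fun q => avg_ge0 (fun x => normr_ge0 _)); rewrite e'.
have clp k : (k <= K)%N -> avg (fun x => (rho k x - clip al M (rho k x)) ^+ 2) <= e ^+ 2.
  move=> kK.
  have h1 := entropy_iter es W0 eps0 al0 aM (ltW lam0) n20 (ltW tau0) r0 k.
  have h2 : avg (fun x => entropy al M lam (r0 x)) <= M ^+ 2 / 2.
    apply: avg_le_cst => x.
    have /andP[a1 a2] := cell_avg_itv x.
    rewrite entropy_itv ?a1// ler_wpM2r//.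
    by rewrite ler_pXn2r ?nnegrE ?(ltW M0)// (le_trans _ a1)// ltW.
  have h3 : lam / 2 * avg (fun x => (rho k x - clip al M (rho k x)) ^+ 2) <=
      avg (fun x => entropy al M lam (rho k x)).
    by rewrite -avgZ; apply: le_avg => x; exact: entropy_ge.
  have h4 : k%:R * tau * (n2 * (d%:R * (2 * (Wt * (M * (1 + lam) * eps)))) +
                tau * ((1 + lam) / 2 * rm ^+ 2)) <= 1.
    apply: (@le_trans _ _ (T * (n2 * (d%:R * (2 * (Wt * (M * (1 + lam) * eps)))) +
                tau * ((1 + lam) / 2 * rm ^+ 2)))).
      by rewrite ler_wpM2r ?tauk// addr_ge0// !mulr_ge0 ?addr_ge0 ?sqr_ge0 ?invr_ge0// ltW.
    have -> : T * (n2 * (d%:R * (2 * (Wt * (M * (1 + lam) * eps)))) +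
        tau * ((1 + lam) / 2 * rm ^+ 2)) = A * eps + tau * (T * ((1 + lam) / 2 * rm ^+ 2)).
      by rewrite /A; ring.
    have : tau * (T * ((1 + lam) / 2 * rm ^+ 2)) <= e / 2 by apply: tau_b => //; rewrite /B; move: rm0 B2; clear; lra.
    move: Ae e1; clear; lra.
  have h5 : lam / 2 * avg (fun x => (rho k x - clip al M (rho k x)) ^+ 2) <= lam / 2 * e ^+ 2.
    have -> : lam / 2 * e ^+ 2 = M ^+ 2 / 2 + 1.
      by rewrite /lam; field; rewrite gt_eqF.
    move: h1 h2 h3 h4; rewrite -/rm -/Wt -/(rho k); clear; lra.
  by move: h5; rewrite ler_pM2l// divr_gt0.
have mobc k i : (k <= K)%N ->
    avg (fun x => `|mobility es al M lam (rho k) i x - clip al M (rho k x)|) <= e ^+ 2.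
  move=> kK; apply: (@le_trans _ _ (avg (fun x => `|dif (es i) (rho k) x|))).
    apply: le_avg => x; apply: le_trans (mob_close al0 aM (ltW lam0) _ _) _.
    exact: clip_lip.
  apply: le_trans (dif1 k i kK) _.
  by rewrite invfM mulrA ler_pdivrMr// -ler_pdivrMl ?exprn_gt0// mulrC.
have smo k : (k <= K)%N -> avg (fun x => `|smoothen es L (rho k) x - rho k x|) <= e.
  move=> kK; apply: le_trans (avg_smoothen_sub _ L0 _) _.
  have h : \sum_i avg (fun x => `|dif (es i) (rho k) x|) <= d%:R * (V1 / (beta * n%:R)).
    rewrite -[X in X%:R * _]card_ord mulr_natl -sumr_const; apply: ler_sum => i _; exact: dif1.
  apply: (@le_trans _ _ (2 * (delta * n%:R) * (d%:R * (V1 / (beta * n%:R))))).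
    apply: ler_pM; [by rewrite mulr_ge0|by apply: sumr_ge0 => i _; exact: avg_ge0| |exact: h].
    by rewrite ler_wpM2l.
  rewrite le_eqVlt; apply/orP; left; apply/eqP; rewrite /delta.
  by field; rewrite !gt_eqF.
have grd k : (k <= K)%N -> (1 - e) *
    avg (fun x => n%:R * enorm (\row_i dif (es i) (smoothen es L (rho k)) x)) <=
    nltv W (rho k) + e.
  move=> kK.
  have gs := @grad_smoothen R _ d es WL n%:R L WL0 n0 L0 (rho k) e (fun nu => proj1 (andP (iso nu))).
  apply: le_trans gs _.
  rewrite -/kap lerD2l.
  have av : avg (fun x => `|rho k x|) <= M + 1.
    apply: (@le_trans _ _ (avg (fun x => M + `|rho k x - clip al M (rho k x)|))).
      apply: le_avg => x; have /andP[c1 c2] := clip_itv al0 aM (ltW lam0) (rho k x).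
      rewrite -[X in `|X| <= _](subrK (clip al M (rho k x))) addrC.
      apply: le_trans (ler_normD _ _) _; rewrite lerD2r.
      by rewrite ger0_norm// (le_trans _ c1)// ltW.
    rewrite avgD avg_cst lerD2l; apply: le_trans (avg_norm_le_sqr e0 (clp k kK)) _.
    by apply: le_trans e1 _; rewrite invf_le1// ler1n.
  apply: (@le_trans _ _ (n%:R * kap * ((2 / (delta * n%:R / 2)) ^+ 2 * (M + 1)))).
    rewrite ler_wpM2l ?mulr_ge0 ?(ltW n0)//.
    apply: ler_pM; [exact: sqr_ge0|exact: avg_ge0| |exact: av].
    have LR0 : 0 < L%:R :> R by rewrite ltr0n.
    have dn0 : 0 < delta * n%:R / 2 by rewrite divr_gt0// (lt_le_trans _ dn2).
    have i1 : 0 <= 2 / L%:R :> R by rewrite divr_ge0// ltW.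
    have i2 : 0 <= 2 / (delta * n%:R / 2) by rewrite divr_ge0// ltW.
    by rewrite ler_pXn2r ?nnegrE// ler_wpM2l// lef_pV2 ?posrE.
  have -> : n%:R * kap * ((2 / (delta * n%:R / 2)) ^+ 2 * (M + 1)) =
      (16 * kap * (M + 1) / (delta ^+ 2 * e)) * e / n%:R.
    by field; rewrite !gt_eqF.
  by rewrite ler_pdivrMr// mulrC ler_wpM2l// ltW.
constructor; apply: (@Scheme e j p K L WL rho (fun k => curv W eps (rho k))
  (fun k cp x => ssgn eps (dif (walk_end es cp.2) (rho k) x))
  (fun k => mobility es al M lam (rho k))) => //.
- exact: leq_addl.
- by rewrite -(invrK e) lef_pV2 ?posrE// invr_gt0.
- have := tau_b 1 ler01; rewrite mulr1 -/tau => h.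
  have h' : tau <= e / 2 by apply: h; rewrite /B; move: rm0 B1 B2; clear; lra.
  exact: le_trans h' he2.
- by rewrite ler_pdivrMr// mulrC -ler_pdivrMr.
- by move=> nu; have /andP[] := iso nu.
- move=> k phi; rewrite -/n -/tau.
  rewrite (eq_avg (g := fun x => tau * (rate W es n2 eps al M lam (rho k) x * phi x))); last first.
    by move=> x; rewrite /rho iterS {1}/euler addrAC subrr add0r mulrA.
  rewrite avgZ avg_rate mulr_sumr; congr (_ * _); apply: eq_bigr => i _.
  by rewrite -avgZ; apply: eq_avg => x; rewrite /n2; ring.
- move=> k x; rewrite /rho iterS {1}/euler addrAC subrr add0r normrM ger0_norm ?(ltW tau0)//.
  apply: (@le_trans _ _ (tau * rm)).
    rewrite ler_wpM2l ?(ltW tau0)//; exact: norm_rate.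
  have h : tau * rm <= e / 2 by apply: tau_b => //; rewrite /B; move: B1 B2; clear; lra.
  exact: le_trans h he2.
- by move=> k cp x; exact: norm_ssgn.
- move=> k phi; rewrite avg_curv /W /weights big_map; congr (- _); apply: eq_bigr => cp _ /=.
  by rewrite [n%:R * _]mulrC -mulrA -avgZ; congr (_ * _); apply: eq_avg => x; rewrite mulrCA.
- by move=> k i x; exact: mob_itv al0 aM (ltW lam0) _ _.
- move=> k; apply: le_trans (curv_ge W0 eps0 (rho k)).
  by rewrite lerD2l lerN2 -/Wt (le_trans We).
(* The mobility is at least al, so that the dissipation controls al times the squared gradients; the
   dissipation is bounded by the initial energy, and e <= 1 / 2. *)
- have h1 := en K (leqnn _); have h2 := energy_ge W0 eps0 (rho K).
  have h3 : 0 <= nltv W (rho K).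
    by rewrite /nltv big_seq; apply: sumr_ge0 => v vW; rewrite mulr_ge0 ?W0 ?avg_ge0.
  have h4 : e * V <= 2^-1 * V by rewrite ler_wpM2r.
  have h5 : tau * \sum_(l < K) dissip W es n2 eps al M lam (rho l) <= 2 * V + 2.
    move: h1 h2 h3 h4 We; rewrite -/Wt; lra.
  rewrite -/n -/tau ler_pdivlMr//; apply: le_trans h5; rewrite mulrC mulrCA ler_wpM2l ?(ltW tau0)//.
  rewrite mulr_sumr; apply: ler_sum => k _; rewrite /dissip !mulr_sumr; apply: ler_sum => i _.
  rewrite -!avgZ; apply: le_avg => x; rewrite exprMn -/n2 mulrCA ler_wpM2l// ler_wpM2r ?sqr_ge0//.
  by have /andP[] := mob_itv al0 aM (ltW lam0) (rho k x) (rho k (x + es i)).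
Unshelve. all: exact: (cell_avg rho0).
Qed.

End scheme.

(** * The discrete solution as a function on space-time *)

Arguments srho {R d al M V T rho0 e j} s.
Arguments sw {R d al M V T rho0 e j} s.
Arguments ssg {R d al M V T rho0 e j} s.
Arguments smob {R d al M V T rho0 e j} s.
Arguments sp_large {R d al M V T rho0 e j} s.
Arguments sp_fine {R d al M V T rho0 e j} s.
Arguments stau {R d al M V T rho0 e j} s.
Arguments sWL_ge0 {R d al M V T rho0 e j} s.
Arguments sWL_small {R d al M V T rho0 e j} s.
Arguments sWL_iso {R d al M V T rho0 e j} s.
Arguments srho_0 {R d al M V T rho0 e j} s.
Arguments srho_step {R d al M V T rho0 e j} s.
Arguments srho_close {R d al M V T rho0 e j} s.
Arguments ssg_le1 {R d al M V T rho0 e j} s.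
Arguments sw_parts {R d al M V T rho0 e j} s.
Arguments smob_itv {R d al M V T rho0 e j} s.
Arguments smob_close {R d al M V T rho0 e j} s.
Arguments srho_tv {R d al M V T rho0 e j} s.
Arguments srho_curv {R d al M V T rho0 e j} s.
Arguments srho_clip {R d al M V T rho0 e j} s.
Arguments srho_smoothen {R d al M V T rho0 e j} s.
Arguments srho_grad {R d al M V T rho0 e j} s.
Arguments sdissip {R d al M V T rho0 e j} s.
Arguments sK_gt0 {R d al M V T rho0 e j} s.
Arguments sL_gt0 {R d al M V T rho0 e j} s.

Section lipschitz_cells.
Context {R : realType} {d : nat} (p : nat).
Local Notation n := p.+1.
Local Notation G := 'rV['I_p.+1]_d.
Implicit Types phi : 'rV[R]_d -> R.

Let n0 : 0 < n%:R :> R. Proof. by rewrite ltr0n. Qed.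

Lemma lip_node phi (B : R) x : Defs.periodic phi -> 0 <= B ->
  (forall x y, `|phi (x + y) - phi x| <= B * \sum_i `|y 0 i|) ->
  `|phi x - phi (node (cell p x))| <= B * (d%:R / n%:R).
Proof.
move=> pphi B0 lip; have [y [hy xy]] := nodeP p x.
rewrite -(periodic_congr pphi hy).
have -> : phi x = phi (y + (x - y)) by rewrite addrC subrK.
apply: le_trans (lip _ _) _; rewrite ler_wpM2l//.
rewrite -[X in X%:R / _]card_ord mulr_natl -sumr_const; apply: ler_sum => i _.
by rewrite !mxE; exact: ltW (xy i).
Qed.

Lemma int_cell_test (f : G -> R) phi (B : R) : Defs.periodic phi -> continuous phi -> 0 <= B ->
  (forall x y, `|phi (x + y) - phi x| <= B * \sum_i `|y 0 i|) ->
  `|\int[torus d]_x (f (cell p x) * phi x) - avg (fun g => f g * phi (node g))| <=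
  B * (d%:R / n%:R) * avg (fun g => `|f g|).
Proof.
move=> pphi cphi B0 lip; rewrite -!Rintegral_cell.
have b1 : bm setT (fun x : 'rV[R]_d => f (cell p x)) by exact: bm_cell.
have b2 : bm setT phi by exact: bm_periodic.
have b3 : bm setT (fun x : 'rV[R]_d => f (cell p x) * phi (node (cell p x))).
  exact: (bm_cell (fun g => f g * phi (node g))).
rewrite -RintegralB//; first last.
- exact: torus_integrable.
- by apply: torus_integrable; exact: bmM.
rewrite -RintegralZl//; last first.
  by apply: torus_integrable; exact: (bm_cell (fun g => `|f g|)).
apply: le_norm_Rintegral => //.
- by apply: torus_integrable; apply: bmB => //; exact: bmM.
- by apply: torus_integrable; apply: bmZ; exact: (bm_cell (fun g => `|f g|)).
move=> x _; rewrite -mulrBr normrM mulrC ler_wpM2r//; exact: lip_node.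
Qed.

Lemma node_dif phi (B : R) w g : Defs.periodic phi -> test_bound phi B ->
  `|n%:R * dif (walk_end (unit_shift p) w) (phi \o node (p := p)) g -
    walk_end (fun i => 'D_(unitv i) phi (node g)) w| <= B * (size w)%:R ^+ 2 / n%:R.
Proof.
move=> pphi [B0 _ _ _ tB].
rewrite /dif /= (periodic_congr pphi (node_walk g w)).
have := tB (node g) w n%:R^-1; 
set D := walk_end (fun i => 'D_(unitv i) phi (node g)) w; set a := phi (_ + _) => h.
have -> : n%:R * (a - phi (node g)) - D = n%:R * (a - phi (node g) - n%:R^-1 * D).
  by field; rewrite gt_eqF.
rewrite normrM ger0_norm ?(ltW n0)//.
have -> : B * (size w)%:R ^+ 2 / n%:R = n%:R * (B * (n%:R^-1 * (size w)%:R) ^+ 2).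
  by field; rewrite gt_eqF.
by rewrite ler_wpM2l// ltW.
Qed.

End lipschitz_cells.

Section step_functions.
Context {R : realType} {d : nat}.
Variables (al M V T e : R) (rho0 : 'rV[R]_d -> R) (j : nat).
Variable S : scheme al M V T rho0 e j.
Hypotheses (d_gt0 : (0 < d)%N) (al_gt0 : 0 < al) (al_le_M : al <= M) (V_ge0 : 0 <= V)
  (T_gt0 : 0 < T) (brho0 : bm setT rho0) (e_gt0 : 0 < e) (e_le : e <= 2^-1).

Local Notation n := (sp S).+1.
Local Notation K := (sK S).
Local Notation G := 'rV['I_(sp S).+1]_d.
Local Notation es := (unit_shift (sp S)).

Definition sgrad k i (x : G) : R := n%:R * dif (es i) (sw S k) x.

(** Each soft sign is carried by the vector of its walk. To first order in the mesh width a
    difference along a walk is the derivative along this vector, so the divergence of this field is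
    [sw] up to Taylor remainders. *)
Definition sfield k (x : G) : 'rV[R]_d :=
  \sum_(cp <- sWL S) (cp.1 * ssg S k cp x) *: walk_end (fun i => unitv i) cp.2.

Definition sclip k (x : G) : R := clip al M (srho S k x).

(** The summand 1 lets the energy dominate constants and L1 norms as well, so that the errors of a
    time level take the form constant * e * energy. What is bounded is the sum over time, see
    [sum_senergy]. *)
Definition senergy k : R :=
  1 + avg (fun x => sw S k x ^+ 2) + \sum_i avg (fun x => sgrad k i x ^+ 2).

Let n0 : 0 < n%:R :> R. Proof. by rewrite ltr0n. Qed.

Lemma avg_sqr_ge0 (f : G -> R) : 0 <= avg (fun x => f x ^+ 2).
Proof. by apply: avg_ge0 => x; exact: sqr_ge0. Qed.

Lemma senergy_ge1 k : 1 <= senergy k.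
Proof. by rewrite /senergy -addrA lerDl addr_ge0 ?avg_sqr_ge0// sumr_ge0// => i _; exact: avg_sqr_ge0. Qed.

Lemma avg_norm_le1 (f : G -> R) : avg (fun x => `|f x|) <= 1 + avg (fun x => f x ^+ 2).
Proof.
rewrite -[X in X + _](@avg_cst R G) -avgD; apply: le_avg => x.
have := sqr_ge0 (`|f x| - 1); have := sqr_ge0 (f x); rewrite sqrrB real_normK ?num_real//.
by rewrite expr1n mulr1; lra.
Qed.

Lemma avg_sw_le k : avg (fun x => `|sw S k x|) <= senergy k.
Proof.
apply: le_trans (avg_norm_le1 _) _; rewrite /senergy lerDl sumr_ge0// => i _.
exact: avg_sqr_ge0.
Qed.

Lemma avg_sgrad_le k i : avg (fun x => `|sgrad k i x|) <= senergy k.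
Proof.
apply: le_trans (avg_norm_le1 _) _; rewrite /senergy (bigD1 i)//=.
have := avg_sqr_ge0 (sw S k).
have : 0 <= \sum_(l | l != i) avg (fun x => sgrad k l x ^+ 2).
  by apply: sumr_ge0 => l _; exact: avg_sqr_ge0.
lra.
Qed.

Lemma sfield_le k x : enorm (sfield k x) <= 1 + e.
Proof.
apply: enorm_comb; [exact: sWL_ge0|by rewrite addr_ge0// ltW|exact: sWL_iso|].
by move=> cp; exact: ssg_le1.
Qed.

Lemma sclip_itv k x : al <= sclip k x <= M.
Proof. exact: (clip_itv al_gt0 al_le_M (lexx 0)). Qed.

Lemma avg_srho_sclip k : (k <= K)%N -> avg (fun x => `|srho S k x - sclip k x|) <= e.
Proof. by move=> kK; apply: avg_norm_le_sqr => //; exact: srho_clip. Qed.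

Lemma avg_srho k : avg (srho S k) = \int[torus d]_x rho0 x.
Proof.
elim: k => [|k <-].
  rewrite srho_0; have := avg_cell_avg brho0 (p := sp S) (fun=> 1).
  rewrite (eq_avg (g := cell_avg rho0)); last by move=> g; rewrite mul1r.
  by move=> ->; apply: eq_Rintegral => x _; rewrite mulr1.
have := srho_step S k (fun=> 1).
rewrite [X in _ * X]big1 ?mulr0.
  by rewrite (eq_avg (g := fun x => srho S k.+1 x - srho S k x)) ?avgB => [/eqP|x]; rewrite ?subr_eq0 ?mulr1// => /eqP.
move=> i _; rewrite -[RHS](@avg_cst R G); apply: eq_avg => x.
by rewrite {2}/dif subrr !mulr0.
Qed.

Lemma step_mass k : (k <= K)%N -> `|avg (sclip k) - \int[torus d]_x rho0 x| <= e.
Proof.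
move=> kK; rewrite -(avg_srho k) -avgB; apply: le_trans (le_norm_avg _) _.
apply: le_trans (avg_srho_sclip kK); apply: le_avg => x; by rewrite distrC.
Qed.

Lemma avg_sw k : avg (sw S k) = 0.
Proof.
have := sw_parts S k (fun=> 1).
rewrite (eq_avg (g := sw S k)) => [->|x]; last by rewrite mulr1.
rewrite big1 ?oppr0// => cp _; rewrite (eq_avg (g := fun=> 0)) ?avg_cst ?mulr0// => x.
by rewrite /dif subrr !mulr0.
Qed.

Lemma sw_poincare k : avg (fun x => sw S k x ^+ 2) <= d%:R * \sum_i avg (fun x => sgrad k i x ^+ 2).
Proof.
have := @poincare R G d es (sw S k) n (@unit_shift_gen d (sp S)) (avg_sw k).
move=> h; apply: le_trans h _; rewrite ler_wpM2l//; apply: ler_sum => i _.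
by rewrite -avgZ; apply: le_avg => x; rewrite /sgrad exprMn.
Qed.

Lemma sum_senergy : T / K%:R * \sum_(k < K) senergy k <=
  T + (d%:R + 1) * ((2 * V + 2) / al).
Proof.
have K0 : 0 < K%:R :> R by rewrite ltr0n sK_gt0.
have t0 : 0 <= T / K%:R by rewrite divr_ge0// ltW.
apply: (@le_trans _ _ (T / K%:R * \sum_(k < K) (1 + (d%:R + 1) *
   \sum_i avg (fun x => sgrad k i x ^+ 2)))).
  rewrite ler_wpM2l//; apply: ler_sum => k _; rewrite /senergy -addrA lerD2l mulrDl mul1r.
  by rewrite lerD2r sw_poincare.
rewrite big_split/= sumr_const card_ord mulrDr -mulr_sumr -[1 *+ K]mulr_natl mulr1.
rewrite divfK ?gt_eqF// lerD2l mulrCA ler_wpM2l ?addr_ge0//.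
exact: sdissip.
Qed.

Section level.
Variables (k : nat).
Hypothesis kK : (k <= K)%N.

(** Integrals become sums over nodes at the price of a Lipschitz constant times the mesh width. The
    discrete integration by parts [sw_parts] then differs from the claim by the Taylor remainders
    along the walks, which [sWL_small] controls. *)
Lemma step_weak_div phi (B : R) : torus_test phi -> test_bound phi B ->
  `|\int[torus d]_x (dot (sfield k (cell (sp S) x)) (grad phi x)) +
    \int[torus d]_x (sw S k (cell (sp S) x) * phi x)| <=
  (1 + 3 * d%:R ^+ 2) * B * e * senergy k.
Proof.
move=> [sphi pphi] tB; have [B0 _ _ lipB _] := tB.
have E1 := senergy_ge1 k.
have dn : 0 <= d%:R / n%:R :> R by rewrite divr_ge0// ltW.
have ne : d%:R / n%:R <= d%:R * e by rewrite ler_wpM2l// sp_fine.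
have dR1 : 1 <= d%:R :> R by rewrite ler1n.
have cphi : continuous phi by exact: (sphi 0%N).
have cD i : continuous ('D_(unitv i) phi) by exact: ((sphi 1%N).2 (unitv i)).2.
have pD i : Defs.periodic ('D_(unitv i) phi) by exact: periodic_derive.
pose zi i g := sfield k g 0 i.
have zi2 i g : `|zi i g| <= 2.
  apply: le_trans (norm_coord_enorm _ _) _; apply: le_trans (sfield_le _ _) _.
  have := e_le; lra.
have e1 : `|\int[torus d]_x (sw S k (cell (sp S) x) * phi x) -
    avg (fun g => sw S k g * phi (node g))| <= B * (d%:R * e) * senergy k.
  apply: le_trans (int_cell_test _ pphi cphi B0 (fun x y => (lipB x y).1)) _.
  by apply: ler_pM; [rewrite mulr_ge0|exact: avg_ge0|rewrite ler_wpM2l|exact: avg_sw_le].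
have e2 i : `|\int[torus d]_x (zi i (cell (sp S) x) * 'D_(unitv i) phi x) -
    avg (fun g => zi i g * 'D_(unitv i) phi (node g))| <= B * (d%:R * e) * 2.
  apply: le_trans (int_cell_test _ (pD i) (cD i) B0 (fun x y => (lipB x y).2 i)) _.
  by apply: ler_pM; [rewrite mulr_ge0|exact: avg_ge0|rewrite ler_wpM2l|exact: avg_le_cst].
have -> : \int[torus d]_x (dot (sfield k (cell (sp S) x)) (grad phi x)) =
    \sum_i \int[torus d]_x (zi i (cell (sp S) x) * 'D_(unitv i) phi x).
  rewrite -Rintegral_sum//.
    by apply: eq_Rintegral => x _; apply: eq_bigr => i _; rewrite mxE.
  move=> i; apply: torus_integrable; apply: bmM; first exact: (bm_cell (zi i)).
  exact: bm_periodic.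
have e3 : `|avg (fun g => sw S k g * phi (node g)) +
    \sum_i avg (fun g => zi i g * 'D_(unitv i) phi (node g))| <= B * e.
  have -> : \sum_i avg (fun g => zi i g * 'D_(unitv i) phi (node g)) =
      \sum_(cp <- sWL S) cp.1 * avg (fun g => ssg S k cp g *
        walk_end (fun i => 'D_(unitv i) phi (node g)) cp.2).
    rewrite -avg_sum; under [RHS]eq_bigr do rewrite -avgZ.
    rewrite -avg_sum; apply: eq_avg => g.
    rewrite (eq_bigr (fun i => \sum_(cp <- sWL S) cp.1 * (ssg S k cp g *
       (walk_end (fun i => unitv i : 'rV[R]_d) cp.2 0 i * 'D_(unitv i) phi (node g))))).
      rewrite exchange_big; apply: eq_bigr => cp _; rewrite -!mulr_sumr.
      by rewrite [in RHS]walk_end_coord.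
    move=> i _; rewrite /zi /sfield summxE mulr_suml; apply: eq_bigr => cp _.
    by rewrite mxE !mulrA.
  rewrite (sw_parts S k (fun g => phi (node g))) addrC -sumrB.
  apply: le_trans (ler_norm_sum _ _ _) _.
  apply: (@le_trans _ _ (B * ((\sum_(cp <- sWL S) cp.1 * (size cp.2)%:R ^+ 2) / n%:R))); last first.
    by rewrite ler_wpM2l// sWL_small.
  rewrite mulr_suml mulr_sumr big_seq [leRHS]big_seq; apply: ler_sum => cp cpW.
  have c0 := sWL_ge0 S _ cpW.
  rewrite -mulrBr normrM ger0_norm//.
  have -> : B * (cp.1 * (size cp.2)%:R ^+ 2 / n%:R) = cp.1 * (B * (size cp.2)%:R ^+ 2 / n%:R) by ring.
  rewrite ler_wpM2l// -avgB; apply: le_trans (le_norm_avg _) _; apply: avg_le_cst => g.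
  rewrite -mulrBr normrM; apply: (@le_trans _ _ (1 * (B * (size cp.2)%:R ^+ 2 / n%:R))); last by rewrite mul1r.
  apply: ler_pM => //; first exact: ssg_le1.
  rewrite distrC; exact: node_dif.
have e4 : `|\sum_i \int[torus d]_x (zi i (cell (sp S) x) * 'D_(unitv i) phi x) -
    \sum_i avg (fun g => zi i g * 'D_(unitv i) phi (node g))| <= d%:R * (B * (d%:R * e) * 2).
  rewrite -sumrB; apply: le_trans (ler_norm_sum _ _ _) _.
  by rewrite -[X in X%:R * _]card_ord mulr_natl -sumr_const; apply: ler_sum => i _.
move: e1 e3 e4; set X := \int[_]_x _; set Y := avg _; set Z := \sum_i _; set U := \sum_i _.
move=> e1 e3 e4.
have -> : U + X = (U - Z) + (Y + Z) + (X - Y) by ring.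
apply: le_trans (ler_normD _ _) _; apply: le_trans (lerD (ler_normD _ _) (lexx _)) _.
apply: le_trans (lerD (lerD e4 e3) e1) _.
have Be : 0 <= B * e by rewrite mulr_ge0// ltW.
have h1 : d%:R <= d%:R ^+ 2 :> R by rewrite expr2 ler_peMr.
have -> : d%:R * (B * (d%:R * e) * 2) + B * e + B * (d%:R * e) * senergy k =
  (B * e) * (2 * d%:R ^+ 2 + 1 + d%:R * senergy k) by ring.
have -> : (1 + 3 * d%:R ^+ 2) * B * e * senergy k = (B * e) * ((1 + 3 * d%:R ^+ 2) * senergy k) by ring.
rewrite ler_wpM2l//.
have h2 : d%:R * senergy k <= d%:R ^+ 2 * senergy k by rewrite ler_wpM2r// (le_trans _ E1).
have h3 : (1 + 2 * d%:R ^+ 2) * 1 <= (1 + 2 * d%:R ^+ 2) * senergy k.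
  by rewrite ler_wpM2l// addr_ge0// mulr_ge0 ?sqr_ge0.
lra.
Qed.

Lemma step_weak_grad phi (B : R) i : torus_test phi -> test_bound phi B ->
  `|\int[torus d]_x (sw S k (cell (sp S) x) * 'D_(unitv i) phi x) +
    \int[torus d]_x (sgrad k i (cell (sp S) x) * phi x)| <=
  3 * d%:R * B * e * senergy k.
Proof.
move=> [sphi pphi] tB; have [B0 _ _ lipB _] := tB.
have E1 := senergy_ge1 k.
have dn : 0 <= d%:R / n%:R :> R by rewrite divr_ge0// ltW.
have ne : d%:R / n%:R <= d%:R * e by rewrite ler_wpM2l// sp_fine.
have dR1 : 1 <= d%:R :> R by rewrite ler1n.
have cphi : continuous phi by exact: (sphi 0%N).
have cD : continuous ('D_(unitv i) phi) by exact: ((sphi 1%N).2 (unitv i)).2.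
have pD : Defs.periodic ('D_(unitv i) phi) by exact: periodic_derive.
have e1 : `|\int[torus d]_x (sw S k (cell (sp S) x) * 'D_(unitv i) phi x) -
    avg (fun g => sw S k g * 'D_(unitv i) phi (node g))| <= B * (d%:R * e) * senergy k.
  apply: le_trans (int_cell_test _ pD cD B0 (fun x y => (lipB x y).2 i)) _.
  by apply: ler_pM; [rewrite mulr_ge0|exact: avg_ge0|rewrite ler_wpM2l|exact: avg_sw_le].
have e2 : `|\int[torus d]_x (sgrad k i (cell (sp S) x) * phi x) -
    avg (fun g => sgrad k i g * phi (node g))| <= B * (d%:R * e) * senergy k.
  apply: le_trans (int_cell_test _ pphi cphi B0 (fun x y => (lipB x y).1)) _.
  by apply: ler_pM; [rewrite mulr_ge0|exact: avg_ge0|rewrite ler_wpM2l|exact: avg_sgrad_le].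
have e3 : `|avg (fun g => sw S k g * 'D_(unitv i) phi (node g)) +
    avg (fun g => sgrad k i g * phi (node g))| <= B * e * senergy k.
  have -> : avg (fun g => sgrad k i g * phi (node g)) =
      avg (fun g => sw S k g * (n%:R * dif (- es i) (phi \o node (p := sp S)) g)).
    rewrite (eq_avg (g := fun g => n%:R * (dif (es i) (sw S k) g * phi (node g)))).
      rewrite avgZ (avg_dif_parts (es i) (sw S k) (phi \o node (p := sp S))) -avgZ.
      by apply: eq_avg => g; rewrite mulrCA.
    by move=> g; rewrite /sgrad mulrA.
  rewrite -avgD; apply: le_trans (le_norm_avg _) _.
  apply: (@le_trans _ _ (avg (fun g => B * e * `|sw S k g|))); last first.
    by rewrite avgZ ler_wpM2l ?mulr_ge0 ?(ltW e_gt0)// avg_sw_le.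
  apply: le_avg => g; rewrite -mulrDr normrM mulrC ler_wpM2r//.
  have := node_dif [:: (i, false)] g pphi tB.
  rewrite !walk_end_cons !walk_end0 !addr0 /step_end /= opprK expr1n mulr1 addrC => h.
  by apply: le_trans h _; rewrite ler_wpM2l// sp_fine.
move: e1 e2 e3; set X := \int[_]_x _; set Y := avg _; set Z := \int[_]_x _; set U := avg _.
move=> e1 e2 e3.
have -> : X + Z = (X - Y) + (Z - U) + (Y + U) by ring.
apply: le_trans (ler_normD _ _) _; apply: le_trans (lerD (ler_normD _ _) (lexx _)) _.
apply: le_trans (lerD (lerD e1 e2) e3) _.
have BeE : 0 <= B * e * senergy k by rewrite !mulr_ge0// ?(ltW e_gt0)// (le_trans _ E1).
have -> : B * (d%:R * e) * senergy k + B * (d%:R * e) * senergy k + B * e * senergy k =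
  (B * e * senergy k) * (2 * d%:R + 1) by ring.
have -> : 3 * d%:R * B * e * senergy k = (B * e * senergy k) * (3 * d%:R) by ring.
rewrite ler_wpM2l//; lra.
Qed.

Let N := nltv (weights es (sWL S) n%:R) (srho S k).

Lemma step_grad_le : avg (fun x => n%:R * enorm (\row_i dif (es i)
    (smoothen es (sL S) (srho S k)) x)) <= N + e * (4 * V + 4).
Proof.
have h1 := srho_grad S _ kK; have h2 := srho_tv S _ kK; rewrite -/N in h1 h2.
have e0 := e_gt0; have el := e_le; have V0 := V_ge0.
set A := avg _ in h1 *.
have A0 : 0 <= A by apply: avg_ge0 => x; rewrite mulr_ge0 ?enorm_ge0// ltW.
have eV : e * V <= 2^-1 * V by rewrite ler_wpM2r.
(* From (1 - e) A <= N + e one first gets A <= 2 (N + e); this crude bound makes e A of order e,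
   which restores the factor 1 in front of N. *)
have A1 : A / 2 <= N + e by apply: le_trans h1; rewrite mulrC ler_wpM2r//; lra.
have eA : e * A <= e * (2 * (2 * V + 1) + 2 * e) by rewrite ler_wpM2l ?(ltW e0)//; lra.
have ee : e * e <= e * 2^-1 by rewrite ler_wpM2l// ltW.
lra.
Qed.

(** The clipped density is exchanged for the smoothed one, F, and the divergence for backward
    difference quotients at the nodes. Summation by parts then leaves the mean Euclidean gradient of
    F, at most the nonlocal variation up to O(e). *)
Lemma step_tv_pairing (zeta : 'rV[R]_d -> 'rV[R]_d) (B : R) : torus_test_field zeta ->
  (forall x, enorm (zeta x) <= 1) -> (forall i, test_bound (fun x => zeta x 0 i) B) ->
  - (\int[torus d]_x (sclip k (cell (sp S) x) * diverg zeta x)) <=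
  N + e * (4 * V + 4 + (2 + 2 * M) * d%:R ^+ 2 * B).
Proof.
move=> [sz pz] z1 tB.
have B0 : 0 <= B by have [] := tB (Ordinal d_gt0).
have pzi i : Defs.periodic (fun x => zeta x 0 i) by move=> x l; rewrite pz.
have dR1 : 1 <= d%:R :> R by rewrite ler1n.
have d2 : d%:R <= d%:R ^+ 2 :> R by rewrite expr2 ler_peMr.
have M0 : 0 <= M by rewrite (le_trans _ al_le_M)// ltW.
pose F := smoothen es (sL S) (srho S k).
pose D g := n%:R * \sum_i (zeta (node g) 0 i - zeta (node (g - es i)) 0 i).
have Dle g : `|D g| <= d%:R * B.
  rewrite normrM ger0_norm ?(ltW n0)// -ler_pdivlMl//; apply: le_trans (ler_norm_sum _ _ _) _.
  rewrite [leRHS]mulrCA -[X in X%:R * _]card_ord mulr_natl -sumr_const; apply: ler_sum => i _.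
  have [_ _ _ lipB _] := tB i.
  have := @node_step R d (sp S) g (i, false); rewrite /step_end /= => h.
  rewrite (periodic_congr (pzi i) h) distrC mulrC; apply: le_trans (lipB _ _).1 _.
  rewrite ler_wpM2l// (bigD1 i)//= big1 ?addr0.
    by rewrite !mxE !eqxx mulr1 normrN ger0_norm// invr_ge0 ltW.
  by move=> l /negbTE li; rewrite !mxE eqxx li mulr0 oppr0 normr0.
have Dx x : `|diverg zeta x - D (cell (sp S) x)| <= 2 * d%:R ^+ 2 * B * e.
  have -> : diverg zeta x - D (cell (sp S) x) =
    \sum_i (('D_(unitv i) (fun y => zeta y 0 i) x -
             'D_(unitv i) (fun y => zeta y 0 i) (node (cell (sp S) x))) +
       ('D_(unitv i) (fun y => zeta y 0 i) (node (cell (sp S) x)) -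
        n%:R * (zeta (node (cell (sp S) x)) 0 i - zeta (node (cell (sp S) x - es i)) 0 i))).
    by rewrite /diverg /D mulr_sumr -sumrB; apply: eq_bigr => i _; rewrite addrA subrK.
  apply: le_trans (ler_norm_sum _ _ _) _.
  apply: (@le_trans _ _ (d%:R * (B * (d%:R * e) + B * e))); last first.
    have : 0 <= B * e by rewrite mulr_ge0// ltW.
    have : d%:R * (B * e) <= d%:R ^+ 2 * (B * e) by rewrite ler_wpM2r// mulr_ge0// ltW.
    lra.
  rewrite -[X in X%:R * _]card_ord mulr_natl -sumr_const; apply: ler_sum => i _.
  have [_ _ _ lipB _] := tB i.
  apply: le_trans (ler_normD _ _) _; apply: lerD.
    have hl := @lip_node R d (sp S) ('D_(unitv i) (fun y => zeta y 0 i)) B x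
      (periodic_derive (unitv i) (pzi i)) B0 (fun x y => (lipB x y).2 i).
    apply: le_trans hl _.
    by rewrite ler_wpM2l// ler_wpM2l// sp_fine.
  have := node_dif [:: (i, false)] (cell (sp S) x) (pzi i) (tB i).
  rewrite !walk_end_cons !walk_end0 !addr0 /step_end /= opprK expr1n mulr1 => h.
  apply: le_trans (_ : B / n%:R <= _); last by rewrite ler_wpM2l// sp_fine.
  apply: le_trans h; rewrite le_eqVlt; apply/orP; left; apply/eqP; congr `|_|.
  by rewrite /dif/=; ring.
have bD : bm setT (diverg zeta).
  apply: bm_sum => i; apply: bm_periodic => //; last exact: periodic_derive.
  exact: ((sz i 1%N).2 (unitv i)).2.
have br : bm setT (fun x : 'rV[R]_d => sclip k (cell (sp S) x)) by exact: bm_cell.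
have h1 : - (\int[torus d]_x (sclip k (cell (sp S) x) * diverg zeta x)) <=
    - avg (fun g => sclip k g * D g) + M * (2 * d%:R ^+ 2 * B * e).
  rewrite addrC -lerBlDr opprK addrC -Rintegral_cell -RintegralB//; first last.
  - by apply: torus_integrable; exact: bmM.
  - by apply: torus_integrable; exact: (bm_cell (fun g => sclip k g * D g)).
  apply: le_trans (ler_norm _) _; apply: torus_le_cst.
    by apply: bmB; [exact: (bm_cell (fun g => sclip k g * D g))|exact: bmM].
  move=> x; rewrite -mulrBr normrM distrC; apply: ler_pM => //.
  have /andP[c1 c2] := sclip_itv k (cell (sp S) x).
  by rewrite ger0_norm// (le_trans _ c1)// ltW.
have h2 : - avg (fun g => sclip k g * D g) <= - avg (fun g => F g * D g) + 2 * e * (d%:R * B).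
  rewrite addrC -lerBlDr opprK addrC -avgB; apply: le_trans (ler_norm _) _.
  apply: le_trans (le_norm_avg _) _.
  apply: (@le_trans _ _ (avg (fun g => (d%:R * B) * (`|F g - srho S k g| + `|srho S k g - sclip k g|)))).
    apply: le_avg => g; rewrite -mulrBl normrM mulrC; apply: ler_pM => //.
    by apply: le_trans (ler_normD _ _); rewrite addrA subrK.
  rewrite avgZ avgD mulrC ler_wpM2r ?mulr_ge0//.
  have := srho_smoothen S _ kK; have := avg_srho_sclip kK; rewrite /F; lra.
have h3 := @avg_parts_smoothen R G d es n%:R (sL S) n0 (srho S k) (zeta \o node (p := sp S)) (fun g => z1 _).
have h4 := step_grad_le.
have h5 : e * (d%:R * B) <= e * (d%:R ^+ 2 * B).
  by rewrite ler_wpM2l ?(ltW e_gt0)// ler_wpM2r.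
move: h1 h2 h3; rewrite /= -/F -/D; lra.
Qed.

(** In [srho_curv] the density becomes the clipped one. As [sw] is controlled in L2, the change is
    split by Young's inequality with weight e, which is why [srho_clip] measures the clipping in
    mean square by e^2. *)
Lemma step_curv_le : N <= - avg (fun g => sclip k g * sw S k g) + 2 * e * senergy k.
Proof.
have h1 := srho_curv S k; rewrite -/N in h1.
have e0 := e_gt0.
have h2 : `|avg (fun g => sw S k g * (srho S k g - sclip k g))| <=
    e / 2 * avg (fun g => sw S k g ^+ 2) + e / 2.
  apply: le_trans (le_norm_avg _) _.
  apply: (@le_trans _ _ (avg (fun g => e / 2 * sw S k g ^+ 2 +
     (2 * e)^-1 * (srho S k g - sclip k g) ^+ 2))).
    apply: le_avg => g; rewrite normrM; set a := sw S k g; set b := _ - _.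
    rewrite -[a ^+ 2]real_normK ?num_real// -[b ^+ 2]real_normK ?num_real//.
    have : 0 <= (2 * e)^-1 * (e * `|a| - `|b|) ^+ 2.
      by rewrite mulr_ge0 ?sqr_ge0// invr_ge0 mulr_ge0// ltW.
    have -> : (2 * e)^-1 * (e * `|a| - `|b|) ^+ 2 =
       e / 2 * `|a| ^+ 2 + (2 * e)^-1 * `|b| ^+ 2 - `|a| * `|b| by field; rewrite gt_eqF.
    by rewrite subr_ge0.
  rewrite avgD !avgZ lerD2l.
  apply: (@le_trans _ _ ((2 * e)^-1 * e ^+ 2)).
    by rewrite ler_wpM2l ?srho_clip// invr_ge0 mulr_ge0// ltW.
  by rewrite le_eqVlt; apply/orP; left; apply/eqP; field; rewrite gt_eqF.
have h3 : avg (fun g => sw S k g * (srho S k g - sclip k g)) =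
   avg (fun g => sw S k g * srho S k g) - avg (fun g => sclip k g * sw S k g).
  by rewrite -avgB; apply: eq_avg => g; ring.
rewrite h3 ler_norml in h2; have /andP[h4 _] := h2.
have h5 : 1 + avg (fun g => sw S k g ^+ 2) <= senergy k.
  by rewrite /senergy lerDl sumr_ge0// => i _; exact: avg_sqr_ge0.
have h6 : e * (1 + avg (fun g => sw S k g ^+ 2)) <= e * senergy k by rewrite ler_wpM2l// ltW.
have h7 : e * 1 <= e * senergy k by rewrite ler_wpM2l ?senergy_ge1// ltW.
have h8 : 0 <= e * avg (fun g => sw S k g ^+ 2) by rewrite mulr_ge0 ?avg_sqr_ge0// ltW.
lra.
Qed.

End level.
End step_functions.

Arguments sgrad {R d al M V T e rho0 j} S k i x.
Arguments sfield {R d al M V T e rho0 j} S k x.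
Arguments sclip {R d al M V T e rho0 j} S k x.
Arguments senergy {R d al M V T e rho0 j} S k.

(** * The weak equation of the discrete solution *)

Section spacetime_tests.
Context {R : realType} {d : nat}.
Implicit Types u : R * 'rV[R]_d -> R.

Definition edir (i : 'I_d) : R * 'rV[R]_d := (0, unitv i).

Definition tdir : R * 'rV[R]_d := (1, 0).

Lemma continuous_slice u t : continuous u -> continuous (fun x : 'rV[R]_d => u (t, x)).
Proof.
move=> cu x.
have h : ((t, y) : R * 'rV[R]_d) @[y --> x] --> (t, x).
  have h1 := @cst_continuous 'rV[R]_d R t x.
  have h2 : y @[y --> x] --> x by exact: cvg_id.
  exact: (cvg_pair h1 h2).
exact: (continuous_cvg _ (cu (t, x)) h).
Qed.

Lemma derive_slice u t x i : 'D_(unitv i) (fun y => u (t, y)) x = 'D_(edir i) u (t, x).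
Proof.
rewrite /derive; suff -> : (fun h : R => h^-1 *: (((fun y => u (t, y)) \o shift x) (h *: unitv i) - u (t, x))) =
  (fun h : R => h^-1 *: ((u \o shift (t, x)) (h *: edir i) - u (t, x))) by [].
apply/funext => h /=; congr (_ *: (u _ - _)).
by rewrite /edir; congr pair; rewrite /= scaler0 add0r.
Qed.

Lemma derivable_slice u t x i : derivable u (t, x) (edir i) ->
  derivable (fun y => u (t, y)) x (unitv i).
Proof.
rewrite /derivable; suff -> : (fun h : R => h^-1 *: (((fun y => u (t, y)) \o shift x) (h *: unitv i) - u (t, x))) =
  (fun h : R => h^-1 *: ((u \o shift (t, x)) (h *: edir i) - u (t, x))) by [].
apply/funext => h /=; congr (_ *: (u _ - _)).
by rewrite /edir; congr pair; rewrite /= scaler0 add0r.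
Qed.

(* B bounds the first derivatives of u on [0, T] and their Lipschitz constants. *)
Definition stest_bound (T : R) u (B : R) : Prop :=
  [/\ 0 <= B,
      forall t x, 0 <= t <= T -> `|time_deriv u (t, x)| <= B /\
        forall i, `|'D_(edir i) u (t, x)| <= B,
      forall s t x y, 0 <= s <= T -> 0 <= t <= T ->
        `|time_deriv u (s, x) - time_deriv u (t, y)| <= B * (`|s - t| + \sum_i `|x 0 i - y 0 i|) &
      forall s t x y i, 0 <= s <= T -> 0 <= t <= T ->
        `|'D_(edir i) u (s, x) - 'D_(edir i) u (t, y)| <= B * (`|s - t| + \sum_i `|x 0 i - y 0 i|)].

Lemma lip_spacetime (T : R) u (B : R) : 0 <= B ->
  (forall v y, derivable u y v) ->
  (forall t x, 0 <= t <= T -> `|'D_tdir u (t, x)| <= B) ->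
  (forall t x i, 0 <= t <= T -> `|'D_(edir i) u (t, x)| <= B) ->
  forall s t x y, 0 <= s <= T -> 0 <= t <= T ->
    `|u (s, x) - u (t, y)| <= B * (`|s - t| + \sum_i `|x 0 i - y 0 i|).
Proof.
move=> B0 du ht hx s t x y sT tT.
have h1 : `|u (s, x) - u (t, x)| <= B * `|s - t|.
  have e1 c : (t, x) + c *: tdir = (t + c, x).
    by rewrite /tdir; congr pair; rewrite /= ?scaler0 ?addr0// /GRing.scale/= mulr1.
  have e2 : t + (s - t) = s by rewrite addrC subrK.
  have [st|ts] := leP t s.
    have [c /andP[c0 c1]] := mvt_line (b := s - t) (a := 0) (phi := u) (x := (t, x)) (v := tdir)
      ltac:(by rewrite subr_ge0) (fun _ => du _ _).
    rewrite !e1 e2 addr0 subr0 => ->; rewrite normrM mulrC ler_wpM2r//; apply: ht.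
    by move: sT tT => /andP[? ?] /andP[? ?]; apply/andP; split; lra.
  have [c /andP[c0 c1]] := mvt_line (b := 0) (a := s - t) (phi := u) (x := (t, x)) (v := tdir)
      ltac:(by rewrite subr_le0 ltW) (fun _ => du _ _).
  rewrite !e1 e2 addr0 sub0r opprB => h; rewrite distrC h normrM mulrC distrC ler_wpM2r//; apply: ht.
  by move: sT tT => /andP[? ?] /andP[? ?]; apply/andP; split; lra.
have h2 : `|u (t, x) - u (t, y)| <= B * \sum_i `|x 0 i - y 0 i|.
  have := @lip_path _ _ (fun z => u (t, z)) B [seq ((x - y) 0 i, unitv i) | i <- enum 'I_d] y.
  have e3 : y + (x - y) = x by rewrite addrC subrK.
  rewrite row_path row_path_len e3 => h.
  rewrite (eq_bigr (fun i => `|(x - y) 0 i|)); last by move=> i _; rewrite !mxE.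
  apply: h => c z /mapP[i _ ->] /=; first exact: derivable_slice.
  by rewrite derive_slice; exact: hx.
rewrite mulrDr; apply: le_trans (lerD h1 h2).
by apply: le_trans (ler_normD _ _); rewrite addrA subrK.
Qed.

Lemma periodic_slice_derive u v : (forall t, Defs.periodic (fun x => u (t, x))) ->
  forall t, Defs.periodic (fun x => 'D_v u (t, x)).
Proof.
move=> pu t x k; rewrite /derive.
suff -> : (fun h : R => h^-1 *: ((u \o shift (t, x + map_mx intr k)) (h *: v) -
      u (t, x + map_mx intr k))) = (fun h => h^-1 *: ((u \o shift (t, x)) (h *: v) - u (t, x))) by [].
apply/funext => h /=; rewrite pu; congr (_ *: (_ - _)).
have -> : h *: v + (t, x + map_mx intr k) = (h * v.1 + t, h *: v.2 + x + map_mx intr k).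
  by congr pair; rewrite /= addrA.
by rewrite pu.
Qed.

Lemma stest_boundP (T : R) u : spacetime_test T u -> exists B, stest_bound T u B.
Proof.
move=> [su pu _].
have [c0 h1] := su 2%N.
have du v x : derivable u x v by exact: (h1 v).1.
have d2u v w x : derivable ('D_v u) x w by exact: ((h1 v).2.2 w).1.
have c1 v : continuous ('D_v u) by exact: (h1 v).2.1.
have c2 v w : continuous ('D_w ('D_v u)) by exact: ((h1 v).2.2 w).2.
pose dir (o : option 'I_d) := if o is Some i then edir i else tdir.
have /choice[B1 HB1] : forall o, exists B, 0 <= B /\
    forall t x, 0 <= t <= T -> `|'D_(dir o) u (t, x)| <= B.
  move=> o; have [B ? ?] := spacetime_bounded T (c1 (dir o)) (periodic_slice_derive (dir o) pu).
  by exists B.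
have /choice[B2 HB2] : forall oo : option 'I_d * option 'I_d, exists B, 0 <= B /\
    forall t x, 0 <= t <= T -> `|'D_(dir oo.1) ('D_(dir oo.2) u) (t, x)| <= B.
  move=> [a b]; have [B ? ?] := spacetime_bounded T (c2 (dir b) (dir a))
    (periodic_slice_derive (dir a) (periodic_slice_derive (dir b) pu)).
  by exists B.
pose B := \sum_o B1 o + \sum_oo B2 oo.
have s1 : 0 <= \sum_o B1 o by apply: sumr_ge0 => o _; exact: (HB1 o).1.
have s2 : 0 <= \sum_oo B2 oo by apply: sumr_ge0 => o _; exact: (HB2 o).1.
have b0 : 0 <= B by rewrite addr_ge0.
have b1 o t x : 0 <= t <= T -> `|'D_(dir o) u (t, x)| <= B.
  move=> tT; apply: le_trans ((HB1 o).2 t x tT) _; rewrite /B (bigD1 o)//=.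
  have : 0 <= \sum_(l | l != o) B1 l by apply: sumr_ge0 => l _; exact: (HB1 l).1.
  lra.
have b2 o o2 t x : 0 <= t <= T -> `|'D_(dir o) ('D_(dir o2) u) (t, x)| <= B.
  move=> tT; apply: le_trans ((HB2 (o, o2)).2 t x tT) _; rewrite /B (bigD1 (o, o2))//=.
  have : 0 <= \sum_(l | l != (o, o2)) B2 l by apply: sumr_ge0 => l _; exact: (HB2 l).1.
  lra.
exists B; split => //.
- by move=> t x tT; split=> [|i]; [exact: (b1 None)|exact: (b1 (Some i))].
- move=> s t x y; apply: (@lip_spacetime T ('D_tdir u) B b0 (d2u tdir)).
  + by move=> r z; exact: (b2 None None).
  + by move=> r z i; exact: (b2 (Some i) None).
- move=> s t x y i; apply: (@lip_spacetime T ('D_(edir i) u) B b0 (d2u (edir i))).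
  + by move=> r z; exact: (b2 None (Some i)).
  + by move=> r z l; exact: (b2 (Some l) (Some i)).
Qed.

End spacetime_tests.

Section discrete_weak_equation.
Context {R : realType} {d : nat}.
Variables (al M V T e : R) (rho0 : 'rV[R]_d -> R) (j : nat).
Variable S : scheme al M V T rho0 e j.
Hypotheses (d_gt0 : (0 < d)%N) (al_gt0 : 0 < al) (al_le_M : al <= M) (V_ge0 : 0 <= V)
  (T_gt0 : 0 < T) (brho0 : bm setT rho0) (e_gt0 : 0 < e) (e_le : e <= 2^-1).

Local Notation n := (sp S).+1.
Local Notation K := (sK S).
Local Notation G := 'rV['I_(sp S).+1]_d.
Local Notation es := (unit_shift (sp S)).
Local Notation ST := (measurableTypeR R * 'rV[R]_d)%type.
Local Notation tau := (T / K%:R).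

Let n0 : 0 < n%:R :> R. Proof. by rewrite ltr0n. Qed.
Let K0 : 0 < K%:R :> R. Proof. by rewrite ltr0n sK_gt0. Qed.
Let tau0 : 0 < tau. Proof. by rewrite divr_gt0. Qed.
Let Ktau : K%:R * tau = T. Proof. by rewrite mulrCA mulfV ?mulr1// gt_eqF. Qed.
Let M0 : 0 <= M. Proof. by rewrite (le_trans _ al_le_M)// ltW. Qed.

Lemma tick_time k : (k <= K)%N -> 0 <= k%:R * tau <= T.
Proof.
move=> kK; rewrite mulr_ge0 ?(ltW tau0)//=.
by rewrite -[leRHS]Ktau ler_wpM2r ?ler_nat// ltW.
Qed.

Variables (u : R * 'rV[R]_d -> R) (B : R).
Hypotheses (tu : spacetime_test T u) (tB : stest_bound T u B).

Definition test_val k (g : G) : R := u (k%:R * tau, node g).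

Let du v y : derivable u y v. Proof. by have [su _ _] := tu; exact: ((su 1%N).2 v).1. Qed.

Lemma test_val_time k g : (k < K)%N -> exists2 c, k%:R * tau <= c <= k.+1%:R * tau &
  test_val k.+1 g - test_val k g = tau * time_deriv u (c, node g).
Proof.
move=> kK.
have e1 c : (k%:R * tau, node g) + c *: (1, 0) = (k%:R * tau + c, node g) :> R * 'rV[R]_d.
  by congr pair; rewrite /= ?scaler0 ?addr0// /GRing.scale/= mulr1.
have [c /andP[c0 c1]] := mvt_line (a := 0) (b := tau) (phi := u) (x := (k%:R * tau, node g)) (v := (1, 0))
   (ltW tau0) (fun _ => @du _ _).
rewrite !e1 addr0 subr0 => h; exists (k%:R * tau + c); first by rewrite -natr1 mulrDl mul1r lerDl c0 lerD2l.
by rewrite /test_val -natr1 mulrDl mul1r h.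
Qed.

Lemma test_val_space k i g : exists2 c, 0 <= c <= n%:R^-1 &
  n%:R * dif (es i) (test_val k) g = 'D_(edir i) u (k%:R * tau, node g + c *: unitv i).
Proof.
have [_ pu _] := tu.
have e1 c : (k%:R * tau, node g) + c *: edir i = (k%:R * tau, node g + c *: unitv i).
  by congr pair; rewrite /= ?scaler0 ?addr0.
have [|c /andP[c0 c1]] := mvt_line (a := 0) (b := n%:R^-1) (phi := u) (x := (k%:R * tau, node g)) (v := edir i)
   _ (fun _ => @du _ _); first by rewrite invr_ge0 ltW.
rewrite !e1 scale0r addr0 subr0 => h; exists c; first by rewrite c0.
rewrite /dif /test_val (periodic_congr (pu _) (@node_shift R d (sp S) g i)) h mulrA mulfV ?mul1r// gt_eqF.
Qed.

Lemma test_val_space_le k i g : (k <= K)%N -> `|n%:R * dif (es i) (test_val k) g| <= B.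
Proof.
move=> kK; have [c _ ->] := test_val_space k i g; have [_ h _ _] := tB.
exact: (h _ _ (tick_time kK)).2.
Qed.

(* Abel summation in time *)
Lemma discrete_by_parts :
  \sum_(k < K) (avg (fun g => srho S k.+1 g * (test_val k.+1 g - test_val k g)) +
     tau * \sum_i avg (fun g => smob S k i g * sgrad S k i g * (n%:R * dif (es i) (test_val k) g))) =
  - \int[torus d]_x (rho0 x * u (0, node (cell (sp S) x))).
Proof.
have step (k : 'I_K) : avg (fun g => srho S k.+1 g * (test_val k.+1 g - test_val k g)) +
     tau * \sum_i avg (fun g => smob S k i g * sgrad S k i g * (n%:R * dif (es i) (test_val k) g)) =
   avg (fun g => srho S k.+1 g * test_val k.+1 g) - avg (fun g => srho S k g * test_val k g).
  rewrite -(srho_step S k (test_val k)) -avgD -avgB; apply: eq_avg => g; ring.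
rewrite (eq_bigr _ (fun k _ => step k)) -(big_mkord xpredT (fun k =>
  avg (fun g => srho S k.+1 g * test_val k.+1 g) - avg (fun g => srho S k g * test_val k g))).
rewrite telescope_sumr//.
have uT g : test_val K g = 0.
  have [_ _ [s sT us]] := tu; by rewrite /test_val us// Ktau ltW.
rewrite (eq_avg (g := fun=> 0)) ?avg_cst ?sub0r; last by move=> g; rewrite uT mulr0.
congr (- _); rewrite -(avg_cell_avg brho0 (fun g => u (0, node g))) srho_0.
by apply: eq_avg => g; rewrite /test_val mul0r mulrC.
Qed.

Lemma sum_nodes (x : 'rV[R]_d) : exists2 y, congr_tor y x & 
  \sum_i `|y 0 i - node (cell (sp S) x) 0 i| <= d%:R * e.
Proof.
have [y [xy hy]] := cellP (sp S) x; exists y; first exact: congr_tor_sym.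
rewrite -[X in X%:R * _]card_ord mulr_natl -sumr_const; apply: ler_sum => i _.
have /andP[h1 h2] := hy i; rewrite ger0_norm//; apply: le_trans (ltW h2) _; exact: sp_fine.
Qed.

Lemma step_integrand k t x g : (k < K)%N -> k%:R * tau <= t <= k.+1%:R * tau ->
  g = cell (sp S) x ->
  `|(sclip S k g * time_deriv u (t, x) +
     sclip S k g * dot (\row_i sgrad S k i g) (grad (fun y => u (t, y)) x)) -
    (sclip S k g * ((test_val k.+1 g - test_val k g) / tau) +
     \sum_i sclip S k g * (sgrad S k i g * (n%:R * dif (es i) (test_val k) g)))| <=
  M * B * (d%:R + 2) * e * (1 + \sum_i `|sgrad S k i g|).
Proof.
move=> kK /andP[t1 t2] gx; have [B0 _ lipt lipx] := tB; have [_ pu _] := tu.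
have /andP[r1 r2] := @sclip_itv _ _ _ _ _ _ _ _ _ S al_gt0 al_le_M k g.
have tT : 0 <= t <= T.
  have /andP[a _] := tick_time (ltnW kK); have /andP[_ b] := tick_time kK.
  by rewrite (le_trans a)//= (le_trans t2).
have te : tau <= e by exact: stau.
have ne : n%:R^-1 <= e by exact: sp_fine.
have [y yx hy] := sum_nodes x; rewrite -gx in hy.
have E1 : `|time_deriv u (t, x) - (test_val k.+1 g - test_val k g) / tau| <= B * ((d%:R + 2) * e).
  have [c /andP[c1 c2] ->] := test_val_time g kK.
  rewrite mulrAC mulfV ?gt_eqF// mul1r.
  have -> : time_deriv u (t, x) = time_deriv u (t, y).
    exact/esym/(periodic_congr (periodic_slice_derive (1, 0) pu t) yx).
  have cT : 0 <= c <= T.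
    have /andP[a _] := tick_time (ltnW kK); have /andP[_ b] := tick_time kK.
    by rewrite (le_trans a)//= (le_trans c2).
  apply: le_trans (lipt _ _ _ _ tT cT) _; rewrite ler_wpM2l//.
  have : `|t - c| <= e.
    apply: le_trans te; rewrite -natr1 mulrDl mul1r in t2 c2.
    by rewrite ler_norml; apply/andP; split; lra.
  have : 0 <= e by exact: ltW.
  lra.
have E2 i : `|'D_(edir i) u (t, x) - n%:R * dif (es i) (test_val k) g| <= B * ((d%:R + 2) * e).
  have [c /andP[c1 c2] ->] := test_val_space k i g.
  rewrite -(periodic_congr (periodic_slice_derive (edir i) pu t) yx).
  apply: le_trans (lipx _ _ _ _ i tT (tick_time (ltnW kK))) _; rewrite ler_wpM2l//.
  have h1 : `|t - k%:R * tau| <= e.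
    apply: le_trans te; rewrite -natr1 mulrDl mul1r in t2.
    by rewrite ger0_norm; lra.
  have h2 : \sum_l `|y 0 l - (node g + c *: unitv i) 0 l| <= d%:R * e + e.
    apply: (@le_trans _ _ (\sum_l (`|y 0 l - node g 0 l| + `|(c *: unitv i : 'rV[R]_d) 0 l|))).
      apply: ler_sum => l _.
      have -> : y 0 l - (node g + c *: unitv i) 0 l = (y 0 l - node g 0 l) - (c *: unitv i : 'rV[R]_d) 0 l.
        by rewrite [X in _ - X = _]mxE opprD addrA.
      exact: ler_normB.
    rewrite big_split/=; apply: lerD; first exact: hy.
    rewrite (bigD1 i)//= big1 ?addr0.
      by rewrite !mxE !eqxx mulr1 ger0_norm// (le_trans c2).
    by move=> l /negbTE li; rewrite !mxE eqxx li mulr0 normr0.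
  lra.
rewrite /dot mulr_sumr.
have -> : (sclip S k g * time_deriv u (t, x) +
     \sum_i sclip S k g * ((\row_i sgrad S k i g) 0 i * grad (fun y => u (t, y)) x 0 i)) -
    (sclip S k g * ((test_val k.+1 g - test_val k g) / tau) +
     \sum_i sclip S k g * (sgrad S k i g * (n%:R * dif (es i) (test_val k) g))) =
   sclip S k g * (time_deriv u (t, x) - (test_val k.+1 g - test_val k g) / tau) +
   \sum_i sclip S k g * (sgrad S k i g * ('D_(edir i) u (t, x) - n%:R * dif (es i) (test_val k) g)).
  rewrite opprD addrACA -mulrBr -sumrB; congr (_ + _); apply: eq_bigr => i _.
  by rewrite !mxE derive_slice; ring.
have rM : `|sclip S k g| <= M by rewrite ger0_norm// (le_trans _ r1)// ltW.
have X0 : 0 <= B * ((d%:R + 2) * e) by rewrite !mulr_ge0 ?addr_ge0// ltW.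
have -> : M * B * (d%:R + 2) * e * (1 + \sum_i `|sgrad S k i g|) =
  M * (B * ((d%:R + 2) * e)) + \sum_i M * (`|sgrad S k i g| * (B * ((d%:R + 2) * e))).
  by rewrite -mulr_sumr -mulr_suml; ring.
apply: le_trans (ler_normD _ _) _; apply: lerD; first by rewrite normrM ler_pM.
apply: le_trans (ler_norm_sum _ _ _) _; apply: ler_sum => i _.
by rewrite normrM ler_pM// normrM ler_wpM2l.
Qed.

Lemma bm_step (f : nat -> G -> R) :
  bm (slab T : set ST) (fun q : ST => f (tick T K q.1) (cell (sp S) q.2)).
Proof.
split; first exact: (measurable_step T_gt0 (sK_gt0 S) f).
exists (\sum_(k < K) \sum_g `|f k g|) => -[t x] [/= + _]; rewrite in_itv/= => /andP[t0 t1].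
have tK := tick_lt T_gt0 (sK_gt0 S) (ltW t0) t1.
rewrite (bigD1 (Ordinal tK))//= (bigD1 (cell (sp S) x))//=.
have h1 : 0 <= \sum_(i | i != cell (sp S) x) `|f (tick T K t) i| by exact: sumr_ge0.
have h2 : 0 <= \sum_(i < K | i != Ordinal tK) \sum_g `|f i g|.
  by apply: sumr_ge0 => i _; exact: sumr_ge0.
by rewrite -addrA lerDl addr_ge0.
Qed.

Lemma slab_integrable (f : ST -> R) : bm (slab T : set ST) f ->
  (@spacetime R d).-integrable (slab T) (EFin \o f).
Proof.
apply: bm_integrable; first exact: measurable_slab.
apply: le_lt_trans (ltry T); rewrite le_eqVlt; apply/orP; left; apply/eqP.
exact: spacetime_slab.
Qed.

Definition weak_const : R := M * (d%:R + 2) * (1 + d%:R) + 3 + d%:R * M + d%:R.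

Let step_term k := avg (fun g => srho S k.+1 g * (test_val k.+1 g - test_val k g)) +
  tau * \sum_i avg (fun g => smob S k i g * sgrad S k i g * (n%:R * dif (es i) (test_val k) g)).

Let clip_term k (g : G) := sclip S k g * ((test_val k.+1 g - test_val k g) / tau) +
  \sum_i sclip S k g * (sgrad S k i g * (n%:R * dif (es i) (test_val k) g)).

Lemma sum_avg_sgrad_le k : 1 + \sum_i avg (fun g => `|sgrad S k i g|) <= (1 + d%:R) * senergy S k.
Proof.
rewrite mulrDl mul1r; apply: lerD; first exact: senergy_ge1.
rewrite -[X in X%:R * _]card_ord mulr_natl -sumr_const; apply: ler_sum => i _.
exact: avg_sgrad_le.
Qed.

(** The scheme moves [srho] with mobility [smob]; the limit equation has the density in both places.
    The mobility error a is small in the mean and multiplies a gradient controlled in L2: Young's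
    inequality with weight e, together with a^2 <= M a, explains the e^2 in [smob_close]. *)
Lemma step_term_close k : (k < K)%N ->
  `|tau * avg (clip_term k) - step_term k| <= (3 + d%:R * M) * B * e * (tau * senergy S k).
Proof.
move=> kK; have [B0 tB1 _ _] := tB; have kK' := ltnW kK.
have -> : tau * avg (clip_term k) - step_term k =
  avg (fun g => (sclip S k g - srho S k.+1 g) * (test_val k.+1 g - test_val k g)) +
  tau * \sum_i avg (fun g => (sclip S k g - smob S k i g) * sgrad S k i g * (n%:R * dif (es i) (test_val k) g)).
  rewrite /step_term /clip_term avgD mulrDr avg_sum opprD addrACA -mulrBr -sumrB -avgZ -avgB.
  congr (_ + _ * _); last by apply: eq_bigr => i _; rewrite -avgB; apply: eq_avg => g; ring.
  by apply: eq_avg => g; field; rewrite !gt_eqF.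
have e0 := e_gt0.
have h1 : `|avg (fun g => (sclip S k g - srho S k.+1 g) * (test_val k.+1 g - test_val k g))| <=
    2 * e * (tau * B).
  apply: le_trans (le_norm_avg _) _.
  apply: (@le_trans _ _ (avg (fun g => (tau * B) * (`|srho S k g - sclip S k g| + e)))).
    apply: le_avg => g; rewrite normrM mulrC; apply: ler_pM => //.
      have [c /andP[c1 c2] ->] := test_val_time g kK.
      rewrite normrM ger0_norm ?(ltW tau0)// ler_wpM2l ?(ltW tau0)//; apply: (tB1 _ _ _).1.
      have /andP[a _] := tick_time kK'; have /andP[_ b] := tick_time kK.
      by rewrite (le_trans a)//= (le_trans c2).
    rewrite distrC; apply: le_trans (ler_distD (srho S k g) _ _) _.
    by rewrite addrC lerD2l; exact: srho_close.
  have tB0 : 0 <= tau * B by exact: mulr_ge0 (ltW tau0) B0.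
  rewrite avgZ avgD avg_cst mulrC ler_wpM2r//.
  have := avg_srho_sclip e_gt0 kK'; lra.
have h2 i : `|avg (fun g => (sclip S k g - smob S k i g) * sgrad S k i g * (n%:R * dif (es i) (test_val k) g))| <=
    B * (e * avg (fun g => sgrad S k i g ^+ 2) + M * e).
  apply: le_trans (le_norm_avg _) _.
  apply: (@le_trans _ _ (avg (fun g => B * (e * sgrad S k i g ^+ 2 +
     e^-1 * (M * `|smob S k i g - sclip S k g|))))).
    apply: le_avg => g; rewrite normrM mulrC; apply: ler_pM => //; first exact: test_val_space_le.
    rewrite normrM distrC; set a := `|_ - _|; set b := sgrad _ _ _ _.
    have aM : a <= M.
      have /andP[? ?] := @sclip_itv _ _ _ _ _ _ _ _ _ S al_gt0 al_le_M k g; have /andP[? ?] := smob_itv S k i g.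
      by rewrite /a ler_norml; have := al_gt0 => ?; apply/andP; split; lra.
    have a0 : 0 <= a by exact: normr_ge0.
    apply: (@le_trans _ _ (e * b ^+ 2 + e^-1 * (a * a))); last first.
      by rewrite lerD2l ler_wpM2l ?invr_ge0 ?(ltW e0)// ler_wpM2r.
    rewrite -[b ^+ 2]real_normK ?num_real//; move: (`|b|) (normr_ge0 b) => c c0.
    have : 0 <= e^-1 * (e * c - a) ^+ 2 by rewrite mulr_ge0 ?sqr_ge0// invr_ge0 ltW.
    have -> : e^-1 * (e * c - a) ^+ 2 = e * c ^+ 2 + e^-1 * (a * a) - 2 * (a * c).
      by field; rewrite gt_eqF.
    have : 0 <= a * c by rewrite mulr_ge0.
    lra.
  rewrite !(avgZ, avgD) ler_wpM2l// lerD2l mulrCA ler_wpM2l//.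
  rewrite ler_pdivrMl// -expr2; exact: smob_close.
apply: le_trans (ler_normD _ _) _; rewrite [X in _ + X]normrM (ger0_norm (ltW tau0)).
have E1 := senergy_ge1 S k.
have h3 : `|\sum_i avg (fun g => (sclip S k g - smob S k i g) * sgrad S k i g * (n%:R * dif (es i) (test_val k) g))| <=
    B * (e * senergy S k + d%:R * M * e).
  apply: le_trans (ler_norm_sum _ _ _) _.
  apply: (@le_trans _ _ (\sum_i B * (e * avg (fun g => sgrad S k i g ^+ 2) + M * e))).
    by apply: ler_sum => i _.
  rewrite -mulr_sumr ler_wpM2l// big_split/= sumr_const card_ord -mulr_sumr -[_ *+ d]mulr_natl mulrA.
  rewrite lerD2r ler_wpM2l ?(ltW e0)// /senergy lerDr addr_ge0// avg_sqr_ge0//.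
have h4 : tau * `|\sum_i avg (fun g => (sclip S k g - smob S k i g) * sgrad S k i g * (n%:R * dif (es i) (test_val k) g))| <=
   tau * (B * (e * senergy S k + d%:R * M * e)) by rewrite ler_wpM2l ?(ltW tau0).
apply: le_trans (lerD h1 h4) _.
have -> : 2 * e * (tau * B) + tau * (B * (e * senergy S k + d%:R * M * e)) =
  (B * e * tau) * (2 + senergy S k + d%:R * M) by ring.
have -> : (3 + d%:R * M) * B * e * (tau * senergy S k) = (B * e * tau) * ((3 + d%:R * M) * senergy S k) by ring.
apply: ler_wpM2l.
  by apply: mulr_ge0; [apply: mulr_ge0 => //; exact: ltW|exact: ltW tau0].
have : (2 + d%:R * M) * 1 <= (2 + d%:R * M) * senergy S k by rewrite ler_wpM2l// addr_ge0// mulr_ge0.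
lra.
Qed.

(** Three errors add up: evaluation of the test function at nodes and ticks, the passage from the
    clipped density to the scheme, and, after summation by parts, the initial datum tested at
    nodes. *)
Lemma step_weak_equation :
  `|\int[spacetime]_(q in slab T)
      (sclip S (tick T K q.1) (cell (sp S) q.2) * time_deriv u q +
       sclip S (tick T K q.1) (cell (sp S) q.2) *
          dot (\row_i sgrad S (tick T K q.1) i (cell (sp S) q.2)) (grad (fun x => u (q.1, x)) q.2)) +
    \int[torus d]_x (rho0 x * u (0, x))| <=
  weak_const * B * e * (tau * \sum_(k < K) senergy S k + \int[torus d]_x `|rho0 x|).
Proof.
have [B0 tB1 _ _] := tB; have [su pu _] := tu; have e0 := ltW e_gt0.
have c1 v : continuous ('D_v u) by exact: ((su 1%N).2 v).2.
have bD v : bm (slab T : set ST) ('D_v u : ST -> R).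
  by apply: bm_spacetime => //; exact: periodic_slice_derive.
have br := bm_step (sclip S); have bg i := bm_step (fun k => sgrad S k i).
have bdot : bm (slab T : set ST) (fun q : ST => dot (\row_i sgrad S (tick T K q.1) i (cell (sp S) q.2))
    (grad (fun x => u (q.1, x)) q.2)).
  rewrite (_ : (fun q : ST => _) = fun q : ST =>
      \sum_i sgrad S (tick T K q.1) i (cell (sp S) q.2) * 'D_(edir i) u q).
    by apply: bm_sum => i; exact: bmM (bg i) (bD (edir i)).
  by apply/funext => -[t x]; apply: eq_bigr => i _; rewrite !mxE derive_slice.
set I := \int[_]_(_ in _) _.
have h1 : `|I - \int[spacetime]_(q in slab T) clip_term (tick T K q.1) (cell (sp S) q.2)| <=
    M * (d%:R + 2) * (1 + d%:R) * B * e * (tau * \sum_(k < K) senergy S k).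
  rewrite /I -RintegralB//; first last.
  - exact: slab_integrable (bm_step clip_term).
  - apply: slab_integrable; apply: bmD; first exact: bmM br (bD (1, 0)).
    exact: bmM br bdot.
  - exact: measurable_slab.
  apply: (@le_trans _ _ (\int[spacetime]_(q in slab T)
     (M * B * (d%:R + 2) * e * (1 + \sum_i `|sgrad S (tick T K q.1) i (cell (sp S) q.2)|)))).
    apply: le_norm_Rintegral.
    - exact: measurable_slab.
    - apply: slab_integrable; apply: bmB; last exact: (bm_step clip_term).
      apply: bmD; first exact: bmM br (bD (1, 0)).
      exact: bmM br bdot.
    - exact: (slab_integrable (bm_step (fun k g => M * B * (d%:R + 2) * e * (1 + \sum_i `|sgrad S k i g|)))).
    move=> [t x] [/= + _]; rewrite in_itv/= => /andP[t0 t1].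
    apply: step_integrand => //; first exact: (tick_lt T_gt0 (sK_gt0 S) (ltW t0) t1).
    by have /andP[-> /ltW ->] := tickP T_gt0 (sK_gt0 S) (ltW t0).
  rewrite (Rintegral_step T_gt0 (sK_gt0 S) (fun k g => M * B * (d%:R + 2) * e * (1 + \sum_i `|sgrad S k i g|))).
  rewrite [leRHS]mulrCA ler_wpM2l ?(ltW tau0)// mulr_sumr; apply: ler_sum => k _.
  rewrite avgZ avgD avg_cst avg_sum.
  have -> : M * (d%:R + 2) * (1 + d%:R) * B * e * senergy S k =
    M * B * (d%:R + 2) * e * ((1 + d%:R) * senergy S k) by ring.
  by rewrite ler_wpM2l ?sum_avg_sgrad_le// !mulr_ge0// addr_ge0.
have h2 : `|\int[spacetime]_(q in slab T) clip_term (tick T K q.1) (cell (sp S) q.2) -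
    \sum_(k < K) step_term k| <= (3 + d%:R * M) * B * e * (tau * \sum_(k < K) senergy S k).
  rewrite (Rintegral_step T_gt0 (sK_gt0 S) clip_term) !mulr_sumr -sumrB.
  apply: le_trans (ler_norm_sum _ _ _) _; apply: ler_sum => k _; exact: step_term_close.
have h3 : `|\sum_(k < K) step_term k + \int[torus d]_x (rho0 x * u (0, x))| <=
    d%:R * B * e * \int[torus d]_x `|rho0 x|.
  have bu : bm setT (fun x : 'rV[R]_d => u (0, x)).
    apply: (bm_periodic _ _ (pu 0)) => //.
    exact: continuous_slice (su 0%N).
  have bn := bm_cell (p := sp S) (fun g => u (0, node g)).
  rewrite /step_term discrete_by_parts addrC -RintegralB//; first last.
  - by apply: torus_integrable; exact: bmM.
  - by apply: torus_integrable; exact: bmM.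
  rewrite -RintegralZl//; last by apply: torus_integrable; exact: bm_norm.
  apply: le_norm_Rintegral => //.
  - by apply: torus_integrable; apply: bmB; exact: bmM.
  - by apply: torus_integrable; apply: bmZ; exact: bm_norm.
  move=> x _; rewrite -mulrBr normrM mulrC ler_wpM2r//.
  have [y yx hy] := sum_nodes x; rewrite -(periodic_congr (pu 0) yx).
  have zT : (0 : R) <= 0 <= T by apply/andP; split=> //; exact: ltW.
  have h := @lip_spacetime R d T u B B0 (fun v y => @du v y) (fun t x tT => (tB1 t x tT).1)
    (fun t x i tT => (tB1 t x tT).2 i) 0 0 y (node (cell (sp S) x)) zT zT.
  apply: le_trans h _; rewrite subrr normr0 add0r [d%:R * B]mulrC -mulrA.
  by rewrite ler_wpM2l.
move: h1 h2 h3; set X := \int[_]_(_ in _) _; set Y := \sum_(k < K) step_term k; set Z := \int[_]_x _.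
set U := \int[_]_x _; set E := tau * _ => h1 h2 h3.
have -> : I + Z = (I - X) + (X - Y) + (Y + Z) by ring.
apply: le_trans (ler_normD _ _) _; apply: le_trans (lerD (ler_normD _ _) (lexx _)) _.
apply: le_trans (lerD (lerD h1 h2) h3) _.
have E0 : 0 <= E.
  rewrite mulr_ge0 ?(ltW tau0)//; apply: sumr_ge0 => k _; exact: le_trans ler01 (senergy_ge1 S k).
have U0 : 0 <= U by apply: Rintegral_ge0.
have a1 : 0 <= (M * (d%:R + 2) * (1 + d%:R) + 3 + d%:R * M) * B * e * U by rewrite !mulr_ge0 ?addr_ge0 ?mulr_ge0 ?addr_ge0.
have a2 : 0 <= d%:R * B * e * E by apply: mulr_ge0 => //; rewrite !mulr_ge0.
clearbody E U => {h1 h2 h3}.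
rewrite /weak_const; lra.
Qed.

End discrete_weak_equation.

(** * Compactness of the discrete solutions *)

Section box_linear.
Context {R : realType} {G : finZmodType}.

Lemma boxB L (es : seq G) (f g : G -> R) x :
  box L es (fun y => f y - g y) x = box L es f x - box L es g x.
Proof.
elim: es x => //= h es IH x; rewrite /box1 -mulrBl -sumrB; congr (_ / _).
by apply: eq_bigr => l _; rewrite IH.
Qed.

End box_linear.

Section coarse_cells.
Context {R : realType} {d : nat} (p P : nat).
Local Notation n := p.+1.

(** Up to an integer vector, x lies in each coordinate less than one coarse mesh width beyond the
    node of its coarse cell, hence about n / (P + 1) fine cells; the 1 accounts for rounding. *)
Lemma cell_coarse (x : 'rV[R]_d) : exists l : 'I_d -> nat,
  (forall i, (l i)%:R <= n%:R / P.+1%:R + 1 :> R) /\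
  cell p x = cell p (node (cell P x) : 'rV[R]_d) + \sum_i unit_shift p i *+ l i.
Proof.
have n0 : 0 < n%:R :> R by rewrite ltr0n.
have [y [[k xy] hy]] := cellP P x.
have -> : cell p x = cell p y by rewrite xy cellD_int.
set c := node (cell P x) in hy *.
have ic i : Num.floor (n%:R * c 0 i) <= Num.floor (n%:R * y 0 i).
  by apply: le_floor; rewrite ler_pM2l//; have /andP[h _] := hy i; rewrite subr_ge0 in h.
clearbody c.
exists (fun i => `|Num.floor (n%:R * y 0%R i) - Num.floor (n%:R * c 0%R i)|%N); split=> [i|].
  have h0 : 0 <= Num.floor (n%:R * y 0 i) - Num.floor (n%:R * c 0 i) by rewrite subr_ge0.
  have -> : `|Num.floor (n%:R * y 0%R i) - Num.floor (n%:R * c 0%R i)|%N%:R =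
      (Num.floor (n%:R * y 0 i))%:~R - (Num.floor (n%:R * c 0 i))%:~R :> R.
    by rewrite -intrB -[in RHS](gez0_abs h0).
  have /andP[a1 _] := floor_itv (n%:R * y 0 i); have /andP[_ a2] := floor_itv (n%:R * c 0 i).
  have /andP[_ a3] := hy i.
  have : n%:R * (y 0 i - c 0 i) <= n%:R / P.+1%:R by rewrite ler_pM2l// ltW.
  rewrite intrD1 in a2; rewrite mulrBr => {a3}; move: (n%:R / P.+1%:R) => X; lra.
apply/rowP => i; rewrite !mxE summxE (bigD1 i)//= big1 ?addr0.
  rewrite mulmxnE mxE eqxx /cell1.
  have h0 : 0 <= Num.floor (n%:R * y 0 i) - Num.floor (n%:R * c 0 i) by rewrite subr_ge0.
  have -> : Zp1 *+ `|Num.floor (n%:R * y 0%R i) - Num.floor (n%:R * c 0%R i)|%N =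
    Zp1 *~ (Num.floor (n%:R * y 0 i) - Num.floor (n%:R * c 0 i)) :> 'I_p.+1.
    by rewrite -[in RHS](gez0_abs h0) -pmulrn.
  by rewrite -mulrzDr addrC subrK.
by move=> l /negbTE il; rewrite mulmxnE mxE eq_sym il mul0rn.
Qed.

Lemma dif_sum_le (f : 'rV['I_p.+1]_d -> R) (C : R) (l : 'I_d -> nat) (r : seq 'I_d) g :
  (forall i h, `|dif (unit_shift p i) f h| <= C) ->
  `|f (g + \sum_(i <- r) unit_shift p i *+ l i) - f g| <= C * \sum_(i <- r) (l i)%:R.
Proof.
move=> fC; elim: r g => [|i r IH] g; first by rewrite !big_nil addr0 subrr normr0 mulr0.
rewrite !big_cons mulrDr addrA.
have h1 m : `|f (g + unit_shift p i *+ m) - f g| <= C * m%:R.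
  elim: m => [|m IHm]; first by rewrite mulr0n addr0 subrr normr0 mulr0.
  rewrite mulrSr addrA -natr1 mulrDr mulr1 [leRHS]addrC.
  apply: le_trans (lerD (fC i (g + unit_shift p i *+ m)) IHm).
  by apply: le_trans (ler_normD _ _); rewrite /dif addrA subrK.
rewrite [leRHS]addrC; apply: le_trans (lerD (IH (g + unit_shift p i *+ l i)) (h1 _)).
by apply: le_trans (ler_normD _ _); rewrite addrA subrK.
Qed.

End coarse_cells.

(* [r], [w], [z] and [g] stand for rho, div z, z and grad div z; the energy [E] bounds
   the pairings of w and g with test functions. *)
Section approximants.
Context {R : realType} {d : nat}.
Variables (al M V T : R) (rho0 : 'rV[R]_d -> R).
Local Notation ST := (measurableTypeR R * 'rV[R]_d)%type.

Record approximant (C e : R) (j : nat) (r w : R -> 'rV[R]_d -> R)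
    (z g : R -> 'rV[R]_d -> 'rV[R]_d) (E : R -> R) : Prop := Approximant {
  ap_r : forall t x, al <= r t x <= M;
  ap_E : forall t, 1 <= E t;
  ap_z : forall t x, enorm (z t x) <= 1 + e;
  ap_bmr : forall t, bm setT (r t);
  ap_bmw : forall t, bm setT (w t);
  ap_bmz : forall t i, bm setT (fun x => z t x 0 i);
  ap_bmg : forall t i, bm setT (fun x => g t x 0 i);
  ap_slabr : bm (slab T : set ST) (fun q => r q.1 q.2);
  ap_slabw : bm (slab T : set ST) (fun q => w q.1 q.2);
  ap_slabz : forall i, bm (slab T : set ST) (fun q => z q.1 q.2 0 i);
  ap_slabg : forall i, bm (slab T : set ST) (fun q => g q.1 q.2 0 i);
  ap_slabE : bm (slab T : set ST) (fun q => E q.1);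
  ap_intE : \int[@spacetime R d]_(q in slab T) E q.1 <= C;
  ap_L2 : \int[spacetime]_(q in slab T)
    (w q.1 q.2 ^+ 2 + \sum_i z q.1 q.2 0 i ^+ 2 + \sum_i g q.1 q.2 0 i ^+ 2) <= C;
  ap_w2 : forall t, \int[torus d]_x (w t x ^+ 2) <= E t;
  ap_mass : forall t, 0 <= t <= T ->
    `|\int[torus d]_x r t x - \int[torus d]_x rho0 x| <= e;
  ap_tv : forall t zeta B, 0 <= t <= T -> torus_test_field zeta ->
    (forall x, enorm (zeta x) <= 1) -> (forall i, test_bound (fun x => zeta x 0 i) B) ->
    - (\int[torus d]_x (r t x * diverg zeta x)) <= V + C * (1 + B) * e;
  ap_sub : forall t zeta B, 0 <= t <= T -> torus_test_field zeta ->
    (forall x, enorm (zeta x) <= 1) -> (forall i, test_bound (fun x => zeta x 0 i) B) ->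
    - (\int[torus d]_x (r t x * diverg zeta x)) <=
    - (\int[torus d]_x (r t x * w t x)) + C * (1 + B) * e * E t;
  ap_div : forall t phi B, 0 <= t <= T -> torus_test phi -> test_bound phi B ->
    `|\int[torus d]_x (dot (z t x) (grad phi x)) + \int[torus d]_x (w t x * phi x)| <=
    C * (1 + B) * e * E t;
  ap_grad : forall t phi B i, 0 <= t <= T -> torus_test phi -> test_bound phi B ->
    `|\int[torus d]_x (w t x * 'D_(unitv i) phi x) + \int[torus d]_x (g t x 0 i * phi x)| <=
    C * (1 + B) * e * E t;
  ap_eq : forall u B, spacetime_test T u -> stest_bound T u B ->
    `|\int[spacetime]_(q in slab T)
        (r q.1 q.2 * time_deriv u q +
         r q.1 q.2 * dot (g q.1 q.2) (grad (fun x => u (q.1, x)) q.2)) +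
      \int[torus d]_x (rho0 x * u (0, x))| <= C * (1 + B) * e;
  ap_code : forall q t, (q.+1 * q.+1 <= j)%N -> 0 <= t <= T ->
    exists A : 'rV['I_(q.+1 * q.+1).-1.+1]_d -> R,
      (forall h, al <= A h <= M) /\
      \int[torus d]_x `|r t x - A (cell (q.+1 * q.+1).-1 x)| <= C / q.+1%:R + C * e;
  ap_equi : forall q s t kap, (q.+1 * q.+1 <= j)%N -> 0 <= s <= T -> 0 <= t <= T -> 0 < kap ->
    \int[torus d]_x `|r t x - r s x| <=
    C * (e + q.+1%:R^-1 + q.+1%:R * (kap + (`|t - s| + e) / kap)) }.

End approximants.

(** * Compactness in space and time of one discrete solution *)

Section step_compactness.
Context {R : realType} {d : nat}.
Variables (al M V T e : R) (rho0 : 'rV[R]_d -> R) (j : nat).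
Variable S : scheme al M V T rho0 e j.
Hypotheses (al_gt0 : 0 < al) (al_le_M : al <= M) (V_ge0 : 0 <= V)
  (T_gt0 : 0 < T) (brho0 : bm setT rho0) (e_gt0 : 0 < e) (e_le : e <= 2^-1).

Local Notation n := (sp S).+1.
Local Notation K := (sK S).
Local Notation G := 'rV['I_(sp S).+1]_d.
Local Notation es := (unit_shift (sp S)).
Local Notation tau := (T / K%:R).

Variable q : nat.
Hypothesis qn : (q.+1 * q.+1 <= j)%N.
Local Notation Q := q.+1.
(** Box averages run over m points, a length of about 1 / Q. On the coarse grid, of mesh width 1 /
    Q^2, averages of bounded functions vary by O(1 / Q) within a cell. *)
Let m := (n %/ Q)%N.

Let n0 : 0 < n%:R :> R. Proof. by rewrite ltr0n. Qed.
Let Q0 : 0 < Q%:R :> R. Proof. by rewrite ltr0n. Qed.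
Let QQn : (Q * Q <= n)%N. Proof. exact: leq_trans qn (leq_trans (sp_large S) (leqnSn _)). Qed.
Let m_gt0 : (0 < m)%N.
Proof. by rewrite divn_gt0// (leq_trans _ QQn)// leq_pmulr. Qed.
Let m0 : 0 < m%:R :> R. Proof. by rewrite ltr0n. Qed.
Let mn : m%:R / n%:R <= Q%:R^-1 :> R.
Proof. by rewrite ler_pdivrMr// ler_pdivlMl// -natrM ler_nat mulnC leq_divM. Qed.
Let nm : n%:R / m%:R <= 2 * Q%:R :> R.
Proof.
rewrite ler_pdivrMr// -!natrM ler_nat.
have h := ltn_ceil n (ltn0Sn q); rewrite -/m in h.
have mm := m_gt0; apply: leq_trans (ltnW h) _; move: m mm => a a0.
by rewrite mulnAC; rewrite leq_mul// mul2n -addnn -addn1 leq_add2l.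
Qed.
Let M0 : 0 <= M. Proof. by rewrite (le_trans _ al_le_M)// ltW. Qed.

Let bx (f : G -> R) := box m (axes es) f.

Lemma grad_bound k : (k <= K)%N -> avg (fun x => n%:R * enorm (\row_i dif (es i)
    (smoothen es (sL S) (srho S k)) x)) <= 4 * V + 4.
Proof.
move=> kK; have h1 := step_grad_le V_ge0 e_gt0 e_le kK; have h2 := srho_tv S _ kK.
have e0 := e_gt0; have el := e_le; have V0 := V_ge0.
have eV : e * V <= 2^-1 * V by rewrite ler_wpM2r.
lra.
Qed.

(** The bound on first differences that is uniform in e holds for the smoothed density F, see
    [grad_bound]. The box average is therefore compared with F, which is e-close to [srho] in the
    mean, before and after averaging. *)
Lemma avg_box_srho k : (k <= K)%N ->
  avg (fun x => `|srho S k x - bx (srho S k) x|) <= 2 * e + d%:R * (4 * V + 4) / Q%:R.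
Proof.
move=> kK; set F := smoothen es (sL S) (srho S k).
have V0 : 0 <= 4 * V + 4 by have := V_ge0; lra.
have h1 : avg (fun x => `|F x - srho S k x|) <= e by exact: srho_smoothen.
have h2 : avg (fun x => `|bx (fun y => F y - srho S k y) x|) <= e.
  by apply: le_trans (avg_norm_box _ _ _) h1.
have h3 : avg (fun x => `|bx F x - F x|) <= d%:R * (4 * V + 4) / Q%:R.
  apply: le_trans (avg_box_sub m_gt0 _ _) _; rewrite big_map big_enum/=.
  apply: (@le_trans _ _ (m%:R / n%:R * (d%:R * (4 * V + 4)))); last first.
    by rewrite mulrC ler_wpM2l// mulr_ge0.
  rewrite -mulrA; apply: ler_wpM2l; first exact: ltW m0.
  rewrite ler_pdivlMl//.
  rewrite mulr_sumr -[X in X%:R * _]card_ord mulr_natl -sumr_const; apply: ler_sum => i _.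
  apply: le_trans (grad_bound kK); exact: avg_norm_dif_smoothen.
apply: (@le_trans _ _ (avg (fun x => (`|F x - srho S k x| + `|bx F x - F x|) +
   `|bx (fun y => F y - srho S k y) x|))).
  apply: le_avg => x; rewrite /bx boxB.
  have -> : srho S k x - box m (axes es) (srho S k) x =
    - (F x - srho S k x) - (box m (axes es) F x - F x) +
     (box m (axes es) F x - box m (axes es) (srho S k) x) by ring.
  apply: le_trans (ler_normD _ _) _; rewrite lerD2r.
  by apply: le_trans (ler_normB _ _) _; rewrite normrN.
by rewrite !avgD; apply: le_trans (lerD (lerD h1 h3) h2) _; move: (_ / Q%:R) => X; lra.
Qed.

(** A is the box average of the clipped density, sampled at the nodes of the coarse grid and clipped
    again, which keeps it in [al, M] and is a contraction. *)
Lemma step_code k : (k <= K)%N -> exists A : 'rV['I_(Q * Q).-1.+1]_d -> R,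
  (forall h, al <= A h <= M) /\
  \int[torus d]_x `|sclip S k (cell (sp S) x) - A (cell (Q * Q).-1 x)| <=
    (d%:R * (4 * V + 4) + 8 * d%:R * M) / Q%:R + 4 * e.
Proof.
move=> kK; pose P := (Q * Q).-1; have PQ : P.+1 = (Q * Q)%N by rewrite prednK// muln_gt0.
pose F := bx (sclip S k).
pose A (h : 'rV['I_P.+1]_d) := clip al M (F (cell (sp S) (node h : 'rV[R]_d))).
exists A; split; first by move=> h; exact: (clip_itv al_gt0 al_le_M (lexx 0)).
have rM x : `|sclip S k x| <= M.
  have /andP[a1 a2] := sclip_itv al_gt0 al_le_M k x (S := S).
  by rewrite ger0_norm// (le_trans _ a1)// ltW.
have h1 : avg (fun x => `|sclip S k x - F x|) <= d%:R * (4 * V + 4) / Q%:R + 4 * e.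
  have c1 := avg_srho_sclip e_gt0 kK (S := S).
  have c2 := avg_box_srho kK.
  have c3 : avg (fun x => `|bx (fun y => srho S k y - sclip S k y) x|) <= e.
    by apply: le_trans (avg_norm_box _ _ _) c1.
  apply: (@le_trans _ _ (avg (fun x => (`|srho S k x - sclip S k x| + `|srho S k x - bx (srho S k) x|) +
    `|bx (fun y => srho S k y - sclip S k y) x|))); last first.
    by rewrite !avgD; apply: le_trans (lerD (lerD c1 c2) c3) _; move: (_ / Q%:R) => X; lra.
  apply: le_avg => x; rewrite /F /bx boxB.
  have -> : sclip S k x - box m (axes es) (sclip S k) x =
    - (srho S k x - sclip S k x) + (srho S k x - box m (axes es) (srho S k) x) +
     (box m (axes es) (srho S k) x - box m (axes es) (sclip S k) x) by ring.
  apply: le_trans (ler_normD _ _) _; rewrite lerD2r.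
  by apply: le_trans (ler_normD _ _) _; rewrite normrN.
have h2 (x : 'rV[R]_d) : `|F (cell (sp S) x) - F (cell (sp S) (node (cell P x) : 'rV[R]_d))| <= 8 * d%:R * M / Q%:R.
  have [l [hl ->]] := cell_coarse (sp S) P x.
  have dF i h : `|dif (es i) F h| <= 2 * M / m%:R.
    by apply: norm_dif_box => //; exact: mem_axes.
  apply: le_trans (dif_sum_le l (index_enum 'I_d) _ dF) _.
  have lP i : (l i)%:R <= 2 * (n%:R / P.+1%:R) :> R.
    apply: le_trans (hl i) _; rewrite mulrDl mul1r lerD2l ler_pdivlMr ?ltr0n// mul1r ler_nat PQ.
    exact: QQn.
  apply: (@le_trans _ _ (2 * M / m%:R * (d%:R * (2 * (n%:R / P.+1%:R))))).
    apply: ler_wpM2l; first by rewrite divr_ge0 ?mulr_ge0// ltW.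
    by rewrite -[X in X%:R * _]card_ord mulr_natl -sumr_const; apply: ler_sum => i _.
  rewrite PQ natrM.
  have -> : 2 * M / m%:R * (d%:R * (2 * (n%:R / (Q%:R * Q%:R)))) =
    4 * M * d%:R / (Q%:R * Q%:R) * (n%:R / m%:R) by field; rewrite !gt_eqF.
  apply: (@le_trans _ _ (4 * M * d%:R / (Q%:R * Q%:R) * (2 * Q%:R))).
    by rewrite ler_wpM2l// divr_ge0 ?mulr_ge0// ltW.
  by rewrite le_eqVlt; apply/orP; left; apply/eqP; field; rewrite gt_eqF.
have b1 := bm_cell (fun g => `|sclip S k g - F g|) : bm setT (fun x : 'rV[R]_d => _).
have b2 : bm setT (fun x : 'rV[R]_d => sclip S k (cell (sp S) x)) by exact: bm_cell.
have b3 : bm setT (fun x : 'rV[R]_d => A (cell P x)) by exact: bm_cell.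
apply: (@le_trans _ _ (\int[torus d]_x (`|sclip S k (cell (sp S) x) - F (cell (sp S) x)| + 8 * d%:R * M / Q%:R))).
  apply: le_Rintegral => //.
  - by apply: torus_integrable; apply: bm_norm; exact: bmB.
  - by apply: torus_integrable; apply: bmD => //; exact: bm_cst.
  move=> x _; have := h2 x; set a := sclip _ _ _; set b := F _ => h.
  have ea : clip al M a = a by rewrite (clip_id al_gt0 al_le_M (lexx 0))//; exact: sclip_itv.
  rewrite -[X in `|X - _|]ea.
  apply: le_trans (clip_lip al_gt0 al_le_M (lexx 0) (F (cell (sp S) (node (cell P x) : 'rV[R]_d))) a) _.
  by apply: le_trans (ler_distD b _ _) _; rewrite lerD2l.
rewrite RintegralD//; first last.
- by apply: torus_integrable; exact: bm_cst.
- exact: torus_integrable.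
rewrite (Rintegral_cell (fun g => `|sclip S k g - F g|)).
have -> : \int[torus d]_(x in [set: 'rV[R]_d]) (8 * d%:R * M / Q%:R) = 8 * d%:R * M / Q%:R.
  have := Rintegral_cell (R := R) (d := d) (p := sp S) (fun=> 8 * d%:R * M / Q%:R).
  by rewrite avg_cst.
by rewrite (mulrDl _ (8 * d%:R * M)) [leRHS]addrAC lerD2r; exact: h1.
Qed.

(** The increment in time is tested with an averaged sign, whose difference quotients are at most 4
    Q. Young's inequality with weight kap balances the total dissipation against the elapsed
    time. *)
Lemma step_test k l (sg : G -> R) (kap : R) : (k <= l)%N -> (l <= K)%N -> 0 < kap ->
  (forall g, `|sg g| <= 1) ->
  avg (fun g => (srho S l g - srho S k g) * box m [seq - h | h <- axes es] sg g) <=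
  2 * Q%:R * M * (kap * ((2 * V + 2) / al) + d%:R * ((l - k)%:R * tau / kap)).
Proof.
move=> kl lK kap0 sg1; set psi := box _ _ sg.
have K0 : 0 < K%:R :> R by rewrite ltr0n sK_gt0.
have tau0 : 0 < tau by rewrite divr_gt0.
have dpsi i g : `|n%:R * dif (es i) psi g| <= 4 * Q%:R.
  have h : `|dif (- es i) psi (g + es i)| <= 2 * 1 / m%:R.
    by apply: norm_dif_box => //; apply/mapP; exists (es i) => //; exact: mem_axes.
  have -> : dif (es i) psi g = - dif (- es i) psi (g + es i) by rewrite /dif addrK opprB.
  rewrite normrM normrN ger0_norm ?(ltW n0)//.
  apply: (@le_trans _ _ (n%:R * (2 * 1 / m%:R))); first by rewrite ler_wpM2l// ltW.
  have -> : n%:R * (2 * 1 / m%:R) = 2 * (n%:R / m%:R) :> R by ring.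
  by have := nm; lra.
pose c := 2 * Q%:R * M.
have c0 : 0 <= c by rewrite /c !mulr_ge0// ltW.
have step i0 : avg (fun g => (srho S i0.+1 g - srho S i0 g) * psi g) <=
    c * (kap * (tau * \sum_i avg (fun g => sgrad S i0 i g ^+ 2)) + d%:R * (tau / kap)).
  rewrite srho_step.
  have -> : c * (kap * (tau * \sum_i avg (fun g => sgrad S i0 i g ^+ 2)) + d%:R * (tau / kap)) =
    tau * \sum_(i < d) c * (kap * avg (fun g => sgrad S i0 i g ^+ 2) + kap^-1).
    rewrite -mulr_sumr big_split/= sumr_const card_ord -mulr_sumr -[_ *+ d]mulr_natl; ring.
  rewrite ler_wpM2l ?(ltW tau0)//; apply: ler_sum => i _.
  apply: le_trans (ler_norm _) _; apply: le_trans (le_norm_avg _) _.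
  apply: (@le_trans _ _ (avg (fun g => c * (kap * sgrad S i0 i g ^+ 2 + kap^-1)))); last first.
    by rewrite !(avgZ, avgD) avg_cst.
  apply: le_avg => g; rewrite -/(sgrad S i0 i g); set a := sgrad S i0 i g.
  apply: (@le_trans _ _ ((M * `|a|) * (4 * Q%:R))).
    rewrite normrM; apply: ler_pM => //; rewrite normrM ler_wpM2r//.
    have /andP[a1 a2] := smob_itv S i0 i g.
    by rewrite ger0_norm// (le_trans _ a1)// ltW.
  have h : 2 * `|a| <= kap * a ^+ 2 + kap^-1.
    have : 0 <= kap^-1 * (kap * `|a| - 1) ^+ 2 by rewrite mulr_ge0 ?sqr_ge0// invr_ge0 ltW.
    rewrite -[a ^+ 2]real_normK ?num_real//.
    have -> : kap^-1 * (kap * `|a| - 1) ^+ 2 = kap * `|a| ^+ 2 + kap^-1 - 2 * `|a|.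
      by field; rewrite gt_eqF.
    by rewrite subr_ge0.
  have -> : M * `|a| * (4 * Q%:R) = c * (2 * `|a|) by rewrite /c; ring.
  by rewrite ler_wpM2l.
pose D i0 := \sum_i avg (fun g => sgrad S i0 i g ^+ 2).
have D0 i0 : 0 <= D i0 by apply: sumr_ge0 => i _; exact: avg_sqr_ge0.
have key l0 : (k <= l0)%N -> avg (fun g => (srho S l0 g - srho S k g) * psi g) <=
    c * (kap * (tau * \sum_(k <= i0 < l0) D i0) + d%:R * ((l0 - k)%:R * tau / kap)).
  elim: l0 => [|l0 IH].
    rewrite leqn0 => /eqP ->; rewrite big_nil subn0 !(mul0r, mulr0, addr0).
    by rewrite (eq_avg (g := fun=> 0)) ?avg_cst// => g; rewrite subrr mul0r.
  rewrite leq_eqVlt => /orP[/eqP <-|].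
    rewrite big_geq// subnn !(mul0r, mulr0, addr0).
    by rewrite (eq_avg (g := fun=> 0)) ?avg_cst// => g; rewrite subrr mul0r.
  rewrite ltnS => kl0; rewrite big_nat_recr//= subSn// -natr1.
  have := IH kl0; have := step l0; rewrite -/(D l0) => h1 h2.
  rewrite (eq_avg (g := fun g => (srho S l0.+1 g - srho S l0 g) * psi g +
     (srho S l0 g - srho S k g) * psi g)); last by move=> g; ring.
  rewrite avgD; apply: le_trans (lerD h1 h2) _.
  by rewrite le_eqVlt; apply/orP; left; apply/eqP; ring.
apply: le_trans (key l kl) _; rewrite -/c ler_wpM2l// lerD2r ler_wpM2l ?(ltW kap0)//.
apply: le_trans (sdissip S); rewrite ler_wpM2l ?(ltW tau0)//.
apply: (@le_trans _ _ (\sum_(0 <= i0 < K) D i0)); last by rewrite big_mkord.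
rewrite (@big_cat_nat _ _ _ k 0 K)//= ?(leq_trans kl)// (@big_cat_nat _ _ _ l k K)//=.
by rewrite addrCA lerDl addr_ge0// sumr_ge0.
Qed.

(** The L1 norm of the averaged increment is its pairing with its own sign; by adjointness the
    average moves to the sign and [step_test] applies. The rest is the distance of the densities to
    their averages. *)
Lemma step_equicontinuous k l (kap : R) : (k <= l)%N -> (l <= K)%N -> 0 < kap ->
  avg (fun g => `|sclip S l g - sclip S k g|) <=
  4 * e + 2 * (d%:R * (4 * V + 4)) / Q%:R +
  2 * Q%:R * M * (kap * ((2 * V + 2) / al) + d%:R * ((l - k)%:R * tau / kap)).
Proof.
move=> kl lK kap0; have kK := leq_trans kl lK.
pose D g := srho S l g - srho S k g.
pose sg g := Num.sg (bx D g).
have h1 : avg (fun g => `|bx D g|) <=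
    2 * Q%:R * M * (kap * ((2 * V + 2) / al) + d%:R * ((l - k)%:R * tau / kap)).
  apply: le_trans (step_test kl lK kap0 (sg := sg) _); last first.
    by move=> g; rewrite /sg normr_sg; case: (_ == _).
  rewrite -/D -avg_box_adjoint le_eqVlt; apply/orP; left; apply/eqP.
  by apply: eq_avg => g; rewrite /sg mulrC -normrEsg.
have h2 := avg_box_srho lK; have h3 := avg_box_srho kK.
apply: (@le_trans _ _ (avg (fun g => (`|srho S l g - bx (srho S l) g| + `|srho S k g - bx (srho S k) g|) +
   `|bx D g|))); last first.
  by rewrite !avgD; apply: le_trans (lerD (lerD h2 h3) h1) _; rewrite -[2 * _ / _]mulrA; move: (_ / Q%:R) => X; lra.
apply: le_avg => g; apply: le_trans (clip_lip al_gt0 al_le_M (lexx 0) _ _) _.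
have -> : srho S l g - srho S k g = (srho S l g - bx (srho S l) g) - (srho S k g - bx (srho S k) g) + bx D g.
  by rewrite /bx /D boxB; ring.
apply: le_trans (ler_normD _ _) _; rewrite lerD2r; exact: ler_normB.
Qed.

End step_compactness.

(** The summands of [approx_const] become variables here, so that linear arithmetic need not look
    into them. *)
Lemma approx_const_bounds {R : realFieldType} (C V a b c f g w h k m : R) :
  0 <= V -> 0 <= a -> 0 <= b -> 0 <= c -> 0 <= f -> 0 <= g -> 0 <= w -> 0 <= h -> 0 <= k -> 0 <= m ->
  C = a + b + 1 + (4 * V + 4 + c) + (V + 1) + 2 + (1 + f) + g + w + (h + k) + 4 + 2 * h + m ->
  [/\ a + b <= C, V + 1 + 4 * V + 4 <= C /\ 2 + 4 * V + 4 <= C, c <= C,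
    1 + f <= C & [/\ g <= C, w <= C, h + k <= C, 4 <= C & 2 * h <= C /\ m <= C]].
Proof. by move=> ? ? ? ? ? ? ? ? ? ? ->; do !split; lra. Qed.

Section approximant_of_scheme.
Context {R : realType} {d : nat}.
Variables (al M V T : R) (rho0 : 'rV[R]_d -> R).
Hypotheses (d_gt0 : (0 < d)%N) (al_gt0 : 0 < al) (al_le_M : al <= M) (V_ge0 : 0 <= V)
  (T_gt0 : 0 < T) (brho0 : bm setT rho0).
Local Notation ST := (measurableTypeR R * 'rV[R]_d)%type.

Definition approx_const : R :=
  let C8 := (2 * V + 2) / al in let E8 := T + (d%:R + 1) * C8 in let U := \int[torus d]_x `|rho0 x| in
  E8 + (1 + d%:R * 4) * T + 1 +
  (4 * V + 4 + (2 + 2 * M) * d%:R ^+ 2) + (V + 1) + 2 +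
  (1 + 3 * d%:R ^+ 2) + 3 * d%:R + weak_const (d := d) M * (E8 + U) +
  (d%:R * (4 * V + 4) + 8 * d%:R * M) + 4 + 2 * (d%:R * (4 * V + 4)) +
  2 * M * (C8 + d%:R).

Lemma approximant_of_scheme (e : R) (j : nat) (S : scheme al M V T rho0 e j) :
  0 < e -> e <= 2^-1 ->
  approximant al M V T rho0 approx_const e j
    (fun t x => sclip S (tick T (sK S) t) (cell (sp S) x))
    (fun t x => sw S (tick T (sK S) t) (cell (sp S) x))
    (fun t x => sfield S (tick T (sK S) t) (cell (sp S) x))
    (fun t x => \row_i sgrad S (tick T (sK S) t) i (cell (sp S) x))
    (fun t => senergy S (tick T (sK S) t)).
Proof.
move=> e0 el; set tk := tick T (sK S); set ce := cell (sp S).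
have M0 : 0 <= M by rewrite (le_trans _ al_le_M)// ltW.
have V0 := V_ge0; have T0 := ltW T_gt0; have eW := ltW e0.
pose C8 := (2 * V + 2) / al; pose E8 := T + (d%:R + 1) * C8; pose U := \int[torus d]_x `|rho0 x|.
have C80 : 0 <= C8 by rewrite divr_ge0 ?(ltW al_gt0)// addr_ge0// mulr_ge0.
have E80 : 0 <= E8 by rewrite addr_ge0// mulr_ge0// addr_ge0.
have U0 : 0 <= U by apply: Rintegral_ge0.
have p1 : 0 <= (1 + d%:R * 4) * T by rewrite mulr_ge0// addr_ge0// mulr_ge0.
have p2 : 0 <= 4 * V + 4 by lra.
have p3 : 0 <= (2 + 2 * M) * d%:R ^+ 2 by rewrite mulr_ge0 ?sqr_ge0// addr_ge0// mulr_ge0.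
have p4 : 0 <= 3 * d%:R ^+ 2 :> R by rewrite mulr_ge0 ?sqr_ge0.
have p5 : 0 <= 3 * d%:R :> R by rewrite mulr_ge0.
have wc0 : 0 <= weak_const (d := d) M.
  have h1 : 0 <= M * d%:R by rewrite mulr_ge0.
  have h2 : 0 <= d%:R :> R by [].
  have h3 : 0 <= M * d%:R * d%:R by rewrite mulr_ge0.
  rewrite /weak_const; lra.
have p6 : 0 <= weak_const (d := d) M * (E8 + U) by apply: mulr_ge0 => //; exact: addr_ge0.
have p7 : 0 <= d%:R * (4 * V + 4) by rewrite mulr_ge0.
have p8 : 0 <= 8 * d%:R * M by rewrite !mulr_ge0.
have p9 : 0 <= 2 * M * (C8 + d%:R) by rewrite !mulr_ge0// addr_ge0.
have [cab [cV cV'] c2 cf [cg cw ck c4 [ch cm]]] :=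
  approx_const_bounds V0 E80 p1 p3 p4 p5 p6 p7 p8 p9 (erefl approx_const).
have ca : E8 <= approx_const by apply: le_trans cab; rewrite lerDl.
set C := approx_const in ca cab cV cV' c2 cf cg cw ck c4 ch cm *; clearbody C.
have tK t : 0 <= t <= T -> (tk t <= sK S)%N by exact: (tick_le T_gt0 (sK_gt0 S)).
have E1 t : 1 <= senergy S (tk t) by exact: senergy_ge1.
have intE : \int[@spacetime R d]_(q in slab T) senergy S (tk q.1) <= E8.
  have := Rintegral_step T_gt0 (sK_gt0 S) (fun k (_ : 'rV['I_(sp S).+1]_d) => senergy S k) (R := R) (d := d).
  move=> ->; rewrite (eq_bigr (fun k : 'I_(sK S) => senergy S k)); last by move=> k _; rewrite avg_cst.
  exact: sum_senergy.
have eB B (c : R) X : 0 <= c -> c <= C -> 0 <= B -> 0 <= X -> c * B * e * X <= C * (1 + B) * e * X.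
  move=> c0 cC B0 X0; rewrite ler_wpM2r// ler_wpM2r//; apply: ler_pM => //; by rewrite lerDr.
split.
- by move=> t x; exact: sclip_itv.
- exact: E1.
- by move=> t x; exact: sfield_le.
- by move=> t; exact: bm_cell.
- by move=> t; exact: bm_cell.
- by move=> t i; exact: (bm_cell (fun h => sfield S (tk t) h 0 i)).
- by move=> t i; exact: (bm_cell (fun h => (\row_i sgrad S (tk t) i h) 0 i)).
- exact: bm_step.
- exact: bm_step.
- by move=> i; exact: (bm_step (S := S) T_gt0 (fun k h => sfield S k h 0 i)).
- by move=> i; exact: (bm_step (S := S) T_gt0 (fun k h => (\row_i sgrad S k i h) 0 i)).
- exact: (bm_step (S := S) T_gt0 (fun k h => senergy S k)).
- exact: le_trans intE ca.
- have bz := bm_step (S := S) T_gt0 (fun k h => sw S k h ^+ 2 + \sum_i sfield S k h 0 i ^+ 2 +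
      \sum_i (\row_i sgrad S k i h) 0 i ^+ 2).
  have := Rintegral_step T_gt0 (sK_gt0 S) (fun k h => sw S k h ^+ 2 + \sum_i sfield S k h 0 i ^+ 2 +
      \sum_i (\row_i sgrad S k i h) 0 i ^+ 2) (R := R) (d := d).
  move=> ->.
  apply: (@le_trans _ _ (T / (sK S)%:R * \sum_(k < sK S) (senergy S k + d%:R * 4))).
    rewrite ler_wpM2l ?divr_ge0//; apply: ler_sum => k _; rewrite !avgD !avg_sum.
    have h1 : \sum_i avg (fun h => sfield S k h 0 i ^+ 2) <= d%:R * 4.
      rewrite -[X in X%:R * _]card_ord mulr_natl -sumr_const; apply: ler_sum => i _.
      apply: avg_le_cst => h; rewrite -[_ ^+ 2]real_normK ?num_real//.
      have -> : 4 = 2 ^+ 2 :> R by ring.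
      rewrite ler_pXn2r ?nnegrE//; apply: le_trans (norm_coord_enorm _ _) _.
      apply: le_trans (sfield_le (S := S) e0 _ _) _; lra.
    have h2 : \sum_i avg (fun h => (\row_i sgrad S k i h) 0 i ^+ 2) = \sum_i avg (fun h => sgrad S k i h ^+ 2).
      by apply: eq_bigr => i _; apply: eq_avg => h; rewrite mxE.
    rewrite h2 /senergy; move: h1; lra.
  rewrite big_split/= sumr_const card_ord mulrDr -[(_ * 4) *+ _]mulr_natl mulrA divfK; last first.
    by rewrite gt_eqF// ltr0n sK_gt0.
  have := sum_senergy S T_gt0; rewrite -/C8 -/E8 => h.
  have h1 : T * (d%:R * 4) <= (1 + d%:R * 4) * T by lra.
  exact: le_trans (lerD h h1) cab.
- move=> t; rewrite (Rintegral_cell (fun g => sw S (tk t) g ^+ 2)).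
  have : 0 <= \sum_i avg (fun h => sgrad S (tk t) i h ^+ 2).
    by apply: sumr_ge0 => i _; exact: avg_sqr_ge0.
  rewrite /senergy; lra.
- move=> t tT; have := step_mass brho0 e0 (tK t tT).
  by rewrite -(Rintegral_cell (sclip S (tk t))).
- move=> t zeta B tT tz z1 tB; have B0 : 0 <= B by have [] := tB (Ordinal d_gt0).
  apply: le_trans (step_tv_pairing d_gt0 al_gt0 al_le_M V_ge0 e0 el (tK t tT) tz z1 tB) _.
  have h1 := srho_tv S _ (tK t tT).
  apply: le_trans (lerD h1 (lexx _)) _.
  have -> : (1 + e) * V + e + e * (4 * V + 4 + (2 + 2 * M) * d%:R ^+ 2 * B) =
    V + e * ((V + 1 + 4 * V + 4) + (2 + 2 * M) * d%:R ^+ 2 * B) by ring.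
  rewrite lerD2l [leRHS]mulrC ler_wpM2l// mulrDr mulr1; apply: lerD; first exact: cV.
  by rewrite ler_wpM2r.
- move=> t zeta B tT tz z1 tB; have B0 : 0 <= B by have [] := tB (Ordinal d_gt0).
  apply: le_trans (step_tv_pairing d_gt0 al_gt0 al_le_M V_ge0 e0 el (tK t tT) tz z1 tB) _.
  have h1 := step_curv_le (S := S) e0 (tK t tT).
  have -> : \int[torus d]_x (sclip S (tk t) (ce x) * sw S (tk t) (ce x)) =
    avg (fun g => sclip S (tk t) g * sw S (tk t) g).
    exact: (Rintegral_cell (fun g => sclip S (tk t) g * sw S (tk t) g)).
  apply: le_trans (lerD h1 (lexx _)) _; rewrite -addrA lerD2l.
  have X0 : 0 <= 4 * V + 4 + (2 + 2 * M) * d%:R ^+ 2 * B by rewrite addr_ge0// mulr_ge0.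
  have h2 : e * (4 * V + 4 + (2 + 2 * M) * d%:R ^+ 2 * B) * 1 <=
     e * (4 * V + 4 + (2 + 2 * M) * d%:R ^+ 2 * B) * senergy S (tk t).
    by rewrite ler_wpM2l ?E1// mulr_ge0.
  rewrite mulr1 in h2; apply: le_trans (lerD (lexx _) h2) _.
  rewrite -mulrDl ler_wpM2r ?(le_trans ler01 (E1 t))//.
  have -> : 2 * e + e * (4 * V + 4 + (2 + 2 * M) * d%:R ^+ 2 * B) =
    e * ((2 + 4 * V + 4) + (2 + 2 * M) * d%:R ^+ 2 * B) by ring.
  rewrite [leRHS]mulrC ler_wpM2l// mulrDr mulr1; apply: lerD; first exact: cV'.
  by rewrite ler_wpM2r.
- move=> t phi B tT tphi tB; have B0 : 0 <= B by have [] := tB.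
  apply: le_trans (step_weak_div S d_gt0 e0 el (tk t) tphi tB) _.
  by apply: eB; [rewrite addr_ge0|exact: cf|exact: B0|exact: le_trans ler01 (E1 t)].
- move=> t phi B i tT tphi tB; have B0 : 0 <= B by have [] := tB.
  have -> : \int[torus d]_x ((\row_i sgrad S (tk t) i (ce x)) 0 i * phi x) =
     \int[torus d]_x (sgrad S (tk t) i (ce x) * phi x).
    by apply: eq_Rintegral => x _; rewrite mxE.
  apply: le_trans (step_weak_grad S d_gt0 e0 (tk t) i tphi tB) _.
  by apply: eB; [exact: p5|exact: cg|exact: B0|exact: le_trans ler01 (E1 t)].
- move=> u B tu tB; have B0 : 0 <= B by have [] := tB.
  apply: le_trans (step_weak_equation S al_gt0 al_le_M T_gt0 brho0 e0 tu tB) _.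
  apply: (@le_trans _ _ (weak_const (d := d) M * B * e * (E8 + U))).
    by rewrite ler_wpM2l ?mulr_ge0// lerD2r; exact: sum_senergy.
  have -> : weak_const (d := d) M * B * e * (E8 + U) = weak_const (d := d) M * (E8 + U) * B * e * 1 by ring.
  by rewrite -[leRHS]mulr1; apply: eB.
- move=> q t qj tT; have [A [hA iA]] := step_code (S := S) al_gt0 al_le_M V_ge0 e0 el qj (tK t tT).
  exists A; split => //; apply: le_trans iA _; apply: lerD.
    by rewrite ler_wpM2r ?invr_ge0.
  by rewrite ler_wpM2r.
- move=> q s t kap qj.
  wlog st : s t / s <= t.
    move=> H sT tT kap0; have [st|/ltW ts] := leP s t; first exact: H.
    rewrite (_ : \int[torus d]_x _ = \int[torus d]_x `|sclip S (tk s) (ce x) - sclip S (tk t) (ce x)|).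
      by rewrite distrC; exact: H.
    by apply: eq_Rintegral => x _; rewrite distrC.
  move=> sT tT kap0; have /andP[s0 _] := sT; have /andP[t0 _] := tT.
  have st' : (tk s <= tk t)%N.
    rewrite /tk /tick; apply: le_truncn.
    by rewrite ler_wpM2r ?invr_ge0// ler_wpM2r.
  rewrite (Rintegral_cell (fun g => `|sclip S (tk t) g - sclip S (tk s) g|)).
  apply: le_trans (step_equicontinuous (S := S) al_gt0 al_le_M V_ge0 T_gt0 e0 el qj st' (tK t tT) kap0) _.
  have tau0 : 0 <= T / (sK S)%:R by rewrite divr_ge0.
  have h : (tk t - tk s)%:R * (T / (sK S)%:R) <= `|t - s| + e.
    have /andP[a1 _] := tickP T_gt0 (sK_gt0 S) t0; have /andP[_ a2] := tickP T_gt0 (sK_gt0 S) s0.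
    have a3 := stau S; rewrite natrB// mulrBl ger0_norm ?subr_ge0//.
    rewrite -natr1 mulrDl mul1r in a2; move: a1 a2 a3; rewrite -/tk.
    move: (_ * _) => X; move: (_ * _) => Y; clear; lra.
  have Q1 : 0 <= q.+1%:R :> R by [].
  have h3 : (tk t - tk s)%:R * (T / (sK S)%:R) / kap <= (`|t - s| + e) / kap.
    by rewrite ler_wpM2r// invr_ge0 ltW.
  have h4 : 0 <= (`|t - s| + e) / kap by rewrite divr_ge0 ?addr_ge0// ltW.
  have h5 : kap * C8 + d%:R * ((tk t - tk s)%:R * (T / (sK S)%:R) / kap) <=
     (C8 + d%:R) * (kap + (`|t - s| + e) / kap).
    have : d%:R * ((tk t - tk s)%:R * (T / (sK S)%:R) / kap) <= d%:R * ((`|t - s| + e) / kap).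
      by rewrite ler_wpM2l.
    have : 0 <= C8 * ((`|t - s| + e) / kap) by rewrite mulr_ge0.
    have : 0 <= d%:R * kap by rewrite mulr_ge0// ltW.
    lra.
  rewrite [leRHS]mulrDr; apply: lerD; last first.
    apply: (@le_trans _ _ (2 * q.+1%:R * M * ((C8 + d%:R) * (kap + (`|t - s| + e) / kap)))).
      by rewrite ler_wpM2l// !mulr_ge0.
    have -> : 2 * q.+1%:R * M * ((C8 + d%:R) * (kap + (`|t - s| + e) / kap)) =
      (2 * M * (C8 + d%:R)) * (q.+1%:R * (kap + (`|t - s| + e) / kap)) by ring.
    have h6 : 0 <= kap + (`|t - s| + e) / kap by apply: addr_ge0; first exact: ltW.
    by apply: ler_wpM2r; first exact: mulr_ge0.
  rewrite [leRHS]mulrDr; apply: lerD; first by rewrite ler_wpM2r.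
  by rewrite ler_wpM2r ?invr_ge0.
Qed.

Lemma approximant_exists : (forall x, al <= rho0 x <= M) ->
  (forall zeta, torus_test_field zeta -> (forall x, enorm (zeta x) <= 1) ->
    \int[torus d]_x (- rho0 x * diverg zeta x) <= V) ->
  exists2 C : R, 0 <= C & forall (e : R) (j : nat), 0 < e -> e <= 2^-1 ->
  exists r w z g E, approximant al M V T rho0 C e j r w z g E.
Proof.
move=> h1 h2.
have ex (e : R) (j : nat) : 0 < e -> e <= 2^-1 ->
    exists r w z g E, approximant al M V T rho0 approx_const e j r w z g E.
  move=> e0 el.
  have [S] := scheme_exists d_gt0 al_gt0 al_le_M V_ge0 T_gt0 (proj1 brho0) h1 h2 j e0 el.
  by do 5 eexists; exact: approximant_of_scheme S e0 el.
exists approx_const => //.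
(* The constant is nonnegative because, for any approximant, it bounds the integral of an energy
   that is at least 1. *)
have h : 0 < 2^-1 :> R by rewrite invr_gt0.
have [r [w [z [g [E [_ aE _ _ _ _ _ _ _ _ _ _ i _ _ _ _ _ _ _ _ _ _]]]]]] := ex _ 0%N h (lexx _).
by apply: le_trans i; apply: Rintegral_ge0 => q _; exact: le_trans ler01 (aE _).
Qed.

End approximant_of_scheme.

(** * Limits of sequences that converge rapidly in the mean *)

Section rapid_limits.
Context {R : realType}.

(** A limit defined at every point: the upper limit, or 0 where it is infinite. Being taken
    pointwise, it commutes with fixing t, so that the same function is the limit on space-time and
    on each time slice. *)
Definition blim {X : Type} (f : nat -> X -> R) (x : X) : R :=
  fine (limn_esup (fun k => (f k x)%:E)).

Lemma blim_dist {X : Type} (f : nat -> X -> R) k x :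
  ((`|f k x - blim f x|)%:E <= \sum_(k <= i <oo) (`|f i x - f i.+1 x|)%:E)%E.
Proof.
set S := (X in (_ <= X)%E).
have S0 : (0 <= S)%E by apply: nneseries_ge0 => n _ _; rewrite lee_fin.
case E : S S0 => [s| |] // s0; last by rewrite leey.
have h n : (k <= n)%N -> `|f k x - f n x| <= s.
  move=> kn; rewrite -lee_fin -E.
  apply: (@le_trans _ _ (\sum_(k <= i < n) (`|f i x - f i.+1 x|)%:E)%E); last first.
    by apply: nneseries_lim_ge => i _ _; rewrite lee_fin.
  rewrite sumEFin lee_fin; elim: n kn => [|n IH].
    by rewrite leqn0 => /eqP ->; rewrite subrr normr0 big_geq.
  rewrite leq_eqVlt => /orP[/eqP <-|]; first by rewrite subrr normr0 big_geq.
  rewrite ltnS => kn; rewrite big_nat_recr//=.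
  by apply: le_trans (ler_distD (f n x) _ _) _; rewrite lerD2r; exact: IH.
rewrite /blim; set L := limn_esup _.
have hU : (L <= (f k x + s)%:E)%E.
  apply: (@le_trans _ _ (ereal_sup ((fun n => (f n x)%:E) @` [set n | (k <= n)%N]))).
    apply: ereal_inf_lbound => /=; exists [set n | (k <= n)%N] => //.
    exact: nbhs_infty_ge.
  apply: ge_ereal_sup => _ [n /= kn <-]; rewrite lee_fin.
  by have := h n kn; rewrite distrC ler_distl => /andP[].
have hL : ((f k x - s)%:E <= L)%E.
  apply: le_ereal_inf_tmp => _ /= [V nV <-].
  have [n Vn kn] : exists2 n, V n & (k <= n)%N.
    have [N _ hN] := nV; exists (maxn N k); last exact: leq_maxr.
    by apply: hN => /=; exact: leq_maxl.
  apply: (@le_trans _ _ (f n x)%:E).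
    by rewrite lee_fin; have := h n kn; rewrite distrC ler_distl => /andP[].
  by apply: ereal_sup_ubound => /=; exists n.
move: L hU hL => [l| |]// hU hL; rewrite lee_fin ler_distlC /=.
by move: hU hL; rewrite !lee_fin => -> ->.
Qed.

Context {dX : measure_display} {X : measurableType dX} (mu : {measure set X -> \bar R}).
Variables (D : set X) (f : nat -> X -> R).
Hypotheses (mD : measurable D) (mf : forall k, measurable_fun D (f k)).

Lemma measurable_blim : measurable_fun D (blim f).
Proof.
apply: (measurableT_comp (f := fine)) => //.
by apply: measurable_fun_limn_esup => n; apply/measurable_EFinP; exact: mf.
Qed.

Lemma nneseries_geometric (c : R) k : 0 <= c ->
  (\sum_(k <= i <oo) (c / 2 ^+ i)%:E = (2 * c / 2 ^+ k)%:E)%E.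
Proof.
move=> c0; rewrite -(@nneseries_addn _ (fun i => (c / 2 ^+ i)%:E)); last first.
  by move=> i; rewrite lee_fin divr_ge0// exprn_ge0.
apply/cvg_lim => //; have := @cvg_geometric_eseries_half R (2 * c / 2 ^+ k) 0.
rewrite expr0 divr1; apply: cvg_trans; apply: near_eq_cvg; apply: nearW => n.
apply: eq_bigr => i _; congr EFin; rewrite natrX addn1 exprD exprS; field.
by rewrite !expf_neq0//=.
Qed.

Lemma integral_blim (c : R) k : 0 <= c ->
  (forall i, (\int[mu]_(x in D) (`|f i x - f i.+1 x|)%:E <= (c / 2 ^+ i)%:E)%E) ->
  (\int[mu]_(x in D) (`|f k x - blim f x|)%:E <= (2 * c / 2 ^+ k)%:E)%E.
Proof.
move=> c0 fc; rewrite -nneseries_geometric//.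
have mfd i : measurable_fun D (fun x => (`|f i x - f i.+1 x|)%:E).
  by apply/measurable_EFinP; apply: measurableT_comp => //; exact: measurable_funB.
have sE x : (\sum_(k <= i <oo) (`|f i x - f i.+1 x|)%:E = \sum_(i <oo) (`|f (i + k)%N x - f (i + k).+1 x|)%:E)%E.
  by rewrite -(@nneseries_addn _ (fun i => (`|f i x - f i.+1 x|)%:E)) => // i; rewrite lee_fin.
apply: (@le_trans _ _ (\int[mu]_(x in D) \sum_(i <oo) (`|f (i + k)%N x - f (i + k).+1 x|)%:E)%E).
  apply: ge0_le_integral => //.
  - apply/measurable_EFinP; apply: measurableT_comp => //; apply: measurable_funB => //.
    exact: measurable_blim.
  - apply: ge0_emeasurable_sum => [n x _ _|n _]; [by rewrite lee_fin|exact: mfd].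
  - by move=> x _; rewrite -sE; exact: blim_dist.
rewrite integral_nneseries//.
rewrite -[leRHS](@nneseries_addn _ (fun i => (c / 2 ^+ i)%:E)); last first.
  by move=> i; rewrite lee_fin divr_ge0// exprn_ge0.
by apply: lee_nneseries => *; [apply: integral_ge0 => x _; rewrite lee_fin|exact: fc].
Qed.

End rapid_limits.

(** * Subsequences by the pigeonhole principle *)

Section extraction.

Definition unbounded_nat (S : set nat) := forall N, exists2 n, S n & (N <= n)%N.

Lemma infinite_fiber (F : finType) (code : nat -> F) (S : set nat) :
  unbounded_nat S -> exists c, unbounded_nat (S `&` [set n | code n = c]).
Proof.
move=> iS; apply: contrapT => /forallNP h.
have /choice[b hb] : forall c, exists N, forall n, S n -> code n = c -> (n < N)%N.
  move=> c; have /existsNP[N hN] := h c; exists N => n Sn cn.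
  by rewrite ltnNge; apply/negP => Nn; apply: hN; exists n.
have [n Sn bn] := iS (\max_c b c).
have := hb _ n Sn erefl; rewrite ltnNge (leq_trans _ bn)//.
exact: leq_bigmax.
Qed.

(** Finite codes stand for total boundedness. Each S k is an unbounded subset of the preceding one,
    lying beyond the k-th threshold, on which the k-th code is constant; phi k is an element of S k
    that is at least k. *)
Lemma extract_close (Q : nat -> nat -> nat -> Prop) :
  (forall k, exists (F : finType) (code : nat -> F) N, forall i j, (N <= i)%N -> (N <= j)%N ->
    code i = code j -> Q k i j) ->
  exists phi : nat -> nat, (forall k, (k <= phi k)%N) /\ forall k l, (k <= l)%N -> Q k (phi k) (phi l).
Proof.
move=> codes.
have step k (S : {S : set nat | unbounded_nat S}) : {S' : {S : set nat | unbounded_nat S} |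
    sval S' `<=` sval S /\ forall i j, sval S' i -> sval S' j -> Q k i j}.
  apply: cid; case: S => S iS; have [F [code [N h]]] := codes k.
  have [c ic] := infinite_fiber code iS.
  have iS' : unbounded_nat (S `&` [set n | code n = c] `&` [set n | (N <= n)%N]).
    by move=> n; have [m [Sm cm]] := ic (maxn n N); rewrite geq_max => /andP[nm Nm]; exists m.
  exists (exist _ _ iS'); split => /= [n [[]]//|i j [[_ ci] Ni] [[_ cj] Nj]].
  by apply: h => //; rewrite ci cj.
have iT : unbounded_nat setT by move=> n; exists n.
pose S := fix S k := match k with 0 => sval (step 0%N (exist _ _ iT)) | k'.+1 => sval (step k'.+1 (S k')) end.
have Ssub k l : (k <= l)%N -> sval (S l) `<=` sval (S k).
  elim: l => [|l IH]; first by rewrite leqn0 => /eqP ->.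
  rewrite leq_eqVlt => /orP[/eqP <-//|]; rewrite ltnS => /IH h n hn; apply: h.
  by have [+ _] := svalP (step l.+1 (S l)); apply.
have SQ k i j : sval (S k) i -> sval (S k) j -> Q k i j.
  by case: k => [|k]; [have [_] := svalP (step 0%N (exist _ _ iT))|have [_] := svalP (step k.+1 (S k))]; apply.
have /choice[phi hphi] : forall k, exists n, sval (S k) n /\ (k <= n)%N.
  by move=> k; have [n Sn kn] := svalP (S k) k; exists n.
exists phi; split=> [k|k l kl]; first exact: (hphi k).2.
by apply: SQ; [exact: (hphi k).1|apply: Ssub kl _ _; exact: (hphi l).1].
Qed.

End extraction.

Section approximant_compactness.
Context {R : realType} {d : nat}.
Variables (al M V T C : R) (rho0 : 'rV[R]_d -> R).
Hypotheses (T_gt0 : 0 < T) (C_ge0 : 0 <= C).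
Variables (e : nat -> R) (r w : nat -> R -> 'rV[R]_d -> R) (z g : nat -> R -> 'rV[R]_d -> 'rV[R]_d)
  (E : nat -> R -> R).
Hypotheses (e_le : forall i, e i <= i.+1%:R^-1)
  (apx : forall i, approximant al M V T rho0 C (e i) i (r i) (w i) (z i) (g i) (E i)).
Local Notation ST := (measurableTypeR R * 'rV[R]_d)%type.

Lemma bm_dist (f h : 'rV[R]_d -> R) : bm setT f -> bm setT h -> bm setT (fun x => `|f x - h x|).
Proof. by move=> bf bh; apply: bm_norm; exact: bmB. Qed.

Lemma L1_triangle (f h k : 'rV[R]_d -> R) : bm setT f -> bm setT h -> bm setT k ->
  \int[torus d]_x `|f x - k x| <= \int[torus d]_x `|f x - h x| + \int[torus d]_x `|h x - k x|.
Proof.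
move=> bf bh bk; rewrite -RintegralD//; try by apply: torus_integrable; exact: bm_dist.
apply: le_Rintegral => //; try by apply: torus_integrable; try apply: bmD; exact: bm_dist.
by move=> x _; exact: ler_distD.
Qed.

Let equi_close (y Q kap e' a : R) : 0 < y -> Q * y = 1 -> 0 < kap -> kap <= y ^+ 2 ->
  e' <= y ^+ 2 * kap -> a <= y ^+ 2 * kap -> Q * (kap + (a + e') / kap) <= 3 * y.
Proof.
move=> y0 Qy k0 h1 h2 h3.
have h4 : (a + e') / kap <= 2 * y ^+ 2.
  by rewrite ler_pdivrMr// -mulrA; move: h2 h3; move: (_ * kap) => X; lra.
have -> : 3 * y = Q * (3 * y ^+ 2) by rewrite mulrCA expr2 (mulrA Q) Qy mul1r.
rewrite ler_wpM2l//; first by rewrite -(pmulr_lge0 _ y0) Qy.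
by move: h1 h4; move: (_ / kap) (y ^+ 2) => X Y; lra.
Qed.

(** The code records, for each time of a grid of mesh at most y^4 and each coarse cell, the value of
    the coarse density rounded to multiples of y. With kap = y^2 a time shift costs 5 C y and the
    passage to the coarse density 2 C y; two of each and the rounding give 14 C y + y, at most
    eta. *)
Lemma approximant_codes (eta : R) : 0 < eta ->
  exists (F : finType) (code : nat -> F) N, forall i j, (N <= i)%N -> (N <= j)%N ->
    code i = code j -> forall t, 0 <= t <= T -> \int[torus d]_x `|r i t x - r j t x| <= eta.
Proof.
move=> eta0; pose B := 14 * C + 1; have B0 : 0 < B by have := C_ge0; rewrite /B; lra.
have [q [y [yE hq]]] : exists (q : nat) (y : R), q.+1%:R^-1 = y /\ y <= eta / B.
  exists (Num.truncn (B / eta)); eexists; split; first exact: erefl; rewrite invf_ple ?posrE ?divr_gt0// invf_div.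
  by apply/ltW; apply: truncnS_gt.
have y0 : 0 < y by rewrite -yE.
have y1 : y <= 1 by rewrite -yE invf_le1// ler1n.
have Qy : q.+1%:R * y = 1 by rewrite -yE mulfV.
pose kap := y ^+ 2; have kap0 : 0 < kap by rewrite exprn_gt0.
pose del := y ^+ 2 * kap; have del0 : 0 < del by rewrite mulr_gt0// exprn_gt0.
pose L := (Num.truncn (T / del)).+1.
have L0 : 0 < L%:R :> R by rewrite ltr0n.
have TL : T / L%:R <= del.
  rewrite ler_pdivrMr// mulrC -ler_pdivrMr//; apply/ltW; exact: truncnS_gt.
pose N := maxn (q.+1 * q.+1) (Num.truncn (del^-1)).+1.
have eN i : (N <= i)%N -> e i <= del.
  move=> Ni; apply: le_trans (e_le i) _; rewrite invf_ple ?posrE//.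
  apply/ltW; apply: lt_le_trans (truncnS_gt _) _; rewrite ler_nat.
  by rewrite (leq_trans _ (leqnSn i))// (leq_trans _ Ni)// leq_maxr.
have qN i : (N <= i)%N -> (q.+1 * q.+1 <= i)%N by apply: leq_trans; exact: leq_maxl.
have delQ : del <= y.
  by rewrite /del /kap -exprD -[leRHS]expr1 ler_wiXn2l// ltW.
pose tl (l : 'I_L.+1) : R := T * l%:R / L%:R.
have tlT l : 0 <= tl l <= T.
  rewrite /tl divr_ge0 ?mulr_ge0 ?(ltW T_gt0)//= ler_pdivrMr// ler_pM2l//.
  by rewrite ler_nat -ltnS.
pose m := (q.+1 * q.+1).-1.
have /choice[A hA] : forall il : nat * 'I_L.+1, exists A : 'rV['I_m.+1]_d -> R, (N <= il.1)%N ->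
    (forall h, al <= A h <= M) /\
    \int[torus d]_x `|r il.1 (tl il.2) x - A (cell m x)| <= 2 * C * y.
  move=> [i l]; have [Ni|_] := leqP N i; last by exists (fun=> 0).
  have [A [h1 h2]] := ap_code (apx i) (qN _ Ni) (tlT l); exists A => _; split => //.
  apply: le_trans h2 _; have : C * e i <= C * y by rewrite ler_wpM2l// (le_trans (eN _ Ni)).
  by rewrite yE -[2 * C * y]mulrA; move: (C * _) (C * y) => X Y; lra.
pose K := Num.truncn ((M - al) / y).
pose code i : {ffun 'I_L.+1 * 'rV['I_m.+1]_d -> 'I_K.+1} :=
  [ffun lh => inord (Num.truncn ((A (i, lh.1) lh.2 - al) / y))].
exists {ffun 'I_L.+1 * 'rV['I_m.+1]_d -> 'I_K.+1}, code, N => i j Ni Nj cij t /andP[t0 tT].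
have AA l h : `|A (i, l) h - A (j, l) h| <= y.
  have [hAi _] := hA (i, l) Ni; have [hAj _] := hA (j, l) Nj.
  have /andP[a1 a2] := hAi h; have /andP[b1 b2] := hAj h.
  have := congr1 (fun f : {ffun _ -> _} => val (f (l, h))) cij; rewrite !ffunE/= !inordK; first last.
  - by rewrite ltnS; apply: le_truncn; rewrite ler_pM2r ?invr_gt0// lerD2r.
  - by rewrite ltnS; apply: le_truncn; rewrite ler_pM2r ?invr_gt0// lerD2r.
  have p1 : 0 <= (A (i, l) h - al) / y by rewrite divr_ge0 ?subr_ge0 ?(ltW y0).
  have p2 : 0 <= (A (j, l) h - al) / y by rewrite divr_ge0 ?subr_ge0 ?(ltW y0).
  have /andP[c1 c2] := truncn_itv p1; have /andP[c3 c4] := truncn_itv p2.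
  move=> E1; rewrite E1 in c1 c2; move: c1 c2 c3 c4.
  move: (Num.truncn _) => n.
  rewrite ler_pdivlMr// ltr_pdivrMr// ler_pdivlMr// ltr_pdivrMr// -[n.+1%:R]natr1 mulrDl mul1r.
  move: (_ * y) => X *; rewrite ler_distl; apply/andP; split; lra.
have lL : (Num.truncn (t * L%:R / T) < L.+1)%N.
  have h0 : 0 <= t * L%:R / T by rewrite divr_ge0 ?mulr_ge0// ltW.
  have /andP[h _] := truncn_itv h0; rewrite ltnS -(ler_nat R); apply: le_trans h _.
  by rewrite ler_pdivrMr// [leRHS]mulrC ler_pM2r.
pose l := Ordinal lL.
have tl_t : 0 <= t - tl l <= del.
  have h : 0 <= t * L%:R / T by rewrite divr_ge0 ?mulr_ge0// ltW.
  have -> : tl l = T * (Num.truncn (t * L%:R / T))%:R / L%:R by [].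
  have /andP[] := truncn_itv h; move: (Num.truncn _) => n.
  rewrite ler_pdivlMr// ltr_pdivrMr// -[n.+1%:R]natr1 mulrDl mul1r => h1 h2.
  apply/andP; split; first by rewrite subr_ge0 ler_pdivrMr// mulrC.
  apply: le_trans TL; rewrite lerBlDr -mulrDl ler_pdivlMr//; apply/ltW; apply: lt_le_trans h2 _.
  by rewrite addrC lerD2l mulrC.
have close i0 : (N <= i0)%N -> \int[torus d]_x `|r i0 t x - r i0 (tl l) x| <= 5 * C * y.
  move=> Ni0; have tT' : 0 <= t <= T by rewrite t0.
  apply: le_trans (ap_equi (apx i0) (qN _ Ni0) (tlT l) tT' kap0) _.
  rewrite [5 * C]mulrC -mulrA ler_wpM2l//.
  have h1 : q.+1%:R * (kap + (`|t - tl l| + e i0) / kap) <= 3 * y.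
    apply: (equi_close y0 Qy) => //; first exact: eN.
    by case/andP: tl_t => ? ?; rewrite ger0_norm.
  apply: le_trans (lerD (lerD (le_trans (eN _ Ni0) delQ) (lexx _)) h1) _.
  by rewrite yE; lra.
have [_ hi] := hA (i, l) Ni; have [_ hj] := hA (j, l) Nj; rewrite /= in hi hj.
have ci := close i Ni; have cj := close j Nj.
have bA i0 : bm setT (fun x : 'rV[R]_d => A (i0, l) (cell m x)) by exact: (bm_cell (A (i0, l))).
have br i0 s : bm setT (r i0 s) by exact: ap_bmr (apx i0) s.
apply: le_trans (L1_triangle (br i t) (br i (tl l)) (br j t)) _.
apply: le_trans (lerD ci (L1_triangle (br i (tl l)) (bA i) (br j t))) _.
apply: le_trans (lerD (lexx _) (lerD hi (L1_triangle (bA i) (bA j) (br j t)))) _.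
have hAA : \int[torus d]_x `|A (i, l) (cell m x) - A (j, l) (cell m x)| <= y.
  apply: le_trans (ler_norm _) _; apply: torus_le_cst; first exact: bm_dist.
  by move=> x; rewrite normr_id.
apply: le_trans (lerD (lexx _) (lerD (lexx _) (lerD hAA (L1_triangle (bA j) (br j (tl l)) (br j t))))) _.
have sw (f h : 'rV[R]_d -> R) : \int[torus d]_x `|f x - h x| = \int[torus d]_x `|h x - f x|.
  by apply: eq_Rintegral => x _; rewrite distrC.
rewrite [X in _ + (_ + (_ + (X + _)))]sw [X in _ + (_ + (_ + (_ + X)))]sw.
apply: le_trans (lerD (lexx _) (lerD (lexx _) (lerD (lexx _) (lerD hj cj)))) _.
have : B * y <= eta by rewrite -ler_pdivlMl// mulrC.
by rewrite /B; lra.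
Qed.

End approximant_compactness.

Section limit_density.
Context {R : realType} {d : nat}.
Variables (al M V T C : R) (rho0 : 'rV[R]_d -> R).
Hypotheses (al_gt0 : 0 < al) (al_le_M : al <= M) (T_gt0 : 0 < T) (C_ge0 : 0 <= C).
Hypothesis approximants : forall (e : R) (j : nat), 0 < e -> e <= 2^-1 ->
  exists r w z g E, approximant al M V T rho0 C e j r w z g E.
Local Notation ST := (measurableTypeR R * 'rV[R]_d)%type.

(** Along a subsequence consecutive distances are at most 2^-k, uniformly in t. The upper limit is
    clipped to lie in [al, M] everywhere, which takes it no farther from the approximants, as they
    lie there already. *)
Lemma limit_density : exists rho : R -> 'rV[R]_d -> R,
  [/\ forall t x, al <= rho t x <= M, forall t, bm setT (rho t),
      bm (slab T : set ST) (fun q => rho q.1 q.2) &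
      forall k, exists e j r w z g E, [/\ approximant al M V T rho0 C e j r w z g E,
        (k <= j)%N, 0 < e, e <= 4^-1 ^+ k &
        forall t, 0 <= t <= T -> \int[torus d]_x `|r t x - rho t x| <= 4^-1 ^+ k]].
Proof.
pose e i : R := 4^-1 ^+ i.+1.
have i4 : 0 < 4^-1 :> R by rewrite invr_gt0.
have i41 : 4^-1 <= 1 :> R by rewrite invf_le1// ler1n.
have e0 i : 0 < e i by rewrite exprn_gt0.
have e2 i : e i <= 2^-1.
  rewrite /e exprS; apply: (@le_trans _ _ (4^-1 * 1)).
    by rewrite ler_pM2l// exprn_ile1// ltW.
  by rewrite mulr1 lef_pV2 ?posrE// ler_nat.
have eN i : e i <= i.+1%:R^-1.
  by rewrite /e exprVn lef_pV2 ?posrE ?exprn_gt0// -natrX ler_nat ltnW// ltn_expl.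
have /choice[p hp] : forall i, exists p : (R -> 'rV[R]_d -> R) * (R -> 'rV[R]_d -> R) *
    (R -> 'rV[R]_d -> 'rV[R]_d) * (R -> 'rV[R]_d -> 'rV[R]_d) * (R -> R),
    approximant al M V T rho0 C (e i) i p.1.1.1.1 p.1.1.1.2 p.1.1.2 p.1.2 p.2.
  move=> i; have [r [w [z [g [E h]]]]] := approximants i (e0 i) (e2 i).
  by exists (r, w, z, g, E).
pose r i := (p i).1.1.1.1.
have [phi [phik phic]] : exists phi : nat -> nat, (forall k, (k <= phi k)%N) /\
    forall k l, (k <= l)%N -> forall t, 0 <= t <= T ->
      \int[torus d]_x `|r (phi k) t x - r (phi l) t x| <= 2^-1 ^+ k.
  apply: (@extract_close (fun k i j => forall t, 0 <= t <= T ->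
      \int[torus d]_x `|r i t x - r j t x| <= 2^-1 ^+ k)) => k.
  have half0 : 0 < 2^-1 ^+ k :> R by rewrite exprn_gt0// invr_gt0.
  exact: (approximant_codes T_gt0 C_ge0 eN hp half0).
have measurable_clip : measurable_fun setT (clip al M).
  by apply: measurable_maxr => //; exact: measurable_minr.
pose rho t x := clip al M (blim (fun k => r (phi k) t) x).
have br k t : bm setT (r (phi k) t) by exact: ap_bmr (hp (phi k)) t.
have rhoI t x : al <= rho t x <= M by exact: (clip_itv al_gt0 al_le_M (lexx 0)).
have rhoB t x : `|rho t x| <= M.
  by have /andP[a1 a2] := rhoI t x; rewrite ger0_norm// (le_trans _ a1)// ltW.
have mrho t : measurable_fun setT (rho t).
  apply: (measurableT_comp measurable_clip); apply: measurable_blim => // k; exact: (proj1 (br k t)).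
have brho t : bm setT (rho t) by split=> //; exists M => x _.
exists rho; split => //.
  split; last by exists M => q _.
  apply: (measurableT_comp measurable_clip).
  apply: (@measurable_blim _ _ _ _ (fun k (q : ST) => r (phi k) q.1 q.2)).
  by move=> k; exact: (proj1 (ap_slabr (hp (phi k)))).
(* The index 2 k + 1 turns the bound 2 / 2^(2 k + 1) of [integral_blim] into 4^-k. *)
move=> k; exists (e (phi k.*2.+1)), (phi k.*2.+1), (r (phi k.*2.+1)).
do 4 eexists; split; first exact: hp.
- by apply: leq_trans (phik _); rewrite -addnn -addnS leq_addr.
- exact: e0.
- rewrite /e; apply: ler_wiXn2l => //.
  by rewrite ltnW// ltnS (leq_trans _ (phik _))// -addnn -addnS leq_addr.
move=> t tT; set l := k.*2.+1.
have h (f : 'rV[R]_d -> R) : bm setT f -> ((\int[torus d]_x `|f x|)%:E = \int[torus d]_x (`|f x|)%:E)%E.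
  move=> bf; rewrite /Rintegral fineK//; apply: integrable_fin_num => //.
  by apply: torus_integrable; exact: bm_norm.
rewrite -lee_fin h; last exact: bmB.
have mb : measurable_fun setT (blim (fun k => r (phi k) t)).
  by apply: measurable_blim => i; exact: (proj1 (br i t)).
have m2 : measurable_fun setT (fun x : 'rV[R]_d => `|r (phi l) t x - blim (fun k => r (phi k) t) x|).
  by apply: measurableT_comp => //; apply: measurable_funB => //; exact: (proj1 (br _ _)).
have m1 := proj1 (bm_norm (bmB (br l t) (brho t))).
apply: (@le_trans _ _ (\int[torus d]_x (`|r (phi l) t x - blim (fun k => r (phi k) t) x|)%:E)%E).
  apply: ge0_le_integral => //.
  - exact/measurable_EFinP.
  - exact/measurable_EFinP.
  move=> x _; rewrite lee_fin.
  have -> : r (phi l) t x = clip al M (r (phi l) t x).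
    by rewrite (clip_id al_gt0 al_le_M (lexx 0))//; exact: ap_r (hp _) _ _.
  apply: le_trans (clip_lip al_gt0 al_le_M (lexx 0) _ _) _.
  by rewrite (clip_id al_gt0 al_le_M (lexx 0))//; exact: ap_r (hp _) _ _.
apply: le_trans (integral_blim (c := 1) measurableT _ l ler01 _) _.
- by move=> i; exact: (proj1 (br i t)).
- move=> i; rewrite -h; last exact: bmB.
  by rewrite lee_fin mul1r -exprVn; apply: phic.
- rewrite lee_fin mulr1 /l exprS invfM mulrA divff// mul1r -exprVn -muln2 mulnC exprM.
  by rewrite expr2 -invfM -natrM.
Qed.

End limit_density.

(** * Mean convergence, slices and pairings *)

Section mean_convergence.
Context {R : realType} {dX : measure_display} {X : measurableType dX} (mu : {measure set X -> \bar R}).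
Variables (D : set X) (mD : measurable D).

(** Integrals summable over k make the series of the h k integrable, hence finite almost everywhere,
    and there its terms tend to 0. *)
Lemma ae_cvg0 (h : nat -> X -> \bar R) (c : R) : 0 <= c ->
  (forall k, measurable_fun D (h k)) -> (forall k x, D x -> (0 <= h k x)%E) ->
  (forall k, (\int[mu]_(x in D) h k x <= (c / 2 ^+ k)%:E)%E) ->
  {ae mu, forall x, D x -> h k x @[k --> \oo] --> 0%E}.
Proof.
move=> c0 mh h0 hc.
have iG : mu.-integrable D (fun x => \sum_(k <oo) h k x)%E.
  apply/integrableP; split.
    by apply: ge0_emeasurable_sum => // n x Dx _; exact: h0.
  rewrite (eq_integral (fun x => \sum_(k <oo) h k x)%E); last first.
    move=> x; rewrite inE => Dx; rewrite gee0_abs//; apply: nneseries_ge0 => n _ _; exact: h0.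
  rewrite integral_nneseries//.
  apply: (@le_lt_trans _ _ (\sum_(0 <= i <oo) (c / 2 ^+ i)%:E)%E).
    by apply: lee_nneseries => *; [apply: integral_ge0 => x Dx; exact: h0|exact: hc].
  by rewrite nneseries_geometric// ltry.
apply: filterS (integrable_ae mD iG) => x fx Dx.
have := nneseries_tail_cvg (f := h ^~ x) _ (fun k _ => h0 k x Dx).
move=> /(_ xpredT); rewrite ltey_eq (fx Dx) => /(_ isT) ht.
apply: squeeze_cvge (cvg_cst _) ht.
apply: nearW => k; rewrite h0//=.
rewrite (nneseries_split k 1); last by move=> *; exact: h0.
rewrite addn1 big_nat1 leeDl//; apply: nneseries_ge0 => n _ _; exact: h0.
Qed.

Hypothesis muD : (mu D < +oo)%E.

Lemma integrable_close (f g : X -> R) : bm D f -> measurable_fun D g ->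
  (\int[mu]_(x in D) (`|f x - g x|)%:E < +oo)%E -> mu.-integrable D (EFin \o g).
Proof.
move=> bf mg fg.
have i1 : mu.-integrable D (EFin \o (fun x => f x - g x)).
  apply/integrableP; split; first by apply/measurable_EFinP/measurable_funB => //; exact: (proj1 bf).
  by under eq_integral do rewrite /= .
have -> : EFin \o g = ((EFin \o f) \- (EFin \o (fun x => (f x - g x)%R)))%E.
  by apply/funext => x /=; rewrite -EFinB; congr EFin; ring.
by apply: integrableB => //; exact: bm_integrable.
Qed.

Lemma integrable_mul_bm (h psi : X -> R) : mu.-integrable D (EFin \o h) -> bm D psi ->
  mu.-integrable D (EFin \o (fun x => h x * psi x)).
Proof.
move=> /[swap] -[mpsi [B hB]].
have hB1 x : D x -> `|psi x| <= `|B| + 1.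
  by move=> Dx; apply: le_trans (hB x Dx) _; apply: le_trans (ler_norm _) _; rewrite lerDl.
have B1 : 0 < `|B| + 1 by rewrite ltr_wpDl.
move=> /integrableP[mh ih]; apply/integrableP; split.
  by apply/measurable_EFinP; apply: measurable_funM => //; exact/measurable_EFinP.
apply: (@le_lt_trans _ _ (\int[mu]_(x in D) ((`|B| + 1)%:E * `|(EFin \o h) x|))%E).
  apply: ge0_le_integral => //.
  - apply/measurable_EFinP; apply: measurableT_comp => //; apply: measurable_funM => //.
    exact/measurable_EFinP.
  - by apply: measurable_funeM; apply: measurableT_comp => //; exact: mh.
  by move=> x Dx /=; rewrite lee_fin normrM mulrC ler_wpM2r//; exact: hB1.
have mab : measurable_fun D (fun x => `|(EFin \o h) x|)%E by apply: measurableT_comp.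
rewrite ge0_integralZl ?lee_fin ?(ltW B1)//.
by rewrite lte_mul_pinfty// lee_fin ltW.
Qed.

Lemma cvg_pairing (f : nat -> X -> R) (g psi : X -> R) : (forall k, bm D (f k)) ->
  measurable_fun D g -> bm D psi ->
  (\int[mu]_(x in D) (`|f k x - g x|)%:E @[k --> \oo] --> 0%E)%E ->
  \int[mu]_(x in D) (f k x * psi x) @[k --> \oo] --> \int[mu]_(x in D) (g x * psi x).
Proof.
move=> bf mg bpsi /fine_cvgP[fin cvg0].
have [mpsi [B hB]] := bpsi.
have hB1 x : D x -> `|psi x| <= `|B| + 1.
  by move=> Dx; apply: le_trans (hB x Dx) _; apply: le_trans (ler_norm _) _; rewrite lerDl.
have B1 : 0 < `|B| + 1 by rewrite ltr_wpDl.
have ig : mu.-integrable D (EFin \o g).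
  have [N _ hN] := fin; apply: (integrable_close (bf N) mg).
  by rewrite ltey_eq hN//=.
have igp (h : X -> R) : mu.-integrable D (EFin \o h) -> mu.-integrable D (EFin \o (fun x => h x * psi x)).
  by move=> ih; exact: integrable_mul_bm ih bpsi.
apply/cvgrPdist_le => eps eps0.
have /cvgrPdist_le /(_ (eps / (`|B| + 1))) : (fine (\int[mu]_(x in D) (`|f k x - g x|)%:E)) @[k --> \oo] --> (0 : R) by exact: cvg0.
rewrite divr_gt0// => /(_ isT) near0.
near=> k.
have ifk : mu.-integrable D (EFin \o f k) by exact: bm_integrable.
rewrite -RintegralB//; try exact: igp.
have id : mu.-integrable D (EFin \o (fun x => f k x - g x)).
  rewrite (_ : EFin \o _ = (EFin \o f k) \- (EFin \o g))%E; first exact: integrableB.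
  by apply/funext.
have id' : mu.-integrable D (EFin \o (fun x => `|f k x - g x|)) by exact: (integrable_norm id).
apply: le_trans (le_norm_Rintegral (g := fun x => (`|B| + 1) * `|f k x - g x|) mD _ _ _) _.
- rewrite (_ : EFin \o _ = EFin \o (fun x => (- (f k x - g x)) * psi x)).
    apply: igp; rewrite (_ : EFin \o _ = \- (EFin \o (fun x => (f k x - g x)%R)))%E; first exact: integrableN.
    by apply/funext.
  by apply/funext => x /=; congr EFin; ring.
- by have := integrableZl mD (`|B| + 1) id'; apply: eq_integrable => //.
- move=> x Dx; rewrite -mulrBl normrM distrC mulrC ler_wpM2r//; exact: hB1.
rewrite RintegralZl// mulrC -ler_pdivlMr//.
have : `|0 - fine (\int[mu]_(x in D) (`|f k x - g x|)%:E)| <= eps / (`|B| + 1) by near: k.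
by rewrite sub0r normrN; apply: le_trans; exact: ler_norm.
Unshelve. all: by end_near. Qed.

End mean_convergence.

(** * Time slices of functions on space-time *)

Section slices.
Context {R : realType} {d : nat} (T : R).
Hypothesis T_gt0 : 0 < T.
Local Notation ST := (measurableTypeR R * 'rV[R]_d)%type.
Implicit Types f : R -> 'rV[R]_d -> \bar R.

(** The integrand is extended by zero outside the slab, so that Tonelli's theorem applies on the
    whole line. *)
Let slice f (t : R) : \bar R := (\int[torus d]_x ((fun q : ST => f q.1 q.2) \_ (slab T : set ST)) (t, x))%E.

Let sliceE f t : t \in `]0, T[ -> slice f t = (\int[torus d]_x f t x)%E.
Proof.
move=> tT; apply: eq_integral => x _; rewrite patchE ifT// inE; split => //=.
Qed.

Let slice_out f t : t \notin `]0, T[ -> slice f t = 0%E.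
Proof.
move=> tT; rewrite /slice integral0_eq// => x _; rewrite patchE ifF//.
by apply/negbTE/negP; rewrite inE => -[/= h _]; move: tT; rewrite h.
Qed.

Lemma slab_tonelli f : measurable_fun (slab T : set ST) (fun q : ST => f q.1 q.2) ->
  (forall t x, (0 <= f t x)%E) ->
  measurable_fun (setT : set (measurableTypeR R)) (slice f) /\
  (\int[@spacetime R d]_(q in slab T) f q.1 q.2 = \int[@lebesgue_measure R]_t slice f t)%E.
Proof.
move=> mf f0.
have mp : measurable_fun setT ((fun q : ST => f q.1 q.2) \_ (slab T : set ST)).
  have mS : measurable (slab T : set ST) by exact: measurable_slab.
  exact: (measurable_restrictT _ mS).1.
have p0 q : (0 <= ((fun q : ST => f q.1 q.2) \_ (slab T : set ST)) q)%E.
  by rewrite patchE; case: ifP.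
split.
  exact: (measurable_fun_fubini_tonelli_F (m2 := torus d) _ mp p0).
rewrite integral_mkcond; exact: (fubini_tonelli1 (m1 := @lebesgue_measure R) (m2 := torus d) _ mp p0).
Qed.

Lemma slab_integral_le (f : R -> 'rV[R]_d -> \bar R) (c : R) : 0 <= c ->
  measurable_fun (slab T : set ST) (fun q : ST => f q.1 q.2) ->
  (forall t x, (0 <= f t x)%E) ->
  (forall t, t \in `]0, T[ -> (\int[torus d]_x f t x <= c%:E)%E) ->
  (\int[@spacetime R d]_(q in slab T) f q.1 q.2 <= (c * T)%:E)%E.
Proof.
move=> c0 mf f0 fc; have [ms ->] := slab_tonelli mf f0.
have mT : measurable (`]0, T[%classic : set (measurableTypeR R)) by exact: measurable_itv.
rewrite (_ : slice f = slice f \_ `]0, T[); last first.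
  apply/funext => t; rewrite patchE; case: ifPn => // h; apply: slice_out.
  by apply: contra h => tT; rewrite inE.
rewrite -integral_mkcond; apply: (@le_trans _ _ (\int[@lebesgue_measure R]_(t in `]0%R, T[) (cst c%:E) t)%E).
  apply: ge0_le_integral => //.
  - by move=> t _; apply: integral_ge0 => x _; rewrite patchE; case: ifP.
  - exact: measurable_funTS.
  - by move=> t /= tT; rewrite sliceE ?inE//; apply: fc; rewrite inE.
by rewrite integral_cst// [X in (_ * X)%E](lebesgue_slab T_gt0) -EFinM.
Qed.

Lemma ae_slice_lty f : measurable_fun (slab T : set ST) (fun q : ST => f q.1 q.2) ->
  (forall t x, (0 <= f t x)%E) ->
  (\int[@spacetime R d]_(q in slab T) f q.1 q.2 < +oo)%E ->
  ae_time T (fun t => (\int[torus d]_x f t x < +oo)%E).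
Proof.
move=> mf f0; have [ms ->] := slab_tonelli mf f0 => fi.
have s0 t : (0 <= slice f t)%E.
  by apply: integral_ge0 => x _; rewrite patchE; case: ifP.
have /integrable_ae : (@lebesgue_measure R).-integrable setT (slice f).
  apply/integrableP; split => //.
  by under eq_integral do rewrite gee0_abs//.
move=> /(_ measurableT); apply: filterS => t /(_ I) ft tT.
by rewrite -sliceE// ltey_eq ft.
Qed.

Lemma ae_slice_cvg0 (f : nat -> R -> 'rV[R]_d -> \bar R) (c : R) : 0 <= c ->
  (forall k, measurable_fun (slab T : set ST) (fun q : ST => f k q.1 q.2)) ->
  (forall k t x, (0 <= f k t x)%E) ->
  (forall k, (\int[@spacetime R d]_(q in slab T) f k q.1 q.2 <= (c / 2 ^+ k)%:E)%E) ->
  ae_time T (fun t => (\int[torus d]_x f k t x)%E @[k --> \oo] --> 0%E).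
Proof.
move=> c0 mf f0 fc.
have s0 k t : (0 <= slice (f k) t)%E.
  by apply: integral_ge0 => x _; rewrite patchE; case: ifP.
have h := @ae_cvg0 R _ (measurableTypeR R) (@lebesgue_measure R) setT measurableT
  (fun k => slice (f k)) c c0 (fun k => proj1 (slab_tonelli (mf k) (f0 k))) (fun k t _ => s0 k t).
apply: filterS (h _) => [t ht tT|k]; last by have [_ <-] := slab_tonelli (mf k) (f0 k).
have ft := ht I.
by under eq_cvg do rewrite -sliceE//.
Qed.

End slices.

(** * Convex combinations of approximate solutions *)

Section midpoint_integral.
Context {R : realType} {dX : measure_display} {X : measurableType dX} (mu : {measure set X -> \bar R}).
Variables (D : set X) (mD : measurable D) (muD : (mu D < +oo)%E).

Lemma Rintegral_mid (f g : X -> R) : bm D f -> bm D g ->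
  \int[mu]_(x in D) ((f x + g x) / 2) = (\int[mu]_(x in D) f x + \int[mu]_(x in D) g x) / 2.
Proof.
move=> bf bg; under eq_Rintegral do rewrite mulrC.
by rewrite RintegralZl ?RintegralD// 1?mulrC//; apply: bm_integrable => //; exact: bmD.
Qed.

End midpoint_integral.

(* A candidate assigns to [None], [inl i] and [inr i] the functions div z, z_i and the
   i-th component of grad div z. *)
Section candidates.
Context {R : realType} {d : nat}.
Variables (T Ce : R) (rho0 : 'rV[R]_d -> R) (rho : R -> 'rV[R]_d -> R).
Hypotheses (T_gt0 : 0 < T) (brho : forall t, bm setT (rho t)).
Local Notation ST := (measurableTypeR R * 'rV[R]_d)%type.
Hypothesis sbrho : bm (slab T : set ST) (fun q => rho q.1 q.2).
Local Notation I := (option ('I_d + 'I_d)).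
Implicit Types F : I -> R -> 'rV[R]_d -> R.

Definition cfield F t x : 'rV[R]_d := \row_i F (Some (inl i)) t x.
Definition cgrad F t x : 'rV[R]_d := \row_i F (Some (inr i)) t x.

(** All relations contain the limit density [rho] in place of an approximate one, which makes them
    convex in F. The error depends on t because the energies are controlled only after integration
    in time, and on the test function only through its bound B. *)
Definition near_solution F (b t : R) : Prop :=
  [/\ forall zeta B, torus_test_field zeta -> (forall x, enorm (zeta x) <= 1) ->
        (forall i, test_bound (fun x => zeta x 0 i) B) ->
        - (\int[torus d]_x (rho t x * diverg zeta x)) <=
        - (\int[torus d]_x (rho t x * F None t x)) + (1 + B) * b,
      forall phi B, torus_test phi -> test_bound phi B ->
        `|\int[torus d]_x (dot (cfield F t x) (grad phi x)) + \int[torus d]_x (F None t x * phi x)| <=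
        (1 + B) * b &
      forall phi B i, torus_test phi -> test_bound phi B ->
        `|\int[torus d]_x (F None t x * 'D_(unitv i) phi x) +
          \int[torus d]_x (F (Some (inr i)) t x * phi x)| <= (1 + B) * b].

Record candidate (n : nat) F : Prop := Candidate {
  cd_z : forall t x, enorm (cfield F t x) <= 1 + 2^-1 ^+ n;
  cd_bm : forall c t, bm setT (F c t);
  cd_slab : forall c, bm (slab T : set ST) (fun q => F c q.1 q.2);
  cd_err : exists er : R -> R, [/\ forall t, 0 <= er t, bm (slab T : set ST) (fun q => er q.1),
    \int[@spacetime R d]_(q in slab T) er q.1 <= Ce / 2 ^+ n &
    forall t, 0 <= t <= T -> near_solution F (er t) t];
  cd_eq : forall u B, spacetime_test T u -> stest_bound T u B ->
    `|\int[spacetime]_(q in slab T)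
        (rho q.1 q.2 * time_deriv u q +
         rho q.1 q.2 * dot (cgrad F q.1 q.2) (grad (fun x => u (q.1, x)) q.2)) +
      \int[torus d]_x (rho0 x * u (0, x))| <= Ce * (1 + B) / 2 ^+ n }.

Definition cmid F F' : I -> R -> 'rV[R]_d -> R := fun c t x => (F c t x + F' c t x) / 2.

Definition cenergy F : R := \int[@spacetime R d]_(q in slab T) \sum_c F c q.1 q.2 ^+ 2.

Let mS : measurable (slab T : set ST). Proof. exact: measurable_slab. Qed.
Let sS : (@spacetime R d (slab T) < +oo)%E.
Proof. apply: le_lt_trans (ltry T); rewrite le_eqVlt; apply/orP; left; apply/eqP; exact: spacetime_slab. Qed.
Let mid_le (a b c e : R) : `|a| <= c -> `|b| <= e -> `|(a + b) / 2| <= (c + e) / 2.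
Proof.
move=> h1 h2; rewrite normrM [`|2^-1|]ger0_norm ?invr_ge0// ler_wpM2r ?invr_ge0//.
by apply: le_trans (ler_normD _ _) _; exact: lerD.
Qed.
Lemma bm_test (phi : 'rV[R]_d -> R) : torus_test phi -> bm setT phi.
Proof. by move=> [sphi pphi]; apply: bm_periodic => //; have [] := sphi 1%N. Qed.

Lemma bm_dtest (phi : 'rV[R]_d -> R) i : torus_test phi -> bm setT ('D_(unitv i) phi).
Proof.
move=> [sphi pphi]; apply: bm_periodic => //; last exact: periodic_derive.
exact: ((sphi 1%N).2 (unitv i)).2.
Qed.

Lemma near_solution_mid F F' b b' t : (forall c, bm setT (F c t)) -> (forall c, bm setT (F' c t)) ->
  near_solution F b t -> near_solution F' b' t -> near_solution (cmid F F') ((b + b') / 2) t.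
Proof.
move=> bF bF' [h1 h2 h3] [h1' h2' h3']; split.
- move=> zeta B tz z1 tB; have := h1 zeta B tz z1 tB; have := h1' zeta B tz z1 tB.
  have -> : \int[torus d]_x (rho t x * cmid F F' None t x) =
    (\int[torus d]_x (rho t x * F None t x) + \int[torus d]_x (rho t x * F' None t x)) / 2.
    rewrite -Rintegral_mid//; try exact: bmM; try exact: torus_lty.
    by apply: eq_Rintegral => x _; rewrite /cmid; field.
  move: (\int[torus d]_x _) (\int[torus d]_x _) (\int[torus d]_x _) => X Y Z; lra.
- move=> phi B tphi tB; have := mid_le (h2 phi B tphi tB) (h2' phi B tphi tB).
  have bd (G : I -> R -> 'rV[R]_d -> R) : (forall c, bm setT (G c t)) ->
      bm setT (fun x => dot (cfield G t x) (grad phi x)).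
    move=> bG; apply: bm_sum => i; under eq_fun do rewrite !mxE.
    by apply: bmM => //; exact: bm_dtest.
  have -> : \int[torus d]_x (dot (cfield (cmid F F') t x) (grad phi x)) =
    (\int[torus d]_x (dot (cfield F t x) (grad phi x)) + \int[torus d]_x (dot (cfield F' t x) (grad phi x))) / 2.
    rewrite -Rintegral_mid//; try exact: bd; try exact: torus_lty.
    apply: eq_Rintegral => x _; rewrite -big_split/= mulr_suml; apply: eq_bigr => i _.
    by rewrite !mxE /cmid; field.
  have -> : \int[torus d]_x (cmid F F' None t x * phi x) =
    (\int[torus d]_x (F None t x * phi x) + \int[torus d]_x (F' None t x * phi x)) / 2.
    rewrite -Rintegral_mid//; try (by apply: bmM => //; exact: bm_test); try exact: torus_lty.
    by apply: eq_Rintegral => x _; rewrite /cmid; field.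
  rewrite -mulrDr mulrA.
  by move=> h; apply: le_trans h; rewrite le_eqVlt; apply/orP; left; apply/eqP; congr `|_|; field.
- move=> phi B i tphi tB; have := mid_le (h3 phi B i tphi tB) (h3' phi B i tphi tB).
  have -> : \int[torus d]_x (cmid F F' None t x * 'D_(unitv i) phi x) =
    (\int[torus d]_x (F None t x * 'D_(unitv i) phi x) + \int[torus d]_x (F' None t x * 'D_(unitv i) phi x)) / 2.
    rewrite -Rintegral_mid//; try (by apply: bmM => //; exact: bm_dtest); try exact: torus_lty.
    by apply: eq_Rintegral => x _; rewrite /cmid; field.
  have -> : \int[torus d]_x (cmid F F' (Some (inr i)) t x * phi x) =
    (\int[torus d]_x (F (Some (inr i)) t x * phi x) + \int[torus d]_x (F' (Some (inr i)) t x * phi x)) / 2.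
    rewrite -Rintegral_mid//; try (by apply: bmM => //; exact: bm_test); try exact: torus_lty.
    by apply: eq_Rintegral => x _; rewrite /cmid; field.
  rewrite -mulrDr mulrA.
  by move=> h; apply: le_trans h; rewrite le_eqVlt; apply/orP; left; apply/eqP; congr `|_|; field.
Qed.

Let bm_mid {dX : measure_display} {X : measurableType dX} (D : set X) (f g : X -> R) :
  bm D f -> bm D g -> bm D (fun x => (f x + g x) / 2).
Proof. by move=> bf bg; under eq_fun do rewrite mulrC; apply: bmZ; exact: bmD. Qed.

Lemma bm_spacetime_derive u v : spacetime_test T u -> bm (slab T : set ST) ('D_v u : ST -> R).
Proof.
move=> [su pu _]; apply: bm_spacetime => //; first exact: ((su 1%N).2 v).2.
exact: periodic_slice_derive.
Qed.

Lemma bm_spacetime_grad u i : spacetime_test T u ->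
  bm (slab T : set ST) (fun q => grad (fun x => u (q.1, x)) q.2 0 i).
Proof.
move=> tu; have := bm_spacetime_derive (edir i) tu.
congr (bm _ _); apply/funext => -[t x]; by rewrite mxE derive_slice.
Qed.

Lemma candidate_mid n F F' : candidate n F -> candidate n F' -> candidate n (cmid F F').
Proof.
move=> [z1 b1 s1 [er1 [p1 q1 i1 e1]] w1] [z2 b2 s2 [er2 [p2 q2 i2 e2]] w2]; split.
- move=> t x; have -> : cfield (cmid F F') t x = 2^-1 *: (cfield F t x + cfield F' t x).
    by apply/rowP => i; rewrite !mxE /cmid mulrC.
  rewrite enormZ [`|2^-1|]ger0_norm ?invr_ge0//.
  have := z1 t x; have := z2 t x; have := enormD (cfield F t x) (cfield F' t x).
  by rewrite ler_pdivrMl//; lra.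
- by move=> c t; exact: bm_mid.
- by move=> c; exact: (bm_mid (s1 c) (s2 c)).
- exists (fun t => (er1 t + er2 t) / 2); split.
  + by move=> t; rewrite divr_ge0// addr_ge0.
  + exact: (bm_mid q1 q2).
  + by rewrite (Rintegral_mid mS sS q1 q2); move: i1 i2; lra.
  + by move=> t tT; apply: near_solution_mid => //; [exact: e1|exact: e2].
- move=> u B tu tB; have := mid_le (w1 u B tu tB) (w2 u B tu tB).
  have bG (G : I -> R -> 'rV[R]_d -> R) : (forall c, bm (slab T : set ST) (fun q => G c q.1 q.2)) ->
    bm (slab T : set ST) (fun q => rho q.1 q.2 * time_deriv u q +
         rho q.1 q.2 * dot (cgrad G q.1 q.2) (grad (fun x => u (q.1, x)) q.2)).
    move=> sG; apply: bmD; apply: bmM => //; first exact: (bm_spacetime_derive tdir).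
    apply: bm_sum => i; under eq_fun do rewrite mxE.
    by apply: bmM; [exact: sG|exact: bm_spacetime_grad].
  move=> h; apply: le_trans (le_trans h _); last first.
    by rewrite le_eqVlt; apply/orP; left; apply/eqP; field.
  rewrite le_eqVlt; apply/orP; left; apply/eqP; congr `|_|.
  have := Rintegral_mid mS sS (bG F s1) (bG F' s2) => E1.
  transitivity ((\int[spacetime]_(q in slab T)
        (rho q.1 q.2 * time_deriv u q +
         rho q.1 q.2 * dot (cgrad F q.1 q.2) (grad (fun x => u (q.1, x)) q.2)) +
     \int[spacetime]_(q in slab T)
        (rho q.1 q.2 * time_deriv u q +
         rho q.1 q.2 * dot (cgrad F' q.1 q.2) (grad (fun x => u (q.1, x)) q.2))) / 2 +
      \int[torus d]_x (rho0 x * u (0, x))); last by field.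
  congr (_ + _); rewrite -E1; apply: eq_Rintegral => q _.
  have -> : dot (cgrad (cmid F F') q.1 q.2) (grad (fun x => u (q.1, x)) q.2) =
    (dot (cgrad F q.1 q.2) (grad (fun x => u (q.1, x)) q.2) +
     dot (cgrad F' q.1 q.2) (grad (fun x => u (q.1, x)) q.2)) / 2.
    by rewrite -big_split/= mulr_suml; apply: eq_bigr => i _; rewrite !mxE /cmid; field.
  by field.
Qed.

Lemma candidate_mono m n F : 0 <= Ce -> (m <= n)%N -> candidate n F -> candidate m F.
Proof.
move=> Ce0 mn [z1 b1 s1 [er1 [p1 q1 i1 e1]] w1].
have h : 2^-1 ^+ n <= 2^-1 ^+ m :> R.
  by apply: ler_wiXn2l => //; rewrite invf_le1// ler1n.
have h' c : 0 <= c -> c / 2 ^+ n <= c / 2 ^+ m :> R by move=> c0; rewrite -!exprVn ler_wpM2l.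
split => //.
- by move=> t x; apply: le_trans (z1 t x) _; rewrite lerD2l.
- exists er1; split => //; apply: le_trans i1 _; exact: h'.
- move=> u B tu tB; apply: le_trans (w1 u B tu tB) (h' _ _).
  by have [B0 _ _ _] := tB; rewrite mulr_ge0// addr_ge0.
Qed.

Lemma cenergy_parallelogram F F' : (forall c, bm (slab T : set ST) (fun q => F c q.1 q.2)) ->
  (forall c, bm (slab T : set ST) (fun q => F' c q.1 q.2)) ->
  cenergy (fun c t x => F c t x - F' c t x) = 2 * cenergy F + 2 * cenergy F' - 4 * cenergy (cmid F F').
Proof.
move=> s1 s2; apply/eqP; rewrite -subr_eq opprK; apply/eqP.
have b1 : bm (slab T : set ST) (fun q => \sum_c F c q.1 q.2 ^+ 2) by apply: bm_sum => c; exact: bmX.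
have b2 : bm (slab T : set ST) (fun q => \sum_c F' c q.1 q.2 ^+ 2) by apply: bm_sum => c; exact: bmX.
have b3 : bm (slab T : set ST) (fun q => \sum_c (F c q.1 q.2 - F' c q.1 q.2) ^+ 2).
  by apply: bm_sum => c; apply: (bmX _ (bmB (s1 c) (s2 c))).
have b4 : bm (slab T : set ST) (fun q => \sum_c cmid F F' c q.1 q.2 ^+ 2).
  by apply: bm_sum => c; apply: (bmX _ (bm_mid (s1 c) (s2 c))).
have int (f : ST -> R) : bm (slab T : set ST) f -> (@spacetime R d).-integrable (slab T) (EFin \o f).
  exact: slab_integrable.
rewrite /cenergy -!RintegralZl -?RintegralD//; try (apply: int => //; try exact: bmZ).
apply: eq_Rintegral => q _; rewrite !mulr_sumr -!big_split/=; apply: eq_bigr => c _.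
by rewrite /cmid; field.
Qed.

(** The infima m n of the energy increase with n and are bounded by C; S is their supremum. The
    tuples have energy at most S + 16^-k and an index n so large that m n >= S - 16^-k. Midpoints of
    consecutive ones then have energy at least S - 16^-k, and the parallelogram identity bounds the
    energy of the differences by 8 * 16^-k. *)
Lemma candidate_sequence (C : R) : 0 <= C -> 0 <= Ce ->
  (forall n, exists2 F, candidate n F & cenergy F <= C) ->
  exists F_ : nat -> I -> R -> 'rV[R]_d -> R, [/\ forall k, candidate k (F_ k),
    forall k, cenergy (F_ k) <= C + 1 &
    forall k, cenergy (fun c t x => F_ k c t x - F_ k.+1 c t x) <= 8 * 16^-1 ^+ k].
Proof.
move=> C0 Ce0 ex.
have en0 F : 0 <= cenergy F.
  by apply: Rintegral_ge0 => q _; apply: sumr_ge0 => c _; exact: sqr_ge0.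
pose A n := [set cenergy F | F in candidate n].
have iA n : has_inf (A n).
  split; first by have [F cF _] := ex n; exists (cenergy F); exists F.
  by exists 0 => _ [F _ <-].
pose m n := inf (A n).
have m_le n F : candidate n F -> m n <= cenergy F.
  by move=> cF; apply: ge_inf; [exact: (iA n).2|exists F].
have m_C n : m n <= C by have [F cF FC] := ex n; apply: le_trans FC; exact: m_le.
have m_mono i j : (i <= j)%N -> m i <= m j.
  move=> ij; apply: lb_le_inf; first exact: (iA j).1.
  by move=> _ [F cF <-]; apply: m_le; exact: candidate_mono cF.
have sm : has_sup (range m).
  by split; [exists (m 0%N); exists 0%N|exists C => _ [n _ <-]].
pose S := sup (range m).
have m_S n : m n <= S by apply: ub_le_sup; [exact: sm.2|exists n].
have S_C : S <= C by apply: ge_sup; [exact: sm.1|move=> _ [n _ <-]].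
have h0 k : 0 < 16^-1 ^+ k :> R by rewrite exprn_gt0.
have h1 k : 16^-1 ^+ k <= 1 :> R by rewrite exprn_ile1// invf_le1// ler1n.
have /choice[p hp] : forall k, exists p : nat * (I -> R -> 'rV[R]_d -> R),
    [/\ (k <= p.1)%N, candidate p.1 p.2, cenergy p.2 <= S + 16^-1 ^+ k & S - 16^-1 ^+ k <= m p.1].
  move=> k; have [_ [n0 _ <-] hn0] := sup_adherent (h0 k) sm.
  set n := maxn k n0.
  have [_ [F cF <-] hF] := inf_adherent (h0 k) (iA n).
  exists (n, F); split => //=; first exact: leq_maxl.
    by apply/ltW; apply: lt_le_trans hF _; rewrite lerD2r; exact: m_S.
  by apply: le_trans (ltW hn0) _; apply: m_mono; exact: leq_maxr.
exists (fun k => (p k).2); split=> k.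
- by have [kp cp _ _] := hp k; exact: candidate_mono cp.
- by have [_ _ cp _] := hp k; apply: le_trans cp _; exact: lerD.
have [_ c1 e1 m1] := hp k; have [_ c2 e2 m2] := hp k.+1.
have h2 : 16^-1 ^+ k.+1 <= 16^-1 ^+ k :> R.
  by rewrite exprS ler_piMl ?(ltW (h0 k))// invf_le1// ler1n.
rewrite cenergy_parallelogram; [|by move=> c; exact: (cd_slab c1 c)|by move=> c; exact: (cd_slab c2 c)].
set n := minn (p k).1 (p k.+1).1.
have cm : candidate n (cmid (p k).2 (p k.+1).2).
  by apply: candidate_mid; [apply: candidate_mono c1 => //; exact: geq_minl|
    apply: candidate_mono c2 => //; exact: geq_minr].
have hm : S - 16^-1 ^+ k <= m n.
  rewrite /n /minn; case: ifP => _ //; apply: le_trans m2; by rewrite lerD2l lerN2.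
have := m_le _ _ cm; move: hm e1 e2 h2; move: (m n) (cenergy _) (cenergy _) (cenergy _) (16^-1 ^+ k) (16^-1 ^+ k.+1).
by move=> *; lra.
Qed.

End candidates.

Lemma EFin_Rintegral {R : realType} {dX : measure_display} {X : measurableType dX}
    (mu : {measure set X -> \bar R}) (D : set X) (f : X -> R) : measurable D ->
  mu.-integrable D (EFin \o f) ->
  ((\int[mu]_(x in D) f x)%:E = \int[mu]_(x in D) (f x)%:E)%E.
Proof. by move=> mD fi; rewrite /Rintegral fineK//; exact: integrable_fin_num. Qed.

Lemma big_option_sum {V : nmodType} {A : finType} (f : option (A + A) -> V) :
  \sum_c f c = f None + \sum_i f (Some (inl i)) + \sum_i f (Some (inr i)).
Proof.
rewrite (bigD1 None)//= (reindex_omap (@Some _) id)/=; last by case.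
by rewrite (eq_bigl xpredT) ?big_sumType/= ?addrA// => i; rewrite eqxx.
Qed.

Section candidate_of_approximant.
Context {R : realType} {d : nat}.
Variables (al M V T C : R) (rho0 : 'rV[R]_d -> R) (rho : R -> 'rV[R]_d -> R).
Hypotheses (d_gt0 : (0 < d)%N) (al_gt0 : 0 < al) (al_le_M : al <= M) (T_gt0 : 0 < T) (C_ge0 : 0 <= C)
  (rho_itv : forall t x, al <= rho t x <= M) (brho : forall t, bm setT (rho t)).
Local Notation ST := (measurableTypeR R * 'rV[R]_d)%type.
Hypothesis sbrho : bm (slab T : set ST) (fun q => rho q.1 q.2).

(** Pairs a function a, small in L1 and bounded by L, with one bounded in L2: the product is at most
    h f^2 where |a| <= h |f|, and at most |a|^2 / h <= L |a| / h elsewhere. *)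
Lemma young_pairing {dX : measure_display} {X : measurableType dX}
    (mu : {measure set X -> \bar R}) (D : set X) (h L : R) (a f : X -> R) : measurable D ->
  (mu D < +oo)%E -> 0 < h -> bm D a -> bm D f -> (forall x, D x -> `|a x| <= L) ->
  `|\int[mu]_(x in D) (a x * f x)| <=
  h * \int[mu]_(x in D) (f x ^+ 2) + h^-1 * L * \int[mu]_(x in D) `|a x|.
Proof.
move=> mD muD h0 ba bf aL.
have int (k : X -> R) : bm D k -> mu.-integrable D (EFin \o k) by exact: bm_integrable.
have b1 := bmX 2 bf; have b2 := bm_norm ba.
rewrite -!RintegralZl -?RintegralD//; try (apply: int => //; exact: bmZ).
apply: le_norm_Rintegral => //; try (apply: int); first exact: bmM.
  by apply: bmD; exact: bmZ.
move=> x Dx; rewrite normrM.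
have h3 : 0 <= h * f x ^+ 2 by rewrite mulr_ge0 ?sqr_ge0// ltW.
have L0 : 0 <= L := le_trans (normr_ge0 _) (aL x Dx).
have h4 : 0 <= h^-1 * L * `|a x| by rewrite !mulr_ge0// invr_ge0 ltW.
have [le1|le1] := leP `|a x| (h * `|f x|).
  apply: (@le_trans _ _ (h * f x ^+ 2)); last by rewrite lerDl.
  by rewrite -[f x ^+ 2]real_normK ?num_real// expr2 mulrA ler_wpM2r.
apply: (@le_trans _ _ (h^-1 * L * `|a x|)); last by rewrite lerDr.
rewrite mulrC ler_wpM2r// mulrC ler_pdivlMr// mulrC; apply: le_trans (ltW le1) _; exact: aL.
Qed.

Definition err_const : R := (C + d%:R + 1 + M) * C + (2 * C + T + d%:R * M * T).

(** The density of the approximant is replaced by [rho], at L1 distance at most h^2 with h = 2^-n.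
    As div z and its gradient are controlled in L2, Young's inequality with weight h loses a square
    root and the relations hold up to O(h). This accounts for 4^-n in the hypotheses and 2^-n in
    [candidate]. *)
Lemma candidate_of_approximant (n : nat) (e : R) (j : nat) r w z g E :
  approximant al M V T rho0 C e j r w z g E -> 0 < e -> e <= 4^-1 ^+ n ->
  (forall t, 0 <= t <= T -> \int[torus d]_x `|r t x - rho t x| <= 4^-1 ^+ n) ->
  exists2 F, candidate T err_const rho0 rho n F & cenergy T F <= C.
Proof.
move=> ap e0 eh rc.
pose h : R := 2^-1 ^+ n.
have h0 : 0 < h by rewrite exprn_gt0.
have h1 : h <= 1 by rewrite exprn_ile1// invf_le1// ler1n.
have hh : 4^-1 ^+ n = h ^+ 2 :> R.
  by rewrite /h -exprM mulnC exprM expr2 -invfM -natrM.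
rewrite hh in eh rc.
have hS : h ^+ 2 <= h by rewrite expr2 ler_piMl// ltW.
have M0 : 0 <= M by rewrite (le_trans _ al_le_M)// ltW.
have el := le_trans eh hS.
pose F (c : option ('I_d + 'I_d)) : R -> 'rV[R]_d -> R :=
  match c with None => w | Some (inl i) => fun t x => z t x 0 i | Some (inr i) => fun t x => g t x 0 i end.
have fz t x : cfield F t x = z t x by apply/rowP => i; rewrite mxE.
have fg t x : cgrad F t x = g t x by apply/rowP => i; rewrite mxE.
have rT t : bm setT (r t) := ap_bmr ap t.
have aM t x : `|r t x - rho t x| <= M.
  have /andP[a1 a2] := ap_r ap t x; have /andP[a3 a4] := rho_itv t x.
  by rewrite ler_norml; apply/andP; split; have := al_gt0; lra.
have D0 : 0 <= C + d%:R + 1 + M by have := C_ge0; have := ler0n R d; lra.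
have Dp0 : 0 <= 2 * C + T + d%:R * M * T.
  have : 0 <= d%:R * M * T by rewrite !mulr_ge0// ltW.
  by have := C_ge0; have := T_gt0; lra.
have DC0 : 0 <= (C + d%:R + 1 + M) * C by exact: mulr_ge0.
have eB B t : 0 <= B -> C * (1 + B) * e * E t <= (1 + B) * ((C + d%:R + 1 + M) * h * E t).
  move=> B0; have E0 : 0 <= E t by apply: le_trans (ap_E ap t).
  have -> : (1 + B) * ((C + d%:R + 1 + M) * h * E t) = C * (1 + B) * (h * E t) + (1 + B) * (d%:R + 1 + M) * (h * E t) by ring.
  rewrite -[leLHS]mulrA -[leLHS]addr0; apply: lerD.
    by rewrite ler_wpM2l ?mulr_ge0 ?addr_ge0// ler_wpM2r.
  by rewrite !mulr_ge0 ?addr_ge0// ltW.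
exists F; last first.
  apply: le_trans (ap_L2 ap); rewrite le_eqVlt; apply/orP; left; apply/eqP.
  apply: eq_Rintegral => q _; rewrite big_option_sum/=; ring.
split.
- by move=> t x; rewrite fz; apply: le_trans (ap_z ap t x) _; rewrite lerD2l.
- by case=> [[i|i]|] t; [exact: ap_bmz ap t i|exact: ap_bmg ap t i|exact: ap_bmw ap t].
- by case=> [[i|i]|]; [exact: ap_slabz ap i|exact: ap_slabg ap i|exact: ap_slabw ap].
- exists (fun t => (C + d%:R + 1 + M) * h * E t).
  have E0 t : 0 <= E t by apply: le_trans (ap_E ap t).
  split.
  + by move=> t; rewrite !mulr_ge0// ltW.
  + exact: (bmZ _ (ap_slabE ap)).
  + rewrite RintegralZl//; last first.
      by apply: slab_integrable => //; exact: (ap_slabE ap).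
    exact: measurable_slab.
    rewrite -exprVn -/h mulrAC ler_wpM2r ?(ltW h0)//.
    apply: (@le_trans _ _ ((C + d%:R + 1 + M) * C)); first by rewrite ler_wpM2l//; exact: ap_intE ap.
    by rewrite lerDl.
  + move=> t tT; split.
    * move=> zeta B tz z1 tB.
      have B0 : 0 <= B by have [] := tB (Ordinal d_gt0).
      pose a x := r t x - rho t x.
      have ba : bm setT a by exact: bmB.
      have tl : (torus d [set: 'rV[R]_d] < +oo)%E by exact: torus_lty.
      have bd : bm setT (diverg zeta).
        apply: bm_sum => i; have [sz pz] := tz; apply: bm_periodic => //.
          exact: ((sz i 1%N).2 (unitv i)).2.
        by apply: periodic_derive => x k; rewrite pz.
      have int (f : 'rV[R]_d -> R) : bm setT f -> (torus d).-integrable setT (EFin \o f) by exact: torus_integrable.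
      have e1 : \int[torus d]_x (rho t x * diverg zeta x) =
          \int[torus d]_x (r t x * diverg zeta x) - \int[torus d]_x (a x * diverg zeta x).
        rewrite -RintegralB//; try (by apply: int; exact: bmM).
        by apply: eq_Rintegral => x _; rewrite /a; ring.
      have e2 : \int[torus d]_x (r t x * w t x) =
          \int[torus d]_x (rho t x * w t x) + \int[torus d]_x (a x * w t x).
        rewrite -RintegralD//; try (by apply: int; apply: bmM => //; exact: ap_bmw ap t).
        by apply: eq_Rintegral => x _; rewrite /a; ring.
      have h2 : `|\int[torus d]_x (a x * diverg zeta x)| <= d%:R * B * h ^+ 2.
        apply: (@le_trans _ _ (\int[torus d]_x (d%:R * B * `|a x|))); last first.
          rewrite RintegralZl//; last by apply: int; exact: bm_norm.
          by rewrite ler_wpM2l ?mulr_ge0//; exact: rc.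
        apply: le_norm_Rintegral => //; try (apply: int); first exact: bmM.
          by apply: bmZ; exact: bm_norm.
        move=> x _; rewrite normrM mulrC ler_wpM2r//; apply: le_trans (ler_norm_sum _ _ _) _.
        rewrite -[X in X%:R * _]card_ord mulr_natl -sumr_const; apply: ler_sum => i _.
        by have [_ _ hB _ _] := tB i; exact: hB.
      have h3 := young_pairing measurableT tl h0 ba (ap_bmw ap t) (fun x _ => aM t x).
      have h4 : h^-1 * M * \int[torus d]_x `|a x| <= M * h.
        apply: (@le_trans _ _ (h^-1 * M * h ^+ 2)).
          by rewrite ler_wpM2l ?mulr_ge0 ?invr_ge0 ?(ltW h0)//; exact: rc.
        by rewrite le_eqVlt; apply/orP; left; apply/eqP; field; rewrite gt_eqF.
      have h5 : h * \int[torus d]_x (w t x ^+ 2) <= h * E t by rewrite ler_wpM2l ?(ltW h0)//; exact: ap_w2 ap t.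
      have h6 := ap_sub ap tT tz z1 tB.
      have h7 : C * (1 + B) * e * E t <= C * (1 + B) * (h * E t).
        by rewrite -mulrA ler_wpM2l ?mulr_ge0 ?addr_ge0// ler_wpM2r.
      have h8 : h <= h * E t by rewrite ler_peMr ?(ltW h0)//; exact: ap_E ap t.
      have h9 : d%:R * B * h ^+ 2 <= d%:R * B * (h * E t).
        by rewrite ler_wpM2l ?mulr_ge0//; apply: le_trans hS h8.
      have h10 : M * h <= M * (h * E t) by rewrite ler_wpM2l.
      have b0 : 0 <= h * E t by rewrite mulr_ge0// ltW.
      have x1 : 0 <= B * (h * E t) by rewrite mulr_ge0.
      have x2 : 0 <= d%:R * (h * E t) by rewrite mulr_ge0.
      have x3 : 0 <= M * (B * (h * E t)) by rewrite mulr_ge0.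
      have -> : (1 + B) * ((C + d%:R + 1 + M) * h * E t) = C * (1 + B) * (h * E t) + d%:R * B * (h * E t) +
        h * E t + M * (h * E t) + d%:R * (h * E t) + B * (h * E t) + M * (B * (h * E t)) by ring.
      rewrite e1 {}e2 in h6 *.
      move: h2 h3; rewrite !ler_norml => /andP[_ h2] /andP[h3 _].
      have h3' : - (\int[torus d]_x (a x * w t x)) <=
        h * \int[torus d]_x (w t x ^+ 2) + h^-1 * M * \int[torus d]_x `|a x| by rewrite lerNl.
      move: (\int[torus d]_x (a x * diverg zeta x)) (\int[torus d]_x (r t x * diverg zeta x))
       (\int[torus d]_x (rho t x * w t x)) (\int[torus d]_x (a x * w t x)) (h * \int[torus d]_x (w t x ^+ 2))
       (h^-1 * M * \int[torus d]_x `|a x|) h2 h3' h4 h5 h6 h7 h9 h10 x1 x2 x3.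
      move: (C * (1 + B) * e * E t) (C * (1 + B) * (h * E t)) (d%:R * B * h ^+ 2) (d%:R * B * (h * E t))
        (M * h) (M * (h * E t)) (M * (B * (h * E t))) (B * (h * E t)) (d%:R * (h * E t)) (h * E t).
      clear=> *; lra.
    * move=> phi B tphi tB; have [B0 _ _ _ _] := tB.
      under eq_Rintegral do rewrite fz.
      by apply: le_trans (ap_div ap tT tphi tB) _; exact: eB.
    * move=> phi B i tphi tB; have [B0 _ _ _ _] := tB.
      by apply: le_trans (ap_grad ap i tT tphi tB) _; exact: eB.
- move=> u B tu tB; have [B0 tB1 _ _] := tB.
  pose a (q : ST) := rho q.1 q.2 - r q.1 q.2.
  have sa : bm (slab T : set ST) a by exact: (bmB sbrho (ap_slabr ap)).
  have sb v : bm (slab T : set ST) ('D_v u : ST -> R) by exact: bm_spacetime_derive.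
  have sg i : bm (slab T : set ST) (fun q => g q.1 q.2 0 i) := ap_slabg ap i.
  have sG : bm (slab T : set ST) (fun q => dot (g q.1 q.2) (grad (fun x => u (q.1, x)) q.2)).
    by apply: bm_sum => i; apply: bmM => //; exact: bm_spacetime_grad.
  have int (f : ST -> R) : bm (slab T : set ST) f -> (@spacetime R d).-integrable (slab T) (EFin \o f).
    exact: slab_integrable.
  have mS : measurable (slab T : set ST) by exact: measurable_slab.
  pose X (q : ST) := time_deriv u q + dot (g q.1 q.2) (grad (fun x => u (q.1, x)) q.2).
  have sX : bm (slab T : set ST) X by apply: bmD => //; exact: sb.
  have eX : \int[spacetime]_(q in slab T) (rho q.1 q.2 * time_deriv u q +
         rho q.1 q.2 * dot (cgrad F q.1 q.2) (grad (fun x => u (q.1, x)) q.2)) =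
      \int[spacetime]_(q in slab T) (r q.1 q.2 * time_deriv u q +
         r q.1 q.2 * dot (g q.1 q.2) (grad (fun x => u (q.1, x)) q.2)) +
      \int[spacetime]_(q in slab T) (a q * X q).
    have sr : bm (slab T : set ST) (fun q => r q.1 q.2) := ap_slabr ap.
    rewrite -RintegralD//; last first.
    + by apply: int; exact: bmM.
    + by apply: int; apply: bmD; apply: bmM => //; exact: sb.
    by apply: eq_Rintegral => q _; rewrite fg /a /X; ring.
  have a0 : \int[@spacetime R d]_(q in slab T) `|a q| <= h ^+ 2 * T.
    have ia := int _ (bm_norm sa).
    rewrite -lee_fin EFin_Rintegral//.
    apply: (@slab_integral_le R d T T_gt0 (fun t x => (`|rho t x - r t x|)%:E)).
    + exact: sqr_ge0.
    + by apply/measurable_EFinP; exact: (proj1 (bm_norm sa)).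
    + by move=> t x; rewrite lee_fin.
    + move=> t; rewrite in_itv/= => /andP[t0 t1].
      rewrite -EFin_Rintegral//; last by apply: torus_integrable; exact: bm_norm (bmB _ _).
      rewrite lee_fin; have tT : 0 <= t <= T by rewrite !ltW.
      apply: le_trans (rc t tT); rewrite le_eqVlt; apply/orP; left; apply/eqP.
      by apply: eq_Rintegral => x _; rewrite distrC.
  have sgg : bm (slab T : set ST) (fun q => \sum_i g q.1 q.2 0 i ^+ 2) by apply: bm_sum => i; exact: bmX.
  have g2 : \int[@spacetime R d]_(q in slab T) (\sum_i g q.1 q.2 0 i ^+ 2) <= C.
    apply: le_trans (ap_L2 ap); apply: le_Rintegral => //; try (apply: int => //).
      apply: bmD => //; apply: bmD; first exact: bmX (ap_slabw ap).
      by apply: bm_sum => i; exact: bmX (ap_slabz ap i).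
    move=> q _; rewrite lerDr addr_ge0 ?sqr_ge0// sumr_ge0// => i _; exact: sqr_ge0.
  have hK : `|\int[spacetime]_(q in slab T) (a q * X q)| <=
      B * (h * C) + B * (1 + d%:R * h^-1 * M) * (h ^+ 2 * T).
    apply: (@le_trans _ _ (B * (h * \int[@spacetime R d]_(q in slab T) (\sum_i g q.1 q.2 0 i ^+ 2)) +
       B * (1 + d%:R * h^-1 * M) * \int[@spacetime R d]_(q in slab T) `|a q|)); last first.
      apply: lerD; first by rewrite ler_wpM2l// ler_wpM2l// ltW.
      by rewrite ler_wpM2l// mulr_ge0// addr_ge0// !mulr_ge0// invr_ge0 ltW.
    rewrite mulrA -!RintegralZl -?RintegralD//; try (apply: int => //; apply: bmZ => //; exact: bm_norm);
      try exact: int; try (by apply: int; exact: bm_norm).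
    apply: le_norm_Rintegral => //; try apply: int; first exact: bmM.
      by apply: bmD; apply: bmZ => //; exact: bm_norm.
    move=> q [/= ]; rewrite in_itv/= => /andP[t0 t1] _.
    have tT : 0 <= q.1 <= T by rewrite !ltW.
    have [u1 u2] := tB1 q.1 q.2 tT; rewrite -surjective_pairing in u1.
    rewrite /X mulrDr; apply: le_trans (ler_normD _ _) _.
    have k1 : `|a q * time_deriv u q| <= B * `|a q|.
      by rewrite normrM mulrC ler_wpM2r.
    have k2 : `|a q * dot (g q.1 q.2) (grad (fun x => u (q.1, x)) q.2)| <=
        \sum_i B * (h * g q.1 q.2 0 i ^+ 2 + h^-1 * M * `|a q|).
      rewrite /dot mulr_sumr; apply: le_trans (ler_norm_sum _ _ _) _; apply: ler_sum => i _.
      rewrite mulrA normrM [leLHS]mulrC; apply: ler_pM => //.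
        by rewrite mxE derive_slice; exact: u2.
      rewrite normrM; set b := g q.1 q.2 0 i.
      have aqM : `|a q| <= M by rewrite /a distrC; exact: aM.
      have [le1|le1] := leP `|a q| (h * `|b|).
        apply: (@le_trans _ _ (h * b ^+ 2)).
          by rewrite -[b ^+ 2]real_normK ?num_real// expr2 mulrA ler_wpM2r.
        by rewrite lerDl !mulr_ge0// invr_ge0 ltW.
      apply: (@le_trans _ _ (h^-1 * M * `|a q|)).
        rewrite mulrC ler_wpM2r// mulrC ler_pdivlMr// mulrC; exact: le_trans (ltW le1) aqM.
      by rewrite lerDr mulr_ge0 ?sqr_ge0// ltW.
    apply: le_trans (lerD k1 k2) _.
    rewrite -mulr_sumr big_split/= sumr_const card_ord -mulr_sumr -[_ *+ d]mulr_natl.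
    by rewrite le_eqVlt; apply/orP; left; apply/eqP; ring.
  have h5 := ap_eq ap tu tB.
  rewrite eX addrAC; apply: le_trans (ler_normD _ _) _; apply: le_trans (lerD h5 hK) _.
  rewrite -exprVn -/h.
  have h7 : C * (1 + B) * e <= C * (1 + B) * h by rewrite ler_wpM2l ?mulr_ge0 ?addr_ge0.
  have h8 : B * T * h ^+ 2 <= B * T * h by rewrite ler_wpM2l ?mulr_ge0// ltW.
  have -> : B * (1 + d%:R * h^-1 * M) * (h ^+ 2 * T) = B * T * h ^+ 2 + d%:R * M * T * B * h.
    by field; rewrite gt_eqF.
  have x1 : 0 <= (C + d%:R + 1 + M) * C * ((1 + B) * h) by rewrite !mulr_ge0 ?addr_ge0// ltW.
  have x2 : 0 <= (C + T + d%:R * M * T) * h.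
    by rewrite !mulr_ge0 ?addr_ge0 ?mulr_ge0// ltW.
  have -> : err_const * (1 + B) * h = (C + d%:R + 1 + M) * C * ((1 + B) * h) + (C + T + d%:R * M * T) * h +
    C * (1 + B) * h + B * (h * C) + B * T * h + d%:R * M * T * B * h by rewrite /err_const; ring.
  move: x1 x2 h7 h8; move: (_ * ((1 + B) * h)) ((C + T + d%:R * M * T) * h) => X1 X2.
  move: (B * (h * C)) (d%:R * M * T * B * h) (C * (1 + B) * e) (C * (1 + B) * h) (B * T * h ^+ 2) (B * T * h).
  move=> *; lra.
Qed.

End candidate_of_approximant.

(** * The limit of the approximate solutions *)

Section measurable_rows.
Context {R : realType} {n : nat} {dX : measure_display} {X : measurableType dX} (D : set X).

Lemma measurable_rows (mD : measurable D) (f : X -> 'rV[R]_n) :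
  (forall i, measurable_fun D (fun x => f x 0 i)) -> measurable_fun D f.
Proof.
move=> mf _ B.
suff : g_sigma_preimage (fun (i : 'I_n) (x : 'rV[R]_n) => x 0 i : R) `<=`
    [set B | measurable (D `&` f @^-1` B)] by apply.
apply: smallest_sub; first split => /=.
- by rewrite preimage_set0 setI0.
- move=> A mA; rewrite setTD preimage_setC -setDE.
  have -> : D `\` f @^-1` A = D `\` (D `&` f @^-1` A) by rewrite setDIr setDv set0U.
  exact: measurableD.
- by move=> F mF; rewrite preimage_bigcup setI_bigcupr; exact: bigcupT_measurable.
rewrite -bigcup_seq => A [i _ [C mC <-]] /=.
by have := mf i mD C mC; rewrite setTI.
Qed.

Lemma measurable_enorm (f : X -> 'rV[R]_n) : (forall i, measurable_fun D (fun x => f x 0 i)) ->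
  measurable_fun D (fun x => enorm (f x)).
Proof.
move=> mf; have ms : measurable_fun setT (@Num.sqrt R) by apply: continuous_measurable_fun; exact: (@sqrt_continuous R).
apply: (measurableT_comp ms).
by apply: measurable_sum => i; apply: measurable_funM.
Qed.

End measurable_rows.

(** * Radial projection on the unit ball *)

Section ball_projection.
Context {R : realType} {n : nat}.
Implicit Types u v : 'rV[R]_n.

(** Applied to the limit field, whose approximants are bounded by 1 + 2^-k, it secures length at
    most 1 at every point. The inverse is a real power so that [measurable_powR] applies. *)
Definition ball_proj v : 'rV[R]_n := Num.max 1 (enorm v) `^ (-1) *: v.

Let max1_gt0 v : 0 < Num.max 1 (enorm v). Proof. by rewrite lt_max ltr01. Qed.

Let ball_projE v : ball_proj v = (Num.max 1 (enorm v))^-1 *: v.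
Proof. by rewrite /ball_proj powRN powRr1// ltW. Qed.

Lemma enorm_ball_proj v : enorm (ball_proj v) <= 1.
Proof.
rewrite ball_projE enormZ ger0_norm ?invr_ge0 ?(ltW (max1_gt0 v))//.
by rewrite ler_pdivrMl// mulr1 le_max lexx orbT.
Qed.

Lemma ball_proj_dist u v (h : R) : 0 <= h -> enorm u <= 1 + h -> enorm (u - ball_proj v) <= 2 * enorm (u - v) + h.
Proof.
move=> h0 uh; have -> : u - ball_proj v = (u - v) + (v - ball_proj v) by rewrite addrA subrK.
apply: le_trans (enormD _ _) _; have e0 := enorm_ge0 (u - v).
have hv : enorm v <= enorm (u - v) + 1 + h.
  have : enorm v <= enorm u + enorm (v - u).
    by apply: le_trans (enormD _ _); rewrite addrC subrK.
  have -> : enorm (v - u) = enorm (u - v) by rewrite -opprB -scaleN1r enormZ normrN1 mul1r.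
  by move: uh; lra.
have : enorm (v - ball_proj v) <= enorm (u - v) + h; last by lra.
have -> : v - ball_proj v = (1 - (Num.max 1 (enorm v))^-1) *: v by rewrite scalerBl scale1r ball_projE.
rewrite enormZ; have [v1|v1] := leP (enorm v) 1.
  by rewrite invr1 subrr normr0 mul0r addr_ge0.
have v0 : 0 < enorm v := lt_trans ltr01 v1.
rewrite ger0_norm; last by rewrite subr_ge0 invf_le1// ltW.
rewrite mulrBl mul1r mulVf ?gt_eqF//; lra.
Qed.

End ball_projection.

Section limit_tuple.
Context {R : realType} {d : nat}.
Variables (T Ce C : R) (rho0 : 'rV[R]_d -> R) (rho : R -> 'rV[R]_d -> R).
Hypotheses (T_gt0 : 0 < T) (C_ge0 : 0 <= C).
Local Notation ST := (measurableTypeR R * 'rV[R]_d)%type.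
Local Notation I := (option ('I_d + 'I_d)).
Variable F_ : nat -> I -> R -> 'rV[R]_d -> R.
Hypotheses (cF : forall k, candidate T Ce rho0 rho k (F_ k)) (eF : forall k, cenergy T (F_ k) <= C)
  (dF : forall k, cenergy T (fun c t x => F_ k c t x - F_ k.+1 c t x) <= 8 * 16^-1 ^+ k).
Local Notation mu := (@spacetime R d).
Local Notation D := (slab T : set ST).

Let mD : measurable D. Proof. exact: measurable_slab. Qed.
Let sb k c : bm D (fun q => F_ k c q.1 q.2) := cd_slab (cF k) c.
Let mFt k c t : measurable_fun setT (F_ k c t) := (proj1 (cd_bm (cF k) c t)).
Let int (f : ST -> R) : bm D f -> mu.-integrable D (EFin \o f).
Proof. exact: slab_integrable. Qed.

Let muD : (mu D = T%:E)%E. Proof. exact: spacetime_slab. Qed.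

Let slab_cst (a : R) : \int[mu]_(q in D) a = a * T.
Proof. by rewrite Rintegral_cst// [X in fine X]muD. Qed.

(** From squared L2 norms of order 16^-k to L1 norms: |a| <= s a^2 + 1 / s with s = 4^k. The result
    is summable over k, as [integral_blim] requires. *)
Lemma slab_dist k c : (\int[mu]_(q in D) (`|F_ k c q.1 q.2 - F_ k.+1 c q.1 q.2|)%:E <= ((8 + T) / 2 ^+ k)%:E)%E.
Proof.
have b1 := bmB (sb k c) (sb k.+1 c); have b2 := bm_norm b1; have b3 := bmX 2 b1.
rewrite -EFin_Rintegral// ?lee_fin; last exact: int.
pose s : R := 4 ^+ k; have s0 : 0 < s by rewrite exprn_gt0.
have h1 : \int[mu]_(q in D) `|F_ k c q.1 q.2 - F_ k.+1 c q.1 q.2| <=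
    s * \int[mu]_(q in D) ((F_ k c q.1 q.2 - F_ k.+1 c q.1 q.2) ^+ 2) + \int[mu]_(q in D) s^-1.
  rewrite -RintegralZl -?RintegralD//; try (apply: int => //; try exact: bmZ; exact: bm_cst).
  apply: le_Rintegral => //; try (apply: int => //).
    by apply: bmD; [exact: bmZ|exact: bm_cst].
  move=> q _; move: (_ - _) => a.
  have : 0 <= (s * `|a| - 2^-1) ^+ 2 by exact: sqr_ge0.
  rewrite -[a ^+ 2]real_normK ?num_real//; move: `|a| (normr_ge0 a) => {}a a0 h.
  rewrite -(ler_pM2l s0) mulrDr mulfV ?gt_eqF//.
  have -> : s * (s * a ^+ 2) = (s * a) ^+ 2 by ring.
  by move: h; move: (s * a) => x; rewrite !expr2; lra.
apply: le_trans h1 _; rewrite slab_cst.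
have h2 : \int[mu]_(q in D) ((F_ k c q.1 q.2 - F_ k.+1 c q.1 q.2) ^+ 2) <= 8 * 16^-1 ^+ k.
  apply: le_trans (dF k); apply: le_Rintegral => //; try apply: int => //.
    by apply: bm_sum => c'; exact: (bmX _ (bmB (sb k c') (sb k.+1 c'))).
  by move=> q _; rewrite (bigD1 c)//= lerDl sumr_ge0// => c' _; exact: sqr_ge0.
have h3 : s * (8 * 16^-1 ^+ k) = 8 * s^-1.
  have -> : 16^-1 ^+ k = s^-1 * s^-1 :> R.
    by rewrite /s -!exprVn -exprMn; congr (_ ^+ k); rewrite -invfM -natrM.
  by field; rewrite gt_eqF.
apply: (@le_trans _ _ (8 * s^-1 + s^-1 * T)).
  by rewrite lerD2r -h3 ler_wpM2l ?(ltW s0).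
rewrite [s^-1 * T]mulrC -mulrDl ler_wpM2l ?addr_ge0 ?(ltW T_gt0)//.
by rewrite lef_pV2 ?posrE ?exprn_gt0// /s lerXn2r ?nnegrE// ler_nat.
Qed.

Let G c t x := blim (fun k => F_ k c t) x.

Let mGt c t : measurable_fun setT (G c t).
Proof. by apply: measurable_blim => k; exact: mFt. Qed.

Let mG c : measurable_fun D (fun q => G c q.1 q.2).
Proof.
apply: (@measurable_blim R _ ST D (fun k (q : ST) => F_ k c q.1 q.2)) => k; exact: (proj1 (sb k c)).
Qed.

Let distG k c : (\int[mu]_(q in D) (`|F_ k c q.1 q.2 - G c q.1 q.2|)%:E <= (2 * (8 + T) / 2 ^+ k)%:E)%E.
Proof.
apply: (@integral_blim R _ ST mu D (fun k (q : ST) => F_ k c q.1 q.2)) => //.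
- by move=> i; exact: (proj1 (sb i c)).
- by rewrite addr_ge0// ltW.
- by move=> i; exact: slab_dist.
Qed.

(** Fatou's lemma along the sequence, which converges almost everywhere, keeps the L2 bound. *)
Let sqrG c : (\int[mu]_(q in D) (G c q.1 q.2 ^+ 2)%:E <= C%:E)%E.
Proof.
have mF k : measurable_fun D (fun q => (F_ k c q.1 q.2 ^+ 2)%:E).
  by apply/measurable_EFinP; exact: (proj1 (bmX 2 (sb k c))).
have aecv : {ae mu, forall q, D q -> (`|F_ k c q.1 q.2 - G c q.1 q.2|)%:E @[k --> \oo] --> 0%E}.
  apply: (@ae_cvg0 R _ ST mu D mD (fun k q => (`|F_ k c q.1 q.2 - G c q.1 q.2|)%:E) (2 * (8 + T))).
  - by rewrite mulr_ge0// addr_ge0// ltW.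
  - move=> k; apply/measurable_EFinP; apply: measurableT_comp => //; apply: measurable_funB => //.
    exact: (proj1 (sb k c)).
  - by move=> k q _; rewrite lee_fin.
  - by move=> k; exact: distG.
have -> : (\int[mu]_(q in D) (G c q.1 q.2 ^+ 2)%:E = \int[mu]_(q in D) limn_einf (fun k => (F_ k c q.1 q.2 ^+ 2)%:E))%E.
  apply: ae_eq_integral => //.
  - by apply/measurable_EFinP; apply: measurable_funX; exact: mG.
  - rewrite /limn_einf; apply: (measurableT_comp (f := -%E)) => //.
    by apply: measurable_fun_limn_esup => k; apply: (measurableT_comp (f := -%E)).
  apply: filterS aecv => q + Dq => /(_ Dq) h.
  have h1 : F_ k c q.1 q.2 @[k --> \oo] --> G c q.1 q.2.
    apply/cvgrPdist_le => eps eps0.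
    have /fine_cvgP[_ /cvgrPdist_le /(_ eps eps0)] := h.
    by apply: filterS => k; rewrite /= sub0r normrN normr_id distrC.
  have h2 : (F_ k c q.1 q.2 ^+ 2)%:E @[k --> \oo] --> (G c q.1 q.2 ^+ 2)%:E.
    apply: cvg_EFin; first exact: nearW.
    by rewrite /= expr2; under eq_cvg do rewrite /= expr2; exact: cvgM.
  by rewrite (cvg_limn_einf_sup h2).1.
apply: le_trans (fatou mu mD mF _) _; first by move=> k q _; rewrite lee_fin sqr_ge0.
rewrite limn_einf_lim; apply: lime_le; first exact: is_cvg_einfs.
apply: nearW => k; apply: (@le_trans _ _ (\int[mu]_(q in D) (F_ k c q.1 q.2 ^+ 2)%:E)%E).
  by apply: ereal_inf_lbound; exists k => //=.
rewrite -EFin_Rintegral//; last exact: int (bmX _ (sb k c)).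
rewrite lee_fin; apply: le_trans (eF k); apply: le_Rintegral => //; try apply: int => //.
- exact: bmX.
- by apply: bm_sum => c'; exact: bmX.
- by move=> q _; rewrite (bigD1 c)//= lerDl sumr_ge0// => c' _; exact: sqr_ge0.
Qed.

(** H consists of the upper limits G, with the field z projected on the unit ball. Up to 2^-k the
    approximate fields lie in the ball already, so that the projection respects the rate of
    convergence, see [ball_proj_dist]. *)
Lemma limit_tuple : exists2 H : I -> R -> 'rV[R]_d -> R,
  [/\ forall c t, measurable_fun setT (H c t), forall c, measurable_fun D (fun q => H c q.1 q.2) &
      forall t x, enorm (cfield H t x) <= 1] &
  exists2 L : R, 0 <= L & forall c, (\int[mu]_(q in D) (H c q.1 q.2 ^+ 2)%:E <= L%:E)%E /\
    forall k, (\int[mu]_(q in D) (`|F_ k c q.1 q.2 - H c q.1 q.2|)%:E <= (L / 2 ^+ k)%:E)%E.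
Proof.
pose z t x := ball_proj (cfield G t x).
pose H (c : I) t x := if c is Some (inl i) then z t x 0 i else G c t x.
have zE t x : cfield H t x = z t x by apply/rowP => i; rewrite mxE.
have mz (dX : measure_display) (X : measurableType dX) (A : set X) (f : X -> R) (h : X -> 'rV[R]_d) i :
    (forall l, measurable_fun A (fun q => cfield G (f q) (h q) 0 l)) ->
    measurable_fun A (fun q => z (f q) (h q) 0 i).
  move=> ml; rewrite /z /ball_proj; under eq_fun do rewrite mxE.
  apply: measurable_funM => //.
  apply: (measurableT_comp (measurable_powR _)); apply: measurable_maxr => //.
  exact: measurable_enorm.
have mHt c t : measurable_fun setT (H c t).
  case: c => [[i|i]|]; try exact: mGt.
  apply: (mz _ _ setT (fun=> t) id) => l; under eq_fun do rewrite mxE; exact: mGt.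
have mH c : measurable_fun D (fun q => H c q.1 q.2).
  case: c => [[i|i]|]; try exact: mG.
  apply: (mz _ _ D fst snd) => l; under eq_fun do rewrite mxE; exact: mG.
pose L0 : R := 2 * (8 + T); have L00 : 0 <= L0 by rewrite mulr_ge0// addr_ge0// ltW.
exists H; first by split => // t x; rewrite zE enorm_ball_proj.
have zd k i q : `|F_ k (Some (inl i)) q.1 q.2 - z q.1 q.2 0 i| <=
    2 * (\sum_l `|F_ k (Some (inl l)) q.1 q.2 - G (Some (inl l)) q.1 q.2|) + 2^-1 ^+ k.
  have h0 : 0 <= 2^-1 ^+ k :> R by rewrite exprn_ge0// invr_ge0.
  have := ball_proj_dist (cfield G q.1 q.2) h0 (cd_z (cF k) q.1 q.2).
  move=> h; apply: le_trans (le_trans h _); last first.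
    rewrite lerD2r ler_wpM2l//; apply: le_trans (enorm_sum _) _; apply: ler_sum => l _.
    by rewrite !mxE.
  by have := norm_coord_enorm (cfield (F_ k) q.1 q.2 - ball_proj (cfield G q.1 q.2)) i; rewrite !mxE.
have LL : 0 <= 2 * d%:R * L0 by apply: mulr_ge0 => //; exact: mulr_ge0.
have T0 := ltW T_gt0; have C0 := C_ge0.
exists (L0 + C + T + 2 * d%:R * L0).
  by move: LL T0 C0 L00; move: (2 * d%:R * L0) => X; lra.
have lowr c k : (\int[mu]_(q in D) (`|F_ k c q.1 q.2 - G c q.1 q.2|)%:E <= ((L0 + C + T + 2 * d%:R * L0) / 2 ^+ k)%:E)%E.
  apply: le_trans (distG k c) _; rewrite lee_fin ler_wpM2r ?invr_ge0 ?exprn_ge0// -/L0; move: LL; move: (2 * d%:R * L0) => X; lra.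
have lsqr c : (\int[mu]_(q in D) (G c q.1 q.2 ^+ 2)%:E <= (L0 + C + T + 2 * d%:R * L0)%:E)%E.
  by apply: le_trans (sqrG c) _; rewrite lee_fin; move: LL L00; move: (2 * d%:R * L0) => X; lra.
case=> [[i|i]|]; [split|by split; [exact: lsqr|exact: lowr]|by split; [exact: lsqr|exact: lowr]].
- apply: (@le_trans _ _ (\int[mu]_(q in D) (cst 1%E) q)%E).
    apply: ge0_le_integral => //.
    - by move=> q _; rewrite lee_fin sqr_ge0.
    - by apply/measurable_EFinP; apply: measurable_funX; exact: mH (Some (inl i)).
    move=> q _; rewrite lee_fin -[_ ^+ 2]real_normK ?num_real// expr_le1//.
    apply: le_trans (norm_coord_enorm _ _) (enorm_ball_proj _).
  rewrite integral_cst// mul1e [X in (X <= _)%E]muD lee_fin; move: LL L00; move: (2 * d%:R * L0) => X; lra.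
- move=> k.
  have ml l : measurable_fun D (fun q => (`|F_ k (Some (inl l)) q.1 q.2 - G (Some (inl l)) q.1 q.2|)%:E).
    apply/measurable_EFinP; apply: measurableT_comp => //.
    by apply: measurable_funB; [exact: (proj1 (sb k _))|exact: mG].
  apply: (@le_trans _ _ (\int[mu]_(q in D)
     (2%:E * \sum_l (`|F_ k (Some (inl l)) q.1 q.2 - G (Some (inl l)) q.1 q.2|)%:E + (2^-1 ^+ k)%:E))%E).
    apply: ge0_le_integral => //.
    - apply/measurable_EFinP; apply: measurableT_comp => //; apply: measurable_funB.
        exact: (proj1 (sb k _)).
      exact: mH (Some (inl i)).
    - apply: emeasurable_funD => //; apply: measurable_funeM; exact: emeasurable_sum.
    - by move=> q _; rewrite sumEFin -EFinM -EFinD lee_fin; exact: zd.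
  rewrite ge0_integralD//; last 2 first.
  - by move=> q _; rewrite mule_ge0// sume_ge0.
  - apply: measurable_funeM; exact: emeasurable_sum.
  rewrite integral_cst// [X in (_ + _ * X)%E]muD ge0_integralZl//; last 2 first.
  - exact: emeasurable_sum.
  - by move=> q _; rewrite sume_ge0.
  rewrite ge0_integral_sum//.
  apply: (@le_trans _ _ (2%:E * \sum_(l < d) (L0 / 2 ^+ k)%:E + (2^-1 ^+ k)%:E * T%:E)%E).
    by rewrite leeD2r// lee_wpmul2l// lee_sum// => l _; exact: distG.
  rewrite sumEFin -EFinM -EFinM -EFinD lee_fin sumr_const card_ord -[_ *+ d]mulr_natl exprVn.
  have -> : 2 * (d%:R * (L0 / 2 ^+ k)) + (2 ^+ k)^-1 * T = (T + 2 * d%:R * L0) / 2 ^+ k by ring.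
  by rewrite ler_wpM2r ?invr_ge0 ?exprn_ge0//; move: (2 * d%:R * L0) => X; lra.
Qed.

End limit_tuple.

(** * Membership in Lebesgue spaces *)

Section Lfun_tools.
Context {R : realType} {d : nat}.
Implicit Types f : 'rV[R]_d -> R.

Lemma torus_gt0 : (0 < torus d [set: 'rV[R]_d])%E.
Proof. by rewrite [X in (_ < X)%E](probability_setT (torus d)) lte01. Qed.

Lemma Lnorm_oo_le f (B : R) : (forall x, `|f x| <= B) -> ('N[torus d]_+oo[EFin \o f] <= B%:E)%E.
Proof.
move=> fB; rewrite unlock torus_gt0; apply/ess_supP; apply: nearW => x /=.
by rewrite lee_fin.
Qed.

Lemma bm_Lfun f p : (1 <= p)%E -> bm setT f -> f \in Lfun (torus d) p.
Proof.
move=> p1 [mf [B fB]].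
have : f \in Lfun (torus d) +oo%E.
  rewrite inE; apply/andP; split; rewrite inE//=.
  by apply: le_lt_trans (Lnorm_oo_le (fun x => fB x I)) _; exact: ltry.
apply: Lfun_subset => //; [by rewrite leey|exact: fin_num_measure|by rewrite leey].
Qed.

Lemma sqr_Lfun f : measurable_fun setT f -> (\int[torus d]_x (f x ^+ 2)%:E < +oo)%E ->
  f \in Lfun (torus d) 2%:E.
Proof.
move=> mf f2; rewrite inE; apply/andP; split; rewrite inE//= /finite_norm unlock poweR_lty//.
under eq_integral do rewrite /= powR_mulrn// real_normK ?num_real//.
exact: f2.
Qed.

End Lfun_tools.

Section ae_tools.
Context {R : realType} {dX : measure_display} {X : measurableType dX} (mu : {measure set X -> \bar R}).
Implicit Types P Q : X -> Prop.

Lemma ae_imply P Q : (forall x, P x -> Q x) -> {ae mu, forall x, P x} -> {ae mu, forall x, Q x}.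
Proof. by move=> PQ; exact: filterS. Qed.

Lemma ae_and P Q : {ae mu, forall x, P x} -> {ae mu, forall x, Q x} -> {ae mu, forall x, P x /\ Q x}.
Proof. by move=> hP hQ; exact: filterI. Qed.

Lemma ae_forall_fin (A : finType) (P : A -> X -> Prop) :
  (forall a, {ae mu, forall x, P a x}) -> {ae mu, forall x, forall a, P a x}.
Proof. by move=> hP; apply: filter_forall. Qed.

End ae_tools.

(** * Relations satisfied by the limit *)

Section limit_relations.
Context {R : realType} {d : nat}.

Lemma ae_time_imply (T : R) (P Q : R -> Prop) : (forall t, t \in `]0, T[ -> P t -> Q t) ->
  ae_time T P -> ae_time T Q.
Proof.
move=> PQ; apply: (@ae_imply R _ (measurableTypeR R) (@lebesgue_measure R)).
by move=> t h tT; exact: PQ tT (h tT).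
Qed.

Lemma ae_time_and (T : R) (P Q : R -> Prop) : ae_time T P -> ae_time T Q ->
  ae_time T (fun t => P t /\ Q t).
Proof.
move=> hP hQ; have := @ae_and R _ (measurableTypeR R) (@lebesgue_measure R) _ _ hP hQ.
apply: (@ae_imply R _ (measurableTypeR R) (@lebesgue_measure R)).
by move=> t [h1 h2] tT; split; [exact: h1|exact: h2].
Qed.

Lemma ae_time_forall (T : R) (A : finType) (P : A -> R -> Prop) : (forall a, ae_time T (P a)) ->
  ae_time T (fun t => forall a, P a t).
Proof.
move=> hP; have := @ae_forall_fin R _ (measurableTypeR R) (@lebesgue_measure R) _ _ hP.
apply: (@ae_imply R _ (measurableTypeR R) (@lebesgue_measure R)).
by move=> t h tT a; exact: h.
Qed.

Lemma squeeze_eq0 (a : nat -> R) (l : R) (e : nat -> R) (c : R) : a k @[k --> \oo] --> l ->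
  (forall k, `|a k| <= c * e k) -> e k @[k --> \oo] --> 0 -> l = 0.
Proof.
move=> al ae e0.
have ce : c * e k @[k --> \oo] --> (0 : R).
  by rewrite -[X in _ --> X](mulr0 c); apply: cvgM => //; exact: cvg_cst.
have a0 : a k @[k --> \oo] --> (0 : R).
  apply: norm_cvg0; apply: (squeeze_cvgr _ (cvg_cst 0) ce).
  by apply: nearW => k; rewrite normr_ge0 ae.
exact: (cvg_unique _ al a0).
Qed.

Variables (V T Ce L : R) (rho0 : 'rV[R]_d -> R) (rho : R -> 'rV[R]_d -> R).
Hypotheses (T_gt0 : 0 < T) (Ce_ge0 : 0 <= Ce) (L_ge0 : 0 <= L)
  (brho : forall t, bm setT (rho t)).
Local Notation ST := (measurableTypeR R * 'rV[R]_d)%type.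
Local Notation I := (option ('I_d + 'I_d)).
Local Notation mu := (@spacetime R d).
Local Notation D := (slab T : set ST).
Hypotheses (sbrho : bm D (fun q => rho q.1 q.2))
  (tvrho : forall t, 0 <= t <= T -> (TV (rho t) <= V%:E)%E).
Variables (F_ : nat -> I -> R -> 'rV[R]_d -> R) (H : I -> R -> 'rV[R]_d -> R).
Hypotheses (cF : forall k, candidate T Ce rho0 rho k (F_ k))
  (mHt : forall c t, measurable_fun setT (H c t)) (mH : forall c, measurable_fun D (fun q => H c q.1 q.2))
  (zH : forall t x, enorm (cfield H t x) <= 1)
  (sqrH : forall c, (\int[mu]_(q in D) (H c q.1 q.2 ^+ 2)%:E <= L%:E)%E)
  (distH : forall c k, (\int[mu]_(q in D) (`|F_ k c q.1 q.2 - H c q.1 q.2|)%:E <= (L / 2 ^+ k)%:E)%E).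

Let mD : measurable D. Proof. exact: measurable_slab. Qed.
Let sb k c : bm D (fun q => F_ k c q.1 q.2) := cd_slab (cF k) c.
Let bFt k c t : bm setT (F_ k c t) := cd_bm (cF k) c t.

Let bHz i t : bm setT (H (Some (inl i)) t).
Proof.
split => //; exists 1 => x _; have := norm_coord_enorm (cfield H t x) i.
by rewrite mxE => h; exact: le_trans h (zH t x).
Qed.

(** [near_solution] quantifies over all test functions at a fixed time, so that a single null set of
    times serves them all. *)
Let good (er : nat -> R -> R) t := [/\ forall c, (\int[torus d]_x (`|F_ k c t x - H c t x|)%:E @[k --> \oo] --> 0%E)%E,
  er k t @[k --> \oo] --> (0 : R), forall k, near_solution rho (F_ k) (er k t) t &
  (\int[torus d]_x (H None t x ^+ 2)%:E < +oo)%E].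

Lemma ae_good : exists er, ae_time T (good er).
Proof.
have /choice[er her] : forall k, exists er : R -> R, [/\ forall t, 0 <= er t, bm D (fun q => er q.1),
    \int[mu]_(q in D) er q.1 <= Ce / 2 ^+ k & forall t, 0 <= t <= T -> near_solution rho (F_ k) (er t) t].
  by move=> k; exact: cd_err (cF k).
exists er.
have a1 : ae_time T (fun t => forall c, (\int[torus d]_x (`|F_ k c t x - H c t x|)%:E @[k --> \oo] --> 0%E)%E).
  apply: ae_time_forall => c.
  apply: (@ae_slice_cvg0 R d T (fun k t x => (`|F_ k c t x - H c t x|)%:E) L) => // k.
  apply/measurable_EFinP; apply: measurableT_comp => //; apply: measurable_funB => //.
  exact: (proj1 (sb k c)).
have a2 : ae_time T (fun t => er k t @[k --> \oo] --> (0 : R)).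
  have : ae_time T (fun t => (\int[torus d]_x (er k t)%:E @[k --> \oo] --> 0%E)%E).
    apply: (@ae_slice_cvg0 R d T (fun k t x => (er k t)%:E) Ce) => //.
    + by move=> k; apply/measurable_EFinP; have [_ [] ] := her k.
    + by move=> k t x; rewrite lee_fin; have [] := her k.
    + move=> k; have [_ b i _] := her k; rewrite -EFin_Rintegral//; last exact: slab_integrable.
  apply: ae_time_imply => t tT h.
  have e k : (\int[torus d]_(x in [set: 'rV[R]_d]) (er k t)%:E = (er k t)%:E)%E.
    by rewrite integral_cst// [X in (_ * X)%E](probability_setT (torus d)) mule1.
  have /fine_cvgP[_] := h; apply: cvg_trans; apply: near_eq_cvg; apply: nearW => k /=.
  by rewrite e.
have a3 : ae_time T (fun t => (\int[torus d]_x (H None t x ^+ 2)%:E < +oo)%E).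
  apply: (@ae_slice_lty R d T (fun t x => (H None t x ^+ 2)%:E)).
  + apply/measurable_EFinP; apply: measurable_funX; exact: mH.
  + by move=> t x; rewrite lee_fin sqr_ge0.
  + by apply: le_lt_trans (sqrH None) _; exact: ltry.
apply: ae_time_imply (ae_time_and (ae_time_and a1 a2) a3) => t tT [[h1 h2] h3]; split => //.
move=> k; have [_ _ _] := her k; apply.
by move: tT; rewrite in_itv/= => /andP[t0 t1]; rewrite !ltW.
Qed.

Let tdx_lty : (torus d [set: 'rV[R]_d] < +oo)%E. Proof. exact: torus_lty. Qed.

Section good_time.
Variables (er : nat -> R -> R) (t : R).
Hypothesis gt : good er t.

Let pairing c (psi : 'rV[R]_d -> R) : bm setT psi ->
  \int[torus d]_x (F_ k c t x * psi x) @[k --> \oo] --> \int[torus d]_x (H c t x * psi x).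
Proof.
move=> bpsi; have [h _ _ _] := gt.
exact: (@cvg_pairing R _ _ (torus d) setT measurableT tdx_lty (fun k => F_ k c t)).
Qed.

Lemma good_weak_div : weak_div (cfield H t) (H None t).
Proof.
move=> phi tphi; have [B tB] := test_boundP tphi; have [_ e0 ns _] := gt.
have dotE (G : I -> R -> 'rV[R]_d -> R) : (forall i, bm setT (G (Some (inl i)) t)) ->
    \int[torus d]_x (dot (cfield G t x) (grad phi x)) =
    \sum_i \int[torus d]_x (G (Some (inl i)) t x * 'D_(unitv i) phi x).
  move=> bG; rewrite -Rintegral_sum//; last first.
    by move=> i; apply: torus_integrable; apply: bmM => //; exact: bm_dtest.
  by apply: eq_Rintegral => x _; apply: eq_bigr => i _; rewrite !mxE.
apply/eqP; rewrite -addr_eq0; apply/eqP.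
apply: (@squeeze_eq0 (fun k => \int[torus d]_x (dot (cfield (F_ k) t x) (grad phi x)) +
  \int[torus d]_x (F_ k None t x * phi x)) _ (er ^~ t) (1 + B)) => //.
- apply: cvgD; last exact: pairing (bm_test tphi).
  rewrite dotE//; under eq_cvg do rewrite dotE//.
  apply: cvg_big => //; first exact: add_continuous.
  by move=> i _; exact: pairing (bm_dtest i tphi).
- by move=> k; have [_ h _] := ns k; exact: h.
Qed.

Lemma good_weak_grad : weak_grad (H None t) (cgrad H t).
Proof.
move=> phi i tphi; have [B tB] := test_boundP tphi; have [_ e0 ns _] := gt.
rewrite (_ : \int[torus d]_x (cgrad H t x 0 i * phi x) = \int[torus d]_x (H (Some (inr i)) t x * phi x)); last first.
  by apply: eq_Rintegral => x _; rewrite mxE.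
apply/eqP; rewrite -addr_eq0; apply/eqP.
apply: (@squeeze_eq0 (fun k => \int[torus d]_x (F_ k None t x * 'D_(unitv i) phi x) +
  \int[torus d]_x (F_ k (Some (inr i)) t x * phi x)) _ (er ^~ t) (1 + B)) => //.
- by apply: cvgD; apply: pairing; [exact: bm_dtest|exact: bm_test].
- by move=> k; have [_ _ h] := ns k; exact: h.
Qed.

Lemma field_boundP (zeta : 'rV[R]_d -> 'rV[R]_d) : torus_test_field zeta ->
  exists B, forall i, test_bound (fun x => zeta x 0 i) B.
Proof.
move=> [sz pz]; have /choice[b hb] : forall i, exists b, test_bound (fun x => zeta x 0 i) b.
  by move=> i; apply: test_boundP; split => // x k; rewrite pz.
exists (\sum_i b i) => i; have [b0 h1 h2 h3 h4] := hb i.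
have bS : b i <= \sum_i b i.
  by rewrite (bigD1 i)//= lerDl sumr_ge0// => l _; have [] := hb l.
split.
- exact: le_trans bS.
- by move=> x; apply: le_trans (h1 x) bS.
- by move=> x l; apply: le_trans (h2 x l) bS.
- move=> x y; have [h5 h6] := h3 x y; have y0 : 0 <= \sum_l `|y 0 l| by rewrite sumr_ge0.
  by split=> [|l]; [apply: le_trans h5 _|apply: le_trans (h6 l) _]; rewrite ler_wpM2r.
- by move=> x p h; apply: le_trans (h4 x p h) _; rewrite ler_wpM2r ?sqr_ge0.
Qed.

(** For each test field the density is fixed and bounded while div z converges in L1, so the pairing
    passes to the limit; the supremum over test fields is taken afterwards. *)
Lemma good_TV : (TV (rho t) <= (- \int[torus d]_x (rho t x * H None t x))%:E)%E.
Proof.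
have [_ e0 ns _] := gt.
apply: ge_ereal_sup => _ [zeta [tz z1] <-]; rewrite lee_fin.
have [B tB] := field_boundP tz.
have -> : \int[torus d]_x (- rho t x * diverg zeta x) = - (\int[torus d]_x (rho t x * diverg zeta x)).
  rewrite -mulN1r -RintegralZl//; last first.
    apply: torus_integrable; apply: bmM => //; apply: bm_sum => i; apply: bm_dtest.
    by split; [exact: tz.1|move=> x k; rewrite tz.2].
  by apply: eq_Rintegral => x _; ring.
have h : - (\int[torus d]_x (rho t x * F_ k None t x)) + (1 + B) * er k t @[k --> \oo] -->
    - (\int[torus d]_x (rho t x * H None t x)) + (1 + B) * 0.
  apply: cvgD; last by apply: cvgM => //; exact: cvg_cst.
  apply: cvgN; have := @pairing None _ (brho t).
  have sw (f : 'rV[R]_d -> R) : \int[torus d]_x (f x * rho t x) = \int[torus d]_x (rho t x * f x).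
    by apply: eq_Rintegral => x _; rewrite mulrC.
  by rewrite sw; under eq_cvg do rewrite sw.
rewrite mulr0 addr0 in h; rewrite -(cvg_lim _ h)//; apply: limr_ge; first by apply/cvg_ex; eexists; exact: h.
by apply: nearW => k; have [h1 _ _] := ns k; exact: h1.
Qed.

Lemma good_calA : 0 <= t <= T -> calA (rho t) (cfield H t).
Proof.
move=> tT; have [_ _ _ h2] := gt.
split.
- by split; [exact: bm_Lfun|apply: le_lt_trans (tvrho tT) _; exact: ltry].
- by apply: bm_Lfun => //; rewrite lee1n.
- by apply: Lnorm_oo_le => x /=; rewrite ger0_norm ?enorm_ge0.
exists (H None t); last exact: good_TV.
split; last exact: good_weak_div.
- move=> i; apply: bm_Lfun; first by rewrite lee1n.
  by under eq_fun do rewrite mxE.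
- exact: sqr_Lfun.
Qed.

End good_time.

Lemma limit_weak_equation : weak_equation T rho0 rho (cgrad H).
Proof.
move=> u tu; have [B tB] := stest_boundP tu.
have [su pu _] := tu.
have mu_lty : (mu D < +oo)%E.
  apply: le_lt_trans (ltry T); rewrite le_eqVlt; apply/orP; left; apply/eqP.
  exact: spacetime_slab.
have bt : bm D (fun q => rho q.1 q.2 * time_deriv u q).
  by apply: bmM => //; exact: (bm_spacetime_derive T_gt0 tdir tu).
pose psi i (q : ST) := rho q.1 q.2 * grad (fun x => u (q.1, x)) q.2 0 i.
have bpsi i : bm D (psi i) by apply: bmM => //; exact: bm_spacetime_grad.
have expand (G : I -> R -> 'rV[R]_d -> R) : (forall i, mu.-integrable D (EFin \o (fun q => G (Some (inr i)) q.1 q.2))) ->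
    \int[mu]_(q in D) (rho q.1 q.2 * time_deriv u q +
       rho q.1 q.2 * dot (cgrad G q.1 q.2) (grad (fun x => u (q.1, x)) q.2)) =
    \int[mu]_(q in D) (rho q.1 q.2 * time_deriv u q) +
    \sum_i \int[mu]_(q in D) (G (Some (inr i)) q.1 q.2 * psi i q).
  move=> iG.
  have ip i : mu.-integrable D (EFin \o (fun q => G (Some (inr i)) q.1 q.2 * psi i q)).
    exact: (integrable_mul_bm mD (iG i) (bpsi i)).
  rewrite -Rintegral_sum// -RintegralD//; last 2 first.
  - exact: slab_integrable.
  - rewrite (_ : EFin \o _ = (fun q => \sum_i (EFin \o (fun q => (G (Some (inr i)) q.1 q.2 * psi i q)%R)) q)%E).
      exact: integrable_sum.
    by apply/funext => q /=; rewrite sumEFin.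
  apply: eq_Rintegral => q _; congr (_ + _); rewrite /dot mulr_sumr; apply: eq_bigr => i _.
  by rewrite /psi mxE mulrCA.
have iF k i : mu.-integrable D (EFin \o (fun q => F_ k (Some (inr i)) q.1 q.2)) by exact: slab_integrable.
have iH i : mu.-integrable D (EFin \o (fun q => H (Some (inr i)) q.1 q.2)).
  apply: (integrable_close mD mu_lty (sb 0%N (Some (inr i)))) => //.
  by apply: le_lt_trans (distH _ _) _; exact: ltry.
have expH := expand H iH; rewrite /weak_equation in expH *.
apply/eqP; rewrite -addr_eq0; apply/eqP.
apply: (@squeeze_eq0 (fun k => \int[mu]_(q in D) (rho q.1 q.2 * time_deriv u q +
       rho q.1 q.2 * dot (cgrad (F_ k) q.1 q.2) (grad (fun x => u (q.1, x)) q.2)) +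
       \int[torus d]_x (rho0 x * u (0, x))) _ (fun k => 2^-1 ^+ k) (Ce * (1 + B))).
- apply: cvgD; last exact: cvg_cst.
  rewrite expH; under eq_cvg do rewrite expand//.
  apply: cvgD; first exact: cvg_cst.
  apply: cvg_big => //; first exact: add_continuous.
  move=> i _; apply: (@cvg_pairing R _ _ mu D mD mu_lty (fun k q => F_ k (Some (inr i)) q.1 q.2)) => //.
  apply: (@squeeze_cvge _ _ _ _ (fun=> 0%E) _ (fun k => (L / 2 ^+ k)%:E)).
  + by apply: nearW => k; rewrite integral_ge0//= distH.
  + exact: cvg_cst.
  + apply: cvg_EFin; first exact: nearW.
    rewrite -[X in _ --> X](mulr0 L); apply: cvgM; first exact: cvg_cst.
    by under eq_cvg do rewrite -exprVn; apply: cvg_expr; rewrite ger0_norm ?invr_ge0// invf_lt1// ltr1n.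
- by move=> k; rewrite exprVn; exact: cd_eq (cF k) _ _ tu tB.
- by apply: cvg_expr; rewrite ger0_norm ?invr_ge0// invf_lt1// ltr1n.
Qed.

Lemma limit_div_L2_H1 : div_L2_H1 T (cfield H) (H None) (cgrad H).
Proof.
split.
- exact: mH.
- apply: (@measurable_rows R d _ ST D mD (fun q : ST => cgrad H q.1 q.2)) => i.
  by under eq_fun do rewrite mxE; exact: mH.
- have [er] := ae_good; apply: ae_time_imply => t _ h.
  by split; [exact: good_weak_div h|exact: good_weak_grad h].
have mi c : measurable_fun D (fun q => (H c q.1 q.2 ^+ 2)%:E).
  by apply/measurable_EFinP; apply: measurable_funX; exact: mH.
under eq_integral.
  move=> q _; rewrite EFinD sqr_sqrtr ?dot_ge0// /dot -sumEFin.
  under eq_bigr do rewrite !mxE -expr2.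
  over.
rewrite ge0_integralD//; try (by move=> q _; rewrite ?sume_ge0// => *; rewrite lee_fin sqr_ge0);
  try exact: emeasurable_sum.
rewrite lte_add_pinfty//; first by apply: le_lt_trans (sqrH None) _; exact: ltry.
rewrite ge0_integral_sum//; last by move=> i q _; rewrite lee_fin sqr_ge0.
by rewrite lte_sum_pinfty// => i _; apply: le_lt_trans (sqrH _) _; exact: ltry.
Qed.

Lemma limit_solution : exists z w g, [/\ Loo_field T z, ae_time T (fun t => calA (rho t) (z t)),
  div_L2_H1 T z w g & weak_equation T rho0 rho g].
Proof.
exists (cfield H), (H None), (cgrad H); split.
- split; last by exists 1; apply: aeW => q _; exact: zH.
  apply: (@measurable_rows R d _ ST D mD (fun q : ST => cfield H q.1 q.2)) => i.
  by under eq_fun do rewrite mxE; exact: mH.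
- have [er] := ae_good; apply: ae_time_imply => t tT h.
  apply: (good_calA h); move: tT; rewrite in_itv/= => /andP[t0 t1]; by rewrite !ltW.
- exact: limit_div_L2_H1.
- exact: limit_weak_equation.
Qed.

End limit_relations.

(** * Continuity in the Wasserstein distance *)

Section density_measures.
Context {R : realType} {dX : measure_display} {X : measurableType dX}.

Section as_probability.
Variables (m : {measure set X -> \bar R}) (m1 : m setT = 1%E).

(** The proof that the total mass is 1 is an argument of the definition so that the probability
    structure can be attached to this name. *)
Definition as_probability of m setT = 1%E : set X -> \bar R := m.

HB.instance Definition _ := Measure.copy (as_probability m1) m.
HB.instance Definition _ := Measure_isProbability.Build _ _ _ (as_probability m1) m1.

End as_probability.

Lemma probability_of_measure (m : {measure set X -> \bar R}) : m setT = 1%E ->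
  exists P : probability X R, forall A, P A = m A.
Proof. by move=> m1; exists (as_probability m1). Qed.

Section diagonal_image.
Variable m : {measure set X -> \bar R}.

Definition diagonal_image : set (X * X) -> \bar R := fun A => m ((fun x => (x, x)) @^-1` A).

Let mdiag A : measurable A -> measurable ((fun x : X => (x, x)) @^-1` A).
Proof.
have h : measurable_fun setT (fun x : X => (x, x)) by exact: measurable_fun_pair.
by move=> mA; have := h measurableT A mA; rewrite setTI.
Qed.

Let diag0 : diagonal_image set0 = 0%E.
Proof. by rewrite /diagonal_image preimage_set0 measure0. Qed.

Let diag_ge0 A : (0 <= diagonal_image A)%E. Proof. exact: measure_ge0. Qed.

Let diag_sigma_additive : semi_sigma_additive diagonal_image.
Proof.
move=> F mF tF mUF; rewrite /diagonal_image preimage_bigcup.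
apply: measure_semi_sigma_additive.
- by move=> n; exact: mdiag.
- apply/trivIsetP => /= i j _ _ ij; rewrite -preimage_setI.
  by move/trivIsetP : tF => /(_ _ _ _ _ ij) ->//; rewrite preimage_set0.
- by rewrite -preimage_bigcup; exact: mdiag.
Qed.

HB.instance Definition _ := isMeasure.Build _ _ _ diagonal_image diag0 diag_ge0 diag_sigma_additive.

End diagonal_image.

Variables (mu : probability X R) (f : X -> R).
Hypotheses (bf : bm setT f) (f0 : forall x, 0 <= f x).

Definition density of bm setT f & (forall x, 0 <= f x) : set X -> \bar R :=
  fun A => (\int[mu]_(x in A) (f x)%:E)%E.

Local Notation den := (density bf f0).

Let den0 : den set0 = 0%E. Proof. by rewrite /density integral_set0. Qed.

Let den_ge0 A : (0 <= den A)%E.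
Proof. by apply: integral_ge0 => x _; rewrite lee_fin. Qed.

Let den_sigma_additive : semi_sigma_additive den.
Proof.
move=> /= F mF tF mUF; rewrite /density; apply: cvg_toP.
  apply: ereal_nondecreasing_is_cvgn => m n mn.
  apply: lee_sum_nneg_natr => // k _ _.
  by apply: integral_ge0 => /= x Fkx; rewrite lee_fin.
rewrite ge0_integral_bigcup//=.
  by apply: measurable_funTS; apply/measurable_EFinP; exact: (proj1 bf).
by move=> x _; rewrite lee_fin.
Qed.

HB.instance Definition _ := isMeasure.Build _ _ _ den den0 den_ge0 den_sigma_additive.

Lemma density_fin A : measurable A -> den A \is a fin_num.
Proof.
move=> mA; apply: integrable_fin_num => //; apply: (integrableS measurableT) => //.
apply: bm_integrable => //; by rewrite ltey_eq fin_num_measure.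
Qed.

HB.instance Definition _ := Measure_isFinite.Build _ _ _ den density_fin.

End density_measures.

Section torus_distance.
Context {R : realType} {d : nat}.
Implicit Types x y : 'rV[R]_d.

Let dist_inf x y : has_inf (range (fun k : 'rV[int]_d => enorm (x - y + map_mx intr k))).
Proof.
split; first by exists (enorm (x - y + map_mx intr 0)); exists 0.
by exists 0 => _ [k _ <-]; exact: enorm_ge0.
Qed.

Lemma torus_dist_ge0 x y : 0 <= torus_dist x y.
Proof.
apply: lb_le_inf; first exact: (dist_inf x y).1.
by move=> _ [k _ <-]; exact: enorm_ge0.
Qed.

Lemma torus_dist_le x y k : torus_dist x y <= enorm (x - y + map_mx intr k).
Proof. by apply: ge_inf; [exact: (dist_inf x y).2|exists k]. Qed.

Lemma torus_distxx x : torus_dist x x = 0.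
Proof.
apply/eqP; rewrite eq_le torus_dist_ge0 andbT; apply: le_trans (torus_dist_le x x 0) _.
have -> : x - x + map_mx intr 0 = 0 by apply/rowP => i; rewrite !mxE subrr add0r.
by rewrite -(scale0r 0) enormZ normr0 mul0r.
Qed.

Lemma sqr_torus_dist_le x y : torus_dist x y ^+ 2 <= d%:R.
Proof.
(* Brings every coordinate of x - y into [0, 1). *)
pose k : 'rV[int]_d := \row_i - Num.floor (x 0 i - y 0 i).
have h := torus_dist_le x y k.
apply: (@le_trans _ _ (enorm (x - y + map_mx intr k) ^+ 2)).
  by rewrite ler_pXn2r// nnegrE ?torus_dist_ge0 ?enorm_ge0.
rewrite sqr_sqrtr ?dot_ge0// -[X in _ <= X%:R]card_ord -sumr_const; apply: ler_sum => i _.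
rewrite !mxE rmorphN/= -expr2; have /andP[h1 h2] := floor_itv (x 0 i - y 0 i).
rewrite expr_le1// ?subr_ge0// lerBlDr [leRHS]addrC -intrD1; exact: ltW.
Qed.

End torus_distance.

Import HBNNSimple.

(** * Coupling two densities through their common part *)

Section explicit_coupling.
Context {R : realType} {d : nat}.
Local Notation X := ('rV[R]_d).
Local Notation tau := (torus d : probability X R).
Variables (f g : X -> R).
Hypotheses (bf : bm setT f) (bg : bm setT g) (f0 : forall x, 0 <= f x) (g0 : forall x, 0 <= g x)
  (f1 : \int[torus d]_x f x = 1) (g1 : \int[torus d]_x g x = 1).

Let m x := Num.min (f x) (g x).
Let a x := f x - m x.
Let b x := g x - m x.

Let bm_m : bm setT m.
Proof.
split; first by apply: measurable_minr; [exact: (proj1 bf)|exact: (proj1 bg)].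
have [B hB] := bf.2; have [B' hB'] := bg.2; exists (B + B') => x _.
apply: (@le_trans _ _ (`|f x| + `|g x|)); last by apply: lerD; [exact: hB|exact: hB'].
by rewrite /m; case: (leP (f x) (g x)) => _; [rewrite lerDl|rewrite lerDr].
Qed.

Let ba : bm setT a. Proof. exact: bmB. Qed.
Let bb : bm setT b. Proof. exact: bmB. Qed.
Let m0 x : 0 <= m x. Proof. by rewrite le_min f0 g0. Qed.
Let a0 x : 0 <= a x. Proof. by rewrite subr_ge0 ge_min lexx. Qed.
Let b0 x : 0 <= b x. Proof. by rewrite subr_ge0 ge_min lexx orbT. Qed.

Let theta := \int[torus d]_x a x.
Let int (h : X -> R) : bm setT h -> (torus d).-integrable setT (EFin \o h).
Proof. exact: torus_integrable. Qed.

Let thetab : \int[torus d]_x b x = theta.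
Proof. by rewrite /theta /a /b !RintegralB//; try exact: int; rewrite f1 g1. Qed.

Let theta0 : 0 <= theta. Proof. by apply: Rintegral_ge0. Qed.

Lemma theta_le : theta <= \int[torus d]_x `|f x - g x|.
Proof.
apply: le_Rintegral => //; try apply: int => //; first exact: bm_norm (bmB bf bg).
move=> x _; rewrite /a /m; case: (leP (f x) (g x)) => h; first by rewrite subrr.
exact: ler_norm.
Qed.

(** Normalises the product of the two excesses a and b, both of mass [theta]. If [theta] is 0, the
    inverse is 0 by convention, and the excesses vanish almost everywhere. *)
Let ti : {nonneg R} := NngNum (ltac:(rewrite invr_ge0; exact: theta0) : 0 <= theta^-1).

Let off : set (X * X) := [set p | p.1 != p.2].

Let moff : measurable off.
Proof.
have -> : off = \bigcup_(i in setT) [set p : X * X | p.1 0 i != p.2 0 i].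
  apply/seteqP; split=> [p /= pp|p [i _ /= h]].
    have [i hi] : exists i, p.1 0 i != p.2 0 i.
      apply/existsP; apply: contraNT pp; rewrite negb_exists => /forallP h.
      by apply/eqP/rowP => i; apply/eqP; have := h i; rewrite negbK.
    by exists i.
  by apply: contraNneq h => ->.
apply: fin_bigcup_measurable => // i _.
have mi : measurable_fun setT (fun p : X * X => p.1 0 i - p.2 0 i).
  apply: measurable_funB.
    exact: (measurableT_comp (measurable_row_coord i) measurable_fst).
  exact: (measurableT_comp (measurable_row_coord i) measurable_snd).
have := mi measurableT (~` [set 0]) (measurableC (measurable_set1 0)).
rewrite setTI; congr (measurable _); apply/seteqP; split=> p /=.
  by move=> h; apply/eqP => e; apply: h; rewrite e subrr.
by move=> /eqP h e; apply: h; apply/eqP; rewrite -subr_eq0 e.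
Qed.

Let gam : {measure set (X * X) -> \bar R} :=
  measure_add (diagonal_image (density tau bm_m m0))
    (mscale ti (density tau ba a0 \x density tau bb b0)%E).

Let gam_add C : gam C = (diagonal_image (density tau bm_m m0) C +
  mscale ti (density tau ba a0 \x density tau bb b0)%E C)%E.
Proof. exact: measure_addE. Qed.

Let denE (h : X -> R) (bh : bm setT h) (h0 : forall x, 0 <= h x) : density tau bh h0 setT = (\int[torus d]_x h x)%:E.
Proof. by rewrite /density EFin_Rintegral//; exact: int. Qed.

Let gamE A B : measurable A -> measurable B -> gam (A `*` B) =
  (density tau bm_m m0 (A `&` B) + theta^-1%:E * (density tau ba a0 A * density tau bb b0 B))%E.
Proof. by move=> mA mB; rewrite gam_add /diagonal_image /mscale/= product_measure1E. Qed.

Let part (h h' : X -> R) (bh : bm setT h) (h0 : forall x, 0 <= h x) A : measurable A ->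
  (forall x, h x = m x + h' x) -> forall (bh' : bm setT h') (h0' : forall x, 0 <= h' x),
  density tau bh' h0' setT = theta%:E ->
  (density tau bm_m m0 A + theta^-1%:E * (density tau bh' h0' A * theta%:E))%E = (\int[torus d]_(x in A) (h x)%:E)%E.
Proof.
move=> mA hE bh' h0' dT.
have -> : (\int[torus d]_(x in A) (h x)%:E = density tau bm_m m0 A + density tau bh' h0' A)%E.
  rewrite /density -ge0_integralD//.
  - by apply: eq_integral => x _; rewrite hE.
  - by move=> x _; rewrite lee_fin.
  - by apply: measurable_funTS; apply/measurable_EFinP; exact: (proj1 bm_m).
  - by move=> x _; rewrite lee_fin.
  - by apply: measurable_funTS; apply/measurable_EFinP; exact: (proj1 bh').
congr (_ + _)%E; have [t0|t0] := eqVneq theta 0.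
  rewrite t0 mule0 mule0; apply/esym/eqP; rewrite eq_le measure_ge0 andbT.
  have <- : density tau bh' h0' setT = 0%E by rewrite dT t0.
  by apply: le_measure => //; rewrite inE.
by rewrite muleCA -EFinM mulVf// mule1.
Qed.

(** The common part sits on the diagonal, where the cost vanishes. The excesses are coupled by their
    normalised product, of mass [theta], where the squared distance is at most d. *)
Lemma explicit_coupling (mu nu : probability X R) : has_density mu f -> has_density nu g ->
  exists2 gamma, coupling mu nu gamma &
    (\int[gamma]_p (torus_dist p.1 p.2 ^+ 2)%:E <= (d%:R * \int[torus d]_x `|f x - g x|)%:E)%E.
Proof.
move=> [_ _ muE] [_ _ nuE].
have dA : density tau ba a0 setT = theta%:E by rewrite denE.
have dB : density tau bb b0 setT = theta%:E by rewrite denE thetab.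
have gam1 A : measurable A -> gam (A `*` setT) = mu A.
  move=> mA; rewrite gamE// setIT dB muE//; apply: (part bf f0) => // x; by rewrite /a addrC subrK.
have gam2 A : measurable A -> gam (setT `*` A) = nu A.
  move=> mA; rewrite gamE// setTI dA [(theta%:E * _)%E]muleC nuE//; apply: (part bg g0) => // x; by rewrite /b addrC subrK.
have gT : gam setT = 1%E.
  by rewrite -setXTT gam1// probability_setT.
have [P PE] := probability_of_measure gT.
exists P; first by move=> A mA; rewrite !PE gam1// gam2.
have Poff : (P off <= theta%:E)%E.
  rewrite PE gam_add.
  have -> : diagonal_image (density tau bm_m m0) off = 0%E.
    rewrite /diagonal_image (_ : _ @^-1` off = set0) ?measure0//.
    by apply/seteqP; split => x //=; rewrite /off/= eqxx.
  rewrite add0e /mscale/=.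
  apply: (@le_trans _ _ (theta^-1%:E * (theta%:E * theta%:E))%E).
    rewrite lee_wpmul2l// ?lee_fin ?invr_ge0//.
    rewrite -{1}dA -dB -product_measure1E// setXTT; apply: le_measure => //; rewrite inE//.
  rewrite -!EFinM lee_fin; have [->|t0] := eqVneq theta 0; first by rewrite !mulr0.
  by rewrite mulKf.
apply: (@le_trans _ _ (d%:R%:E * P off)%E); last first.
  rewrite EFinM lee_wpmul2l ?lee_fin//; apply: le_trans Poff _; rewrite lee_fin; exact: theta_le.
(* The integral is the supremum over simple functions below the squared distance, each at most d
   times the indicator of [off]. This form is available without measurability of [torus_dist]. *)
rewrite ge0_integralTE; last by move=> p; rewrite lee_fin sqr_ge0.
apply: ge_ereal_sup => _ [h hc <-].
have -> : (P off = \int[P]_p (\1_off p)%:E)%E by rewrite integral_indic// setIT.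
have mi : measurable_fun setT (fun p : X * X => (\1_off p : R)%:E) by exact/measurable_EFinP.
rewrite -integralT_nnsfun -ge0_integralZl//.
apply: ge0_le_integral => //.
- by move=> p _; rewrite lee_fin fun_ge0.
- by apply/measurable_EFinP.
- exact: measurable_funeM.
move=> p _; apply: le_trans (hc p) _; rewrite -EFinM lee_fin indicE.
have [pp|/negPn/eqP pp] := boolP (p.1 != p.2).
  by rewrite mem_set// mulr1; exact: sqr_torus_dist_le.
by rewrite memNset ?mulr0 ?pp ?torus_distxx ?expr0n//= /off/= pp eqxx.
Qed.

End explicit_coupling.

Section wasserstein_curve.
Context {R : realType} {d : nat}.
Variables (al M T : R) (rho : R -> 'rV[R]_d -> R).
Hypotheses (al_gt0 : 0 < al) (rho_itv : forall t x, al <= rho t x <= M)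
  (brho : forall t, bm setT (rho t)) (rho1 : forall t, 0 <= t <= T -> \int[torus d]_x rho t x = 1)
  (rhoc : forall eps : R, 0 < eps -> exists2 del : R, 0 < del & forall s t, 0 <= s <= T -> 0 <= t <= T ->
    `|t - s| < del -> \int[torus d]_x `|rho t x - rho s x| <= eps).

Let rho0 t x : 0 <= rho t x.
Proof. by have /andP[h _] := rho_itv t x; rewrite (le_trans (ltW al_gt0)). Qed.

Lemma W2_continuous : W2_continuous_curve T rho.
Proof.
have /choice[mu hmu] : forall t, exists mu : probability 'rV[R]_d R, 0 <= t <= T -> has_density mu (rho t).
  move=> t; have [tT|ntT] := boolP (0 <= t <= T); last by exists (torus d) => h.
  have d1 : density (torus d) (brho t) (rho0 t) setT = 1%E.
    by rewrite /density -EFin_Rintegral ?rho1//; exact: torus_integrable.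
  have [P PE] := probability_of_measure d1; exists P => _; split.
  - exact: (proj1 (brho t)).
  - by apply: aeW => x.
  - by move=> A mA; rewrite PE.
exists mu; split=> [t|t].
  by rewrite in_itv/= => tT; exact: hmu.
rewrite in_itv/= => tT.
have W2le s (eps : R) : 0 <= s <= T -> 0 <= eps -> d%:R * \int[torus d]_x `|rho s x - rho t x| <= eps ^+ 2 ->
    (0 <= W2 (mu s) (mu t) <= eps%:E)%E.
  move=> sT eps0 ce; rewrite /W2 poweR_ge0/=.
  have [g cg ig] := explicit_coupling (brho s) (brho t) (rho0 s) (rho0 t) (rho1 sT) (rho1 tT) (hmu s sT) (hmu t tT).
  set J := ereal_inf _.
  have J0 : (0 <= J)%E.
    by apply: le_ereal_inf_tmp => _ [g' _ <-]; apply: integral_ge0 => p _; rewrite lee_fin sqr_ge0.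
  have : (J <= (eps ^+ 2)%:E)%E.
    apply: (@le_trans _ _ (d%:R * \int[torus d]_x `|rho s x - rho t x|)%:E); last by rewrite lee_fin.
    by apply: le_trans ig; apply: ereal_inf_lbound; exists g.
  move: J0; case: J => [j| |]//; rewrite !lee_fin => j0 jc.
  by rewrite powR12_sqrt// -[leRHS]ger0_norm// -sqrtr_sqr ler_sqrt// sqr_ge0.
have near_le (eps : R) : 0 < eps -> \forall s \near within `[0, T] (nbhs t),
    (0 <= W2 (mu s) (mu t) <= eps%:E)%E.
  move=> eps0; have d1 : 0 < d%:R + 1 :> R by rewrite ltr_wpDl.
  (* The squared Wasserstein distance is at most d times the L1 distance; dividing eps ^+ 2 by d + 1
     avoids a case distinction on d. *)
  have [del del0 hdel] := rhoc (divr_gt0 (exprn_gt0 2 eps0) d1).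
  rewrite near_withinE; apply: filterS (nbhsx_ballx t del del0) => s /= ts.
  rewrite in_itv/= => sT; apply: W2le => //; first exact: ltW.
  apply: le_trans (ler_wpM2l _ (hdel t s tT sT _)) _ => //; first by rewrite distrC.
  rewrite mulrCA ler_piMr ?sqr_ge0// ler_pdivrMr// mul1r lerDl.
  exact: ler01.
have fin (s eps : R) : (0 <= W2 (mu s) (mu t) <= eps%:E)%E -> W2 (mu s) (mu t) \is a fin_num.
  by move=> /andP[h1 h2]; rewrite fin_numElt (lt_le_trans _ h1) ?ltNyr//= (le_lt_trans h2) ?ltry.
apply/fine_cvgP; split; first by apply: filterS (near_le 1 ltr01) => s; exact: fin.
apply/cvgr0Pnorm_le => eps eps0; apply: filterS (near_le eps eps0) => s h.
move: (h); rewrite -(fineK (fin _ _ h)) !lee_fin => /andP[h1 h2].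
by rewrite /= ger0_norm.
Qed.

End wasserstein_curve.

(** * The limit curve and the existence theorem *)

Lemma le_geometric {R : realType} (x a c : R) : (forall k, x <= a + c * 4^-1 ^+ k) -> x <= a.
Proof.
move=> h; have : a + c * 4^-1 ^+ k @[k --> \oo] --> a + c * (0 : R).
  apply: cvgD; first exact: cvg_cst.
  apply: cvgM; first exact: cvg_cst.
  by apply: cvg_expr; rewrite ger0_norm ?invr_ge0// invf_lt1// ltr1n.
by rewrite mulr0 addr0 => /cvgr_to_ge; apply; exact: nearW.
Qed.

Section limit_curve.
Context {R : realType} {d : nat}.
Variables (al M V T C : R) (rho0 : 'rV[R]_d -> R) (rho : R -> 'rV[R]_d -> R).
Hypotheses (d_gt0 : (0 < d)%N) (C_ge0 : 0 <= C) (brho : forall t, bm setT (rho t)).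
Hypothesis approx : forall k, exists e j r w z g E, [/\ approximant al M V T rho0 C e j r w z g E,
  (k <= j)%N, 0 < e, e <= 4^-1 ^+ k & forall t, 0 <= t <= T -> \int[torus d]_x `|r t x - rho t x| <= 4^-1 ^+ k].

Lemma limit_mass t : 0 <= t <= T -> \int[torus d]_x rho t x = \int[torus d]_x rho0 x.
Proof.
move=> tT; apply/eqP; rewrite -subr_eq0 -normr_le0; apply: (@le_geometric _ _ _ 2) => k.
have [e [j [r [w [z [g [E [a _ _ e4 rr]]]]]]]] := approx k.
have h1 := le_trans (ap_mass a tT) e4.
have h2 : `|\int[torus d]_x r t x - \int[torus d]_x rho t x| <= 4^-1 ^+ k.
  rewrite -RintegralB//; try exact: torus_integrable (ap_bmr a t).
    apply: le_trans (rr t tT); apply: le_norm_Rintegral => //; apply: torus_integrable.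
      by apply: bmB => //; exact: (ap_bmr a t).
    by apply: bm_dist => //; exact: (ap_bmr a t).
  exact: torus_integrable.
by move: h1 h2; rewrite !ler_distl; lra.
Qed.

Lemma limit_TV t : 0 <= t <= T -> (TV (rho t) <= V%:E)%E.
Proof.
move=> tT; apply: ge_ereal_sup => _ [zeta [tz z1] <-]; rewrite lee_fin.
have [B tB] := field_boundP tz.
have bdiv : bm setT (diverg zeta).
  apply: bm_sum => i; apply: bm_dtest.
  by split; [exact: tz.1|move=> x k; rewrite tz.2].
have [D dD] := bdiv.2.
apply: (@le_geometric _ _ _ (C * (1 + B) + D)) => k.
have [e [j [r [w [z [g [E [a _ e0 e4 rr]]]]]]]] := approx k.
have B0 : 0 <= C * (1 + B) * (4^-1 ^+ k - e).
  rewrite mulr_ge0 ?subr_ge0// mulr_ge0// addr_ge0//.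
  by have [] := tB (Ordinal d_gt0).
have h1 := ap_tv a tT tz z1 tB.
have -> : \int[torus d]_x (- rho t x * diverg zeta x) = - (\int[torus d]_x (r t x * diverg zeta x)) +
   \int[torus d]_x ((r t x - rho t x) * diverg zeta x).
  have bR := ap_bmr a t.
  rewrite -mulN1r -RintegralZl//; last by apply: torus_integrable; exact: bmM.
  rewrite -RintegralD//; last 2 first.
  - by apply: torus_integrable; apply: bmZ; exact: bmM.
  - by apply: torus_integrable; apply: bmM => //; exact: bmB.
  by apply: eq_Rintegral => x _; ring.
have h2 : \int[torus d]_x ((r t x - rho t x) * diverg zeta x) <= D * 4^-1 ^+ k.
  have bR := ap_bmr a t.
  have D0 : 0 <= D by apply: le_trans (dD 0 I).
  apply: le_trans (ler_norm _) _; apply: le_trans (ler_wpM2l D0 (rr t tT)).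
  rewrite -RintegralZl//; last by apply: torus_integrable; exact: bm_dist.
  apply: le_norm_Rintegral => //.
  - by apply: torus_integrable; apply: bmM => //; exact: bmB.
  - by apply: torus_integrable; apply: bmZ; exact: bm_dist.
  by move=> x _; rewrite normrM mulrC ler_wpM2r// dD.
by move: h1 h2 B0; rewrite mulrDl mulrBr; lra.
Qed.

(** In [ap_equi] e tends to 0 while q, s, t and kap stay fixed. With Q = q + 1, kap = Q^-2 and |t -
    s| < Q^-4 the three remaining terms are at most 1 / Q each, and Q exceeds 3 C / eps. *)
Lemma limit_modulus (eps : R) : 0 < eps -> exists2 del, 0 < del &
  forall s t, 0 <= s <= T -> 0 <= t <= T -> `|t - s| < del -> \int[torus d]_x `|rho t x - rho s x| <= eps.
Proof.
move=> eps0.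
have bound q s t kap : 0 <= s <= T -> 0 <= t <= T -> 0 < kap ->
    \int[torus d]_x `|rho t x - rho s x| <= C * (q.+1%:R^-1 + q.+1%:R * (kap + `|t - s| / kap)).
  move=> sT tT kap0; apply: (@le_geometric _ _ _ (2 + C + C * q.+1%:R / kap)) => k.
  have [e [j [r [w [z [g [E [a kj e0 e4 rr]]]]]]]] := approx (k + q.+1 * q.+1)%N.
  have br := ap_bmr a.
  have k4 : 4^-1 ^+ (k + q.+1 * q.+1) <= 4^-1 ^+ k :> R.
    by apply: ler_wiXn2l; rewrite ?invr_ge0 ?invf_le1 ?ler1n ?leq_addr.
  have ek := le_trans e4 k4.
  have h1 := L1_triangle (brho t) (br t) (brho s).
  have h2 := L1_triangle (br t) (br s) (brho s).
  have h3 := le_trans (rr t tT) k4; have h4 := le_trans (rr s sT) k4.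
  have h5 := ap_equi a (leq_trans (leq_addl _ _) kj) sT tT kap0.
  have h6 : \int[torus d]_x `|rho t x - r t x| = \int[torus d]_x `|r t x - rho t x|.
    by apply: eq_Rintegral => x _; rewrite distrC.
  have h7 : C * (e + q.+1%:R^-1 + q.+1%:R * (kap + (`|t - s| + e) / kap)) <=
      C * (4^-1 ^+ k + q.+1%:R^-1 + q.+1%:R * (kap + (`|t - s| + 4^-1 ^+ k) / kap)).
    by rewrite ler_wpM2l// lerD// ?lerD2r// ler_wpM2l// lerD2l ler_wpM2r ?invr_ge0 ?lerD2l// ltW.
  rewrite h6 in h1; apply: le_trans h1 _.
  apply: le_trans (lerD h3 (le_trans h2 (lerD (le_trans h5 h7) h4))) _.
  by rewrite le_eqVlt; apply/orP; left; apply/eqP; ring.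
pose q := Num.truncn (3 * C / eps).
have Q0 : 0 < q.+1%:R :> R by [].
have Cq : C * (3 / q.+1%:R) <= eps.
  rewrite mulrA ler_pdivrMr// -ler_pdivrMl// mulrC (mulrC C) ltW//.
  exact: truncnS_gt.
exists (q.+1%:R ^- 4); first by rewrite invr_gt0 exprn_gt0.
move=> s t sT tT ts; apply: le_trans Cq.
have kap0 : 0 < q.+1%:R ^- 2 :> R by rewrite invr_gt0 exprn_gt0.
apply: le_trans (bound q s t _ sT tT kap0) _; rewrite ler_wpM2l//.
have -> : 3 / q.+1%:R = q.+1%:R^-1 + q.+1%:R * (q.+1%:R ^- 2 + q.+1%:R ^- 4 / q.+1%:R ^- 2) :> R.
  by move: (q.+1%:R) Q0 => Q Q0; field; rewrite gt_eqF.
by rewrite lerD2l ler_wpM2l// lerD2l ler_wpM2r ?invr_ge0 ?exprn_ge0// ltW.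
Qed.

End limit_curve.

Lemma smooth_cst {R : realType} {V : normedModType R} (c : R) : smooth (fun _ : V => c).
Proof.
move=> k; elim: k c => [|k IH] c; first exact: cst_continuous.
split=> [|v]; first exact: cst_continuous.
split=> [x|]; first exact: derivable_cst.
by have -> : (fun x => 'D_v (fun _ : V => c) x) = (fun=> 0) by apply: funext => x; exact: derive_cst.
Qed.

Lemma TV_ge0 {R : realType} {d : nat} (f : 'rV[R]_d -> R) : (0 <= TV f)%E.
Proof.
apply: ereal_sup_ubound; exists (fun=> 0).
  split; first by split => // i; under eq_fun do rewrite mxE; exact: smooth_cst.
  by move=> x; rewrite /enorm /dot big1 ?sqrtr0// => i _; rewrite mxE mul0r.
have -> : (fun x => - f x * diverg (fun=> 0) x) = (fun=> 0).
  apply: funext => x; rewrite /diverg big1 ?mulr0// => i _.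
  by under eq_fun do rewrite mxE; exact: derive_cst.
by rewrite /Rintegral integral0.
Qed.

Lemma TV_ae_eq {R : realType} {d : nat} (f g : 'rV[R]_d -> R) :
  measurable_fun setT f -> measurable_fun setT g -> f = g %[ae torus d] -> TV f = TV g.
Proof.
move=> mf mg fg; congr ereal_sup; apply: eq_imagel => zeta [tz _]; congr EFin.
have mdiv : measurable_fun setT (diverg zeta).
  have [] // : bm setT (diverg zeta).
  by apply: bm_sum => i; apply: bm_dtest; split; [exact: tz.1|move=> x k; rewrite tz.2].
apply: ae_eq_Rintegral => //; try (by apply: measurable_funM => //; exact: measurableT_comp).
by apply: filterS fg => x fgx _; rewrite fgx.
Qed.

Lemma existence_between {R : realType} {d : nat} (al M V T : R) (rho0 : 'rV[R]_d -> R) : (0 < d)%N ->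
  0 < al -> al <= M -> 0 <= V -> 0 < T -> bm setT rho0 -> (forall x, al <= rho0 x <= M) ->
  \int[torus d]_x rho0 x = 1 -> (TV rho0 <= V%:E)%E ->
  exists rho, [/\ forall t x, al <= rho t x <= M, forall t, 0 <= t <= T -> (TV (rho t) <= V%:E)%E,
    Loo_BV_Loo T rho, W2_continuous_curve T rho &
    exists z w g, [/\ Loo_field T z, ae_time T (fun t => calA (rho t) (z t)),
      div_L2_H1 T z w g & weak_equation T rho0 rho g]].
Proof.
move=> d0 al0 alM V0 T0 brho0 rho0_itv mass0 tv0.
have [|C C0 hC] := approximant_exists d0 al0 alM V0 T0 brho0 rho0_itv.
  move=> zeta tz z1; rewrite -lee_fin; apply: le_trans tv0.
  by apply: ereal_sup_ubound; exists zeta.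
have [rho [rho_itv brho sbrho happ]] := limit_density al0 alM T0 C0 hC.
have tv := limit_TV d0 C0 brho happ.
exists rho; split => //.
- split; first exact: sbrho.1.
  exists (M + V); apply: aeW => t; rewrite in_itv/= => /andP[t0 t1].
  have tT : 0 <= t <= T by rewrite !ltW.
  have rM x : `|rho t x| <= M.
    by have /andP[h1 h2] := rho_itv t x; rewrite ger0_norm// (le_trans _ h1)// ltW.
  have tvt := tv t tT.
  split; [by split; [exact: bm_Lfun|exact: le_lt_trans tvt (ltry _)]|by apply: bm_Lfun; rewrite ?leey| |].
    rewrite EFinD leeD// Lnorm1.
    rewrite (_ : (\int[_]_x _)%E = (\int[torus d]_x `|rho t x|)%:E).
      by rewrite lee_fin; apply: le_trans (ler_norm _) _; apply: torus_le_cst;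
        [exact: bm_norm|move=> x; rewrite normr_id].
    by rewrite EFin_Rintegral//; apply: torus_integrable; exact: bm_norm.
  by apply: Lnorm_oo_le => x; apply: le_trans (rM x) _; rewrite lerDl.
- apply: (W2_continuous al0 rho_itv brho).
    by move=> t tT; rewrite -mass0; exact: (limit_mass brho happ tT).
  exact: (limit_modulus C0 brho happ).
have Ce0 : 0 <= @err_const R d M T C.
  have M0 : 0 <= M by rewrite (le_trans _ alM)// ltW.
  by rewrite /err_const !addr_ge0// ?mulr_ge0// ?addr_ge0// ltW.
have hcand n : exists2 F, candidate T (@err_const R d M T C) rho0 rho n F & cenergy T F <= C.
  have [e [j [r [w [z [g [E [a _ e0 e4 rr]]]]]]]] := happ n.
  exact: (candidate_of_approximant d0 al0 alM T0 C0 rho_itv brho sbrho a e0 e4 rr).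
have [F [cF eF dF]] := candidate_sequence T0 brho sbrho C0 Ce0 hcand.
have C10 : 0 <= C + 1 by rewrite addr_ge0.
have [H [mHt mH zH] [L L0 hL]] := limit_tuple T0 C10 cF eF dF.
exact: (limit_solution T0 Ce0 L0 brho sbrho tv cF mHt mH zH (fun c => (hL c).1) (fun c => (hL c).2)).
Qed.

Theorem theorem5p1 (R : realType) (d : nat) (alpha c T : R)
    (rho0 : 'rV[R]_d -> R) (d_gt0 : (0 < d)%N)
    (c_gt0 : 0 < c) (c_lt_alpha : c < alpha) (T_gt0 : 0 < T)
    (rho0_P : exists mu0, has_density mu0 rho0)
    (rho0_Loo : rho0 \in Lfun (torus d) +oo%E)
    (rho0_BV : BV rho0)
    (rho0_ge : {ae torus d, forall x, alpha <= rho0 x}) :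
  exists rho : R -> 'rV[R]_d -> R,
    [/\ weak_solution c T rho0 rho,
        forall t, t \in `[0, T] -> (TV (rho t) <= TV rho0)%E &
        ae_spacetime T (fun t x =>
          alpha <= rho t x /\
          ((rho t x)%:E <= 'N[torus d]_+oo[EFin \o rho0])%E)].
Proof.
have [mu0 [mrho0 _ dens]] := rho0_P.
have N_lty : ('N[torus d]_+oo[EFin \o rho0] < +oo)%E.
  by move: rho0_Loo; rewrite inE => /andP[_]; rewrite inE.
have rho0_le : {ae torus d, forall x, (`|rho0 x|%:E <= 'N[torus d]_+oo[EFin \o rho0])%E}.
  by rewrite unlock torus_gt0; exact: ess_sup_ge.
have al0 : 0 < alpha by exact: lt_trans c_lt_alpha.
have alN : (alpha%:E <= 'N[torus d]_+oo[EFin \o rho0])%E.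
  rewrite unlock torus_gt0; apply: ess_sup_gee; first exact: torus_gt0.
  by apply: filterS rho0_ge => x h /=; rewrite lee_fin (le_trans h)// ler_norm.
have [M NM] : exists M, ('N[torus d]_+oo[EFin \o rho0] = M%:E)%E.
  by exists (fine ('N[torus d]_+oo[EFin \o rho0])%E); rewrite fineK// fin_numElt N_lty (lt_le_trans (ltNyr _) alN).
have [V TVV] : exists V, TV rho0 = V%:E.
  by exists (fine (TV rho0)); rewrite fineK// fin_numElt rho0_BV.2 (lt_le_trans (ltNyr _) (TV_ge0 _)).
rewrite NM TVV in rho0_le alN *; rewrite lee_fin in alN.
have V0 : 0 <= V by rewrite -lee_fin -TVV TV_ge0.
(* [rho0] satisfies its bounds almost everywhere. The clipped datum satisfies them everywhere and
   has the same mass, variation and pairings with test functions, M being the essential supremum of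
   the modulus of [rho0]. *)
pose f x := clip alpha M (rho0 x).
have f_itv x : alpha <= f x <= M by exact: (clip_itv al0 alN (lexx 0)).
have mf : measurable_fun setT f.
  apply: measurable_maxr => //; exact: measurable_minr.
have bf : bm setT f.
  split => //; exists M => x _; have /andP[h1 h2] := f_itv x.
  by rewrite ger0_norm// (le_trans _ h1)// ltW.
have fE : f = rho0 %[ae torus d].
  apply: filterS2 rho0_ge rho0_le => x h1 h2 _; apply: (clip_id al0 alN (lexx 0)).
  by rewrite h1 (le_trans (ler_norm _))// -lee_fin.
have mass : \int[torus d]_x f x = 1.
  rewrite (ae_eq_Rintegral _ _ _ fE)// /Rintegral.
  by rewrite -dens// [X in fine X](probability_setT mu0).
have [rho [rho_itv tv h1 h2 [z [w [g [h3 h4 h5 h6]]]]]] := existence_between d_gt0 al0 alN V0 T_gt0 bf f_itv mass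
  (eq_ind _ (fun y => (y <= V%:E)%E) (lexx _) _ (esym (etrans (TV_ae_eq mf mrho0 fE) TVV))).
exists rho; split.
- split => //.
    apply: aeW => q _; have /andP[h _] := rho_itv q.1 q.2; exact: lt_le_trans h.
  exists z, w, g; split => // u tu; rewrite h6//; congr (- _).
  have mu : measurable_fun setT (fun x : 'rV[R]_d => u (0, x)).
    have [su pu _] := tu.
    by apply: measurable_periodic (pu 0); exact: continuous_slice (su 0%N).
  apply: ae_eq_Rintegral => //; try exact: measurable_funM.
  by apply: filterS fE => x fx _; rewrite fx.
- by move=> t; rewrite in_itv/=; exact: tv.
- by apply: aeW => q _; have /andP[h h'] := rho_itv q.1 q.2.
Qed.
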